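(* Suppose we are given two sequences of real numbers $\{\lambda_k\}$, $\{\mu_k\}$ that are either infinite with $\lambda_1>\mu_1>\lambda_2>\mu_2>\dots>0$ and $\lambda_k\to0$, or finite of the same length $n\ge1$ with $\lambda_1>\mu_1>\lambda_2>\mu_2>\dots>\lambda_n>\mu_n\ge0$. Suppose we are also given finitely supported probability measures $\rho_k$ on the unit circle $\mathbb T$, one for each $\lambda_k$, and finitely supported probability measures $\rho_k^1$ on $\mathbb T$, one for each $k$ with $\mu_k>0$. Then there exists a canonical compact spectral data tuple $(R,R_1,p,\mathfrak J_p,\boldsymbol\varphi,\boldsymbol\varphi_1)$ (see context), unique up to unitary equivalence, such that (a) the eigenvalues of $R|_{\mathcal H_0}$ are exactly the $\lambda_k$, and the non-zero eigenvalues of $R_1|_{\mathcal H_0}$ are exactly the $\mu_k$ with $\mu_k>0$; (b) for each $k$, $\rho_k$ is the spectral measure of the unitary operator $\boldsymbol\varphi|_{\operatorname{Ker}(R-\lambda_kI)}$ with respect to the unit vector $\|p_k\|^{-1}p_k$, and, for each $k$ with $\mu_k>0$, $\rho_k^1$ is the spectral measure of the unitary operator $\boldsymbol\varphi_1|_{\operatorname{Ker}(R_1-\mu_kI)}$ with respect to the unit vector $\|p_k^1\|^{-1}p_k^1$.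
   Context: All Hilbert spaces are complex and separable. $pp^*$ denotes $x\mapsto\langle x,p\rangle p$. A conjugation is a conjugate-linear isometric map $\mathfrak J$ with $\mathfrak J^2=I$; a bounded operator $T$ is $\mathfrak J$-symmetric if $T^*=\mathfrak JT\mathfrak J$. The spectral measure of a unitary $U$ with respect to $v$ is the Borel measure $\rho$ on $\mathbb T$ with $\langle U^nv,v\rangle=\int_{\mathbb T}\xi^n\,d\rho(\xi)$, $n\in\mathbb Z$. A vector $v$ is $*$-cyclic for $U$ if the closed span of $\{U^nv:n\in\mathbb Z\}$ is the whole space. Given compact self-adjoint $R,R_1\ge0$ on $\mathcal H$ with $\operatorname{Ker}R=\{0\}$ and $p\in\mathcal H$ with $R^2-R_1^2=pp^*$, put $\mathcal H_0:=\overline{\operatorname{span}}\{R^np:n\ge0\}$ (reducing for $R$ and $R_1$); let $\lambda_1>\lambda_2>\dots$ be the eigenvalues of $R|_{\mathcal H_0}$ and $\mu_1>\mu_2>\dots$ the non-zero eigenvalues of $R_1|_{\mathcal H_0}$; $$\mathcal K:=\overline{\operatorname{span}}\{\operatorname{Ker}(R-\lambda_kI):k\ge1\}\cap\mathcal H_0^\perp,\qquad \mathcal K_1:=\overline{\operatorname{span}}\{\operatorname{Ker}(R_1-\mu_kI):k\ge1\}\cap\mathcal H_0^\perp;$$ and let $p_k$, $p_k^1$ be the orthogonal projections of $p$ onto $\operatorname{Ker}(R-\lambda_kI)$, $\operatorname{Ker}(R_1-\mu_kI)$. A canonical compact spectral data tuple $(R,R_1,p,\mathfrak J_p,\boldsymbol\varphi,\boldsymbol\varphi_1)$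 consists of such $R,R_1,p$ with $\mathcal H=\mathcal H_0\oplus\mathcal K\oplus\mathcal K_1$; a conjugation $\mathfrak J_p$ commuting with $R$ and $R_1$ with $\mathfrak J_pp=p$; a $\mathfrak J_p$-symmetric unitary $\boldsymbol\varphi$ commuting with $R$; a $\mathfrak J_p$-symmetric partial isometry $\boldsymbol\varphi_1$ commuting with $R_1$ with $\operatorname{Ker}\boldsymbol\varphi_1=\operatorname{Ker}R_1$; such that $\boldsymbol\varphi|_{\mathcal K_1}=I_{\mathcal K_1}$, $\boldsymbol\varphi_1|_{\mathcal K}=I_{\mathcal K}$, and for every $k$, $p_k$ is $*$-cyclic for $\boldsymbol\varphi|_{\operatorname{Ker}(R-\lambda_kI)}$ and $p_k^1$ is $*$-cyclic for $\boldsymbol\varphi_1|_{\operatorname{Ker}(R_1-\mu_kI)}$. Two tuples, on $\mathcal H$ and $\mathcal H'$, are unitarily equivalent if there is a unitary $V:\mathcal H\to\mathcal H'$ that maps $p$ to $p'$ and intertwines each of $R,R_1,\mathfrak J_p,\boldsymbol\varphi,\boldsymbol\varphi_1$ with its primed counterpart. *)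

(* Defs.v *)
(* MathComp / MathComp-Analysis: the scalars are R[i] for R : realType. *)
From HB Require Import structures.
From mathcomp Require Import all_boot all_order all_algebra complex.
From mathcomp Require Import all_classical all_reals all_analysis.
Set Implicit Arguments.
Unset Strict Implicit.
Unset Printing Implicit Defensive.
Import Order.TTheory GRing.Theory Num.Theory numFieldNormedType.Exports.
Local Open Scope classical_set_scope.
Local Open Scope ring_scope.
Local Open Scope complex_scope.

(* Complex Hilbert spaces: hdot is linear in its first argument and
   conjugate-linear in its second one. *)
HB.mixin Record CompleteNormedModule_isHilbert (R : realType) H
    & CompleteNormedModule R[i] H := {
  hdot : {dot H for (@Num.conj R[i])} ;
  hdot_normE : forall x : H, `|x| ^+ 2 = hdot x x }.

#[short(type="hilbertType")]
HB.structure Definition Hilbert (R : realType) :=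
  { H of CompleteNormedModule R[i] H & CompleteNormedModule_isHilbert R H }.

Definition separable (T : topologicalType) : Prop :=
  exists2 A : set T, countable A & dense A.

(* The topology of R[i] is the one carried by R[i]^o. *)
Definition unit_circle (R : realType) : set (R[i])^o := [set z | `|z| = 1].
Arguments unit_circle : clear implicits.

Definition circle (R : realType) : Type := set_type (unit_circle R).

HB.instance Definition _ (R : realType) :=
  Topological.copy (circle R) (set_type (unit_circle R)).

Lemma unit_circle1 (R : realType) : (1 : (R[i])^o) \in unit_circle R.
Proof. by apply/mem_set; exact: normr1. Qed.

HB.instance Definition _ (R : realType) :=
  isPointed.Build (circle R) (exist _ (1 : (R[i])^o) (unit_circle1 R)).

Definition circle_val (R : realType) (xi : circle R) : R[i] := set_val xi.

Definition borel_circle (R : realType) :=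
  g_sigma_algebraType (@open (circle R)).

Section measures_on_the_circle.
Context {R : realType}.
Implicit Types rho : {measure set (borel_circle R) -> \bar R}.

Definition finitely_supported rho : Prop :=
  exists A : set (borel_circle R), finite_set A /\ rho (~` A) = 0%E.

Definition circle_integral rho (f : borel_circle R -> R[i]) : R[i] :=
  (\int[rho]_xi complex.Re (f xi)) +i* (\int[rho]_xi complex.Im (f xi)).

End measures_on_the_circle.

Section hilbert_notions.
Context {R : realType} {H : hilbertType R}.
Implicit Types (E A B : set H) (x y v : H) (l : R[i]).

Definition orthogonal_sets A B : Prop :=
  forall x y, A x -> B y -> hdot x y = 0.

Definition orthocompl A : set H := [set x | forall y, A y -> hdot x y = 0].

Definition linear_span A : set H :=
  [set x | exists (n : nat) (c : 'I_n -> R[i]) (a : 'I_n -> H),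
    (forall i, A (a i)) /\ x = \sum_(i < n) c i *: a i].

Definition closed_span A : set H := closure (linear_span A).

(* Orthogonal projection onto E; 0 by default, when there is no such point. *)
Definition oproj E x : H := xget 0 [set y | E y /\ orthocompl E (x - y)].

Definition kernel (T : H -> H) : set H := [set x | T x = 0].

(* Ker (T - l I) *)
Definition eigspace (T : H -> H) l : set H := [set x | T x = l *: x].

(* Eigenvalues of the restriction of T to E. *)
Definition eigenvalues E (T : H -> H) : set R[i] :=
  [set l | exists x, [/\ E x, x != 0 & T x = l *: x]].

Definition compact_operator (T : H -> H) : Prop :=
  precompact (T @` [set x | `|x| <= 1]).

Definition self_adjoint (T : H -> H) : Prop :=
  forall x y, hdot (T x) y = hdot x (T y).

Definition psd (T : H -> H) : Prop := forall x, 0 <= hdot (T x) x.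

Definition commutes (S T : H -> H) : Prop := forall x, S (T x) = T (S x).

(* S is the adjoint of T *)
Definition is_adjoint (T S : H -> H) : Prop :=
  forall x y, hdot (T x) y = hdot x (S y).

(* Conjugate-linearity is carried by the type of J. *)
Definition conjugation (J : {linear H -> H | (@Num.conj R[i]) \; *:%R}) : Prop :=
  (forall x, `|J x| = `|x|) /\ (forall x, J (J x) = x).

Definition J_symmetric (J T : H -> H) : Prop :=
  is_adjoint T (fun x => J (T (J x))).

Definition partial_isometry (T : H -> H) : Prop :=
  continuous T /\ forall x, orthocompl (kernel T) x -> `|T x| = `|x|.

(* U^n x for the restriction of U to E, which is meant to be a bijection of E:
   the negative powers are those of the inverse of that restriction. *)
Definition zpower E (U : H -> H) (n : int) x : H :=
  match n with
  | Posz m => iter m U x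
  | Negz m => iter m.+1 ('pinv_(fun=> 0) E U) x
  end.

Definition star_cyclic E (U : H -> H) v : Prop :=
  closed_span [set zpower E U n v | n in [set: int]] = E.

End hilbert_notions.

(* The linear map V restricts to a unitary operator from E onto F. *)
Definition unitary_onto {R : realType} {H H' : hilbertType R}
    (E : set H) (F : set H') (V : H -> H') : Prop :=
  V @` E = F /\
  forall x y, E x -> E y -> hdot (V x) (V y) = hdot x y.

(* The restriction of U to E is a unitary operator on E, with spectral measure
   rho with respect to v. *)
Definition is_spectral_measure {R : realType} {H : hilbertType R}
    (E : set H) (U : H -> H) (v : H)
    (rho : {measure set (borel_circle R) -> \bar R}) : Prop :=
  unitary_onto E E U /\
  forall n : int, hdot (zpower E U n v) v =
    circle_integral rho (fun xi => circle_val xi ^ n).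

Record spectral_data (R : realType) (H : hilbertType R) := SpectralData {
  sdR : {linear H -> H} ;
  sdR1 : {linear H -> H} ;
  sdp : H ;
  sdJ : {linear H -> H | (@Num.conj R[i]) \; *:%R} ;
  sdphi : {linear H -> H} ;
  sdphi1 : {linear H -> H} }.

Section spectral_data.
Context {R : realType} {H : hilbertType R}.
Variable D : spectral_data H.

Definition sdH0 : set H :=
  closed_span [set iter n (sdR D) (sdp D) | n in [set: nat]].

Definition sdeig : set R[i] := eigenvalues sdH0 (sdR D).

Definition sdeig1 : set R[i] := eigenvalues sdH0 (sdR1 D) `\ 0.

Definition sdK : set H :=
  closed_span (\bigcup_(l in sdeig) eigspace (sdR D) l) `&` orthocompl sdH0.

Definition sdK1 : set H :=
  closed_span (\bigcup_(l in sdeig1) eigspace (sdR1 D) l) `&` orthocompl sdH0.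

Definition sdpk (l : R[i]) : H := oproj (eigspace (sdR D) l) (sdp D).

Definition sdp1k (l : R[i]) : H := oproj (eigspace (sdR1 D) l) (sdp D).

Record canonical_compact_data : Prop := CanonicalCompactData {
  cd_separable : separable H ;
  cd_R_compact : compact_operator (sdR D) ;
  cd_R_self_adjoint : self_adjoint (sdR D) ;
  cd_R_psd : psd (sdR D) ;
  cd_R1_compact : compact_operator (sdR1 D) ;
  cd_R1_self_adjoint : self_adjoint (sdR1 D) ;
  cd_R1_psd : psd (sdR1 D) ;
  cd_R_ker : kernel (sdR D) = [set 0] ;
  (* R^2 - R1^2 = p p^* *)
  cd_rank1 : forall x,
    sdR D (sdR D x) - sdR1 D (sdR1 D x) = hdot x (sdp D) *: sdp D ;
  (* H is the orthogonal direct sum of H0, K and K1; K and K1 are orthogonal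
     to H0 by definition. *)
  cd_K_orth_K1 : orthogonal_sets sdK sdK1 ;
  cd_sum : forall x, exists h k k1,
    [/\ sdH0 h, sdK k, sdK1 k1 & x = h + k + k1] ;
  cd_J_conj : conjugation (sdJ D) ;
  cd_J_R : commutes (sdJ D) (sdR D) ;
  cd_J_R1 : commutes (sdJ D) (sdR1 D) ;
  cd_J_p : sdJ D (sdp D) = sdp D ;
  cd_phi_unitary : unitary_onto [set: H] [set: H] (sdphi D) ;
  cd_phi_sym : J_symmetric (sdJ D) (sdphi D) ;
  cd_phi_R : commutes (sdphi D) (sdR D) ;
  cd_phi1_pisom : partial_isometry (sdphi1 D) ;
  cd_phi1_sym : J_symmetric (sdJ D) (sdphi1 D) ;
  cd_phi1_R1 : commutes (sdphi1 D) (sdR1 D) ;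
  cd_phi1_ker : kernel (sdphi1 D) = kernel (sdR1 D) ;
  cd_phi_K1 : forall x, sdK1 x -> sdphi D x = x ;
  cd_phi1_K : forall x, sdK x -> sdphi1 D x = x ;
  cd_phi_cyclic : forall l, sdeig l ->
    star_cyclic (eigspace (sdR D) l) (sdphi D) (sdpk l) ;
  cd_phi1_cyclic : forall l, sdeig1 l ->
    star_cyclic (eigspace (sdR1 D) l) (sdphi1 D) (sdp1k l) }.

End spectral_data.

Definition unitarily_equivalent {R : realType} {H H' : hilbertType R}
    (D : spectral_data H) (D' : spectral_data H') : Prop :=
  exists V : {linear H -> H'},
    unitary_onto [set: H] [set: H'] V /\ V (sdp D) = sdp D' /\
    [/\ forall x, V (sdR D x) = sdR D' (V x),
        forall x, V (sdR1 D x) = sdR1 D' (V x),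
        forall x, V (sdJ D x) = sdJ D' (V x),
        forall x, V (sdphi D x) = sdphi D' (V x) &
        forall x, V (sdphi1 D x) = sdphi1 D' (V x)].

(* The length of a sequence: None for an infinite sequence, Some n for a
   sequence indexed by 0, ..., n - 1. *)
Definition in_range (len : option nat) (k : nat) : bool :=
  if len is Some n then (k < n)%N else true.

Definition interlacing {R : realType} (len : option nat) (lam mu : nat -> R) :
    Prop :=
  match len with
  | None => (forall k, [/\ lam k > mu k, mu k > lam k.+1 & mu k > 0]) /\
            lam k @[k --> \oo] --> 0
  | Some n => [/\ (1 <= n)%N,
                  forall k, (k < n)%N -> lam k > mu k,
                  forall k, (k.+1 < n)%N -> mu k > lam k.+1 &
                  mu n.-1 >= 0]
  end.

(* The values of lam, mu, rho and rho1 out of range are irrelevant, and so are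
   those of rho1 at the k such that mu k = 0. *)
Definition has_spectral_data {R : realType} {H : hilbertType R}
    (D : spectral_data H) (len : option nat) (lam mu : nat -> R)
    (rho rho1 : nat -> probability (borel_circle R) R) : Prop :=
  [/\ sdeig D = [set (lam k)%:C | k in [set k | in_range len k]],
      sdeig1 D = [set (mu k)%:C | k in [set k | in_range len k /\ 0 < mu k]],
      forall k, in_range len k ->
        is_spectral_measure (eigspace (sdR D) (lam k)%:C) (sdphi D)
          (`|sdpk D (lam k)%:C|^-1 *: sdpk D (lam k)%:C) (rho k) &
      forall k, in_range len k -> 0 < mu k ->
        is_spectral_measure (eigspace (sdR1 D) (mu k)%:C) (sdphi1 D)
          (`|sdp1k D (mu k)%:C|^-1 *: sdp1k D (mu k)%:C) (rho1 k)].

(* Main.v *)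
(* Put L_k = lam_k^2 and M_j = mu_j^2. In any tuple, R^2 - R_1^2 = p p^* gives
   (L_k - M_j) <x, y> = <x, p> <p, y> for x in Ker(R - lam_k) and y in
   Ker(R_1 - mu_j). Expanding p_j^1 in the p_k, the numbers w_k = |p_k|^2 satisfy
   sum_k w_k / (L_k - M_j) = 1 for all j, and R_1^2 >= 0 gives sum_k w_k / L_k <= 1;
   interlacing makes the solution of this system unique. Hence all inner products
   between the vectors phi^n p_k and phi_1^m p_j^1 are determined by the data. These
   vectors span the space, so that two tuples are related by a unitary V that maps
   one such family to the other.

   For the existence, w_k is the limit of the weights of the finite truncations,
   which are given by product formulas. Take p = sum_k sqrt(w_k) h_k for an
   orthonormal sequence h_k; then R^2 - p p^* is compact and positive on the span of
   the h_k, its eigenvectors are f_j = sum_k sqrt(w_k) / (L_k - M_j) h_k and possibly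
   a kernel vector, and R_1 is its square root. Each h_k (each f_j) is finally
   enlarged to an orthonormal block on which phi (phi_1) is diagonal in a
   Householder-rotated basis, with the atoms of rho_k (rho_j^1) as eigenvalues. *)
Require Import Defs.
From HB Require Import structures.
From mathcomp Require Import all_boot all_order all_algebra complex ring lra zify.
From mathcomp Require Import all_classical all_reals all_analysis measurable_realfun.
Set Implicit Arguments.
Unset Strict Implicit.
Unset Printing Implicit Defensive.
Import Order.TTheory GRing.Theory Num.Theory numFieldNormedType.Exports.
Local Open Scope classical_set_scope.
Local Open Scope ring_scope.
Local Open Scope complex_scope.

(** * Hilbert space geometry *)

(** The scalar part concerns the secular function 1 - sum_k w_k / (L_k - z), whose zeros are the
    M_j. Uniqueness of the w_k is proved by peeling: multiplication by (L_m - z) / (M_m - z) removes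
    one pole and one zero and preserves the system, so that only the first weight has to be
    compared. After many steps the function is close to 1 at a removed pole; this is where sum_k w_k
    / L_k <= 1 and L_k -> 0 are used. The equation for a last M_j = 0 comes from no eigenvector of
    the data and needs a dimension count. No spectral theorem is invoked. A compact positive
    operator that does not vanish on a closed invariant subspace has an eigenvector there.
    Completeness of the families of eigenvectors and uniqueness of positive square roots, hence R_1
    = R on the orthogonal complement of H_0, follow from this one fact. In the construction,
    completeness of the f_j amounts to the secular equation having no positive root besides the M_j.
    Real coordinates of p and real rotations keep every basis fixed by the conjugation. *)

Section hdot_theory.
Context {R : realType} {H : hilbertType R}.
Implicit Types (x y z : H) (a : R[i]).

(** The norm of a normed module over [R[i]] is itself a complex number; [nm] is its real form, on
    which order arguments can run. *)
Definition nm x : R := complex.Re `|x|.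

Lemma nmE x : `|x| = (nm x)%:C.
Proof. by rewrite /nm RRe_real// ger0_real. Qed.

Lemma nm_ge0 x : 0 <= nm x.
Proof. by rewrite -ler0c -nmE. Qed.

Lemma nm0 : nm (0 : H) = 0.
Proof. by apply: complexI; rewrite -nmE normr0. Qed.

Lemma nm_eq0 x : (nm x == 0) = (x == 0).
Proof. by rewrite -[RHS]normr_eq0 nmE (inj_eq (@complexI R) (nm x) 0). Qed.

Lemma nm_gt0 x : (0 < nm x) = (x != 0).
Proof. by rewrite lt_def nm_eq0 nm_ge0 andbT. Qed.

Lemma nmN x : nm (- x) = nm x.
Proof. by rewrite /nm normrN. Qed.

Lemma nmB x y : nm (x - y) = nm (y - x).
Proof. by rewrite /nm distrC. Qed.

Lemma nmD x y : nm (x + y) <= nm x + nm y.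
Proof. by rewrite -lecR rmorphD/= -!nmE ler_normD. Qed.

Lemma nm_tri y x z : nm (x - z) <= nm (x - y) + nm (y - z).
Proof. by apply: le_trans (nmD _ _); rewrite addrA subrK. Qed.

Lemma nmZ a x : nm (a *: x) = complex.Re `|a| * nm x.
Proof.
apply: complexI; rewrite rmorphM/= -!nmE normrZ; congr (_ * _).
Qed.

Lemma hdotC x y : hdot x y = (hdot y x)^*%C.
Proof. by rewrite hermC/= expr0 mul1r. Qed.

Lemma hdotDl x y z : hdot (x + y) z = hdot x z + hdot y z.
Proof. exact: linearDl. Qed.

Lemma hdotDr x y z : hdot x (y + z) = hdot x y + hdot x z.
Proof. exact: linearDr. Qed.

Lemma hdotBl x y z : hdot (x - y) z = hdot x z - hdot y z.
Proof. exact: linearBl. Qed.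

Lemma hdotBr x y z : hdot x (y - z) = hdot x y - hdot x z.
Proof. exact: linearBr. Qed.

Lemma hdotZl a x y : hdot (a *: x) y = a * hdot x y.
Proof. exact: linearZl_LR. Qed.

Lemma hdotZr a x y : hdot x (a *: y) = a^*%C * hdot x y.
Proof. exact: linearZr_LR. Qed.

Lemma hdot0l x : hdot 0 x = 0.
Proof. exact: linear0l. Qed.

Lemma hdot0r x : hdot x 0 = 0.
Proof. exact: linear0r. Qed.

Lemma hdot_suml I (s : seq I) (P : pred I) (F : I -> H) y :
  hdot (\sum_(i <- s | P i) F i) y = \sum_(i <- s | P i) hdot (F i) y.
Proof. exact: linear_sumlz. Qed.

Lemma hdot_sumr I (s : seq I) (P : pred I) (F : I -> H) y :
  hdot y (\sum_(i <- s | P i) F i) = \sum_(i <- s | P i) hdot y (F i).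
Proof. exact: linear_sumr. Qed.

Lemma hdot_eq0C x y : hdot x y = 0 -> hdot y x = 0.
Proof. by move=> xy; rewrite hdotC xy conjc0. Qed.

Lemma hdotxx x : hdot x x = (nm x ^+ 2)%:C.
Proof. by rewrite -hdot_normE nmE rmorphXn. Qed.

Lemma hdotxx_eq0 x : hdot x x = 0 -> x = 0.
Proof.
rewrite hdotxx => /complexI/eqP; rewrite expf_eq0/= nm_eq0.
by move/eqP.
Qed.

Lemma sqr_nmD x y :
  nm (x + y) ^+ 2 = nm x ^+ 2 + nm y ^+ 2 + complex.Re (hdot x y) *+ 2.
Proof.
have : hdot (x + y) (x + y) = hdot x x + hdot y y + (hdot x y + hdot y x).
  by rewrite hdotDl !hdotDr; ring.
rewrite !hdotxx (hdotC y x).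
by case: (hdot x y) => u v /= [] ->; rewrite mulr2n.
Qed.

Lemma sqr_nmB x y :
  nm (x - y) ^+ 2 = nm x ^+ 2 + nm y ^+ 2 - complex.Re (hdot x y) *+ 2.
Proof.
rewrite sqr_nmD nmN -scaleN1r hdotZr rmorphN rmorph1 mulN1r.
by case: (hdot x y) => u v /=; rewrite mulNrn.
Qed.

Lemma parallelogram x y :
  nm (x + y) ^+ 2 + nm (x - y) ^+ 2 = (nm x ^+ 2 + nm y ^+ 2) *+ 2.
Proof. by rewrite sqr_nmD sqr_nmB; lra. Qed.

Lemma pythagoras x y : hdot x y = 0 -> nm (x + y) ^+ 2 = nm x ^+ 2 + nm y ^+ 2.
Proof. by move=> xy; rewrite sqr_nmD xy/= mul0rn addr0. Qed.

Lemma cauchy_schwarz x y : `|hdot x y| <= (nm x * nm y)%:C.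
Proof.
have [->|y0] := eqVneq y 0.
  by rewrite hdot0r normr0 nm0 mulr0.
have ny0 : 0 < nm y by rewrite nm_gt0.
pose a := hdot x y / hdot y y.
have hyy : hdot y y != 0 by apply/eqP => /hdotxx_eq0/eqP; apply/negP.
have o : hdot (a *: y) (x - a *: y) = 0.
  have -> : x - a *: y = x + (- a) *: y by rewrite scaleNr.
  rewrite hdotZl hdotDr hdotZr rmorphN/= mulNr.
  apply/eqP; rewrite mulf_eq0; apply/orP; right.
  rewrite subr_eq0; apply/eqP.
  rewrite /a rmorphM/= fmorphV/= -!hdotC.
  by rewrite mulfVK.
have := pythagoras o; rewrite addrC subrK => nx.
have : nm (a *: y) ^+ 2 <= nm x ^+ 2 by rewrite nx lerDl sqr_ge0.
rewrite ler_sqr ?nnegrE ?nm_ge0// -lecR -!nmE normrZ nmE.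
rewrite normrM normfV hdotxx [X in _ / X]ger0_norm ?ler0c ?sqr_ge0//.
rewrite (nmE y) expr2 rmorphM/= invfM.
set u := (nm y)%:C; have u0 : u != 0.
  by rewrite (inj_eq (@complexI R) (nm y) 0) gt_eqF.
rewrite -!mulrA mulVf// mulr1 ler_pdivrMr; last by rewrite /u ltcR.
by rewrite -rmorphM.
Qed.

Lemma cauchy_schwarzR x y : complex.Re `|hdot x y| <= nm x * nm y.
Proof.
have := cauchy_schwarz x y.
by rewrite lecE/= => /andP[].
Qed.

Lemma nmM_Re x y : complex.Re (hdot x y) <= nm x * nm y.
Proof.
apply: le_trans (cauchy_schwarzR x y).
have := normc_ge_Re (hdot x y); rewrite lecE/= => /andP[_].
by apply: le_trans; exact: ler_norm.
Qed.

Lemma closureP (A : set H) x : closure A x <->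
  forall e : R, 0 < e -> exists2 y, A y & nm (x - y) < e.
Proof.
split=> [cA e e0|cA B /nbhs_ballP[e/= e0 eB]].
  have [|y [Ay]] := cA (ball x e%:C).
    by apply: nbhsx_ballx; rewrite ltcR.
  rewrite -ball_normE/= => xy; exists y => //.
  by rewrite -ltcR -nmE.
have [e1 e1E] : exists e1 : R, e = e1%:C.
  by exists (complex.Re e); rewrite RRe_real// gtr0_real.
have [|y Ay xy] := cA e1; first by rewrite -ltcR -e1E.
exists y; split => //; apply: eB.
by rewrite -ball_normE/= e1E nmE ltcR.
Qed.

Lemma invn_lt (e : R) : 0 < e -> exists N : nat, forall n, (N <= n)%N -> n.+1%:R^-1 < e.
Proof.
move=> e0; exists (Num.truncn e^-1).+1 => n Nn.
rewrite invf_plt ?posrE//.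
have /andP[_ /lt_trans] := truncn_itv (ltW (eqbRL (invr_gt0 e) e0)).
by apply; rewrite ltr_nat ltnS.
Qed.

Lemma hilbert_complete (u : nat -> H) :
  (forall e : R, 0 < e -> exists N, forall m n, (N <= m)%N -> (N <= n)%N ->
     nm (u m - u n) < e) ->
  exists l, forall e : R, 0 < e -> exists N, forall n, (N <= n)%N -> nm (l - u n) < e.
Proof.
move=> uC.
have : cvg (u @ \oo).
  apply/cauchy_cvgP/cauchy_exP => e e0.
  have eE : e = (complex.Re e)%:C by rewrite RRe_real// gtr0_real.
  have [|N uN] := uC (complex.Re e); first by rewrite -ltcR -eE.
  exists (u N); exists N => //= n/= Nn.
  by rewrite -ball_normE/= nmE eE ltcR uN.
move=> /cvg_ex[/= l ul]; exists l => e e0.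
have /cvg_ballP/(_ e%:C) := ul; rewrite ltcR => /(_ e0)[N _ Nu].
exists N => n Nn; have := Nu n Nn.
by rewrite -ball_normE/= nmE ltcR.
Qed.

Lemma nm_small0 x : (forall e : R, 0 < e -> nm x < e) -> x = 0.
Proof.
move=> xe; apply/eqP; rewrite -nm_eq0; apply/negbNE/negP => x0.
have := xe (nm x); rewrite lt_def x0 nm_ge0 => /(_ erefl).
by rewrite ltxx.
Qed.

End hdot_theory.


(** * Closed subspaces and orthogonal projections *)

Section csubspaces.
Context {R : realType} {H : hilbertType R}.
Implicit Types (x y z : H) (a : R[i]) (E : set H).

(** Closedness is phrased with real epsilons, in the form of [closureP], so that limits are handled
    without filters. *)
Record csubspace E : Prop := CSubspace {
  csubspace0 : E 0 ;
  csubspaceP : forall a x y, E x -> E y -> E (a *: x + y) ;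
  csubspace_closed : forall x,
    (forall e : R, 0 < e -> exists2 y, E y & nm (x - y) < e) -> E x }.

Lemma csubspaceD E x y : csubspace E -> E x -> E y -> E (x + y).
Proof. by move=> sE Ex Ey; rewrite -[x]scale1r; exact: csubspaceP. Qed.

Lemma csubspaceZ E a x : csubspace E -> E x -> E (a *: x).
Proof.
move=> sE Ex; rewrite -[a *: x]addr0; apply: csubspaceP => //.
exact: csubspace0.
Qed.

Lemma csubspaceN E x : csubspace E -> E x -> E (- x).
Proof. by move=> sE Ex; rewrite -scaleN1r; exact: csubspaceZ. Qed.

Lemma csubspaceB E x y : csubspace E -> E x -> E y -> E (x - y).
Proof. by move=> sE Ex Ey; apply: csubspaceD => //; exact: csubspaceN. Qed.

Lemma csubspace_sum E I (s : seq I) (P : pred I) (F : I -> H) : csubspace E ->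
  (forall i, P i -> E (F i)) -> E (\sum_(i <- s | P i) F i).
Proof.
move=> sE EF; elim/big_ind : _ => //; first exact: csubspace0.
by move=> x y; exact: csubspaceD.
Qed.

Lemma csubspace_closureP E : csubspace E -> closure E = E.
Proof.
move=> sE; apply/seteqP; split => [x /closureP|x]; last exact: subset_closure.
exact: csubspace_closed.
Qed.

Lemma csubspaceI E F : csubspace E -> csubspace F -> csubspace (E `&` F).
Proof.
move=> sE sF; split; first by split; exact: csubspace0.
  by move=> a x y [Ex Fx] [Ey Fy]; split; exact: csubspaceP.
move=> x xE; split.
  by apply: (csubspace_closed sE) => e /xE[y [Ey _]]; exists y.
by apply: (csubspace_closed sF) => e /xE[y [_ Fy]]; exists y.
Qed.

Lemma csubspace_bigcap I (F : I -> set H) :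
  (forall i, csubspace (F i)) -> csubspace [set x | forall i, F i x].
Proof.
move=> sF; split=> [i|a x y Fx Fy i|x xF i]; first exact: csubspace0.
  by apply: csubspaceP.
by apply: (csubspace_closed (sF i)) => e /xF[y Fy]; exists y => //; exact: Fy.
Qed.

(** [f] is a bare function because the lemma is applied to differences of linear maps, which carry
    no bundled structure. *)
Lemma csubspace_eq_lip (H' : hilbertType R) (f : H -> H') (c : R) :
  (forall a x y, f (a *: x + y) = a *: f x + f y) ->
  (forall x, nm (f x) <= c * nm x) -> csubspace [set x | f x = 0].
Proof.
move=> fl fc.
have f0 : f 0 = 0.
  by apply/eqP; rewrite -nm_eq0 eq_le nm_ge0 (le_trans (fc _))// nm0 mulr0.
split => // [a x y /= fx fy|x fx]; first by rewrite fl fx fy scaler0 addr0.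
apply: nm_small0 => e e0.
have c1 : 0 < Num.max c 0 + 1 by rewrite ltr_wpDl// le_max lexx orbT.
have [|y fy xy] := fx (e / (Num.max c 0 + 1)); first by rewrite divr_gt0.
have -> : f x = f (x - y).
  by rewrite -scaleN1r addrC fl fy scaler0 add0r.
apply: le_lt_trans (fc _) _.
rewrite ltr_pdivlMr// in xy.
apply: le_lt_trans xy; rewrite mulrC ler_wpM2l ?nm_ge0//.
by rewrite ler_wpDr// le_max lexx.
Qed.

Lemma csubspace_hdot y : csubspace [set x | hdot x y = 0].
Proof.
split=> [|a x z /= xy zy|x xE /=]; first by rewrite /= hdot0l.
  by rewrite hdotDl hdotZl xy zy mulr0 addr0.
apply/eqP; rewrite -normr_eq0; apply/eqP.
have nR : `|hdot x y| = (complex.Re `|hdot x y|)%:C.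
  by rewrite RRe_real// ger0_real.
rewrite nR; congr (_ %:C); apply/eqP; rewrite eq_le.
rewrite -[X in _ && X]ler0c -nR normr_ge0 andbT.
apply/ler_addgt0Pl => e e0; rewrite addr0.
have [|z /= zy xz] := xE (e / (nm y + 1)).
  by rewrite divr_gt0// ltr_wpDl// nm_ge0.
have -> : hdot x y = hdot (x - z) y by rewrite hdotBl zy subr0.
apply: le_trans (cauchy_schwarzR _ _) _.
rewrite ltr_pdivlMr in xz; last by rewrite ltr_wpDl// nm_ge0.
apply: le_trans (ltW xz); rewrite ler_wpM2l ?nm_ge0//.
by rewrite lerDl.
Qed.

Lemma csubspace_orthocompl (A : set H) : csubspace (orthocompl A).
Proof.
have -> : orthocompl A =
    [set x | forall i : {y | A y}, [set x | hdot x (projT1 i) = 0] x].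
  apply/seteqP; split => [x Ax [y Ay]/=|x xA y Ay]; first exact: Ax.
  exact: (xA (exist _ y Ay)).
by apply: csubspace_bigcap => -[y Ay]; exact: csubspace_hdot.
Qed.

Lemma linear_span_closed (A : set H) a x y :
  linear_span A x -> linear_span A y -> linear_span A (a *: x + y).
Proof.
move=> [n [c [u [Au ->]]]] [m [d [v [Av ->]]]].
exists (n + m)%N,
  (fun i => match fintype.split i with inl j => a * c j | inr j => d j end),
  (fun i => match fintype.split i with inl j => u j | inr j => v j end); split.
  by move=> i; case: (fintype.split i).
rewrite big_split_ord/= scaler_sumr; congr (_ + _); apply: eq_bigr => i _.
  case: split_ordP => j; last by move/eqP; rewrite eq_lrshift.
  by move/lshift_inj => ->; rewrite scalerA.
case: split_ordP => j; first by move/eqP; rewrite eq_rlshift.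
by move/rshift_inj => ->.
Qed.

Lemma linear_span0 (A : set H) : linear_span A 0.
Proof.
exists 0%N, (fun=> 0), (fun=> 0); split; first by case.
by rewrite big_ord0.
Qed.

Lemma subset_linear_span (A : set H) : A `<=` linear_span A.
Proof.
move=> x Ax; exists 1%N, (fun=> 1), (fun=> x); split => //.
by rewrite big_ord1 scale1r.
Qed.

Lemma subset_closed_span (A : set H) : A `<=` closed_span A.
Proof. by move=> x /subset_linear_span; exact: subset_closure. Qed.

Lemma csubspace_closed_span (A : set H) : csubspace (closed_span A).
Proof.
split; first by apply: subset_closure; exact: linear_span0.
  move=> a x y /closureP cx /closureP cy; apply/closureP => e e0.
  have a1 : 0 < complex.Re `|a| + 1.
    by rewrite ltr_wpDl// -ler0c RRe_real// ger0_real.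
  have [|u Au xu] := cx (e / 2 / (complex.Re `|a| + 1)).
    by rewrite !divr_gt0.
  have [|v Av yv] := cy (e / 2); first by rewrite divr_gt0.
  exists (a *: u + v); first exact: linear_span_closed.
  rewrite opprD addrACA -scalerBr; apply: le_lt_trans (nmD _ _) _.
  rewrite [e]splitr; apply: ltrD => //.
  rewrite nmZ; rewrite ltr_pdivlMr// in xu; apply: le_lt_trans xu.
  by rewrite mulrC ler_wpM2l ?nm_ge0// lerDl.
move=> x xA; apply/closureP => e e0.
have [|y /closureP yA xy] := xA (e / 2); first by rewrite divr_gt0.
have [|z Az yz] := yA (e / 2); first by rewrite divr_gt0.
by exists z => //; rewrite [e]splitr; apply: le_lt_trans (nm_tri y _ _) _; exact: ltrD.
Qed.

Lemma closed_span_sub (A E : set H) : csubspace E -> A `<=` E -> closed_span A `<=` E.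
Proof.
move=> sE AE; rewrite -[E]csubspace_closureP//; apply: closure_subset.
move=> _ [n [c [u [Au ->]]]]; apply: csubspace_sum => // i _.
by apply: csubspaceZ => //; apply: AE.
Qed.

Lemma min_dist_orth E x y : csubspace E -> E y ->
  (forall z, E z -> nm (x - y) <= nm (x - z)) -> orthocompl E (x - y).
Proof.
move=> sE Ey ymin z Ez.
have [->|z0] := eqVneq z 0; first by rewrite hdot0r.
pose u := x - y; pose a := hdot u z / hdot z z.
have hzz : hdot z z != 0 by apply/eqP => /hdotxx_eq0/eqP; apply/negP.
have o : hdot (u - a *: z) (a *: z) = 0.
  by rewrite hdotZr hdotBl hdotZl /a mulfVK// subrr mulr0.
have := pythagoras o; rewrite subrK => nu.
have : nm u <= nm (u - a *: z).
  have -> : u - a *: z = x - (y + a *: z) by rewrite /u opprD addrA.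
  by apply: ymin; apply: csubspaceD => //; exact: csubspaceZ.
rewrite -ler_sqr ?nnegrE ?nm_ge0// nu gerDl => naz.
have /eqP : nm (a *: z) ^+ 2 = 0 by apply/eqP; rewrite eq_le naz sqr_ge0.
rewrite expf_eq0/= nm_eq0 scaler_eq0 (negPf z0) orbF mulf_eq0 invr_eq0.
by rewrite (negPf hzz) orbF => /eqP.
Qed.

Lemma projection E x : csubspace E -> exists2 y, E y & orthocompl E (x - y).
Proof.
move=> sE.
pose D := [set nm (x - y) ^+ 2 | y in E].
pose d := inf D.
have D0 : D !=set0 by exists (nm (x - 0) ^+ 2), 0 => //; exact: csubspace0.
have Dlb : has_lbound D by exists 0 => _ [y _ <-]; exact: sqr_ge0.
have dle y : E y -> d <= nm (x - y) ^+ 2.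
  by move=> Ey; apply: ge_inf => //; exists y.
have ex n : exists y, E y /\ nm (x - y) ^+ 2 < d + n.+1%:R^-1.
  have [|_ [y Ey <-] yd] := @inf_adherent _ D n.+1%:R^-1 _ (conj D0 Dlb).
    by rewrite invr_gt0.
  by exists y.
have [u uP] := choice ex.
have uE n : E (u n) by case: (uP n).
have ud n : nm (x - u n) ^+ 2 < d + n.+1%:R^-1 by case: (uP n).
(* The midpoint of [u m] and [u n] lies in [E], at squared distance at least [d] from [x]; the
   parallelogram identity then bounds their distance by the two excesses over [d]. *)
have close m n : nm (u m - u n) ^+ 2 <= (m.+1%:R^-1 + n.+1%:R^-1) *+ 2.
  have := parallelogram (x - u m) (x - u n).
  have -> : x - u m - (x - u n) = - (u m - u n).
    by rewrite opprB addrC addrA subrK opprB addrC.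
  have -> : x - u m + (x - u n) = 2%:R *: (x - 2%:R^-1 *: (u m + u n)).
    rewrite scalerBr scalerA divff ?pnatr_eq0// scale1r scaler_nat mulr2n.
    by rewrite opprD addrACA.
  rewrite nmN nmZ exprMn.
  have -> : complex.Re `|2%:R : R[i]| = 2%:R.
    by rewrite ger0_norm// -(rmorph_nat (real_complex R) 2).
  have := dle (2%:R^-1 *: (u m + u n)).
  move=> /(_ (csubspaceZ _ sE (csubspaceD sE (uE m) (uE n)))).
  have := ud m; have := ud n; move: (m.+1%:R^-1) (n.+1%:R^-1) => s t.
  by rewrite expr2; lra.
have [e e0|y yu] := @hilbert_complete _ _ u.
  have [|N NP] := @invn_lt R (e ^+ 2 / 4); first by rewrite divr_gt0 ?exprn_gt0.
  exists N => m n Nm Nn.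
  rewrite -ltr_sqr ?nnegrE ?nm_ge0 ?(ltW e0)//.
  apply: le_lt_trans (close m n) _.
  by have := NP m Nm; have := NP n Nn; move: (m.+1%:R^-1) (n.+1%:R^-1) => s t; lra.
have Ey : E y.
  apply: (csubspace_closed sE) => e /yu[N NP].
  by exists (u N) => //; exact: NP.
exists y => //; apply: min_dist_orth => // z Ez.
apply/ler_addgt0Pl => e e0.
have [N NP] := yu _ (divr_gt0 e0 (ltr0n R 2)).
have [|N' NP'] := @invn_lt R ((e / 2) ^+ 2); first by rewrite exprn_gt0// divr_gt0.
pose n := maxn N N'.
have := NP n (leq_maxl _ _); have := NP' n (leq_maxr _ _) => n1 n2.
apply: le_trans (nm_tri (u n) _ _) _.
(* Compared through squares: the excess 1/(n+1) is below (e / 2)^2, which (nm (x - z) + e / 2)^2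
   absorbs. *)
have : nm (x - u n) <= nm (x - z) + e / 2.
  rewrite -ler_sqr ?nnegrE ?nm_ge0//; last first.
    by rewrite addr_ge0 ?nm_ge0// divr_ge0// ltW.
  apply: le_trans (ltW (ud n)) _.
  have := dle _ Ez; have : 0 <= nm (x - z) * e by rewrite mulr_ge0 ?nm_ge0// ltW.
  move: n1; move: (n.+1%:R^-1) (nm (x - z)) => s t n1 te dt.
  by rewrite sqrrD mulr2n; nra.
by rewrite nmB in n2; lra.
Qed.

Lemma orthocompl_self E x : E x -> orthocompl E x -> x = 0.
Proof. by move=> Ex /(_ _ Ex) /hdotxx_eq0. Qed.

Lemma csubspace_eqT E F : csubspace E -> csubspace F -> E `<=` F ->
  (forall x, F x -> orthocompl E x -> x = 0) -> E = F.
Proof.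
move=> sE sF EF EF0; apply/seteqP; split => // x Fx.
have [y Ey xy] := projection x sE.
have /EF0 : F (x - y) by apply: csubspaceB => //; exact: EF.
by move=> /(_ xy)/eqP; rewrite subr_eq0 => /eqP ->.
Qed.

Lemma orthocompl_closed_span (A : set H) x :
  (forall y, A y -> hdot x y = 0) -> orthocompl (closed_span A) x.
Proof.
move=> xA y; apply: (@closed_span_sub _ [set y | hdot x y = 0]) => //.
have -> : [set y | hdot x y = 0] = [set y | hdot y x = 0].
  by apply/seteqP; split => z /hdot_eq0C.
exact: csubspace_hdot.
Qed.

Lemma oprojP E x : csubspace E -> E (oproj E x) /\ orthocompl E (x - oproj E x).
Proof.
move=> sE; rewrite /oproj; case: xgetP => [y _ [] //|nE].
by have [y Ey xy] := projection x sE; case: (nE y).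
Qed.

Lemma oproj_uniq E x y : csubspace E -> E y -> orthocompl E (x - y) -> oproj E x = y.
Proof.
move=> sE Ey xy; have [Ep xp] := oprojP x sE.
apply/eqP; rewrite -subr_eq0; apply/eqP; apply: (@orthocompl_self E).
  exact: csubspaceB.
have -> : oproj E x - y = (x - y) - (x - oproj E x).
  by rewrite opprB [RHS]addrC subrKA.
by apply: (csubspaceB (csubspace_orthocompl E)).
Qed.

End csubspaces.

Section make_linear.
Context {R : pzRingType} {U V : lmodType R} (f : U -> V).
Hypothesis fl : forall a x y, f (a *: x + y) = a *: f x + f y.

Definition linear_fun : U -> V := f.
HB.instance Definition _ :=
  GRing.isLinear.Build R U V *:%R linear_fun fl.
Definition make_linear : {linear U -> V} := linear_fun.

End make_linear.

(** * Extending maps from total families *)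

Section extension.
Context {R : realType}.

(** A combination is a list of coefficient-index pairs, possibly with repetitions: concatenation is
    addition, and [I] needs no decidable equality. *)
Definition lincomb (H : hilbertType R) (I : Type) (x : I -> H) (s : seq (R[i] * I)) : H :=
  \sum_(p <- s) p.1 *: x p.2.

Definition total_family (H : hilbertType R) (I : Type) (x : I -> H) : Prop :=
  forall h (e : R), 0 < e -> exists s, nm (h - lincomb x s) < e.

Lemma lincomb_cat (H : hilbertType R) (I : Type) (x : I -> H) s t :
  lincomb x (s ++ t) = lincomb x s + lincomb x t.
Proof. by rewrite /lincomb big_cat. Qed.

Definition scale_seq (I : Type) a (s : seq (R[i] * I)) :=
  [seq (a * p.1, p.2) | p <- s].

Lemma lincomb_scale (H : hilbertType R) (I : Type) (x : I -> H) a s :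
  lincomb x (scale_seq a s) = a *: lincomb x s.
Proof.
rewrite /lincomb big_map scaler_sumr; apply: eq_bigr => p _.
by rewrite scalerA.
Qed.

Lemma lincomb_span (H : hilbertType R) (I : Type) (x : I -> H) h :
  linear_span (range x) h <-> exists s, h = lincomb x s.
Proof.
split=> [[n [c [u [uA ->]]]]|[s ->]].
  have /choice[g gP] : forall i, exists j, x j = u i.
    by move=> i; have [j _ <-] := uA i; exists j.
  exists [seq (c i, g i) | i <- index_enum 'I_n].
  by rewrite /lincomb big_map; apply: eq_bigr => i _; rewrite gP.
elim: s => [|[a i] s]; first by rewrite /lincomb big_nil; exact: linear_span0.
move=> IH; rewrite /lincomb big_cons; apply: linear_span_closed => //=.
by apply: subset_linear_span; exists i.
Qed.

Lemma total_closed_span (H : hilbertType R) (I : Type) (x : I -> H) :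
  total_family x <-> closed_span (range x) = [set: H].
Proof.
split=> [tx|cx h e e0].
  apply/seteqP; split => // h _; apply/closureP => e e0.
  have [s hs] := tx h e e0; exists (lincomb x s) => //.
  by apply/lincomb_span; exists s.
have : closed_span (range x) h by rewrite cx.
move=> /closureP/(_ e e0)[y /lincomb_span[s ->]]; by exists s.
Qed.

Lemma orth_total (H : hilbertType R) (I : Type) (x : I -> H) :
  (forall h, (forall i, hdot h (x i) = 0) -> h = 0) <-> total_family x.
Proof.
split=> [x0|tx h hx].
  apply/total_closed_span; apply: csubspace_eqT => //.
  - exact: csubspace_closed_span.
  - move=> h _ hx; apply: x0 => i; apply: hx.
    by apply: subset_closed_span; exists i.
have /total_closed_span cx := tx.
apply: (@orthocompl_self _ _ (closed_span (range x))); first by rewrite cx.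
by apply: orthocompl_closed_span => _ [i _ <-].
Qed.

Variables (H H' : hilbertType R) (I : Type) (x : I -> H) (y : I -> H') (M : R).
Hypothesis M0 : 0 <= M.
Hypothesis xT : total_family x.
Hypothesis yx : forall s, nm (lincomb y s) <= M * nm (lincomb x s).

(** Closure of the relation between combinations of the [x i] and the same combinations of the
    [y i]. A vector can have several expressions; the bound [yx] still makes [G] the graph of a
    bounded linear map. *)
Let G h k := forall e : R, 0 < e ->
  exists s, nm (h - lincomb x s) < e /\ nm (k - lincomb y s) < e.

Let G_ex h : exists k, G h k.
Proof.
have ex n : exists s, nm (h - lincomb x s) < n.+1%:R^-1.
  by apply: xT; rewrite invr_gt0.
have [s sP] := choice ex.
have [e e0|k kP] := @hilbert_complete _ _ (fun n => lincomb y (s n)).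
  have [|N NP] := @invn_lt R (e / 2 / (M + 1)).
    by rewrite !divr_gt0// ltr_wpDl.
  exists N => m n Nm Nn.
  have -> : lincomb y (s m) - lincomb y (s n) =
      lincomb y (s m ++ scale_seq (-1) (s n)).
    by rewrite lincomb_cat lincomb_scale scaleN1r.
  apply: le_lt_trans (yx _) _.
  rewrite lincomb_cat lincomb_scale scaleN1r.
  have : nm (lincomb x (s m) - lincomb x (s n)) < e / (M + 1).
    apply: le_lt_trans (nm_tri h _ _) _; rewrite nmB.
    have := sP m; have := sP n; have := NP m Nm; have := NP n Nn.
    have -> : e / 2 / (M + 1) = e / (M + 1) / 2 by rewrite mulrAC.
    move: (m.+1%:R^-1) (n.+1%:R^-1) (e / (M + 1)) => a b c; lra.
  rewrite ltr_pdivlMr ?ltr_wpDl//.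
  apply: le_lt_trans; rewrite mulrC ler_wpM2l ?nm_ge0//.
  by rewrite lerDl.
exists k => e e0.
have [N NP] := kP e e0; have [N' NP'] := @invn_lt R e e0.
exists (s (maxn N N')); split; last by apply: NP; exact: leq_maxl.
by apply: lt_trans (sP _) _; apply: NP'; exact: leq_maxr.
Qed.

Let G_bound h k : G h k -> nm k <= M * nm h.
Proof.
move=> hk; apply/ler_addgt0Pl => e e0.
have M1 : 0 < M + 1 by rewrite ltr_wpDl.
have [|s [hs ks]] := hk (e / (M + 1)); first by rewrite divr_gt0.
have : nm k <= nm (k - lincomb y s) + nm (lincomb y s).
  by rewrite -{1}[k](subrK (lincomb y s)) nmD.
have : nm (lincomb x s) <= nm (h - lincomb x s) + nm h.
  rewrite nmB -{1}[lincomb x s](subrK h); exact: nmD.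
have := yx s.
have eE : e = e / (M + 1) * (M + 1) by rewrite divfK// gt_eqF.
move: hs ks eE; move: (e / (M + 1)) => d hs ks -> h1 h2 h3.
have : M * nm (lincomb x s) <= M * (d + nm h) by apply: ler_wpM2l => //; lra.
rewrite mulrDr; move: (M * nm (lincomb x s)) (M * nm h) h1 => p q h1.
by rewrite (mulrC d); lra.
Qed.

Let G_lin a h k h' k' : G h k -> G h' k' -> G (a *: h + h') (a *: k + k').
Proof.
move=> hk hk' e e0.
have a1 : 0 < complex.Re `|a| + 1.
  by rewrite ltr_wpDl// -ler0c RRe_real// ger0_real.
have [|s [hs ks]] := hk (e / 2 / (complex.Re `|a| + 1)); first by rewrite !divr_gt0.
have [|t [ht kt]] := hk' (e / 2); first by rewrite divr_gt0.
exists (scale_seq a s ++ t); rewrite !lincomb_cat !lincomb_scale.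
rewrite !opprD; split.
  rewrite addrACA -scalerBr.
  apply: le_lt_trans (nmD _ _) _; rewrite [e]splitr; apply: ltrD => //.
  rewrite nmZ; rewrite ltr_pdivlMr// in hs; apply: le_lt_trans hs.
  by rewrite mulrC ler_wpM2l ?nm_ge0// lerDl.
rewrite addrACA -scalerBr.
apply: le_lt_trans (nmD _ _) _; rewrite [e]splitr; apply: ltrD => //.
rewrite nmZ; rewrite ltr_pdivlMr// in ks; apply: le_lt_trans ks.
by rewrite mulrC ler_wpM2l ?nm_ge0// lerDl.
Qed.

Let G_uniq h k k' : G h k -> G h k' -> k = k'.
Proof.
move=> hk hk'; have := G_lin (-1) hk' hk.
rewrite !scaleN1r addNr => /G_bound; rewrite nm0 mulr0 => kk.
have /eqP : nm (- k' + k) = 0 by apply/eqP; rewrite eq_le kk nm_ge0.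
by rewrite nm_eq0 addrC subr_eq0 => /eqP.
Qed.

Lemma bounded_extension : exists V : {linear H -> H'},
  (forall i, V (x i) = y i) /\ (forall h, nm (V h) <= M * nm h).
Proof.
have [f fG] := choice G_ex.
have fl a h h' : f (a *: h + h') = a *: f h + f h'.
  by apply: G_uniq (fG _) _; apply: G_lin; exact: fG.
exists (make_linear fl); split => [i|h]; last exact/G_bound/fG.
apply: G_uniq (fG _) _ => e e0.
by exists [:: (1, i)]; rewrite /lincomb !big_seq1 !scale1r !subrr !nm0.
Qed.

End extension.

Lemma hdot_lincomb (R : realType) (H H' : hilbertType R) (I : Type) (x : I -> H)
    (y : I -> H') s t :
  (forall i j, hdot (x i) (x j) = hdot (y i) (y j)) ->
  hdot (lincomb x s) (lincomb x t) = hdot (lincomb y s) (lincomb y t).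
Proof.
move=> xy; rewrite !hdot_suml; apply: eq_bigr => p _.
rewrite !hdot_sumr; apply: eq_bigr => q _.
by rewrite !hdotZl !hdotZr xy.
Qed.

Lemma bounded_eq_total (R : realType) (H H' : hilbertType R) (I : Type) (x : I -> H)
    (f g : H -> H') (c d : R) : total_family x ->
  (forall a x y, f (a *: x + y) = a *: f x + f y) ->
  (forall a x y, g (a *: x + y) = a *: g x + g y) ->
  (forall x, nm (f x) <= c * nm x) -> (forall x, nm (g x) <= d * nm x) ->
  (forall i, f (x i) = g (x i)) -> f =1 g.
Proof.
move=> xT fl gl fc gd fg h; apply/eqP; rewrite -subr_eq0; apply/eqP.
have sE : csubspace [set x | f x - g x = 0].
  apply: (@csubspace_eq_lip _ _ _ (fun x => f x - g x) (c + d)) => [a u v|u].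
    by rewrite fl gl scalerBr opprD addrACA.
  by apply: le_trans (nmD _ _) _; rewrite nmN mulrDl lerD.
suff : closed_span (range x) `<=` [set x | f x - g x = 0].
  by apply; move/total_closed_span : xT => ->.
by apply: closed_span_sub => // _ [i _ <-] /=; rewrite fg subrr.
Qed.

(** Equal Gram matrices make both [x i -> y i] and [y i -> x i] isometric on combinations; the two
    extensions are mutually inverse because they are so on total families. *)
Lemma unitary_gram (R : realType) (H H' : hilbertType R) (I : Type) (x : I -> H)
    (y : I -> H') : total_family x -> total_family y ->
  (forall i j, hdot (x i) (x j) = hdot (y i) (y j)) ->
  exists V : {linear H -> H'}, [/\ forall i, V (x i) = y i,
    unitary_onto [set: H] [set: H'] V,
    forall h k, hdot (V h) (V k) = hdot h k & forall h, nm (V h) = nm h].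
Proof.
move=> xT yT xy.
have nmxy s : nm (lincomb x s) = nm (lincomb y s).
  apply/eqP; rewrite -(@eqrXn2 _ 2)// ?nm_ge0//; apply/eqP/complexI.
  by rewrite -!hdotxx; exact: hdot_lincomb.
have [|V [Vx VM]] := @bounded_extension R H H' I x y 1 ler01 xT.
  by move=> s; rewrite mul1r nmxy.
have [|W [Wy WM]] := @bounded_extension R H' H I y x 1 ler01 yT.
  by move=> s; rewrite mul1r nmxy.
have WV : cancel V W.
  apply: (@bounded_eq_total _ _ _ _ x (W \o V) id 1 1 xT) => //=.
  - by move=> a u v; rewrite !linearP.
  - by move=> h; rewrite mul1r (le_trans (WM _))// mul1r (le_trans (VM _))// mul1r.
  - by move=> h; rewrite mul1r.
  - by move=> i; rewrite Vx Wy.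
have VW : cancel W V.
  apply: (@bounded_eq_total _ _ _ _ y (V \o W) id 1 1 yT) => //=.
  - by move=> a u v; rewrite !linearP.
  - by move=> h; rewrite mul1r (le_trans (VM _))// mul1r (le_trans (WM _))// mul1r.
  - by move=> h; rewrite mul1r.
  - by move=> i; rewrite Wy Vx.
have nmV h : nm (V h) = nm h.
  apply/eqP; rewrite eq_le.
  have := VM h; have := WM (V h); rewrite WV !mul1r => -> ->//.
(* Polarization: norms determine the real parts, and the imaginary parts follow by replacing [h]
   with 'i h. *)
have ReV h k : complex.Re (hdot (V h) (V k)) = complex.Re (hdot h k).
  have := sqr_nmD (V h) (V k); rewrite -linearD !nmV sqr_nmD; lra.
have dV h k : hdot (V h) (V k) = hdot h k.
  have := ReV ('i *: h) k; rewrite linearZ/= !hdotZl.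
  by have := ReV h k; case: (hdot (V h) (V k)) (hdot h k) => [a b] [c d] /=; simpc => /= -> /oppr_inj ->.
exists V; split => //; split => //.
by apply/seteqP; split => // k _; exists (W k).
Qed.

(** * Real series and square-summable families *)

Section real_series.
Context {R : realType}.
Implicit Types (u v : nat -> R) (a M : R).

Definition summ u : Prop := cvgn (series u).
Definition sumR u : R := limn (series u).

Lemma summP a u v : summ u -> summ v ->
  summ (fun k => a * u k + v k) /\ sumR (fun k => a * u k + v k) = a * sumR u + sumR v.
Proof.
move=> su sv; have sau : summ (a *: u : nat -> R) by exact: is_cvg_seriesZ.
have -> : (fun k => a * u k + v k) = (a *: u : nat -> R) + v by [].
split; first exact: is_cvg_seriesD.
by rewrite /sumR lim_seriesD// lim_seriesZ.
Qed.

Lemma summ0 : summ (fun=> 0) /\ sumR (fun=> 0) = 0.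
Proof.
have e : series (fun=> 0 : R) = fun=> 0.
  by apply/funext => n; rewrite /series/= big1.
by rewrite /summ /sumR e; split; [exact: is_cvg_cst|exact: lim_cst].
Qed.

Lemma summZ a u : summ u -> summ (fun k => a * u k) /\ sumR (fun k => a * u k) = a * sumR u.
Proof.
move=> su; have [s0 l0] := summ0; have := summP a su s0.
rewrite l0 addr0.
by have -> : (fun k => a * u k + 0) = (fun k => a * u k) by apply/funext => k; rewrite addr0.
Qed.

Lemma summD u v : summ u -> summ v ->
  summ (fun k => u k + v k) /\ sumR (fun k => u k + v k) = sumR u + sumR v.
Proof.
move=> su sv; have := summP 1 su sv; rewrite mul1r.
by have -> : (fun k => 1 * u k + v k) = (fun k => u k + v k) by apply/funext => k; rewrite mul1r.
Qed.

Lemma series_mono u : (forall k, 0 <= u k) -> {homo series u : n m / (n <= m)%N >-> n <= m}.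
Proof.
move=> u0 n m nm; rewrite -subr_ge0 sub_series_geq//; exact: sumr_ge0.
Qed.

Lemma summ_ge_partial u N : (forall k, 0 <= u k) -> summ u ->
  \sum_(0 <= k < N) u k <= sumR u.
Proof.
move=> u0 su; apply: (nondecreasing_cvgn_le (series_mono u0) su N).
Qed.

Lemma summ_bounded u M : (forall k, 0 <= u k) ->
  (forall N, \sum_(0 <= k < N) u k <= M) -> summ u /\ sumR u <= M.
Proof.
move=> u0 uM.
have su : summ u.
  apply: nondecreasing_is_cvgn; first exact: series_mono.
  by exists M => _ [n _ <-]; exact: uM.
split => //; apply: limr_le => //.
by apply: nearW => n; exact: uM.
Qed.

Lemma summ_norm u v : (forall k, `|u k| <= v k) -> summ v ->
  summ u /\ `|sumR u| <= sumR v.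
Proof.
move=> uv sv.
have su : cvgn [normed series u].
  by apply: (@series_le_cvg _ (fun k => `|u k|) v) => // k; exact: le_trans (uv k).
have su' : summ u by exact: normed_cvg.
split => //; apply: le_trans (lim_series_norm su) _.
exact: lim_series_le.
Qed.

Lemma summ_dom u v : summ v -> (forall k, `|u k| <= v k) -> summ u.
Proof. by move=> sv uv; have [] := summ_norm uv sv. Qed.

Lemma summ_le u v : summ u -> summ v -> (forall k, u k <= v k) -> sumR u <= sumR v.
Proof. exact: lim_series_le. Qed.

Lemma summ_finite u N : (forall k, (N <= k)%N -> u k = 0) ->
  summ u /\ sumR u = \sum_(0 <= k < N) u k.
Proof.
move=> uN.
have ev : \forall n \near \oo, series u n = \sum_(0 <= k < N) u k.
  exists N => // n /= Nn; rewrite /series/= (@big_cat_nat _ _ _ N)//=.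
  rewrite [X in _ + X]big_nat_cond [X in _ + X]big1 ?addr0// => k /andP[/andP[Nk _] _].
  exact: uN.
have cu : series u @ \oo --> \sum_(0 <= k < N) u k.
  by apply: cvg_near_cst.
by split; [apply/cvg_ex; eexists; exact: cu|exact: (cvg_lim _ cu)].
Qed.

Lemma sum_cvg_bound (I : eqType) (s : seq I) (f : I -> nat -> R) (l : I -> R) M :
  (forall i, i \in s -> f i @ \oo --> l i) ->
  (\forall n \near \oo, \sum_(i <- s) f i n <= M) -> \sum_(i <- s) l i <= M.
Proof.
move=> fl fM.
have cs : (fun n => \sum_(i <- s) f i n) @ \oo --> \sum_(i <- s) l i.
  elim: s fl {fM} => [|i s IH] fl.
    under eq_fun do rewrite big_nil.
    by rewrite big_nil; exact: cvg_cst.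
  under eq_fun do rewrite big_cons.
  rewrite big_cons; apply: cvgD; first by apply: fl; rewrite mem_head.
  by apply: IH => j js; apply: fl; rewrite in_cons js orbT.
rewrite -(cvg_lim _ cs)//; apply: limr_le => //.
by apply/cvg_ex; eexists; exact: cs.
Qed.

End real_series.

(** * Cauchy-Schwarz for an abstract dot product *)

Section form_cs.
Context {R : realType} {U : lmodType R[i]} (f : {dot U for (@Num.conj R[i])}).
Implicit Types x y : U.

Lemma dot_ge0 x : 0 <= f x x.
Proof.
have [->|x0] := eqVneq x 0; first by rewrite linear0l.
by apply/ltW; exact: neq0_dnorm_gt0.
Qed.

Lemma dotC x y : f x y = (f y x)^*%C.
Proof. by rewrite hermC/= expr0 mul1r. Qed.

(** Stated for a form without a norm, since it is needed to prove the triangle inequality that makes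
    [l2] a normed space. *)
Lemma dot_cs x y : (complex.Re (f x y)) ^+ 2 <= complex.Re (f x x) * complex.Re (f y y).
Proof.
have [->|y0] := eqVneq y 0.
  by rewrite !linear0r/= expr0n.
have fy : 0 < complex.Re (f y y).
  have : 0 < f y y by exact: neq0_dnorm_gt0.
  by rewrite ltcE/= => /andP[].
(* The minimizer over real t of the quadratic polynomial f (x + t y) (x + t y). *)
pose t := - complex.Re (f x y) / complex.Re (f y y).
have := dot_ge0 (x + t%:C *: y).
rewrite linearDl/= !linearDr/= linearZl_LR/= !linearZr_LR/= (dotC y x) linearZl_LR/=.
rewrite lecE/= => /andP[_].
move: fy; rewrite /t {t}; case: (f x y) (f x x) (f y y) => a b [c d] [g h]/= g0.
rewrite [X in 0 <= X -> _](_ : _ = c - a ^+ 2 / g); last by field; exact: lt0r_neq0.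
by rewrite subr_ge0 ler_pdivrMr.
Qed.

End form_cs.

(** * The Hilbert space of square-summable sequences *)

Section l2_space.
Context {R : realType} (P : pred nat).
Implicit Types (z : R[i]).

Definition abs2 z : R := (complex.Re z) ^+ 2 + (complex.Im z) ^+ 2.

Lemma abs2_ge0 z : 0 <= abs2 z.
Proof. by rewrite addr_ge0// sqr_ge0. Qed.

Lemma abs2M z t : abs2 (z * t) = abs2 z * abs2 t.
Proof. by case: z t => a b [c d]; rewrite /abs2/=; ring. Qed.

Lemma abs2D z t : abs2 (z + t) <= 2 * abs2 z + 2 * abs2 t.
Proof.
case: z t => a b [c d]; rewrite /abs2/= -subr_ge0.
rewrite (_ : _ - _ = (a - c) ^+ 2 + (b - d) ^+ 2); last by ring.
by rewrite addr_ge0// sqr_ge0.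
Qed.

Lemma abs2_eq0 z : abs2 z = 0 -> z = 0.
Proof.
case: z => a b; rewrite /abs2/= => /eqP.
by rewrite paddr_eq0 ?sqr_ge0// !expf_eq0/= => /andP[/eqP-> /eqP->].
Qed.

(** Sequences vanish off [P], so that one construction yields every finite or countable
    dimension. *)
Definition l2_pred : {pred nat -> R[i]} := fun x =>
  `[< (forall k, ~~ P k -> x k = 0) /\ summ (fun k => abs2 (x k)) >].

Lemma l2_submod : GRing.submod_closed l2_pred.
Proof.
split=> [|a x y]; rewrite !unfold_in.
  apply/asboolP; split => //.
  have -> : (fun k => abs2 ((0 : nat -> R[i]) k)) = fun=> 0 :> R.
    by apply/funext => k; rewrite /abs2/= expr0n/= addr0.
  by case: (@summ0 R).
move=> /asboolP[x0 sx] /asboolP[y0 sy]; apply/asboolP; split.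
  by move=> k Pk; rewrite !fctE x0// y0// scaler0 addr0.
have [s _] := summZ (2 * abs2 a) sx.
have [s' _] := summZ 2 sy.
have [t _] := summD s s'.
apply: (summ_dom t) => k.
rewrite ger0_norm ?abs2_ge0// !fctE; apply: le_trans (abs2D _ _) _.
by rewrite abs2M mulrA.
Qed.

HB.instance Definition _ := GRing.isSubmodClosed.Build R[i] (nat -> R[i]) l2_pred l2_submod.

Record l2 := L2 { l2_val : nat -> R[i] ; _ : l2_val \in l2_pred }.
HB.instance Definition _ := [isSub for l2_val].
HB.instance Definition _ := [Choice of l2 by <:].
HB.instance Definition _ := [SubChoice_isSubLmodule of l2 by <:].

Lemma l2_ext (x y : l2) : (forall k, l2_val x k = l2_val y k) -> x = y.
Proof. by move=> xy; apply: val_inj; apply/funext. Qed.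

Lemma l2_supp (x : l2) k : ~~ P k -> l2_val x k = 0.
Proof. by have := valP x; rewrite unfold_in => /asboolP[x0 _] /x0. Qed.

Lemma l2_summ (x : l2) : summ (fun k => abs2 (l2_val x k)).
Proof. by have := valP x; rewrite unfold_in => /asboolP[]. Qed.
Arguments l2_summ x : clear implicits.

Lemma l2_valP a (x y : l2) k : l2_val (a *: x + y) k = a * l2_val x k + l2_val y k.
Proof. by []. Qed.

Definition dotc (x y : l2) k : R[i] := l2_val x k * (l2_val y k)^*%C.

Lemma dotc_bound (x y : l2) k :
  `|complex.Re (dotc x y k)| <= abs2 (l2_val x k) + abs2 (l2_val y k) /\
  `|complex.Im (dotc x y k)| <= abs2 (l2_val x k) + abs2 (l2_val y k).
Proof.
rewrite /dotc; case: (l2_val x k) (l2_val y k) => a b [c d]; rewrite /abs2/=.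
have := (sqr_ge0 (a - c), sqr_ge0 (a + c), sqr_ge0 (b - d), sqr_ge0 (b + d),
  (sqr_ge0 (a - d), sqr_ge0 (a + d), sqr_ge0 (b - c), sqr_ge0 (b + c)),
  (sqr_ge0 a, sqr_ge0 b, sqr_ge0 c, sqr_ge0 d)).
rewrite !expr2 => -[[[[[[h1 h2] h3] h4] [[[h5 h6] h7] h8]] [[[h9 h10] h11] h12]]].
by split; rewrite ler_norml; apply/andP; split; lra.
Qed.

Lemma summ_dotc (x y : l2) :
  summ (fun k => complex.Re (dotc x y k)) /\ summ (fun k => complex.Im (dotc x y k)).
Proof.
have [s _] := summD (l2_summ x) (l2_summ y).
by split; apply: (summ_dom s) => k; case: (dotc_bound x y k).
Qed.

Definition l2_dot (x y : l2) : R[i] :=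
  sumR (fun k => complex.Re (dotc x y k)) +i* sumR (fun k => complex.Im (dotc x y k)).

Lemma l2_dotC x y : l2_dot x y = (l2_dot y x)^*%C.
Proof.
rewrite /l2_dot/=; congr (_ +i* _).
  congr sumR; apply/funext => k; rewrite /dotc.
  by case: (l2_val x k) (l2_val y k) => a b [c d]/=; ring.
have [_ s] := summ_dotc y x.
have [_ e] := summZ (-1) s; rewrite -mulN1r -e.
congr sumR; apply/funext => k; rewrite /dotc.
by case: (l2_val x k) (l2_val y k) => a b [c d]/=; ring.
Qed.

Lemma l2_dotP a (x y z : l2) : l2_dot (a *: x + y) z = a * l2_dot x z + l2_dot y z.
Proof.
have [s1 s2] := summ_dotc x z; have [s3 s4] := summ_dotc y z.
case: a => a b; rewrite /l2_dot.
have [s5 e5] := summP (- b) s2 s3; have [_ e6] := summP a s1 s5.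
have [s7 e7] := summP b s1 s4; have [_ e8] := summP a s2 s7.
simpc; congr (_ +i* _).
  rewrite [RHS](_ : _ = a * sumR (fun k => complex.Re (dotc x z k)) +
    (- b * sumR (fun k => complex.Im (dotc x z k)) + sumR (fun k => complex.Re (dotc y z k)))).
    rewrite -e5 -e6; congr sumR; apply/funext => k; rewrite /dotc.
    rewrite l2_valP.
    by case: (l2_val x k) (l2_val y k) (l2_val z k) => c d [e f] [g h]/=; ring.
  by ring.
rewrite [RHS](_ : _ = a * sumR (fun k => complex.Im (dotc x z k)) +
  (b * sumR (fun k => complex.Re (dotc x z k)) + sumR (fun k => complex.Im (dotc y z k)))).
  rewrite -e7 -e8; congr sumR; apply/funext => k; rewrite /dotc.
  rewrite l2_valP.
  by case: (l2_val x k) (l2_val y k) (l2_val z k) => c d [e f] [g h]/=; ring.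
by ring.
Qed.

Lemma l2_dot_linear (z : l2) : linear_for *%R (l2_dot^~ z).
Proof. by move=> a x y; exact: l2_dotP. Qed.

Lemma l2_dot_linearr (z : l2) : linear_for (@Num.conj R[i] \; *%R) (l2_dot z).
Proof.
move=> a x y; rewrite !(l2_dotC z) l2_dotP rmorphD rmorphM.
by congr (_ + _).
Qed.

HB.instance Definition _ := bilinear_isBilinear.Build R[i] l2 l2 R[i] *%R
  (@Num.conj R[i] \; *%R) l2_dot (l2_dot_linear, l2_dot_linearr).

Lemma l2_dot_herm x y : l2_dot x y = (-1) ^+ false * Num.conj (l2_dot y x).
Proof. by rewrite expr0 mul1r; exact: l2_dotC. Qed.

HB.instance Definition _ := isHermitianSesquilinear.Build R[i] l2 false (@Num.conj R[i])
  l2_dot l2_dot_herm.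

Lemma l2_dotxx x : l2_dot x x = (sumR (fun k => abs2 (l2_val x k)))%:C.
Proof.
rewrite /l2_dot; congr (_ +i* _).
  congr sumR; apply/funext => k; rewrite /dotc /abs2.
  by case: (l2_val x k) => a b /=; ring.
rewrite (_ : (fun k => _) = fun=> 0); first by case: (@summ0 R).
apply/funext => k; rewrite /dotc.
by case: (l2_val x k) => a b /=; ring.
Qed.

Lemma l2_sum_ge0 x : 0 <= sumR (fun k => abs2 (l2_val x k)).
Proof.
have := summ_ge_partial 0 (fun k => abs2_ge0 _) (l2_summ x).
by rewrite big_geq.
Qed.

Lemma l2_sum_ge_term x k : abs2 (l2_val x k) <= sumR (fun k => abs2 (l2_val x k)).
Proof.
have := summ_ge_partial k.+1 (fun k => abs2_ge0 _) (l2_summ x).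
apply: le_trans; rewrite big_nat_recr//= lerDr.
by apply: sumr_ge0 => i _; exact: abs2_ge0.
Qed.

Lemma l2_dot_def x : x != 0 -> 0 < l2_dot x x.
Proof.
move=> x0; rewrite l2_dotxx ltcR lt_def l2_sum_ge0 andbT.
apply: contra x0 => /eqP s0; apply/eqP/l2_ext => k.
apply/abs2_eq0/eqP; rewrite eq_le abs2_ge0 andbT -s0.
exact: l2_sum_ge_term.
Qed.

HB.instance Definition _ := isDotProduct.Build R[i] l2 l2_dot l2_dot_def.

Definition l2_nm (x : l2) : R := Num.sqrt (sumR (fun k => abs2 (l2_val x k))).

Lemma l2_nm_sqr x : l2_nm x ^+ 2 = complex.Re (l2_dot x x).
Proof. by rewrite l2_dotxx sqr_sqrtr// l2_sum_ge0. Qed.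

Lemma l2_nmD x y : l2_nm (x + y) <= l2_nm x + l2_nm y.
Proof.
rewrite -ler_sqr ?nnegrE ?addr_ge0 ?sqrtr_ge0// sqrrD !l2_nm_sqr.
have -> : l2_dot (x + y) (x + y) = l2_dot x x + l2_dot y y + (l2_dot x y + l2_dot y x).
  by rewrite linearDl/= !linearDr/=; ring.
have : complex.Re (l2_dot x y) <= l2_nm x * l2_nm y.
  rewrite (le_trans (ler_norm _))// -ler_sqr ?nnegrE ?mulr_ge0 ?sqrtr_ge0//.
  by rewrite real_normK ?num_real// exprMn !l2_nm_sqr; exact: dot_cs.
rewrite (l2_dotC y x) mulr2n.
by case: (l2_dot x y) (l2_dot x x) (l2_dot y y) => a b [c d] [e f]/=; lra.
Qed.

Lemma l2_nmZ a x : (l2_nm (a *: x))%:C = `|a| * (l2_nm x)%:C.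
Proof.
rewrite normc_def -rmorphM/=; congr (_ %:C).
rewrite -sqrtrM ?addr_ge0 ?sqr_ge0//; congr Num.sqrt.
have [_ <-] := summZ (abs2 a) (l2_summ x).
by congr sumR; apply/funext => k; rewrite -abs2M.
Qed.

Lemma l2_nmDC x y : (l2_nm (x + y))%:C <= (l2_nm x)%:C + (l2_nm y)%:C.
Proof. by rewrite -rmorphD/= lecR l2_nmD. Qed.

Lemma l2_nm_eq0 x : (l2_nm x)%:C = 0 -> x = 0.
Proof.
move=> /complexI n0; apply/eqP; apply: contraT => /l2_dot_def.
by rewrite l2_dotxx -[sumR _]sqr_sqrtr ?l2_sum_ge0// -/(l2_nm x) n0 expr0n/= ltxx.
Qed.

HB.instance Definition _ := @Lmodule_isNormed.Build R[i] l2 (fun x => (l2_nm x)%:C)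
  l2_nmDC l2_nmZ l2_nm_eq0.



Lemma l2_normE (x : l2) : `|x| = (l2_nm x)%:C.
Proof. by []. Qed.

(** The limit is built coordinatewise, from real and imaginary parts. Bounds on partial sums pass to
    the limit, which is why the final estimate is only a weak inequality. *)
Lemma l2_seq_complete (u : nat -> l2) :
  (forall e : R, 0 < e -> exists N, forall m n, (N <= m)%N -> (N <= n)%N ->
     l2_nm (u m - u n) < e) ->
  exists l, forall e : R, 0 < e -> exists N, forall n, (N <= n)%N -> l2_nm (l - u n) <= e.
Proof.
move=> uC.
have valB m n k : l2_val (u m - u n) k = l2_val (u m) k - l2_val (u n) k by [].
have partial (x : l2) (N : nat) e : l2_nm x <= e -> \sum_(0 <= k < N) abs2 (l2_val x k) <= e ^+ 2.
  move=> xe; apply: le_trans (summ_ge_partial N (fun k => abs2_ge0 _) (l2_summ x)) _.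
  rewrite -[leLHS]sqr_sqrtr ?l2_sum_ge0// ler_sqr ?nnegrE ?sqrtr_ge0//.
  by apply: le_trans xe; exact: sqrtr_ge0.
have term (x : l2) k e : 0 < e -> l2_nm x < e ->
    `|complex.Re (l2_val x k)| < e /\ `|complex.Im (l2_val x k)| < e.
  move=> e0 xe.
  have : abs2 (l2_val x k) < e ^+ 2.
    apply: le_lt_trans (l2_sum_ge_term x k) _.
    by rewrite -[ltLHS]sqr_sqrtr ?l2_sum_ge0// ltr_sqr ?nnegrE ?sqrtr_ge0 ?ltW.
  rewrite /abs2 => h; split; rewrite -ltr_sqr ?nnegrE ?normr_ge0 ?(ltW e0)//.
    by rewrite real_normK ?num_real//; apply: le_lt_trans h; rewrite lerDl sqr_ge0.
  by rewrite real_normK ?num_real//; apply: le_lt_trans h; rewrite lerDr sqr_ge0.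
have cre k : exists a, (fun n => complex.Re (l2_val (u n) k)) @ \oo --> (a : R).
  apply/cvg_ex/cauchy_cvgP/cauchy_exP => e e0; have [N NP] := uC e e0.
  exists (complex.Re (l2_val (u N) k)); exists N => // n /= Nn.
  rewrite -ball_normE/=.
  have [+ _] := term (u N - u n) k e e0 (NP _ _ (leqnn _) Nn).
  by rewrite valB raddfB.
have cim k : exists a, (fun n => complex.Im (l2_val (u n) k)) @ \oo --> (a : R).
  apply/cvg_ex/cauchy_cvgP/cauchy_exP => e e0; have [N NP] := uC e e0.
  exists (complex.Im (l2_val (u N) k)); exists N => // n /= Nn.
  rewrite -ball_normE/=.
  have [_] := term (u N - u n) k e e0 (NP _ _ (leqnn _) Nn).
  by rewrite valB raddfB.
have [a aP] := choice cre; have [b bP] := choice cim.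
pose f k := a k +i* b k.
(* A finite partial sum involves finitely many coordinates, hence is the limit in [m] of partial
   sums of [u m - u n], all at most e^2. *)
have key e N : 0 < e -> (forall m n, (N <= m)%N -> (N <= n)%N -> l2_nm (u m - u n) < e) ->
   forall n K, (N <= n)%N -> \sum_(0 <= k < K) abs2 (f k - l2_val (u n) k) <= e ^+ 2.
  move=> e0 NP n K Nn.
  apply: (@sum_cvg_bound _ _ (index_iota 0 K)
    (fun k m => abs2 (l2_val (u m - u n) k))) => [k _|].
    have abs2B (v w : R[i]) : abs2 (v - w) =
        (complex.Re v - complex.Re w) * (complex.Re v - complex.Re w) +
        (complex.Im v - complex.Im w) * (complex.Im v - complex.Im w).
      by rewrite /abs2 !raddfB !expr2.
    rewrite abs2B; under eq_fun do rewrite valB abs2B.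
    apply: cvgD.
      by apply: cvgM; (apply: cvgB; [exact: aP|exact: cvg_cst]).
    by apply: cvgM; (apply: cvgB; [exact: bP|exact: cvg_cst]).
  by exists N => // m /= Nm; apply: (partial (u m - u n) K e); apply/ltW/NP.
have [N1 N1P] := uC 1 ltr01.
have [sf _] : summ (fun k => abs2 (f k - l2_val (u N1) k)) /\ _ :=
  summ_bounded (fun k => abs2_ge0 _) (fun K => key 1 N1 ltr01 N1P N1 K (leqnn _)).
have fP : f \in l2_pred.
  rewrite unfold_in; apply/asboolP; split => [k Pk|].
    rewrite /f; congr (_ +i* _).
      rewrite -(cvg_lim _ (aP k))// (_ : (fun n => _) = fun=> 0) ?lim_cst//.
    by apply/funext => n; rewrite l2_supp.
    rewrite -(cvg_lim _ (bP k))// (_ : (fun n => _) = fun=> 0) ?lim_cst//.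
    by apply/funext => n; rewrite l2_supp.
  have [t1 _] := summZ 2 sf; have [t2 _] := summZ 2 (l2_summ (u N1)).
  have [t3 _] := summD t1 t2.
  apply: (summ_dom t3) => k.
  rewrite ger0_norm ?abs2_ge0//; apply: le_trans (abs2D _ _).
  by rewrite subrK.
exists (L2 fP) => e e0; have [N NP] := uC e e0; exists N => n Nn.
rewrite /l2_nm -(ger0_norm (ltW e0)) -sqrtr_sqr ler_sqrt ?sqr_ge0//.
have [_] := summ_bounded (fun k => abs2_ge0 _) (fun K => key e N e0 NP n K Nn).
exact.
Qed.

(** A Cauchy filter contains balls of radius 1/(n+1); their centres form a Cauchy sequence whose
    limit is the limit of the filter. *)
Lemma l2_complete (F : set_system l2) : ProperFilter F -> cauchy F -> cvg F.
Proof.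
move=> FF Fc.
have ex n : exists x : l2, F (ball x (n.+1%:R^-1%:C)).
  by have /cauchyP := Fc; apply; rewrite ltcR invr_gt0.
have [u uP] := choice ex.
have inv_lt (e : R) : 0 < e -> exists N : nat, forall n, (N <= n)%N -> n.+1%:R^-1 < e.
  move=> e0; exists (Num.truncn e^-1).+1 => n Nn.
  rewrite invf_plt ?posrE//.
  have /andP[_ /lt_trans] := truncn_itv (ltW (eqbRL (invr_gt0 e) e0)).
  by apply; rewrite ltr_nat ltnS.
have [e e0|l lP] := @l2_seq_complete u.
  have [N NP] := inv_lt (e / 2) (divr_gt0 e0 (ltr0n R 2)).
  exists N => m n Nm Nn.
  have [x [xm xn]] := filter_ex (filterI (uP m) (uP n)).
  rewrite -ltcR -l2_normE [e]splitr rmorphD/=.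
  apply: le_lt_trans (ler_distD x _ _) _; apply: ltrD.
    by move: xm; rewrite -ball_normE/= => /lt_trans; apply; rewrite ltcR; exact: NP.
  by move: xn; rewrite distrC -ball_normE/= => /lt_trans; apply; rewrite ltcR; exact: NP.
apply/cvg_ex; exists l; apply/cvg_ballP => e e0.
have [e1 e1E] : exists e1 : R, e = e1%:C.
  by exists (complex.Re e); rewrite RRe_real// gtr0_real.
have e10 : 0 < e1 by rewrite -ltcR -e1E.
have [N NP] := lP (e1 / 2) (divr_gt0 e10 (ltr0n R 2)).
have [N' NP'] := inv_lt (e1 / 2) (divr_gt0 e10 (ltr0n R 2)).
pose n := maxn N N'.
apply: filterS (uP n) => x; rewrite -!ball_normE/= => ux.
rewrite e1E [e1]splitr rmorphD/=; apply: le_lt_trans (ler_distD (u n) _ _) _.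
apply: ler_ltD; first by rewrite l2_normE lecR; apply: NP; exact: leq_maxl.
by apply: lt_trans ux _; rewrite ltcR; apply: NP'; exact: leq_maxr.
Qed.

HB.instance Definition _ := Uniform_isComplete.Build l2 l2_complete.

Lemma l2_hdot_normE (x : l2) : `|x| ^+ 2 = l2_dot x x.
Proof.
rewrite l2_normE l2_dotxx -rmorphXn/=; congr (_ %:C).
by rewrite sqr_sqrtr// l2_sum_ge0.
Qed.

HB.instance Definition _ := CompleteNormedModule_isHilbert.Build R l2 l2_hdot_normE.



Lemma l2_e_subproof k : P k -> (fun j => (j == k)%:R : R[i]) \in l2_pred.
Proof.
move=> Pk; rewrite unfold_in; apply/asboolP; split=> [j|].
  by have [->|//] := eqVneq j k; rewrite Pk.
have [j kj|//] := @summ_finite _ (fun j => abs2 ((j == k)%:R)) k.+1.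
by rewrite gtn_eqF// /abs2/= expr0n/= addr0.
Qed.

Definition l2_e k (Pk : P k) : l2 := L2 (l2_e_subproof Pk).

Lemma hdot_l2_e (x : l2) k (Pk : P k) : hdot x (l2_e Pk) = l2_val x k.
Proof.
rewrite /hdot/= /l2_dot /dotc/=.
have sum1 (v : nat -> R) : sumR (fun j => if j == k then v j else 0) = v k.
  have [j kj|_ ->] := @summ_finite _ (fun j => if j == k then v j else 0) k.+1.
    by rewrite gtn_eqF.
  rewrite big_nat_recr//= eqxx big_nat_cond big1 ?add0r// => j.
  by rewrite andbT => /andP[_ jk]; rewrite ltn_eqF.
rewrite [X in X +i* _](_ : _ = complex.Re (l2_val x k)).
  rewrite [X in _ +i* X](_ : _ = complex.Im (l2_val x k)); first by case: (l2_val x k).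
  rewrite -[RHS](sum1 (fun j => complex.Im (l2_val x j))); congr sumR.
  apply/funext => j; case: eqP => _; case: (l2_val x j) => a b /=; ring.
rewrite -[RHS](sum1 (fun j => complex.Re (l2_val x j))); congr sumR.
apply/funext => j; case: eqP => _; case: (l2_val x j) => a b /=; ring.
Qed.

Lemma l2_conj_subproof (x : l2) : (fun k => (l2_val x k)^*%C) \in l2_pred.
Proof.
rewrite unfold_in; apply/asboolP; split => [k Pk|]; first by rewrite l2_supp// conjc0.
rewrite (_ : (fun k => _) = (fun k => abs2 (l2_val x k))); first exact: l2_summ.
by apply/funext => k; rewrite /abs2; case: (l2_val x k) => a b/=; rewrite sqrrN.
Qed.

Definition l2_conj (x : l2) : l2 := L2 (l2_conj_subproof x).

Lemma l2_conj_linear : linear_for (@Num.conj R[i] \; *:%R) l2_conj.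
Proof.
move=> a x y; apply: l2_ext => k /=.
by rewrite -[LHS]/((a * l2_val x k + l2_val y k)^*%C) rmorphD rmorphM.
Qed.

HB.instance Definition _ := GRing.isLinear.Build R[i] l2 l2 (@Num.conj R[i] \; *:%R)
  l2_conj l2_conj_linear.

Lemma l2_conjK x : l2_conj (l2_conj x) = x.
Proof. by apply: l2_ext => k /=; rewrite conjcK. Qed.

Lemma l2_conj_norm x : `|l2_conj x| = `|x|.
Proof.
rewrite !l2_normE /l2_nm; congr (Num.sqrt (sumR _))%:C.
by apply/funext => k; rewrite /abs2/=; case: (l2_val x k) => a b/=; rewrite sqrrN.
Qed.

End l2_space.

(** Source of the ambient space in the existence part: there [I] is the type of valid block indices,
    and the conjugation fixing the basis becomes the J of the tuple. *)
Lemma l2_model (R : realType) (I : Type) (code : I -> nat) : injective code ->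
  exists (H : hilbertType R) (e : I -> H)
    (J : {linear H -> H | (@Num.conj R[i]) \; *:%R}),
  [/\ forall i, hdot (e i) (e i) = 1, forall i j, i <> j -> hdot (e i) (e j) = 0,
      forall h, (forall i, hdot h (e i) = 0) -> h = 0,
      conjugation J & forall i, J (e i) = e i].
Proof.
move=> ci.
pose P n := `[< exists i, code i = n >].
have PP i : P (code i) by apply/asboolP; exists i.
exists (l2 P), (fun i => l2_e (PP i)), (@l2_conj R P); split.
- by move=> i; rewrite hdot_l2_e/= eqxx.
- move=> i j ij; rewrite hdot_l2_e/=; case: eqP => // /ci ji.
  by case: ij.
- move=> h h0; apply: l2_ext => k; have [/asboolP[i <-]|] := boolP (P k).
    by rewrite -(hdot_l2_e h (PP i)) h0.
  exact: l2_supp.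
- by split => x; [exact: l2_conj_norm|exact: l2_conjK].
- move=> i; apply: l2_ext => k /=; exact: conjc_nat.
Qed.

(** * Diagonal and compact operators *)

Lemma cabsE (R : realType) (z : R[i]) : `|z| = (complex.Re `|z|)%:C.
Proof. by rewrite RRe_real// ger0_real. Qed.

Lemma cabs_ge0 (R : realType) (z : R[i]) : 0 <= complex.Re `|z|.
Proof. by rewrite -ler0c -cabsE. Qed.

Lemma cabs_le0 (R : realType) (z : R[i]) : complex.Re `|z| <= 0 -> z = 0.
Proof.
move=> z0; apply/eqP; rewrite -normr_eq0 cabsE.
have -> : complex.Re `|z| = 0 by apply/eqP; rewrite eq_le z0 cabs_ge0.
by [].
Qed.

Lemma cabs_ReIm (R : realType) (z : R[i]) :
  [/\ `|complex.Re z| <= complex.Re `|z|, `|complex.Im z| <= complex.Re `|z| &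
    complex.Re `|z| <= `|complex.Re z| + `|complex.Im z|].
Proof.
case: z => a b; rewrite normc_def/=; split.
- by rewrite -sqrtr_sqr ler_wsqrtr// lerDl sqr_ge0.
- by rewrite -sqrtr_sqr ler_wsqrtr// lerDr sqr_ge0.
- rewrite -[leRHS]ger0_norm ?addr_ge0// -sqrtr_sqr ler_wsqrtr//.
  rewrite sqrrD !real_normK ?num_real//.
  by rewrite -addrA (addrC (_ *+ 2)) addrA lerDl mulrn_wge0// mulr_ge0.
Qed.

Lemma cabsM (R : realType) (z w : R[i]) :
  complex.Re `|z * w| = complex.Re `|z| * complex.Re `|w|.
Proof. by apply: complexI; rewrite rmorphM/= -!cabsE normrM. Qed.

Lemma bounded_continuous (R : realType) (H H' : hilbertType R) (f : {linear H -> H'}) (M : R) :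
  (forall x, nm (f x) <= M * nm x) -> continuous f.
Proof.
move=> fM x; apply/cvg_ballP => e e0.
have [e1 e1E] : exists e1 : R, e = e1%:C.
  by exists (complex.Re e); rewrite RRe_real// gtr0_real.
have e10 : 0 < e1 by rewrite -ltcR -e1E.
have M1 : 0 < Num.max M 0 + 1 by rewrite ltr_wpDl// le_max lexx orbT.
apply/nbhs_ballP; exists (e1 / (Num.max M 0 + 1))%:C => /=.
  by rewrite ltcR divr_gt0.
move=> y; rewrite -!ball_normE/= !nmE e1E !ltcR ltr_pdivlMr// => xy.
rewrite -linearB; apply: le_lt_trans (fM _) _; apply: le_lt_trans xy.
by rewrite mulrC ler_wpM2l ?nm_ge0// ler_wpDr// le_max lexx.
Qed.

Lemma csubspace_functional (R : realType) (H : hilbertType R) (f : H -> R[i]) (M : R) :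
  (forall a x y, f (a *: x + y) = a * f x + f y) ->
  (forall x, complex.Re `|f x| <= M * nm x) -> csubspace [set x | f x = 0].
Proof.
move=> fl fM.
split => [|a x y /= fx fy|x fx /=].
- by apply: cabs_le0; apply: le_trans (fM _) _; rewrite nm0 mulr0.
- by rewrite fl fx fy mulr0 addr0.
apply: cabs_le0; apply/ler_addgt0Pl => e e0; rewrite addr0.
have M1 : 0 < Num.max M 0 + 1 by rewrite ltr_wpDl// le_max lexx orbT.
have [|z /= fz xz] := fx (e / (Num.max M 0 + 1)); first by rewrite divr_gt0.
have -> : f x = f (x - z).
  by rewrite -scaleN1r addrC fl fz mulr0 add0r.
apply: le_trans (fM _) _; rewrite ltr_pdivlMr// in xz.
apply: le_trans (ltW xz).
by rewrite mulrC ler_wpM2l ?nm_ge0// ler_wpDr// le_max lexx.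
Qed.

Lemma nm_sum (R : realType) (H : hilbertType R) (I : Type) (s : seq I) (F : I -> H) :
  nm (\sum_(i <- s) F i) <= \sum_(i <- s) nm (F i).
Proof.
elim/big_ind2: _ => //; first by rewrite nm0.
by move=> x a y b xa yb; apply: le_trans (nmD _ _) (lerD xa yb).
Qed.

(** * A criterion for precompactness *)

Section precompact_criterion.
Context {R : realType} {H : hilbertType R}.

(** Total boundedness in coordinates: [A] lies within [e] of a bounded box of a finite-dimensional
    space. The bounds on real and imaginary parts reduce compactness to that of a real segment. *)
Definition finitely_approx (A : set H) : Prop := forall e : R, 0 < e ->
  exists (n : nat) (v : 'I_n -> H) (M : R), forall x, A x ->
    exists2 a : 'I_n -> R[i],
      (forall i, `|complex.Re (a i)| <= M /\ `|complex.Im (a i)| <= M) &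
      nm (x - \sum_(i < n) a i *: v i) < e.

Lemma ultra_cvg_bounded (T : Type) (F : set_system T) (g : T -> R) (M : R) :
  UltraFilter F -> F [set x | `|g x| <= M] ->
  exists r, forall d, 0 < d -> F [set x | `|r - g x| < d].
Proof.
move=> FU FM.
have [|r [_ rc]] := @segment_compact R (- M) M (g @ F) _.
  change (F (g @^-1` `[- M, M]%classic)).
  by apply: filterS FM => x /= gx; rewrite in_itv/= -ler_norml.
exists r => d d0.
have [//|nF] := in_ultra_setVsetC [set x | `|r - g x| < d] FU.
have [y [/= yn]] := rc [set y | ~ (`|r - y| < d)] (ball r d) nF (nbhsx_ballx _ _ d0).
by [].
Qed.

(** Along an ultrafilter every bounded coefficient converges; the filter is therefore eventually
    close to one fixed combination, hence Cauchy. *)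
Lemma precompact_finitely_approx (A : set H) : finitely_approx A -> precompact A.
Proof.
move=> Aapp; rewrite precompactE compact_ultra => F FU FA.
suff : cvg F.
  move=> /cvg_ex[l Fl]; exists l; split => //.
  exact: (@closed_cvg _ _ F _ id (closure A) (@closed_closure _ A) FA l Fl).
apply/cauchy_cvgP/cauchy_exP => e e0.
have [e1 e1E] : exists e1 : R, e = e1%:C.
  by exists (complex.Re e); rewrite RRe_real// gtr0_real.
have e10 : 0 < e1 by rewrite -ltcR -e1E.
have e15 : 0 < e1 / 5 by rewrite divr_gt0.
have [n [v [M MP]]] := Aapp _ e15.
have /choice[a aP] : forall x, exists a : 'I_n -> R[i], closure A x ->
    (forall i, `|complex.Re (a i)| <= M /\ `|complex.Im (a i)| <= M) /\
    nm (x - \sum_(i < n) a i *: v i) < e1 / 5 + e1 / 5.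
  move=> x; have [Ax|nAx] := pselect (closure A x); last by exists (fun=> 0).
  have /closureP/(_ _ e15)[y Ay xy] := Ax; have [a aM ya] := MP y Ay.
  by exists a => _; split => //; apply: le_lt_trans (nm_tri y _ _) (ltrD _ _).
(* [d] keeps the total coefficient error at most e1 / 5; the approximants themselves, for points of
   the closure, cost another 2 e1 / 5. *)
pose d := e1 / 5 / (1 + \sum_(i < n) (nm (v i) + nm (v i))).
have S1 : 0 < 1 + \sum_(i < n) (nm (v i) + nm (v i)).
  by rewrite ltr_pwDl// sumr_ge0// => i _; rewrite addr_ge0 ?nm_ge0.
have d0 : 0 < d by rewrite divr_gt0.
have /choice[r rP] : forall i : 'I_n, exists r : R[i], F [set x |
    `|complex.Re r - complex.Re (a x i)| < d / 2 /\
    `|complex.Im r - complex.Im (a x i)| < d / 2].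
  move=> i.
  have [|r1 r1P] := @ultra_cvg_bounded _ F (fun x => complex.Re (a x i)) M FU.
    by apply: filterS FA => x /aP[/(_ i)[]].
  have [|r2 r2P] := @ultra_cvg_bounded _ F (fun x => complex.Im (a x i)) M FU.
    by apply: filterS FA => x /aP[/(_ i)[]].
  exists (r1 +i* r2); have d20 : 0 < d / 2 by rewrite divr_gt0.
  exact: filterI (r1P _ d20) (r2P _ d20).
exists (\sum_(i < n) r i *: v i).
have Fall : F [set x | forall i : 'I_n,
    `|complex.Re (r i) - complex.Re (a x i)| < d / 2 /\
    `|complex.Im (r i) - complex.Im (a x i)| < d / 2].
  exact: filter_forall.
apply: filterS2 FA Fall => x /aP[_ xa] xr.
rewrite -ball_normE/= e1E nmE ltcR.
apply: le_lt_trans (nm_tri (\sum_(i < n) a x i *: v i) _ _) _.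
rewrite [X in _ + X]nmB.
suff : nm (\sum_(i < n) r i *: v i - \sum_(i < n) a x i *: v i) <= e1 / 5 by lra.
rewrite -sumrB; apply: le_trans (nm_sum _ _) _.
apply: (@le_trans _ _ (\sum_(i < n) d * (nm (v i) + nm (v i)))).
  apply: ler_sum => i _; rewrite -scalerBl nmZ.
  have [_ _ h] := cabs_ReIm (r i - a x i).
  have [h1 h2] := xr i; rewrite !raddfB/= in h.
  rewrite mulrDr -mulrDl; apply: ler_wpM2r; first exact: nm_ge0.
  by apply: le_trans h _; lra.
rewrite -mulr_sumr /d mulrAC -mulrA ger_pMr// ler_pdivrMr// mul1r.
by rewrite lerDr.
Qed.

End precompact_criterion.

Lemma functional_eq_total (R : realType) (H : hilbertType R) (I : Type) (x : I -> H)
    (f g : H -> R[i]) (c d : R) : total_family x ->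
  (forall a x y, f (a *: x + y) = a * f x + f y) ->
  (forall a x y, g (a *: x + y) = a * g x + g y) ->
  (forall x, complex.Re `|f x| <= c * nm x) -> (forall x, complex.Re `|g x| <= d * nm x) ->
  (forall i, f (x i) = g (x i)) -> f =1 g.
Proof.
move=> xT fl gl fc gd fg h; apply/eqP; rewrite -subr_eq0; apply/eqP.
have sE : csubspace [set x | f x - g x = 0].
  apply: (@csubspace_functional _ _ (fun x => f x - g x) (c + d)) => [a u v|u].
    by rewrite fl gl mulrBr opprD addrACA.
  rewrite mulrDl; apply: le_trans (lerD (fc u) (gd u)).
  by rewrite -lecR rmorphD/= -!cabsE ler_normB.
suff : closed_span (range x) `<=` [set x | f x - g x = 0].
  by apply; move/total_closed_span : xT => ->.
by apply: closed_span_sub => // _ [i _ <-] /=; rewrite fg subrr.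
Qed.

(** * Operators diagonal in an orthonormal basis *)

Section orthonormal_bases.
Context {R : realType} {H : hilbertType R} {I : choiceType}.
Implicit Types (b : I -> H) (c d : I -> R[i]) (D E : H -> H) (x y : H).

Definition onsys b : Prop := forall i j, hdot (b i) (b j) = (i == j)%:R.

Definition onb b : Prop :=
  onsys b /\ forall h, (forall i, hdot h (b i) = 0) -> h = 0.

(** Merges repeated indices. The coefficients do not depend on [y], so that combinations of a basis
    and of its images can be rewritten together. *)
Lemma lincomb_coef (s : seq (R[i] * I)) : exists (t : seq I) (a : I -> R[i]),
  uniq t /\ forall y : I -> H, lincomb y s = \sum_(i <- t) a i *: y i.
Proof.
exists (undup [seq p.2 | p <- s]), (fun i => \sum_(p <- s | p.2 == i) p.1).
split=> [|y]; first exact: undup_uniq.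
under eq_bigr => i _ do rewrite scaler_suml big_mkcond.
rewrite exchange_big/= /lincomb big_seq [RHS]big_seq.
apply: eq_bigr => p ps.
rewrite (bigD1_seq p.2)/= ?undup_uniq//; last first.
  by rewrite mem_undup; apply/mapP; exists p.
rewrite eqxx big1 ?addr0// => i ip.
by rewrite eq_sym (negPf ip).
Qed.

Lemma onsys_sum_hdot b (t : seq I) (a : I -> R[i]) j : onsys b -> uniq t ->
  hdot (\sum_(i <- t) a i *: b i) (b j) = if j \in t then a j else 0.
Proof.
move=> ob ut; rewrite hdot_suml; case: ifPn => jt.
  rewrite (bigD1_seq j)//= hdotZl ob eqxx mulr1 big1 ?addr0// => i ij.
  by rewrite hdotZl ob (negPf ij) mulr0.
rewrite big_seq big1// => i it; rewrite hdotZl ob.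
by case: eqP => [ij|]; rewrite ?mulr0//; rewrite -ij it in jt.
Qed.

Lemma onsys_sum_nm b (t : seq I) (a : I -> R[i]) : onsys b -> uniq t ->
  nm (\sum_(i <- t) a i *: b i) ^+ 2 = \sum_(i <- t) complex.Re `|a i| ^+ 2.
Proof.
move=> ob; elim: t => [_|i t IH /= /andP[it ut]].
  by rewrite !big_nil nm0 expr0n.
rewrite !big_cons pythagoras ?IH//; last first.
  rewrite hdotZl hdotC onsys_sum_hdot// (negPf it).
  by rewrite conjc0 mulr0.
congr (_ + _); rewrite nmZ exprMn.
suff -> : nm (b i) ^+ 2 = 1 by rewrite mulr1.
by apply: complexI; rewrite -hdotxx ob eqxx.
Qed.

Lemma onsys_nm1 b i : onsys b -> nm (b i) = 1.
Proof.
move=> ob; apply/eqP; rewrite -(@eqrXn2 _ 2)// ?nm_ge0// expr1n; apply/eqP.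
by apply: complexI; rewrite -hdotxx ob eqxx.
Qed.

Lemma onb_total b : onb b -> total_family b.
Proof. by case=> _ /orth_total. Qed.

Lemma onb_ext b x y : onb b -> (forall i, hdot x (b i) = hdot y (b i)) -> x = y.
Proof.
move=> [_ b0] xy; apply/eqP; rewrite -subr_eq0; apply/eqP/b0 => i.
by rewrite hdotBl xy subrr.
Qed.

(** The coordinate form turns operator identities into scalar ones through [onb_ext], without
    density arguments. It also makes sense when some [b i] vanish, as in [vonb] below. *)
Definition diag_op b c D : Prop :=
  (exists M, forall x, nm (D x) <= M * nm x) /\
  forall x i, hdot (D x) (b i) = c i * hdot x (b i).

Lemma diag_exists b c (M : R) : onb b -> 0 <= M -> (forall i, complex.Re `|c i| <= M) ->
  exists D : {linear H -> H}, diag_op b c D /\ forall x, nm (D x) <= M * nm x.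
Proof.
move=> [ob b0] M0 cM.
have bT : total_family b by exact: onb_total.
have [s|D [Db DM]] := @bounded_extension R H H I b (fun i => c i *: b i) M M0 bT.
  have [t [a [ut st]]] := lincomb_coef s; rewrite !st.
  under eq_bigr do rewrite scalerA.
  rewrite -ler_sqr ?nnegrE ?mulr_ge0 ?nm_ge0// exprMn.
  rewrite (onsys_sum_nm (fun i => a i * c i))// onsys_sum_nm// mulr_sumr; apply: ler_sum => i _.
  rewrite cabsM mulrC exprMn ler_wpM2r ?sqr_ge0//.
  by rewrite ler_sqr ?nnegrE ?cabs_ge0//.
exists D; split => //; split; first by exists M.
move=> x i; apply: (@functional_eq_total _ _ _ b (fun x => hdot (D x) (b i))
  (fun x => c i * hdot x (b i)) M M bT).
- by move=> a u v; rewrite linearP hdotDl hdotZl.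
- by move=> a u v; rewrite hdotDl hdotZl mulrDr mulrCA.
- move=> u; apply: le_trans (cauchy_schwarzR _ _) _.
  by rewrite onsys_nm1// mulr1.
- move=> u; rewrite cabsM; apply: ler_pM; rewrite ?cabs_ge0//.
  by apply: le_trans (cauchy_schwarzR _ _) _; rewrite onsys_nm1// mulr1.
- move=> j; rewrite Db hdotZl !ob.
  by case: eqP => [->|]; rewrite ?mulr0.
Qed.

Section with_basis.
Variable b : I -> H.
Hypothesis bB : onb b.

Lemma diag_basis c D i : diag_op b c D -> D (b i) = c i *: b i.
Proof.
move=> [_ Dc]; apply: (onb_ext bB) => j; rewrite Dc hdotZl.
by rewrite (proj1 bB); case: eqP => [->|]; rewrite ?mulr0.
Qed.

Lemma diag_linear c D a x y : diag_op b c D -> D (a *: x + y) = a *: D x + D y.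
Proof.
move=> [_ Dc]; apply: (onb_ext bB) => i.
by rewrite hdotDl hdotZl !Dc hdotDl hdotZl mulrDr mulrCA.
Qed.

Lemma diag_comm c d D E : diag_op b c D -> diag_op b d E -> forall x, D (E x) = E (D x).
Proof.
by move=> [_ Dc] [_ Ed] x; apply: (onb_ext bB) => i; rewrite Dc !Ed Dc mulrCA.
Qed.

Lemma diag_adj c d D E : (forall i, d i = (c i)^*%C) -> diag_op b c D -> diag_op b d E ->
  forall x y, hdot (D x) y = hdot x (E y).
Proof.
move=> dc Dc Ed x y; have [[M DM] Dc'] := Dc; have [[N EN] Ed'] := Ed.
rewrite [LHS]hdotC [RHS]hdotC; congr (_^*)%C.
apply: (@functional_eq_total _ _ _ b (fun y => hdot y (D x)) (fun y => hdot (E y) x)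
  (nm (D x)) (N * nm x) (onb_total bB)).
- by move=> a u v; rewrite hdotDl hdotZl.
- by move=> a u v; rewrite (diag_linear _ _ _ Ed) hdotDl hdotZl.
- by move=> u; apply: le_trans (cauchy_schwarzR _ _) _; rewrite mulrC.
- move=> u; apply: le_trans (cauchy_schwarzR _ _) _.
  by rewrite mulrAC ler_wpM2r ?nm_ge0.
- move=> i; rewrite (diag_basis i Ed) hdotZl hdotC Dc' rmorphM/= -dc.
  by rewrite -hdotC.
Qed.

Lemma diag_comp c d D E : diag_op b c D -> diag_op b d E ->
  diag_op b (fun i => c i * d i) (D \o E).
Proof.
move=> [[M DM] Dc] [[N EN] Ed]; split; last by move=> x i /=; rewrite Dc Ed mulrA.
exists (Num.max M 0 * N) => x /=; apply: le_trans (DM _) _.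
apply: (@le_trans _ _ (Num.max M 0 * nm (E x))).
  by rewrite ler_wpM2r ?nm_ge0// le_max lexx.
by rewrite -mulrA ler_wpM2l// le_max lexx orbT.
Qed.

Lemma diag_eq c d D E : diag_op b c D -> diag_op b d E -> (forall i, c i = d i) -> D =1 E.
Proof.
by move=> [_ Dc] [_ Ed] cd x; apply: (onb_ext bB) => i; rewrite Dc Ed cd.
Qed.

Lemma diag_id c : (forall i, c i = 1) -> diag_op b c id.
Proof.
move=> c1; split; first by exists 1 => x; rewrite mul1r.
by move=> x i; rewrite c1 mul1r.
Qed.

Lemma diag_self_adjoint c D : (forall i, (c i)^*%C = c i) -> diag_op b c D -> self_adjoint D.
Proof. by move=> cr Dc x y; apply: (diag_adj (c := c) (d := c)). Qed.

Lemma diag_unitary c D : (forall i, `|c i| = 1) -> diag_op b c D ->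
  unitary_onto [set: H] [set: H] D.
Proof.
move=> c1 Dc.
have cc i : (c i)^*%C * c i = 1 by rewrite mulrC -sqr_normc c1 expr1n.
have [|E [Ec _]] := @diag_exists b (fun i => (c i)^*%C) 1 bB ler01.
  by move=> i; rewrite normcJ c1.
have ED x : E (D x) = x.
  by apply: (diag_eq (diag_comp Ec Dc) (diag_id (c := fun=> 1) _)).
have DE x : D (E x) = x by rewrite -(diag_comm Ec Dc) ED.
split; first by apply/seteqP; split => // x _; exists (E x).
by move=> x y _ _; rewrite (diag_adj (d := fun i => (c i)^*%C) _ Dc Ec)// ED.
Qed.

Lemma diag_psd c (r : I -> R) (M : R) D : (forall i, c i = (r i ^+ 2)%:C) ->
  (forall i, 0 <= r i <= M) -> 0 <= M -> diag_op b c D -> psd D.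
Proof.
move=> cr r0M M0 Dc x.
(* A self-adjoint square root of [D]: positivity becomes <D x, x> = |E x|^2. *)
have [|E [Ec _]] := @diag_exists b (fun i => (r i)%:C) M bB M0.
  by move=> i; have /andP[r0 rM] := r0M i; rewrite ger0_norm ?ler0c.
have -> : D x = E (E x).
  apply: (diag_eq Dc (diag_comp Ec Ec)) => i.
  by rewrite cr expr2 rmorphM.
rewrite (@diag_self_adjoint (fun i => (r i)%:C) E _ Ec) => [|i]; last exact: conjc_real.
by rewrite hdotxx ler0c sqr_ge0.
Qed.

Lemma diag_eigspace c D l : diag_op b c D ->
  eigspace D l = [set x | forall i, c i != l -> hdot x (b i) = 0].
Proof.
move=> Dc; have [_ Dc'] := Dc; apply/seteqP; split => x /= => [Dx i ci|x0].
  have := Dc' x i; rewrite Dx hdotZl => /eqP.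
  by rewrite -subr_eq0 -mulrBl mulf_eq0 subr_eq0 eq_sym (negPf ci) => /eqP.
apply: (onb_ext bB) => i; rewrite Dc' hdotZl.
by have [->//|ci] := eqVneq (c i) l; rewrite x0// !mulr0.
Qed.

Lemma diag_kernel c D : diag_op b c D ->
  Defs.kernel D = [set x | forall i, c i != 0 -> hdot x (b i) = 0].
Proof.
move=> Dc; rewrite -(diag_eigspace 0 Dc).
by apply/seteqP; split => x; rewrite /Defs.kernel /eigspace/= scale0r.
Qed.

Lemma supp_closed_span (S : set I) x : (forall i, ~ S i -> hdot x (b i) = 0) ->
  closed_span (b @` S) x.
Proof.
move=> xS; have sF := csubspace_closed_span (b @` S).
have [u uF xu] := projection x sF.
suff /eqP : x - u = 0 by rewrite subr_eq0 => /eqP ->.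
apply: (proj2 bB) => i; have [Si|nSi] := pselect (S i).
  by apply: xu; apply: subset_closed_span; exists i.
rewrite hdotBl xS// sub0r; apply/eqP; rewrite oppr_eq0; apply/eqP.
apply: (closed_span_sub (csubspace_hdot (b i)) _ uF) => _ [j Sj <-] /=.
by rewrite (proj1 bB); case: eqP => // ij; rewrite ij in Sj.
Qed.

Lemma supp_orth x y : (forall i, hdot x (b i) = 0 \/ hdot y (b i) = 0) -> hdot x y = 0.
Proof.
move=> xy.
have yS : closed_span (b @` [set i | hdot y (b i) != 0]) y.
  by apply: supp_closed_span => i /= /negP; rewrite negbK => /eqP.
apply: orthocompl_closed_span yS.
by move=> _ [i /= yi <-]; case: (xy i) => // y0; rewrite y0 eqxx in yi.
Qed.

Lemma diag_partial_isometry c (D : {linear H -> H}) :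
  (forall i, c i = 0 \/ `|c i| = 1) -> diag_op b c D -> partial_isometry D.
Proof.
move=> c01 Dc; have [[M DM] Dc'] := Dc; split; first exact: bounded_continuous DM.
move=> x xk.
(* The adjoint of [D], which inverts it on the orthogonal complement of its kernel. *)
have [|E [Ec _]] := @diag_exists b (fun i => (c i)^*%C) 1 bB ler01.
  by move=> i; rewrite normcJ; case: (c01 i) => ->; rewrite ?normr0.
have EDx : E (D x) = x.
  have [_ Ec'] := Ec; apply: (onb_ext bB) => i; rewrite Ec' Dc'.
  case: (c01 i) => ci.
    rewrite ci !mul0r mulr0; apply/esym/xk.
    by have : D (b i) = 0 by rewrite (diag_basis i Dc) ci scale0r.
  by rewrite mulrA (mulrC _ (c i)) -sqr_normc ci expr1n mul1r.
have := diag_adj (d := fun i => (c i)^*%C) (fun=> erefl) Dc Ec x (D x).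
rewrite EDx !hdotxx => /complexI nn; rewrite !nmE; congr (_ %:C).
by apply/eqP; rewrite -(@eqrXn2 _ 2)// ?nm_ge0//; apply/eqP.
Qed.

Section conjugation.
Variable J : {linear H -> H | (@Num.conj R[i]) \; *:%R}.
Hypothesis JC : conjugation J.
Hypothesis Jb : forall i, J (b i) = b i.

Lemma nmJ x : nm (J x) = nm x.
Proof. by rewrite /nm (proj1 JC). Qed.

Lemma hdotJ x y : hdot (J x) (J y) = (hdot x y)^*%C.
Proof.
have ReJ u v : complex.Re (hdot (J u) (J v)) = complex.Re (hdot u v).
  by have := sqr_nmD (J u) (J v); rewrite -linearD !nmJ sqr_nmD; lra.
have := ReJ ('i *: x) y; rewrite linearZ/= !hdotZl; have := ReJ x y.
case: (hdot (J x) (J y)) (hdot x y) => [a1 a2] [c1 c2] /=; rewrite /conjc.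
by rewrite !mul0r !mul1r ?mulN1r ?sub0r ?add0r ?opprK => -> ->.
Qed.

Lemma hdotJb x i : hdot (J x) (b i) = (hdot x (b i))^*%C.
Proof. by rewrite -{1}(Jb i) hdotJ. Qed.

Lemma diag_J c D : diag_op b c D -> diag_op b (fun i => (c i)^*%C) (J \o D \o J).
Proof.
move=> [[M DM] Dc]; split; first by exists M => x /=; rewrite nmJ (le_trans (DM _))// nmJ.
by move=> x i /=; rewrite hdotJb Dc hdotJb rmorphM/= conjcK.
Qed.

Lemma diag_J_symmetric c D : diag_op b c D -> J_symmetric J D.
Proof.
move=> Dc x y; exact: (diag_adj (d := fun i => (c i)^*%C) _ Dc (diag_J Dc)).
Qed.

Lemma diag_J_comm c D : (forall i, (c i)^*%C = c i) -> diag_op b c D -> commutes J D.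
Proof.
move=> cr [_ Dc] x; apply: (onb_ext bB) => i.
by rewrite hdotJb !Dc hdotJb rmorphM/= cr.
Qed.

End conjugation.

Definition bproj (s : seq I) x := \sum_(i <- s) hdot x (b i) *: b i.

Lemma bproj_coord s x i : uniq s ->
  hdot (x - bproj s x) (b i) = if i \in s then 0 else hdot x (b i).
Proof.
move=> us; rewrite hdotBl onsys_sum_hdot//; last exact: (proj1 bB).
by case: ifP; rewrite ?subrr ?subr0.
Qed.

Lemma diag_tail c D (e : R) s : 0 <= e -> uniq s ->
  diag_op b c D -> (forall i, i \notin s -> complex.Re `|c i| <= e) ->
  forall x, nm (D x - bproj s (D x)) <= e * nm x.
Proof.
move=> e0 us Dc ce x.
have [|E [[_ Ec] EM]] := @diag_exists b (fun i => if i \in s then 0 else c i) e bB e0.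
  by move=> i; case: ifPn => [_|/ce//]; rewrite normr0.
suff -> : D x - bproj s (D x) = E x by exact: EM.
apply: (onb_ext bB) => i; rewrite bproj_coord// Ec (proj2 Dc).
by case: ifP; rewrite ?mul0r.
Qed.

Definition tends0 c := forall e : R, 0 < e -> exists2 s : seq I, uniq s &
  forall i, i \notin s -> complex.Re `|c i| <= e.

(** The rank-one term serves the operator R^2 - p p^*; it costs one spanning vector [m] besides the
    basis vectors of the large eigenvalues. The case m = 0 gives the compactness of [D]. *)
Lemma diag_approx c D (m : H) : tends0 c -> diag_op b c D ->
  finitely_approx [set D x - hdot x m *: m | x in [set x | `|x| <= 1]].
Proof.
move=> ct Dc e e0; have [[M DM] _] := Dc.
have [s us ce] := ct (e / 2) (divr_gt0 e0 (ltr0n R 2)).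
exists (size s).+1, (fun i : 'I_(size s).+1 => if unlift ord0 i is Some j
   then b (tnth (in_tuple s) j) else m), (Num.max M 0 + nm m) => _ [x /= x1 <-].
have {}x1 : nm x <= 1 by rewrite -lecR -nmE.
exists (fun i => if unlift ord0 i is Some j
   then hdot (D x) (b (tnth (in_tuple s) j)) else - hdot x m).
  move=> i; case: unliftP => [j _|_].
    have [h1 h2 _] := cabs_ReIm (hdot (D x) (b (tnth (in_tuple s) j))).
    have h : complex.Re `|hdot (D x) (b (tnth (in_tuple s) j))| <= Num.max M 0 + nm m.
      apply: le_trans (cauchy_schwarzR _ _) _; rewrite onsys_nm1 ?mulr1; last exact: (proj1 bB).
      apply: le_trans (DM x) _; rewrite ler_wpDr ?nm_ge0//.
      apply: (@le_trans _ _ (Num.max M 0 * nm x)).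
        by rewrite ler_wpM2r ?nm_ge0// le_max lexx.
      by rewrite ler_piMr// le_max lexx orbT.
    by split; [exact: le_trans h1 h|exact: le_trans h2 h].
  have [h1 h2 _] := cabs_ReIm (- hdot x m).
  have h : complex.Re `|- hdot x m| <= Num.max M 0 + nm m.
    rewrite normrN; apply: le_trans (cauchy_schwarzR _ _) _.
    rewrite ler_wpDl ?le_max ?lexx ?orbT// ler_piMl ?nm_ge0//.
  by split; [exact: le_trans h1 h|exact: le_trans h2 h].
rewrite big_ord_recl unlift_none.
under eq_bigr do rewrite liftK.
rewrite scaleNr opprD opprK addrA subrK.
have -> : \sum_(i < size s) hdot (D x) (b (tnth (in_tuple s) i)) *: b (tnth (in_tuple s) i) =
    bproj s (D x).
  by rewrite /bproj [RHS]big_tnth.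
apply: le_lt_trans (diag_tail (ltW _) us Dc ce x) _; first by rewrite divr_gt0.
apply: (@le_lt_trans _ _ (e / 2)); last by lra.
by rewrite ler_piMr// divr_ge0// ltW.
Qed.

Lemma diag_compact c D : tends0 c -> diag_op b c D -> compact_operator D.
Proof.
move=> ct Dc; apply: precompact_finitely_approx.
have := @diag_approx c D 0 ct Dc.
rewrite (_ : [set _ | _ in _] = D @` [set x | `|x| <= 1])//.
apply/seteqP; split => _ [x x1 <-]; exists x => //;
  by rewrite scaler0 subr0.
Qed.

End with_basis.
End orthonormal_bases.

Lemma quad_discr (R : realType) (a b c : R) : 0 <= c ->
  (forall t : R, 0 <= a + t * b *+ 2 + t ^+ 2 * c) -> b ^+ 2 <= a * c.
Proof.
move=> c0 h; move: c0; rewrite le_eqVlt => /orP[/eqP c0|c0].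
  rewrite -c0 mulr0; rewrite le_eqVlt sqrf_eq0; apply/orP; left.
  (* For c = 0 the polynomial is affine, and this [t] gives it the value -1. *)
  apply: contraT => b0; have := h (- (a + 1) / b / 2).
  rewrite -c0 mulr0 addr0.
  rewrite (_ : _ *+ 2 = - (a + 1)); last by field.
  by lra.
have := h (- b / c); rewrite (_ : _ + _ = a - b ^+ 2 / c); last first.
  by field; exact: lt0r_neq0.
by rewrite subr_ge0 ler_pdivrMr.
Qed.

(** * Eigenvectors of compact positive operators *)

Section compact_psd.
Context {R : realType} {H : hilbertType R} (S : {linear H -> H}).
Hypothesis Scomp : compact_operator S.

Lemma compact_operator_bounded : exists2 M : R, 0 <= M & forall x, nm (S x) <= M * nm x.
Proof.
have [[N NP]|nN] := pselect (exists N : nat, forall x, nm x <= 1 -> nm (S x) <= N%:R).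
  exists N%:R => // x; have [->|x0] := eqVneq x 0.
    by rewrite linear0 nm0 mulr0.
  have n0 : 0 < nm x by rewrite nm_gt0.
  have cn : complex.Re `|(nm x)^-1%:C| = (nm x)^-1.
    by rewrite ger0_norm ?ler0c ?invr_ge0 ?nm_ge0.
  have := NP ((nm x)^-1%:C *: x); rewrite linearZ/= !nmZ cn.
  by rewrite mulVf ?gt_eqF// => /(_ (lexx _)); rewrite mulrC ler_pdivrMr.
(* If the unit ball had unbounded image, these decreasing nonempty sets would have a common cluster
   point y, although all norms near y are below |y| + 1. *)
pose A (N : nat) := [set S x | x in [set x | nm x <= 1 /\ N%:R < nm (S x)]].
have A0 N : A N !=set0.
  apply: contrapT => A0; apply: nN; exists N => x x1.
  by rewrite leNgt; apply/negP => NS; apply: A0; exists (S x), x.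
have Fprop : ProperFilter (filter_from [set: nat] A).
  apply: filter_from_proper; last by move=> N _; exact: A0.
  apply: filter_from_filter; first by exists 0%N.
  move=> M N _ _; exists (maxn M N) => //.
  move=> _ [x [x1 MN] <-]; split; exists x => //; split => //;
    by apply: le_lt_trans MN; rewrite ler_nat ?leq_maxl ?leq_maxr.
have Sc : compact (closure (S @` [set x | `|x| <= 1])) by rewrite -precompactE.
have [|y0 [_ yc0]] := Sc _ Fprop.
  exists 0%N => // _ [x [x1 _] <-]; apply: subset_closure; exists x => //=.
    by rewrite nmE lecR.
pose y : H := y0; have yc : cluster (filter_from [set: nat] A) y := yc0; clearbody y.
have [||z [[x [x1 xn] <-] xy]] := yc (A (Num.truncn (nm y + 1)).+1) (ball y 1%:C).
- by exists (Num.truncn (nm y + 1)).+1.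
- by apply: nbhsx_ballx; rewrite ltcR.
move: xy; rewrite -ball_normE/= nmE ltcR => xy.
have /andP[_ h1] := truncn_itv (addr_ge0 (nm_ge0 y) (ler01 : (0 : R) <= 1)).
exfalso; have := lt_trans h1 xn.
by have := nm_tri y (S x) 0; rewrite !subr0 nmB; lra.
Qed.

Hypothesis Sadj : self_adjoint S.
Hypothesis Spsd : psd S.

Let q x : R := complex.Re (hdot (S x) x).

Let qE x : hdot (S x) x = (q x)%:C.
Proof. by rewrite /q RRe_real// ger0_real. Qed.

Let q_ge0 x : 0 <= q x.
Proof. by rewrite -ler0c -qE. Qed.

Let q_cs x y : (complex.Re (hdot (S x) y)) ^+ 2 <= q x * q y.
Proof.
apply: quad_discr => // t.
have := q_ge0 (x + t%:C *: y); rewrite /q linearD linearZ/=.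
rewrite hdotDl !hdotDr !hdotZl !hdotZr conjc_real.
have -> : hdot (S y) x = (hdot (S x) y)^*%C by rewrite Sadj -hdotC.
case: (hdot (S x) y) (hdot (S x) x) (hdot (S y) y) => a b [c d] [e f]/=.
by rewrite !mul0r !subr0 !mulr2n expr2; lra.
Qed.

(** Let m be the supremum of q x = <S x, x> over the unit ball of [E]. Then |S x - m x|^2 <= m (m -
    q x), so nearly maximal x are nearly eigenvectors. A cluster point of the images [S x], which
    compactness provides, is an exact one; clustering images rather than the x themselves avoids
    weak compactness. *)
Lemma compact_psd_eigenvector (E : set H) : csubspace E ->
  (forall x, E x -> E (S x)) -> (exists2 x, E x & S x != 0) ->
  exists y (l : R), [/\ E y, y != 0, 0 < l & S y = l%:C *: y].
Proof.
move=> sE SE [x0 Ex0 Sx0].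
have [B B0 SB] := compact_operator_bounded.
pose Q := [set q x | x in [set x | E x /\ nm x <= 1]].
have Q0 : Q 0.
  exists 0; first by rewrite /= nm0; split => //; exact: csubspace0.
  by rewrite /q hdot0r.
have Qub : ubound Q B.
  move=> _ [x [Ex x1] <-]; rewrite /q; apply: le_trans (nmM_Re _ _) _.
  apply: (@le_trans _ _ (B * nm x * nm x)); first by rewrite ler_wpM2r ?nm_ge0.
  by rewrite -mulrA ler_piMr// mulr_ile1 ?nm_ge0.
have Qs : has_sup Q by split; [exists 0|exists B].
pose m := sup Q.
have qm x : E x -> nm x <= 1 -> q x <= m.
  by move=> Ex x1; apply: ub_le_sup; [exists B|exists x].
have qZ (t : R) x : q (t%:C *: x) = t ^+ 2 * q x.
  rewrite /q (linearZ_LR S) hdotZl hdotZr conjc_real mulrA -rmorphM/=.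
  by case: (hdot (S x) x) => a b /=; rewrite mul0r subr0 expr2.
have nmZR (t : R) (x : H) : 0 <= t -> nm (t%:C *: x) = t * nm x.
  by move=> t0; rewrite nmZ ger0_norm ?ler0c.
have qm2 x : E x -> q x <= m * nm x ^+ 2.
  move=> Ex; have [->|xn0] := eqVneq x 0.
    by rewrite /q hdot0r nm0 expr0n/= mulr0.
  have n0 : 0 < nm x by rewrite nm_gt0.
  have := qm ((nm x)^-1%:C *: x) (csubspaceZ _ sE Ex).
  rewrite nmZR ?invr_ge0 ?nm_ge0// mulVf ?gt_eqF// => /(_ (lexx _)).
  rewrite qZ exprVn mulrC ler_pdivrMr// exprn_gt0//.
(* Cauchy-Schwarz for the form [q], at [x] and [S x]. *)
have nS2 x : E x -> nm (S x) ^+ 2 <= m * q x.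
  move=> Ex; have [->|Sxn0] := eqVneq (S x) 0.
    rewrite nm0 expr0n/= mulr_ge0// -[m]mulr1 -(expr1n R 2).
    by have := qm 0 (csubspace0 sE); rewrite nm0 ler01 => /(_ erefl); rewrite /q hdot0r expr1n mulr1.
  have n0 : 0 < nm (S x) ^+ 2 by rewrite exprn_gt0// nm_gt0.
  have := q_cs x (S x); rewrite hdotxx/= => h.
  have : nm (S x) ^+ 2 * nm (S x) ^+ 2 <= (m * q x) * nm (S x) ^+ 2.
    rewrite -expr2; apply: le_trans h _.
    by rewrite (mulrC m) -mulrA ler_wpM2l// qm2//; exact: SE.
  by rewrite ler_pM2r.
have m_gt0 : 0 < m.
  rewrite ltNge; apply/negP => m0; move/negP : Sx0; apply.
  have m00 : 0 <= m by apply: le_trans (q_ge0 0) _; apply: qm; rewrite ?nm0//; exact: csubspace0.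
  have mE : m = 0 by apply/eqP; rewrite eq_le m0 m00.
  have := nS2 x0 Ex0; rewrite mE mul0r => h.
  by rewrite -nm_eq0 -sqrf_eq0 eq_le h sqr_ge0.
have nSm x : E x -> nm (S x) <= m * nm x.
  move=> Ex; rewrite -ler_sqr ?nnegrE ?nm_ge0//; last by rewrite mulr_ge0 ?nm_ge0// ltW.
  apply: le_trans (nS2 x Ex) _.
  by rewrite exprMn expr2 -mulrA ler_pM2l// qm2.
pose A (e : R) := [set S x | x in [set x | [/\ E x, nm x <= 1 & m - e < q x]]].
have A0 e : 0 < e -> A e !=set0.
  move=> e0; have [_ [x [Ex x1] <-] xq] := sup_adherent e0 Qs.
  by exists (S x), x.
have Fprop : ProperFilter (filter_from [set e : R | 0 < e] A).
  apply: filter_from_proper; last by move=> e /A0.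
  apply: filter_from_filter; first by exists 1 => /=.
  move=> e d /= e0 d0; exists (Num.min e d); first by rewrite /= lt_min e0.
  move=> _ [x [Ex x1 qx] <-]; split; exists x => //; split => //;
    by apply: le_lt_trans qx; rewrite lerD2l lerN2 ge_min lexx ?orbT.
have Sc : compact (closure (S @` [set x | `|x| <= 1])) by rewrite -precompactE.
have [|y0 [_ yc0]] := Sc _ Fprop.
  exists 1 => //= _ [x [Ex x1 _] <-]; apply: subset_closure; exists x => //=.
    by rewrite nmE lecR.
pose y : H := y0.
have yc : cluster (filter_from [set e : R | 0 < e] A) y := yc0; clearbody y.
have yA e d : 0 < e -> 0 < d -> exists x, [/\ E x, nm x <= 1, m - e < q x & nm (y - S x) < d].
  move=> e0 d0; have [||z [[x [Ex x1 qx] <-] xy]] := yc (A e) (ball y d%:C).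
  - by exists e.
  - by apply: nbhsx_ballx; rewrite ltcR.
  by exists x; split => //; move: xy; rewrite -ball_normE/= nmE ltcR.
have Ey : E y.
  apply: (csubspace_closed sE) => e e0; have [x [Ex _ _ yx]] := yA 1 e ltr01 e0.
  by exists (S x) => //; exact: SE.
exists y, m; split => //.
  (* Nearly maximal x have |S x| >= q x > 2 m / 3, which keeps the cluster point away from 0. *)
  have m3 : 0 < m / 3 by rewrite divr_gt0.
  have [x [Ex x1 qx yx]] := yA _ _ m3 m3.
  have : q x <= nm (S x).
    by apply: le_trans (nmM_Re _ _) _; rewrite ler_piMr// nm_ge0.
  have := nm_tri y (S x) 0; rewrite !subr0 (nmB (S x)) -nm_gt0; lra.
apply/eqP; rewrite -subr_eq0; apply/eqP/nm_small0 => e e0.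
(* Each of the three terms into which S y - m y is split below is at most m d = e / 4; [e'] is
   chosen so that m e' = d^2. *)
pose d := e / (4 * m); have d0 : 0 < d by rewrite divr_gt0// mulr_gt0.
pose e' := d ^+ 2 / m; have e'0 : 0 < e' by rewrite divr_gt0// exprn_gt0.
have [x [Ex x1 qx yx]] := yA e' d e'0 d0.
have w2 : nm (S x - m%:C *: x) <= d.
  rewrite -ler_sqr ?nnegrE ?nm_ge0 ?(ltW d0)// sqr_nmB hdotZr conjc_real.
  rewrite nmZR ?(ltW m_gt0)//.
  have -> : complex.Re (m%:C * hdot (S x) x) = m * q x by rewrite qE -rmorphM.
  have h1 := nS2 x Ex.
  have h2 : (m * nm x) ^+ 2 <= m * m.
    by rewrite -expr2 ler_sqr ?nnegrE ?mulr_ge0 ?nm_ge0 ?(ltW m_gt0)// ler_piMr// ltW.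
  have h3 : m * (m - q x) <= d ^+ 2.
    by rewrite -ler_pdivlMl// mulrC -/e'; lra.
  move: h1 h2 h3; clear; rewrite mulr2n mulrBr.
  move: (nm (S x) ^+ 2) ((m * nm x) ^+ 2) (m * q x) (m * m) (d ^+ 2) => r1 r2 r3 r4 r5; lra.
have -> : S y - m%:C *: y = S (y - S x) + S (S x - m%:C *: x) + m%:C *: (S x - y).
  have e1 : S (y - S x) = S y - S (S x) by rewrite linearB.
  have e2 : S (S x - m%:C *: x) = S (S x) - m%:C *: S x by rewrite linearB linearZ.
  by rewrite e1 e2 scalerBr !addrA subrK subrK.
have ESx := SE x Ex.
have h1 : nm (S (y - S x)) <= m * d.
  apply: le_trans (nSm _ (csubspaceB sE Ey ESx)) _.
  by rewrite ler_pM2l// ltW.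
have h2 : nm (S (S x - m%:C *: x)) <= m * d.
  apply: le_trans (nSm _ (csubspaceB sE ESx (csubspaceZ _ sE Ex))) _.
  by rewrite ler_pM2l.
have h3 : nm (m%:C *: (S x - y)) <= m * d.
  by rewrite nmZR ?(ltW m_gt0)// nmB ler_pM2l// ltW.
have md : m * d = e / 4 by rewrite /d; field; exact: lt0r_neq0.
apply: le_lt_trans (nmD _ _) _; have := nmD (S (y - S x)) (S (S x - m%:C *: x)).
by rewrite md in h1 h2 h3; lra.
Qed.

End compact_psd.

(** * The weights *)

Section weights.
Context {R : realType} (len : option nat) (L M : nat -> R).

(** One formulation for both lengths: the last clause says L k -> 0 for an infinite sequence and is
    vacuous for a finite one. [L] and [M] are to be the squares of [lam] and [mu]. *)
Definition interlaced : Prop :=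
  [/\ forall k, in_range len k -> M k < L k,
      forall j k, (j < k)%N -> in_range len k -> L k < M j,
      forall k, in_range len k -> 0 < L k,
      forall k, in_range len k -> 0 <= M k &
      forall e : R, 0 < e -> exists N, forall k, (N <= k)%N -> in_range len k -> L k < e].

Hypothesis LM : interlaced.

Lemma in_range_le j k : (j <= k)%N -> in_range len k -> in_range len j.
Proof. by case: len => //= n jk; exact: leq_ltn_trans. Qed.

Lemma interlaced_L j k : (j < k)%N -> in_range len k -> L k < L j.
Proof.
move=> jk rk; have [ML LM' _ _ _] := LM.
by apply: lt_trans (LM' _ _ jk rk) (ML _ _); exact: in_range_le (ltnW jk) rk.
Qed.

Lemma interlaced_M j k : (j < k)%N -> in_range len k -> M k < M j.
Proof. by move=> jk rk; have [ML LM' _ _ _] := LM; apply: lt_trans (ML _ rk) (LM' _ _ jk rk). Qed.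

Lemma interlaced_L_inj j k : in_range len j -> in_range len k -> L j = L k -> j = k.
Proof.
move=> rj rk e; case: (ltngtP j k) => // jk.
  by have := interlaced_L jk rk; rewrite e ltxx.
by have := interlaced_L jk rj; rewrite e ltxx.
Qed.

Lemma interlaced_M_inj j k : in_range len j -> in_range len k -> M j = M k -> j = k.
Proof.
move=> rj rk e; case: (ltngtP j k) => // jk.
  by have := interlaced_M jk rk; rewrite e ltxx.
by have := interlaced_M jk rj; rewrite e ltxx.
Qed.

Lemma interlaced_LM_neq j k : in_range len j -> in_range len k -> L k - M j != 0.
Proof.
move=> rj rk; rewrite subr_eq0; have [ML LM' _ _ _] := LM.
case: (ltngtP j k) => [jk|kj|->].
- by rewrite lt_eqF// LM'.
- by rewrite gt_eqF// (lt_trans (ML _ rj))// interlaced_L.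
- by rewrite gt_eqF// ML.
Qed.

(* The squared coordinates of p for the first m pairs (L k, M k): they make
   1 - sum_k W_k / (L k - z) equal to the product of the (M j - z) / (L j - z). *)
Fixpoint trunc_weight (m k : nat) : R :=
  if m is m'.+1 then
    if ~~ in_range len m' then trunc_weight m' k
    else if (k < m')%N then trunc_weight m' k * ((L k - M m') / (L k - L m'))
    else if k == m' then
      (L m' - M m') * (1 - \sum_(0 <= i < m') trunc_weight m' i / (L i - L m'))
    else 0
  else 0.

(** The secular function of the truncation. *)
Definition Phi m z := 1 - \sum_(0 <= k < m) trunc_weight m k / (L k - z).

Lemma trunc_weight_out m k : (m <= k)%N -> trunc_weight m k = 0.
Proof.
elim: m => //= m IH mk; case: ifP => _; first by rewrite IH// ltnW.
by rewrite ltnNge (ltnW mk)/= gtn_eqF.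
Qed.

Lemma trunc_weight_nrange m k : ~~ in_range len k -> trunc_weight m k = 0.
Proof.
elim: m => //= m IH rk; case: ifPn => [_|]; first exact: IH.
rewrite negbK => rm; case: ifP => [km|_]; first by rewrite IH// mul0r.
by case: eqP => // km; rewrite km rm in rk.
Qed.

(** Partial fractions: the new factor rescales the old residues and creates a pole at [L m], whose
    residue contains the value of [Phi m] at [L m]. *)
Lemma PhiS m z : in_range len m -> (forall k, (k <= m)%N -> L k != z) ->
  Phi m.+1 z = Phi m z * ((M m - z) / (L m - z)).
Proof.
move=> rm zL; have Lz k : (k <= m)%N -> L k - z != 0 by move=> /zL; rewrite subr_eq0.
have LmL k : (k < m)%N -> L k - L m != 0.
  by move=> km; rewrite subr_eq0 gt_eqF// interlaced_L.
rewrite /Phi big_nat_recr//= rm/= ltnn eqxx.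
rewrite [X in 1 - (X + _)](_ : _ = \sum_(0 <= k < m)
   (trunc_weight m k / (L k - z) * ((M m - z) / (L m - z))
    - (L m - M m) / (L m - z) * (- (trunc_weight m k / (L k - L m))))); last first.
  rewrite big_nat_cond [RHS]big_nat_cond; apply: eq_bigr => k.
  rewrite andbT => /andP[_ km]; rewrite km.
  have h1 := Lz k (ltnW km); have h2 := Lz m (leqnn m); have h3 := LmL k km.
  by field; rewrite h1 h2 h3.
rewrite sumrB -mulr_suml -mulr_sumr sumrN.
set A := \sum_(0 <= k < m) _ / (L k - z); set B := \sum_(0 <= k < m) _ / (L k - L m).
by have h := Lz m (leqnn m); field.
Qed.

Lemma PhiE m z : (0 < m -> in_range len m.-1)%N -> (forall k, (k < m)%N -> L k != z) ->
  Phi m z = \prod_(0 <= j < m) ((M j - z) / (L j - z)).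
Proof.
elim: m => [_ _|m IH rm zL]; first by rewrite /Phi !big_geq// subr0.
have rm' : in_range len m by exact: rm.
rewrite PhiS// big_nat_recr//= IH// => [m0|k km].
  by apply: in_range_le rm'; exact: leq_pred.
by apply: zL; rewrite ltnW.
Qed.

Lemma Phi_gt0 m : in_range len m -> 0 < Phi m (L m).
Proof.
move=> rm; have [ML LM' _ _ _] := LM.
rewrite PhiE.
- rewrite big_nat_cond; apply: prodr_gt0 => j; rewrite andbT => /andP[_ jm].
  by rewrite divr_gt0// subr_gt0; [exact: LM'|exact: interlaced_L].
- by move=> m0; apply: in_range_le rm; exact: leq_pred.
- by move=> k km; rewrite gt_eqF// interlaced_L.
Qed.

(** A new weight is (L m - M m) times [Phi m (L m)], a product of positive quotients by interlacing;
    later factors are positive too. *)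
Lemma trunc_weight_gt0 m k : (k < m)%N -> in_range len k -> 0 < trunc_weight m k.
Proof.
have [ML LM' _ _ _] := LM.
elim: m => //= m IH; rewrite ltnS => km rk; case: ifPn => [rm|].
  apply: IH => //; rewrite ltn_neqAle km andbT.
  by apply: contraNN rm => /eqP <-.
rewrite negbK => rm; move: km; rewrite leq_eqVlt => /orP[/eqP kE|km].
  have P0 := Phi_gt0 rm; rewrite /Phi subr_gt0 in P0.
  by rewrite kE ltnn eqxx mulr_gt0 ?subr_gt0 ?ML.
rewrite km mulr_gt0 ?IH// divr_gt0// subr_gt0; last exact: interlaced_L.
by apply: lt_trans (ML _ rm) (interlaced_L _ _).
Qed.

Lemma trunc_weight_ge0 m k : 0 <= trunc_weight m k.
Proof.
have [km|mk] := ltnP k m; last by rewrite trunc_weight_out.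
have [rk|rk] := boolP (in_range len k); first by rewrite ltW// trunc_weight_gt0.
by rewrite trunc_weight_nrange.
Qed.

(** A further pair multiplies an old weight by (L k - M m) / (L k - L m), at least 1 because M m < L
    m < L k. *)
Lemma trunc_weight_mono k : {homo trunc_weight^~ k : m n / (m <= n)%N >-> m <= n}.
Proof.
have [ML LM' _ _ _] := LM.
apply: homo_leq => [x|y x z|m]; [exact: lexx|exact: le_trans|].
rewrite /=; case: ifPn => // /negPn rm; case: ltngtP => [km|km|->].
- rewrite ler_peMr ?trunc_weight_ge0// ler_pdivlMr ?mul1r.
    by rewrite lerD2l lerN2 ltW// ML.
  by rewrite subr_gt0 interlaced_L.
- by rewrite trunc_weight_out// ltnW.
- by rewrite trunc_weight_out// mulr_ge0//; [rewrite subr_ge0 ltW// ML|exact/ltW/Phi_gt0].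
Qed.

Lemma trunc_weight_sum_le m N : \sum_(0 <= k < N) trunc_weight m k / L k <= 1.
Proof.
have [ML LM' L0 M0 _] := LM.
have t0 k : 0 <= trunc_weight m k / L k.
  have [rk|rk] := boolP (in_range len k); last by rewrite trunc_weight_nrange// mul0r.
  by rewrite divr_ge0 ?trunc_weight_ge0// ltW// L0.
suff key : \sum_(0 <= k < m) trunc_weight m k / L k <= 1.
  apply: le_trans key; have [Nm|mN] := leqP N m.
    by rewrite [leRHS](big_cat_nat _ Nm)//= lerDl sumr_ge0.
  rewrite (big_cat_nat _ (ltnW mN))//= [X in _ + X]big_nat_cond [X in _ + X]big1 ?addr0// => k.
  by rewrite andbT => /andP[mk _]; rewrite trunc_weight_out// mul0r.
(* Past the end of the sequence the truncated weights stop changing, so [m] is replaced by an [n]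
   with all smaller indices in range, where [PhiE] applies. The claim is then that [Phi n 0], a
   product of quotients M j / L j, is nonnegative. *)
have [n [nm rn tn]] : exists n, [/\ (n <= m)%N, (0 < n -> in_range len n.-1)%N &
    forall k, trunc_weight m k = trunc_weight n k].
  elim: m {t0} => [|m [n [nm rn tn]]]; first by exists 0%N.
  have [rm|rm] := boolP (in_range len m); first by exists m.+1.
  by exists n; split => //=; [exact: leqW|move=> k; rewrite /= rm].
have -> : \sum_(0 <= k < m) trunc_weight m k / L k = \sum_(0 <= k < n) trunc_weight n k / L k.
  rewrite (big_cat_nat _ nm)//= [X in _ + X]big_nat_cond [X in _ + X]big1 ?addr0 => [|k].
    by apply: eq_bigr => k _; rewrite tn.
  by rewrite andbT => /andP[mk _]; rewrite tn trunc_weight_out// mul0r.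
have rk k : (k < n)%N -> in_range len k.
  by case: n rn {nm tn} => // n /(_ isT) rn /ltnSE kn; exact: in_range_le rn.
have e : Phi n 0 = _ := PhiE rn (fun k kn => negbT (gt_eqF (L0 k (rk k kn)))).
rewrite -subr_ge0 [leRHS](_ : _ = Phi n 0); last first.
  by rewrite /Phi; congr (1 - _); apply: eq_bigr => k _; rewrite subr0.
rewrite e.
rewrite big_nat_cond; apply: prodr_ge0 => j; rewrite andbT => /andP[_ jn].
by rewrite !subr0 divr_ge0 ?M0 ?rk// ltW// L0// rk.
Qed.

(** [Phi] vanishes at [M j]: its product formula contains the factor M j - M j. *)
Lemma trunc_weight_sum_eq m j : (j < m)%N -> in_range len j ->
  \sum_(0 <= k < m) trunc_weight m k / (L k - M j) = 1.
Proof.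
elim: m => // m IH; rewrite ltnS => jm rj.
have [rm|rm] := boolP (in_range len m); last first.
  have jm' : (j < m)%N.
    by rewrite ltn_neqAle jm andbT; apply: contraNN rm => /eqP <-.
  rewrite big_nat_recr//= rm trunc_weight_out// mul0r addr0.
  exact: IH.
apply/eqP; rewrite eq_sym -subr_eq0; apply/eqP.
have rk k : (k <= m)%N -> in_range len k by move=> km; exact: in_range_le rm.
rewrite -[LHS]/(Phi m.+1 (M j)) PhiE//; last first.
  by move=> k km; rewrite -subr_eq0 interlaced_LM_neq// rk.
have jI : j \in index_iota 0 m.+1 by rewrite mem_index_iota.
by rewrite (bigD1_seq j jI (iota_uniq _ _))/= subrr !mul0r.
Qed.

Definition weight k : R := limn (trunc_weight^~ k).

Lemma trunc_weight_le m k : in_range len k -> trunc_weight m k <= L k.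
Proof.
move=> rk; have [_ _ L0 _ _] := LM.
have := trunc_weight_sum_le m k.+1; rewrite big_nat_recr//= => h.
rewrite -[leRHS]mul1r -ler_pdivrMr ?L0//; apply: le_trans h.
rewrite lerDr sumr_ge0// => i _.
have [ri|ri] := boolP (in_range len i); last by rewrite trunc_weight_nrange// mul0r.
by rewrite divr_ge0 ?trunc_weight_ge0// ltW// L0.
Qed.

Lemma weight_cvg k : trunc_weight^~ k @ \oo --> weight k.
Proof.
have [rk|rk] := boolP (in_range len k).
  apply: nondecreasing_is_cvgn; first exact: trunc_weight_mono.
  by exists (L k) => _ [m _ <-]; exact: trunc_weight_le.
rewrite /weight; have -> : trunc_weight^~ k = fun=> 0.
  by apply/funext => m; exact: trunc_weight_nrange.
by rewrite lim_cst//; exact: cvg_cst.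
Qed.

Arguments weight_cvg : clear implicits.

Lemma trunc_weight_le_weight m k : trunc_weight m k <= weight k.
Proof.
apply: (nondecreasing_cvgn_le (@trunc_weight_mono k)).
by apply/cvg_ex; eexists; exact: weight_cvg.
Qed.

Lemma weight_gt0 k : in_range len k -> 0 < weight k.
Proof. by move=> rk; apply: lt_le_trans (trunc_weight_le_weight k.+1 k); exact: trunc_weight_gt0. Qed.

Lemma weight_nrange k : ~~ in_range len k -> weight k = 0.
Proof.
move=> rk; rewrite /weight (_ : trunc_weight^~ k = fun=> 0) ?lim_cst//.
by apply/funext => m; exact: trunc_weight_nrange.
Qed.

Lemma weight_ge0 k : 0 <= weight k.
Proof. exact: le_trans (trunc_weight_ge0 0 k) (trunc_weight_le_weight _ _). Qed.

Lemma weight_sum_le N : \sum_(0 <= k < N) weight k / L k <= 1.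
Proof.
apply: (@sum_cvg_bound _ _ (index_iota 0 N) (fun k m => trunc_weight m k / L k)).
  by move=> k _; apply: cvgMl; exact: weight_cvg.
by apply: nearW => m; exact: trunc_weight_sum_le.
Qed.

Lemma L_le0 k : in_range len k -> L k <= L 0.
Proof. by case: k => // k rk; rewrite ltW// interlaced_L. Qed.

(** For k >= m one has L k <= L m, hence the tail is at most L m times sum_k w_k / L k. This is the
    uniform smallness that justifies passing to the limit under the sum. *)
Lemma weight_tail m N : in_range len m -> \sum_(m <= k < N) weight k <= L m.
Proof.
move=> rm; have [_ _ L0 _ _] := LM.
have t0 k : 0 <= weight k / L k.
  have [rk|rk] := boolP (in_range len k); last by rewrite weight_nrange// mul0r.
  by rewrite divr_ge0 ?weight_ge0// ltW// L0.
rewrite -[leRHS]mulr1; have := weight_sum_le N.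
rewrite -(ler_pM2l (L0 _ rm)); apply: le_trans.
apply: (@le_trans _ _ (L m * \sum_(m <= k < N) weight k / L k)); last first.
  rewrite ler_pM2l ?L0//; have [mN|Nm] := leqP m N.
    by rewrite [leRHS](big_cat_nat _ mN)//= lerDr sumr_ge0.
  by rewrite big_geq ?sumr_ge0// ltnW.
rewrite mulr_sumr big_nat_cond [leRHS]big_nat_cond; apply: ler_sum => k.
rewrite andbT => /andP[mk _].
have [rk|rk] := boolP (in_range len k); last by rewrite weight_nrange// mul0r mulr0.
rewrite mulrCA ler_peMr ?weight_ge0// ler_pdivlMr ?L0// mul1r.
by move: mk; rewrite leq_eqVlt => /orP[/eqP->//|mk]; rewrite ltW// interlaced_L.
Qed.

Lemma weight_summ : in_range len 0 -> summ weight.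
Proof.
move=> r0; have [|//] := @summ_bounded R weight (L 0) weight_ge0 _.
by move=> N; exact: weight_tail.
Qed.

Lemma interlaced_inv_bound j : in_range len j ->
  exists2 C : R, 0 < C & forall k, in_range len k -> `|(L k - M j)^-1| <= C.
Proof.
move=> rj; have [ML LM' L0 M0 Lt0] := LM.
(* The poles L k nearest to M j are L j and L (j+1). *)
pose C1 := (L j - M j)^-1.
have C10 : 0 < C1 by rewrite invr_gt0 subr_gt0 ML.
have low k : in_range len k -> (k <= j)%N -> `|(L k - M j)^-1| <= C1.
  move=> rk kj; have d0 : 0 < L j - M j by rewrite subr_gt0 ML.
  have Lkj : L j <= L k.
    by move: kj; rewrite leq_eqVlt => /orP[/eqP->//|kj]; rewrite ltW// interlaced_L.
  have d1 : 0 < L k - M j by apply: lt_le_trans d0 _; rewrite lerD2r.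
  by rewrite gtr0_norm ?invr_gt0// lef_pV2 ?posrE// lerD2r.
have [rj1|nrj1] := boolP (in_range len j.+1); last first.
  exists C1 => // k rk; apply: low => //; rewrite leqNgt.
  by apply: contraNN nrj1 => jk; exact: in_range_le rk.
exists (C1 + (M j - L j.+1)^-1); first by rewrite addr_gt0// invr_gt0 subr_gt0 LM'.
have d0 : 0 < M j - L j.+1 by rewrite subr_gt0 LM'.
move=> k rk; have [kj|jk] := leqP k j.
  by apply: le_trans (low _ rk kj) _; rewrite lerDl invr_ge0 ltW.
have Lkj : L k <= L j.+1.
  by move: jk; rewrite leq_eqVlt => /orP[/eqP->//|kj]; rewrite ltW// interlaced_L.
have d1 : 0 < M j - L k by apply: lt_le_trans d0 _; rewrite lerD2l lerN2.
rewrite -opprB invrN normrN gtr0_norm ?invr_gt0//.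
apply: (@le_trans _ _ (M j - L j.+1)^-1); last by rewrite lerDr ltW.
by rewrite lef_pV2 ?posrE// lerD2l lerN2.
Qed.

(* Dominated convergence: past K the weights have mass at most L K, which tends to 0. *)
Lemma weight_sum_eq j : in_range len j ->
  sumR (fun k => weight k / (L k - M j)) = 1.
Proof.
move=> rj; have [ML LM' L0 M0 Lt0] := LM.
have r0 : in_range len 0 by exact: in_range_le rj.
pose h k := (L k - M j)^-1.
have [C C0 hC] := interlaced_inv_bound rj.
have hw (v : nat -> R) : (forall k, 0 <= v k) -> (forall k, v k <= weight k) ->
    forall k, `|v k * h k| <= C * weight k.
  move=> v0 vw k; rewrite normrM (ger0_norm (v0 k)).
  have [rk|rk] := boolP (in_range len k).
    by rewrite mulrC; apply: ler_pM; rewrite ?hC.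
  have -> : v k = 0 by apply/eqP; rewrite eq_le v0 andbT -(weight_nrange rk).
  by rewrite mul0r mulr_ge0 ?weight_ge0// ltW.
have sC : summ (fun k => C * weight k) by have [] := summZ C (weight_summ r0).
have [sw _] : summ (fun k => weight k * h k) /\ _ := summ_norm (hw _ weight_ge0 (fun=> lexx _)) sC.
apply/eqP; rewrite -subr_eq0 -normr_le0; apply/ler_addgt0Pl => e e0; rewrite addr0.
(* Four errors of at most e / 4 are added: two tails past [K], where [C] bounds the factors [h k],
   the change of the first [K] weights, and the remainder of the series. *)
have e4 : 0 < e / 4 / C by rewrite !divr_gt0.
have [K KP] := Lt0 _ e4.
have tailK v : (forall k, 0 <= v k) -> (forall k, v k <= weight k) -> forall N,
    `|\sum_(K <= k < N) v k * h k| <= e / 4.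
  move=> v0 vw N; apply: le_trans (ler_norm_sum _ _ _) _.
  apply: (@le_trans _ _ (C * \sum_(K <= k < N) weight k)).
    by rewrite mulr_sumr; apply: ler_sum => k _; exact: hw.
  rewrite -ler_pdivlMl// mulrC.
  have [rK|rK] := boolP (in_range len K); first by apply: le_trans (weight_tail N rK) (ltW (KP K _ rK)).
  rewrite big_nat_cond big1 ?ltW// => k; rewrite andbT => /andP[Kk _].
  by apply: weight_nrange; apply: contraNN rK; exact: in_range_le.
have cvK : (fun m => \sum_(0 <= k < K) (weight k - trunc_weight m k) * h k) @ \oo --> (0 : R).
  elim: (K) => [|K' IH].
    under eq_fun do rewrite big_geq//.
    exact: cvg_cst.
  under eq_fun do rewrite big_nat_recr//=.
  have cK : (fun m => (weight K' - trunc_weight m K') * h K') @ \oo --> (weight K' - weight K') * h K'.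
    by apply: cvgM; [apply: cvgB; [exact: cvg_cst|exact: weight_cvg]|exact: cvg_cst].
  rewrite subrr mul0r in cK.
  by have := cvgD IH cK; rewrite addr0; exact.
have [m1 _ m1P] : \forall m \near \oo, `|\sum_(0 <= k < K) (weight k - trunc_weight m k) * h k| < e / 4.
  have e40 : 0 < e / 4 by rewrite divr_gt0.
  have /cvgrPdist_lt/(_ _ e40) := cvK.
  by apply: filterS => m; rewrite sub0r normrN.
have [m2 _ m2P] : \forall m \near \oo, `|sumR (fun k => weight k * h k) -
   \sum_(0 <= k < m) weight k * h k| < e / 4.
  have e40 : 0 < e / 4 by rewrite divr_gt0.
  have swl : series (fun k => weight k * h k) @ \oo --> sumR (fun k => weight k * h k) := sw.
  by have /cvgrPdist_lt/(_ _ e40) := swl.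
pose m := maxn (maxn m1 m2) (maxn K j.+1).
have mm1 : (m1 <= m)%N by rewrite /m !leq_max leqnn.
have mm2 : (m2 <= m)%N by rewrite /m !leq_max leqnn orbT.
have mK : (K <= m)%N by rewrite /m !leq_max leqnn !orbT.
have mj : (j < m)%N by rewrite /m !leq_max leqnn !orbT.
have := m1P m mm1; have := m2P m mm2; have := trunc_weight_sum_eq mj rj.
have := tailK _ (trunc_weight_ge0 m) (trunc_weight_le_weight m) m.
have := tailK _ weight_ge0 (fun=> lexx _) m.
have cat (f : nat -> R) : \sum_(0 <= k < m) f k = \sum_(0 <= k < K) f k + \sum_(K <= k < m) f k.
  by rewrite (big_cat_nat _ mK).
rewrite !cat.
have -> : \sum_(0 <= k < K) (weight k - trunc_weight m k) * h k =
  \sum_(0 <= k < K) weight k * h k - \sum_(0 <= k < K) trunc_weight m k * h k.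
  by rewrite -sumrB; apply: eq_bigr => k _; rewrite mulrBl.
rewrite -/h; move: (sumR _) (\sum_(K <= k < m) weight k * h k)
  (\sum_(K <= k < m) trunc_weight m k * h k) (\sum_(0 <= k < K) weight k * h k) => s a b c.
have -> : \sum_(0 <= k < K) trunc_weight m k / (L k - M j) =
  \sum_(0 <= k < K) trunc_weight m k * h k by [].
move: (\sum_(0 <= k < K) trunc_weight m k * h k) => d.
by rewrite !ler_norml !ltr_norml => /andP[? ?] /andP[? ?] ? /andP[? ?] /andP[? ?]; apply/andP; split; lra.
Qed.

(* Solutions supported on indices at least m; weight_step m turns one into a solution
   for m+1 by multiplying 1 - sum_k u_k / (L k - z) by (L m - z) / (M m - z). *)

Record weight_solution (m : nat) (u : nat -> R) : Prop := WeightSolution {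
  ws_ge0 : forall k, 0 <= u k ;
  ws_lt : forall k, (k < m)%N -> u k = 0 ;
  ws_nrange : forall k, ~~ in_range len k -> u k = 0 ;
  ws_eq : forall j, (m <= j)%N -> in_range len j ->
    summ (fun k => u k / (L k - M j)) /\ sumR (fun k => u k / (L k - M j)) = 1 ;
  ws_le : forall N, \sum_(0 <= k < N) u k / L k <= 1 }.

Definition weight_step m (u : nat -> R) k := u k * ((L m - L k) / (M m - L k)).

Lemma ws_divL_ge0 m u : weight_solution m u -> forall k, 0 <= u k / L k.
Proof.
move=> su k; have [_ _ L0 _ _] := LM.
have [rk|rk] := boolP (in_range len k); last by rewrite (ws_nrange su)// mul0r.
by rewrite divr_ge0 ?(ws_ge0 su)// ltW// L0.
Qed.

Lemma ws_summL m u : weight_solution m u ->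
  summ (fun k => u k / L k) /\ sumR (fun k => u k / L k) <= 1.
Proof.
by move=> su; apply: summ_bounded; [exact: (ws_divL_ge0 su)|exact: ws_le su].
Qed.

(** By partial fractions a new sum is (1 + c) times the old sum at [M j], or at 0, minus c times the
    old sum at [M m]. The coefficients add up to 1, which preserves both the equations and the
    inequality. *)
Lemma weight_step_solution m u : in_range len m -> weight_solution m u ->
  weight_solution m.+1 (weight_step m u).
Proof.
move=> rm su; have [ML LM' L0 M0 _] := LM.
have u'0 k : 0 <= weight_step m u k.
  rewrite /weight_step; have [rk|rk] := boolP (in_range len k); last first.
    by rewrite (ws_nrange su)// mul0r.
  case: (ltngtP k m) => [km|mk|->].
  - by rewrite (ws_lt su)// mul0r.
  - rewrite mulr_ge0 ?(ws_ge0 su)// divr_ge0// subr_ge0 ltW//.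
      exact: interlaced_L.
    exact: LM'.
  - by rewrite subrr mul0r mulr0.
split => //.
- move=> k; rewrite ltnS leq_eqVlt /weight_step => /orP[/eqP->|km].
    by rewrite subrr mul0r mulr0.
  by rewrite (ws_lt su)// mul0r.
- by move=> k rk; rewrite /weight_step (ws_nrange su)// mul0r.
- move=> j mj rj; have [sj ej] := ws_eq su (ltnW mj) rj.
  have [sm em] := ws_eq su (leqnn m) rm.
  have Mmj : M m - M j != 0 by rewrite subr_eq0 gt_eqF// interlaced_M.
  pose c := (L m - M m) / (M m - M j).
  have [s1 e1] := summP (- c) sm sj; have [s2 e2] := summP c sj s1.
  have eqf : (fun k => weight_step m u k / (L k - M j)) =
      (fun k => c * (u k / (L k - M j)) + (- c * (u k / (L k - M m)) + u k / (L k - M j))).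
    apply/funext => k; rewrite /weight_step.
    have [rk|rk] := boolP (in_range len k); last first.
      by rewrite (ws_nrange su)// !mul0r !mulr0 !addr0.
    have h1 := interlaced_LM_neq rj rk; have h2 := interlaced_LM_neq rm rk.
    have h3 : M m - L k != 0 by rewrite -opprB oppr_eq0.
    by rewrite /c; field; rewrite h1 h2 h3 Mmj.
  by rewrite eqf; split => //; rewrite e2 e1 ej em; ring.
(* If M m = 0, no index beyond [m] is in range, and the step leaves only zero weights. *)
- move=> N; have [Mm0|Mm0] := eqVneq (M m) 0.
    rewrite big1 ?ler01// => k _; rewrite /weight_step.
    have [rk|rk] := boolP (in_range len k); last by rewrite (ws_nrange su)// !mul0r.
    case: (ltngtP k m) => [km|mk|->]; last by rewrite subrr !mul0r mulr0 mul0r.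
      by rewrite (ws_lt su)// !mul0r.
    by have := interlaced_M mk rk; rewrite Mm0 ltNge M0.
  have Mm : 0 < M m by rewrite lt_def Mm0 M0.
  have [sm em] := ws_eq su (leqnn m) rm; have [sL eL] := ws_summL su.
  pose c := (L m - M m) / M m.
  have c0 : 0 <= c by rewrite divr_ge0// ?subr_ge0 ltW// ML.
  have [s1 e1] := summP (- c) sm sL; have [s2 e2] := summP c sL s1.
  have eqf : (fun k => weight_step m u k / L k) =
      (fun k => c * (u k / L k) + (- c * (u k / (L k - M m)) + u k / L k)).
    apply/funext => k; rewrite /weight_step.
    have [rk|rk] := boolP (in_range len k); last first.
      by rewrite (ws_nrange su)// !mul0r !mulr0 !addr0.
    have h2 := interlaced_LM_neq rm rk.
    have h3 : M m - L k != 0 by rewrite -opprB oppr_eq0.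
    by rewrite /c; field; rewrite h2 h3 Mm0 gt_eqF// L0.
  have s3 : summ (fun k => weight_step m u k / L k) by rewrite eqf.
  have p0 k : 0 <= weight_step m u k / L k.
    have [rk|rk] := boolP (in_range len k).
      by rewrite divr_ge0// ltW// L0.
    by rewrite /weight_step (ws_nrange su)// !mul0r.
  apply: le_trans (summ_ge_partial N p0 s3) _.
  rewrite eqf e2 e1 em.
  by have := ler_wpM2l c0 eL; rewrite mulr1; lra.
Qed.

(** The secular function again, with signs arranged so that at z = L m the terms are nonnegative for
    [u] supported beyond [m]. *)
Definition Psi z (u : nat -> R) := 1 + sumR (fun k => u k / (z - L k)).

(** The point where sum_k u_k / L k <= 1 enters uniqueness: the terms of [Psi] are at most e u_k / L
    k. As further pairs are removed, [e] can be taken small, and [Psi (L m)] tends to 1. *)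
Lemma weight_solution_Psi m i u (e : R) : in_range len m -> weight_solution i u ->
  (m < i)%N -> 0 <= e ->
  (forall k, (i <= k)%N -> in_range len k -> L k <= e * (L m - L k)) ->
  summ (fun k => u k / (L m - L k)) /\ 1 <= Psi (L m) u <= 1 + e.
Proof.
move=> rm su mi e0 Le; have [_ _ L0 _ _] := LM.
have [sL eL] := ws_summL su; have [s1 e1] := summZ e sL.
have [u0 ue] : (forall k, 0 <= u k / (L m - L k)) /\
    (forall k, u k / (L m - L k) <= e * (u k / L k)).
  have key k : 0 <= u k / (L m - L k) <= e * (u k / L k).
    have [rk|rk] := boolP (in_range len k); last first.
      by rewrite (ws_nrange su)// !mul0r mulr0 lexx.
    have [ki|ik] := ltnP k i; first by rewrite (ws_lt su)// !mul0r mulr0 lexx.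
    have d0 : 0 < L m - L k by rewrite subr_gt0 interlaced_L// (leq_trans mi).
    rewrite divr_ge0 ?(ws_ge0 su) ?(ltW d0)//=.
    rewrite mulrCA ler_wpM2l ?(ws_ge0 su)//.
    by rewrite ler_pdivlMr ?L0// mulrC ler_pdivrMr// Le.
  by split => k; have /andP[] := key k.
have [s2 e2] := @summ_norm R (fun k => u k / (L m - L k)) _ (fun k => eq_ind_r (fun x => x <= _) (ue k) (ger0_norm (u0 k))) s1.
split => //; rewrite /Psi lerD2l lerDl.
have h0 := summ_ge_partial 0 u0 s2; rewrite big_geq// in h0; rewrite h0/=.
apply: le_trans (ler_norm _) _; apply: le_trans e2 _.
by rewrite e1 ler_piMr.
Qed.

(** The factor depends on the removed pair only, so the ratio of the values of [Psi] for two
    solutions survives every step. *)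
Lemma Psi_step m i u : in_range len m -> weight_solution i u -> (m < i)%N -> in_range len i ->
  summ (fun k => u k / (L m - L k)) ->
  Psi (L m) (weight_step i u) = Psi (L m) u * ((L m - L i) / (L m - M i)).
Proof.
move=> rm su mi ri s0; have [ML LM' L0 M0 _] := LM.
have [sm em] := ws_eq su (leqnn i) ri.
have Lmi : L m - M i != 0 by rewrite interlaced_LM_neq.
pose c := (L i - M i) / (L m - M i).
have [s1 e1] := summP (- c) sm s0; have [s2 e2] := summP (- c) s0 s1.
have eqf : (fun k => weight_step i u k / (L m - L k)) =
      (fun k => - c * (u k / (L m - L k)) + (- c * (u k / (L k - M i)) + u k / (L m - L k))).
  apply/funext => k; rewrite /weight_step.
  have [rk|rk] := boolP (in_range len k); last first.
    by rewrite (ws_nrange su)// !mul0r !mulr0 !addr0.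
  have [ki|ik] := ltnP k i; first by rewrite (ws_lt su)// !mul0r !mulr0 !addr0.
  have h1 := interlaced_LM_neq ri rk.
  have h3 : M i - L k != 0 by rewrite -opprB oppr_eq0.
  have h4 : L m - L k != 0 by rewrite subr_eq0 gt_eqF// interlaced_L// (leq_trans mi).
  by rewrite /c; field; rewrite h1 h3 h4 Lmi.
by rewrite /Psi eqf e2 e1 em /c; field.
Qed.

(** The step cancels the pole at [L m]; the value that remains there is read off from the residue
    [u m]. *)
Lemma weight_solution_first m u : in_range len m -> weight_solution m u ->
  u m / (L m - M m) = Psi (L m) (weight_step m u) /\
  summ (fun k => weight_step m u k / (L m - L k)).
Proof.
move=> rm su; have [ML LM' L0 M0 _] := LM.
have [sm em] := ws_eq su (leqnn m) rm.
pose d k : R := if (k == m) then u m / (L m - M m) else 0.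
have [k mk|sd ed] := @summ_finite R d m.+1; first by rewrite /d gtn_eqF.
have ed' : sumR d = u m / (L m - M m).
  rewrite ed big_nat_recr//= /d eqxx big_nat_cond big1 ?add0r// => k.
  by rewrite andbT => /andP[_ km]; rewrite ltn_eqF.
have [s1 e1] := summP (-1) sm sd.
have eqf : (fun k => weight_step m u k / (L m - L k)) =
    (fun k => -1 * (u k / (L k - M m)) + d k).
  apply/funext => k; rewrite /weight_step /d.
  have [rk|rk] := boolP (in_range len k); last first.
    rewrite (ws_nrange su)// !mul0r mulr0 add0r.
    by case: eqP => // km; rewrite km rm in rk.
  case: (ltngtP k m) => [km|mk|->].
  - by rewrite (ws_lt su)// !mul0r mulr0 addr0.
  - have h1 := interlaced_LM_neq rm rk.
    have h3 : M m - L k != 0 by rewrite -opprB oppr_eq0.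
    have h4 : L m - L k != 0 by rewrite subr_eq0 gt_eqF// interlaced_L.
    by field; rewrite h1 h3 h4.
  - by rewrite subrr !mul0r mulr0 mul0r mulN1r addNr.
by rewrite /Psi eqf; split => //; rewrite e1 em ed'; ring.
Qed.

(** Write a and b for the values of [Psi (L m)] after one step. The relation a Psi v' = b Psi u' is
    invariant under further steps, while both values of [Psi] tend to 1; hence a = b. *)
Lemma weight_solution_head m u v : in_range len m ->
  weight_solution m u -> weight_solution m v -> u m = v m.
Proof.
move=> rm su sv; have [ML LM' L0 M0 Lt0] := LM.
have [ua us] := weight_solution_first rm su; have [va vs] := weight_solution_first rm sv.
set a := u m / _ in ua; set b := v m / _ in va.
have a0 : 0 <= a by rewrite divr_ge0 ?(ws_ge0 su)// subr_ge0 ltW// ML.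
have b0 : 0 <= b by rewrite divr_ge0 ?(ws_ge0 sv)// subr_ge0 ltW// ML.
have iter i : (m < i)%N -> exists u' v', [/\ weight_solution i u', weight_solution i v',
    summ (fun k => u' k / (L m - L k)), summ (fun k => v' k / (L m - L k)) &
    a * Psi (L m) v' = b * Psi (L m) u'].
  elim: i => // i IH; rewrite ltnS leq_eqVlt => /orP[/eqP <-|mi].
    exists (weight_step m u), (weight_step m v); split => //; try exact: weight_step_solution.
    by rewrite -ua -va mulrC.
  have [u' [v' [su' sv' s1 s2 ab]]] := IH mi.
  (* Past the end nothing remains to be removed: a solution at level [i] is one at level [i.+1]. *)
  have [ri|ri] := boolP (in_range len i); last first.
    have nr w : weight_solution i w -> weight_solution i.+1 w.
      move=> sw; split; [exact: ws_ge0 sw| |exact: ws_nrange sw| |exact: ws_le sw].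
        move=> k; rewrite ltnS leq_eqVlt => /orP[/eqP->|]; [exact: ws_nrange sw _ ri|exact: ws_lt sw _].
      by move=> j ij; apply: ws_eq sw _ (ltnW ij).
    by exists u', v'; split => //; exact: nr.
  have bnd k : (i.+1 <= k)%N -> in_range len k ->
      L k <= L i / (L m - L i) * (L m - L k).
    move=> ik rk; have h1 := interlaced_L ik rk; have h2 := interlaced_L mi ri.
    rewrite mulrAC ler_pdivlMr ?subr_gt0//.
    by have := L0 _ ri; have := L0 _ rk; nra.
  have e0 : 0 <= L i / (L m - L i).
    by rewrite divr_ge0 ?subr_ge0 ?ltW ?L0// interlaced_L.
  have [t1 _] := weight_solution_Psi rm (weight_step_solution ri su') (leqW mi) e0 bnd.
  have [t2 _] := weight_solution_Psi rm (weight_step_solution ri sv') (leqW mi) e0 bnd.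
  exists (weight_step i u'), (weight_step i v'); split => //; try exact: weight_step_solution.
  by rewrite !Psi_step// !mulrA ab.
suff ab : a = b.
  have LMm : L m - M m != 0 by rewrite subr_eq0 gt_eqF// ML.
  by rewrite -[u m](divfK LMm) -/a ab divfK.
apply/eqP; rewrite -subr_eq0 -normr_le0; apply/ler_addgt0Pl => e e0; rewrite addr0.
pose d := e / (a + b + 1).
have ab1 : 0 < a + b + 1 by rewrite ltr_wpDl// addr_ge0.
have d0 : 0 < d by rewrite divr_gt0.
(* The bound L k < d L m / (1 + d) is L k < d (L m - L k) solved for L k. *)
have [|N NP] := Lt0 (d * L m / (1 + d)).
  by apply: divr_gt0; [rewrite mulr_gt0 ?L0|rewrite addr_gt0].
have [u' [v' [su' sv' _ _ ab]]] := iter (maxn N m.+1) (leq_maxr _ _).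
have bnd k : (maxn N m.+1 <= k)%N -> in_range len k -> L k <= d * (L m - L k).
  rewrite geq_max => /andP[Nk _] rk; have := NP k Nk rk.
  rewrite ltr_pdivlMr ?addr_gt0//; lra.
have [_ /andP[p1 p2]] := weight_solution_Psi rm su' (leq_maxr _ _) (ltW d0) bnd.
have [_ /andP[q1 q2]] := weight_solution_Psi rm sv' (leq_maxr _ _) (ltW d0) bnd.
have dE : d * (a + b + 1) = e by rewrite divfK// gt_eqF.
move: ab p1 p2 q1 q2 dE; move: (Psi _ u') (Psi _ v') => p q ab p1 p2 q1 q2 dE.
have h1 : a - b = b * (p - 1) - a * (q - 1) by rewrite !mulrBr ab; ring.
have h2 : 0 <= b * (p - 1) <= b * d by rewrite mulr_ge0 ?subr_ge0//= ler_wpM2l// lerBlDl.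
have h3 : 0 <= a * (q - 1) <= a * d by rewrite mulr_ge0 ?subr_ge0//= ler_wpM2l// lerBlDl.
have h4 : e = a * d + b * d + d by rewrite -dE; ring.
rewrite ler_norml h1 h4; move: h2 h3 => /andP[? ?] /andP[? ?].
by apply/andP; split; lra.
Qed.

(** Since [weight_step m] multiplies each coordinate beyond [m] by a nonzero factor common to both
    solutions, any coordinate becomes the head after enough steps. *)
Lemma weight_solution_unique m u v : weight_solution m u -> weight_solution m v ->
  forall k, u k = v k.
Proof.
move=> su sv k; have [km|mk] := ltnP k m.
  by rewrite (ws_lt su)// (ws_lt sv).
rewrite -(subnKC mk); move: (k - m)%N => {mk}n.
elim: n m u v su sv => [|n IH] m u v su sv.
  have [rm|rm] := boolP (in_range len m); last by rewrite addn0 (ws_nrange su)// (ws_nrange sv).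
  by rewrite addn0; exact: weight_solution_head.
have [rn|rn] := boolP (in_range len (m + n.+1)); last by rewrite (ws_nrange su)// (ws_nrange sv).
have rm : in_range len m by apply: in_range_le rn; exact: leq_addr.
have := IH _ _ _ (weight_step_solution rm su) (weight_step_solution rm sv).
rewrite addSnnS /weight_step; apply: mulIf.
have mn : (m < m + n.+1)%N by rewrite -[ltnLHS]addn0 ltn_add2l.
rewrite mulf_neq0// ?invr_eq0 subr_eq0 gt_eqF//; first exact: interlaced_L.
by have [_ LM' _ _ _] := LM; exact: LM'.
Qed.

End weights.

(** * Finitely supported measures on the circle *)

Section circle_measures.
Context {R : realType}.
Local Notation T := (borel_circle R).

Lemma circle_val_norm (xi : circle R) : `|circle_val xi| = 1.
Proof. by have /set_mem := valP (xi : {x | x \in unit_circle R}). Qed.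

Lemma circle_val_inj : injective (@circle_val R).
Proof. by move=> x y xy; apply: val_inj. Qed.

Lemma circle_val_continuous : continuous (fun xi : circle R => circle_val xi : (R[i])^o).
Proof. exact: initial_continuous. Qed.

Lemma open_measurable_circle (A : set (circle R)) : open A -> measurable (A : set T).
Proof. by move=> oA; apply: sub_sigma_algebra. Qed.

Lemma measurable_circle1 (x : T) : measurable [set x].
Proof.
rewrite -[X in measurable X]setCK; apply: measurableC.
apply: open_measurable_circle.
have -> : ~` [set x] = (fun xi : circle R => circle_val xi : (R[i])^o) @^-1`
    ~` [set (circle_val (x : circle R) : (R[i])^o)].
  by apply/seteqP; split => y /= yx; [move=> /circle_val_inj|move=> xy; apply: yx; rewrite xy].
have /continuousP cv := circle_val_continuous; apply: cv.
apply: closed_openC.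
by apply: accessible_closed_set1; apply: hausdorff_accessible; exact: norm_hausdorff.
Qed.

Lemma continuous_circle_measurable (g : circle R -> R) : continuous g ->
  measurable_fun setT (g : T -> R).
Proof.
move=> cg; apply: (measurability _ (RGenOInfty.measurableE R)) => _ [_ [r ->] <-].
rewrite setTI; apply: open_measurable_circle.
by have /continuousP cg' := cg; apply: cg'; rewrite set_itvoy; exact: open_gt.
Qed.

Lemma circle_ReIm_measurable :
  measurable_fun setT (fun xi : T => complex.Re (circle_val xi)) /\
  measurable_fun setT (fun xi : T => complex.Im (circle_val xi)).
Proof.
have key (f : R[i] -> R) : (forall z w, `|f z - f w|%:C <= `|z - w|) ->
    measurable_fun setT (fun xi : T => f (circle_val xi)).
  move=> fl; apply: continuous_circle_measurable.
  have cf (z : (R[i])^o) : (fun w : (R[i])^o => f w : R) @ z --> (f z : R).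
    move=> A /nbhs_ballP[e /= e0 eA]; apply/nbhs_ballP.
    exists e%:C => /=; first by rewrite ltcR.
    move=> w; rewrite -ball_normE/= => zw; apply: eA; rewrite -ball_normE/=.
    by rewrite -ltcR; apply: le_lt_trans (fl _ _) zw.
  move=> x; exact: (@continuous_comp _ _ _ (fun xi : circle R => circle_val xi : (R[i])^o)
    (fun w : (R[i])^o => f w : R) x (circle_val_continuous (x := x)) (cf (circle_val x))).
split; apply: key => z w; rewrite -raddfB [`|z - w|]normc_def lecR;
  rewrite -[leLHS]ger0_norm// -sqrtr_sqr ler_wsqrtr//.
  by rewrite real_normK ?num_real// lerDl sqr_ge0.
by rewrite real_normK ?num_real// lerDr sqr_ge0.
Qed.

Definition measurable_ReIm (u : T -> R[i]) : Prop :=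
  measurable_fun setT (fun xi => complex.Re (u xi)) /\
  measurable_fun setT (fun xi => complex.Im (u xi)).

Lemma measurable_ReIm_exp (u : T -> R[i]) n : measurable_ReIm u ->
  measurable_ReIm (fun xi => u xi ^+ n).
Proof.
move=> [ur ui]; elim: n => [|n [IHr IHi]].
  by split; under eq_fun do rewrite expr0/=; exact: measurable_cst.
split.
  rewrite (_ : (fun _ => _) = (fun xi => complex.Re (u xi) * complex.Re (u xi ^+ n) -
      complex.Im (u xi) * complex.Im (u xi ^+ n))).
    by apply: measurable_funB; exact: measurable_funM.
  by apply/funext => xi; rewrite exprS; case: (u xi) (u xi ^+ n) => a b [c d].
rewrite (_ : (fun _ => _) = (fun xi => complex.Re (u xi) * complex.Im (u xi ^+ n) +
    complex.Im (u xi) * complex.Re (u xi ^+ n))).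
  by apply: measurable_funD; exact: measurable_funM.
by apply/funext => xi; rewrite exprS; case: (u xi) (u xi ^+ n) => a b [c d].
Qed.

Lemma circle_val_exp_measurable (n : int) :
  measurable_ReIm (fun xi : T => circle_val xi ^ n).
Proof.
have [mr mi] := circle_ReIm_measurable.
case: n => n; first exact: measurable_ReIm_exp.
(* On the circle the inverse is the conjugate, so negative powers reduce to natural ones. *)
have -> : (fun xi : T => circle_val xi ^ Negz n) =
    (fun xi : T => (circle_val xi)^*%C ^+ n.+1).
  apply/funext => xi; rewrite NegzE -exprnN -exprVn; congr (_ ^+ _).
  rewrite -[LHS]mulr1 -(expr1n _ 2) -(circle_val_norm xi) sqr_normc mulrA mulVf ?mul1r//.
  by rewrite -normr_eq0 circle_val_norm oner_eq0.
apply: measurable_ReIm_exp; split.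
  by rewrite (_ : (fun _ => _) = (fun xi : T => complex.Re (circle_val xi)))//; apply/funext => xi; case: (circle_val xi).
rewrite (_ : (fun _ => _) = \- (fun xi : T => complex.Im (circle_val xi))).
  exact: measurableT_comp.
by apply/funext => xi /=; case: (circle_val xi).
Qed.

Variable rho : probability T R.

Lemma Rintegral_indic_sum (s : seq T) (c : T -> R) :
  rho.-integrable setT (EFin \o (fun x => \sum_(a <- s) c a * \1_[set a] x)) /\
  \int[rho]_x (\sum_(a <- s) c a * \1_[set a] x) = \sum_(a <- s) c a * fine (rho [set a]).
Proof.
elim: s => [|a s [IHi IHe]].
  rewrite (_ : (fun _ => _) = cst 0); last by apply/funext => x; rewrite big_nil.
  by rewrite big_nil Rintegral_cst ?mul0r//; split => //; exact: integrable0.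
have i1 : rho.-integrable setT (EFin \o (\1_[set a] : T -> R)).
  by apply: integrable_indic => //; exact: measurable_circle1.
have i2 : rho.-integrable setT (EFin \o (fun x => c a * (\1_[set a] x : R))).
  by have := integrableZl (measurableT) (c a) i1.
rewrite (_ : (fun _ => _) = (fun x => c a * \1_[set a] x + \sum_(b <- s) c b * \1_[set b] x)); last first.
  by apply/funext => x; rewrite big_cons.
rewrite big_cons; split; first by have := integrableD measurableT i2 IHi.
rewrite RintegralD// IHe RintegralZl//; congr (_ * _ + _).
rewrite /Rintegral integral_indic ?setIT//; exact: measurable_circle1.
Qed.

(** Off a null set [g] coincides with a combination of indicators of points. *)
Lemma Rintegral_finite_support (s : seq T) (g : T -> R) : uniq s ->
  rho (~` [set` s]) = 0%E -> measurable_fun setT g ->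
  \int[rho]_x g x = \sum_(a <- s) g a * fine (rho [set a]).
Proof.
move=> us s0 mg; have [i1 <-] := Rintegral_indic_sum s g.
rewrite /Rintegral; congr fine; apply: ae_eq_integral => //.
- exact/measurable_EFinP.
- exact: (measurable_int rho i1).
have ms : measurable [set` s].
  rewrite (_ : [set` s] = \big[setU/set0]_(a <- s) [set a]).
    by apply: bigsetU_measurable => a _; exact: measurable_circle1.
  apply/seteqP; split => x /=; rewrite -bigcup_seq.
    by move=> xs; exists x.
  by case=> y ys ->.
exists (~` [set` s]); split => //; first exact: measurableC.
move=> x /= nx xs; apply: nx => _; congr EFin.
rewrite (bigD1_seq x)//= indicE mem_set// mulr1 big1 ?addr0// => a ax.
rewrite indicE memNset ?mulr0//= => xa.
by rewrite xa eqxx in ax.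
Qed.

Lemma finitely_supported_atoms : finitely_supported rho ->
  exists (N : nat) (x : nat -> R[i]) (a : nat -> R), [/\ (0 < N)%N,
    (forall i j, (i < N)%N -> (j < N)%N -> x i = x j -> i = j),
    (forall i, `|x i| = 1) /\ (forall i, (i < N)%N -> 0 < a i),
    \sum_(i < N) a i = 1 &
    forall n : int, circle_integral rho (fun xi => circle_val xi ^ n) =
      \sum_(i < N) (a i)%:C * x i ^ n].
Proof.
move=> [A [/finite_seqP[s0 ->] s00]].
pose s := undup s0.
have us : uniq s by exact: undup_uniq.
have s_0 : rho (~` [set` s]) = 0%E.
  by rewrite -s00; congr (rho (~` _)); apply/seteqP; split => x /=; rewrite mem_undup.
(* Points of mass zero are dropped: strictly positive masses are what cyclicity of the block vector
   needs. *)
pose t := [seq x <- s | fine (rho [set x]) != 0].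
have ut : uniq t by rewrite filter_uniq.
have tsum (g : T -> R) : measurable_fun setT g ->
    \int[rho]_x g x = \sum_(a <- t) g a * fine (rho [set a]).
  move=> mg; rewrite (Rintegral_finite_support us s_0 mg) big_filter [RHS]big_mkcond/=.
  by apply: eq_bigr => a _; case: eqP => // ->; rewrite mulr0.
pose x0 : T := point.
have t_sum1 : \sum_(a <- t) fine (rho [set a]) = 1.
  have := tsum (cst 1) (measurable_cst _).
  rewrite Rintegral_cst ?mul1r//= probability_setT/= => ->.
  by apply: eq_bigr => a _; rewrite mul1r.
exists (size t), (fun i => circle_val (nth x0 t i)), (fun i => fine (rho [set nth x0 t i])).
have sizet : (0 < size t)%N.
  rewrite lt0n size_eq0; apply/eqP => tE; move: t_sum1; rewrite tE big_nil => /eqP.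
  by rewrite eq_sym oner_eq0.
split => //.
- by move=> i j it jt /circle_val_inj/eqP; rewrite nth_uniq// => /eqP.
- split=> [i|i it]; first exact: circle_val_norm.
  rewrite lt_def fine_ge0 ?measure_ge0// andbT.
  by have := mem_nth x0 it; rewrite mem_filter => /andP[].
- by rewrite -[RHS]t_sum1 (big_nth x0) big_mkord.
move=> n; have [mr mi] := circle_val_exp_measurable n.
rewrite /circle_integral (tsum _ mr) (tsum _ mi).
rewrite !(big_nth x0) !big_mkord.
apply/eqP; rewrite eq_complex !raddf_sum/=; apply/andP; split; apply/eqP; apply: eq_bigr => i _.
  by case: (circle_val _ ^ n) => u v /=; rewrite mul0r subr0 mulrC.
by case: (circle_val _ ^ n) => u v /=; rewrite mul0r addr0 mulrC.
Qed.

End circle_measures.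

(** * Uniqueness *)

Section cyclic_side.
Context {R : realType} {H : hilbertType R}.

Lemma csubspace_preim (H' : hilbertType R) (f : H -> H') (c : R) (E : set H') : csubspace E ->
  (forall a x y, f (a *: x + y) = a *: f x + f y) ->
  (forall x, nm (f x) <= c * nm x) -> csubspace [set x | E (f x)].
Proof.
move=> sE fl fc.
have f0 : f 0 = 0.
  by apply/eqP; rewrite -nm_eq0 eq_le nm_ge0 (le_trans (fc _))// nm0 mulr0.
split => [|a x y /= fx fy|x fx]; first by rewrite /= f0; exact: csubspace0.
  by rewrite fl; exact: csubspaceP.
apply: (csubspace_closed sE) => e e0.
have c1 : 0 < Num.max c 0 + 1 by rewrite ltr_wpDl// le_max lexx orbT.
have [|y fy xy] := fx (e / (Num.max c 0 + 1)); first by rewrite divr_gt0.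
exists (f y) => //.
have -> : f x - f y = f (x - y).
  have -> : x - y = (-1) *: y + x by rewrite scaleN1r addrC.
  by rewrite fl scaleN1r addrC.
apply: le_lt_trans (fc _) _; rewrite ltr_pdivlMr// in xy.
apply: le_lt_trans xy; rewrite mulrC ler_wpM2l ?nm_ge0//.
by rewrite ler_wpDr// le_max lexx.
Qed.

Lemma orthocomplK (E : set H) x : csubspace E -> orthocompl (orthocompl E) x -> E x.
Proof.
move=> sE xE; have [y Ey xy] := projection x sE.
suff /eqP : x - y = 0 by rewrite subr_eq0 => /eqP ->.
apply: hdotxx_eq0; rewrite hdotBl (xE _ xy) sub0r.
by rewrite hdotC (xy _ Ey) conjc0 oppr0.
Qed.

Variables (T : {linear H -> H}).
Hypothesis Tadj : self_adjoint T.
Hypothesis Tpsd : psd T.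

Lemma eigen_orth (l m : R) x y : l != m -> T x = l%:C *: x -> T y = m%:C *: y -> hdot x y = 0.
Proof.
move=> lm Tx Ty; have := Tadj x y; rewrite Tx Ty hdotZl hdotZr conjc_real.
move/eqP; rewrite -subr_eq0 -mulrBl mulf_eq0 -rmorphB/=.
by rewrite (inj_eq (@complexI R) (l - m) 0) subr_eq0 (negPf lm) => /eqP.
Qed.

(** T x - r x satisfies the eigenvalue equation for -r < 0, which positivity of [T] excludes for a
    nonzero vector. *)
Lemma psd_sqrt_eigen (r : R) x : 0 < r -> T (T x) = (r ^+ 2)%:C *: x -> T x = r%:C *: x.
Proof.
move=> r0 TTx; pose y := T x - r%:C *: x.
have Ty : T y = (- r)%:C *: y.
  rewrite /y linearB linearZ/= TTx scalerBr scalerA -rmorphM/= mulNr -expr2.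
  by rewrite !rmorphN/= !scaleNr opprK addrC.
apply/eqP; rewrite -subr_eq0 -/y; apply/eqP/hdotxx_eq0.
have := Tpsd y; rewrite Ty hdotZl hdotxx -rmorphM/= ler0c mulNr oppr_ge0 => h.
have : r * nm y ^+ 2 = 0 by apply/eqP; rewrite eq_le h mulr_ge0 ?sqr_ge0// ltW.
by move=> /eqP; rewrite mulf_eq0 (gt_eqF r0)/= => /eqP ->.
Qed.

Lemma adj_sqr_ker x : T (T x) = 0 -> T x = 0.
Proof. by move=> TTx; apply: hdotxx_eq0; rewrite -Tadj TTx hdot0l. Qed.

Hypothesis Tcomp : compact_operator T.

Lemma csubspace_eigspace l : csubspace (eigspace T l).
Proof.
have [C C0 TC] := compact_operator_bounded Tcomp.
have -> : eigspace T l = [set x | T x - l *: x = 0].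
  apply/seteqP; split => x; rewrite /eigspace/=; first by move=> ->; rewrite subrr.
  by move/eqP; rewrite subr_eq0 => /eqP.
apply: (@csubspace_eq_lip _ _ _ (fun x => T x - l *: x) (C + complex.Re `|l|)) => [a x y|x].
  by rewrite linearP scalerDr scalerBr !scalerA (mulrC l) opprD addrACA.
apply: le_trans (nmD _ _) _; rewrite nmN nmZ mulrDl lerD//.
Qed.

Variables (p : H) (M : set H).
Hypothesis sM : csubspace M.
Hypothesis Mp : M p.
Hypothesis TM : forall x, M x -> M (T x).
(** The only form of cyclicity used. It can be checked for R_1 as well as for R, although H_0 is
    defined by the orbit of [p] under R alone. *)
Hypothesis cyc : forall x (l : R), M x -> 0 < l -> T x = l%:C *: x -> hdot x p = 0 -> x = 0.

Lemma T_orthocompl x : orthocompl M x -> orthocompl M (T x).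
Proof. by move=> xM y My; rewrite Tadj; apply: xM; exact: TM. Qed.

Local Notation pl l := (oproj (eigspace T l) p).

Lemma oproj_eigspace_eig l : T (pl l) = l *: pl l.
Proof. by have [] := oprojP p (csubspace_eigspace l). Qed.

Lemma hdot_oproj_eig l x : T x = l *: x -> hdot x p = hdot x (pl l).
Proof.
move=> Tx; have [_ o] := oprojP p (csubspace_eigspace l).
have := o x Tx; rewrite hdotBl => /eqP; rewrite subr_eq0 => /eqP e.
by rewrite hdotC e -hdotC.
Qed.

Lemma hdot_oproj_self l : hdot (pl l) p = (nm (pl l) ^+ 2)%:C.
Proof. by rewrite (hdot_oproj_eig (oproj_eigspace_eig l)) hdotxx. Qed.

(** [M] and its orthogonal complement are invariant, so the component of [pl l] off [M] is again an
    eigenvector for [l]. Its inner product with [pl l] equals that with [p], which is in [M]; hence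
    it vanishes. *)
Lemma oproj_eigspace_sub l : M (pl l).
Proof.
have [u Mu o] := projection (pl l) sM.
suff /eqP : pl l - u = 0 by rewrite subr_eq0 => /eqP ->.
have Tv : T (pl l - u) = l *: (pl l - u).
  have h1 : M (T u - l *: u) by apply: csubspaceB => //; [exact: TM|exact: csubspaceZ].
  have h2 : orthocompl M (T (pl l - u) - l *: (pl l - u)).
    by apply: (csubspaceB (csubspace_orthocompl M)); [exact: T_orthocompl|exact: (csubspaceZ _ (csubspace_orthocompl M))].
  have e : T (pl l - u) - l *: (pl l - u) = - (T u - l *: u).
    by rewrite linearB/= oproj_eigspace_eig scalerBr !opprB addrC subrKA.
  have z : T u - l *: u = 0.
    apply: (orthocompl_self h1); rewrite -[_ - _]opprK -e.
    exact: (csubspaceN (csubspace_orthocompl M)).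
  by apply/eqP; rewrite -subr_eq0 e z oppr0.
apply: hdotxx_eq0; rewrite hdotBr.
rewrite (o u Mu) subr0 -(hdot_oproj_eig Tv).
exact: o.
Qed.

(** Subtracting this multiple of [pl] leaves an eigenvector in [M] orthogonal to [p], excluded by
    [cyc]. The positive eigenspaces inside [M] are therefore lines. *)
Lemma eigvec_oproj (l : R) x : 0 < l -> M x -> T x = l%:C *: x ->
  x = (hdot x p / (nm (pl l%:C) ^+ 2)%:C) *: pl l%:C.
Proof.
move=> l0 Mx Tx; apply/eqP; rewrite -subr_eq0; apply/eqP.
set c := _ / _.
have Ty : T (x - c *: pl l%:C) = l%:C *: (x - c *: pl l%:C).
  by rewrite linearB linearZ/= Tx oproj_eigspace_eig scalerBr !scalerA (mulrC c).
apply: (cyc _ l0 Ty); first by apply: csubspaceB => //; apply: csubspaceZ => //; exact: oproj_eigspace_sub.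
rewrite hdotBl hdotZl hdot_oproj_self.
have [p0|p0] := eqVneq (pl l%:C) 0.
  by rewrite (hdot_oproj_eig Tx) p0 hdot0r nm0 expr0n/= mulr0 subr0.
rewrite /c divfK ?subrr//.
by rewrite (inj_eq (@complexI R) _ 0) sqrf_eq0 nm_eq0.
Qed.

Lemma oproj_eigspace_neq0 (l : R) : 0 < l -> eigenvalues M T l%:C -> pl l%:C != 0.
Proof.
move=> l0 [x [Mx x0 Tx]]; apply: contraNN x0 => /eqP p0.
by rewrite (eigvec_oproj l0 Mx Tx) p0 scaler0.
Qed.

(** The vectors of [M] orthogonal to all the [pl] form an invariant closed subspace. If [T] were
    nonzero on it, it would contain an eigenvector, necessarily orthogonal to [p]. *)
Lemma orth_oproj_ker x : M x ->
  (forall l : R, 0 < l -> eigenvalues M T l%:C -> hdot x (pl l%:C) = 0) -> T x = 0.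
Proof.
move=> Mx xl; apply/eqP; apply: contraT => Tx0.
pose E := M `&` orthocompl [set pl l%:C | l in [set l : R | 0 < l /\ eigenvalues M T l%:C]].
have sE : csubspace E by apply: csubspaceI => //; exact: csubspace_orthocompl.
have [||y [l [[My yE] y0 l0 Ty]]] := compact_psd_eigenvector Tcomp Tadj Tpsd sE.
- move=> z [Mz zE]; split; first exact: TM.
  by move=> _ [l [l0 el] <-]; rewrite Tadj oproj_eigspace_eig hdotZr zE ?mulr0//; exists l.
- exists x => //; split => //.
  by move=> _ [l [l0 el] <-]; exact: xl.
have el : eigenvalues M T l%:C by exists y.
have := yE (pl l%:C); rewrite -(hdot_oproj_eig Ty) => yp.
by rewrite (cyc My l0 Ty (yp _)) ?eqxx// in y0; exists l.
Qed.

End cyclic_side.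

(* With V the inclusion of a subspace, this is the uniqueness of the positive square root. *)
Lemma intertwine_sqrt (R : realType) (H H' : hilbertType R) (T : {linear H -> H})
    (T' : {linear H' -> H'}) (V : H -> H') (c : R) (F : set H) :
  compact_operator T -> self_adjoint T -> psd T ->
  compact_operator T' -> self_adjoint T' -> psd T' ->
  (forall a x y, V (a *: x + y) = a *: V x + V y) -> (forall x, nm (V x) <= c * nm x) ->
  csubspace F -> (forall x, F x -> F (T x)) ->
  (forall x, F x -> V (T (T x)) = T' (T' (V x))) ->
  forall x, F x -> V (T x) = T' (V x).
Proof.
move=> Tc Ta Tp Tc' Ta' Tp' Vl Vc sF TF VT.
have [b b0 Tb] := compact_operator_bounded Tc.
have [b' b0' Tb'] := compact_operator_bounded Tc'.
pose W x := V (T x) - T' (V x).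
have Wl a x y : W (a *: x + y) = a *: W x + W y.
  by rewrite /W linearP !Vl linearP scalerBr opprD addrACA.
have V0 : V 0 = 0.
  by apply/eqP; rewrite -nm_eq0 eq_le nm_ge0 (le_trans (Vc _))// nm0 mulr0.
have VZ a x : V (a *: x) = a *: V x by rewrite -[a *: x]addr0 Vl V0 addr0.
have c0 x : 0 <= c * nm x := le_trans (nm_ge0 _) (Vc x).
have Wb x : nm (W x) <= (`|c| * b + b' * `|c|) * nm x.
  have Vc' y : nm (V y) <= `|c| * nm y.
    by apply: le_trans (Vc _) _; rewrite ler_wpM2r ?nm_ge0// ler_norm.
  apply: le_trans (nmD _ _) _; rewrite nmN mulrDl lerD//.
    by apply: le_trans (Vc' _) _; rewrite -mulrA ler_wpM2l.
  by apply: le_trans (Tb' _) _; rewrite -mulrA ler_wpM2l.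
pose E := F `&` [set x | W x = 0].
have sE : csubspace E by apply: csubspaceI sF _; exact: (csubspace_eq_lip Wl Wb).
have TE x : E x -> E (T x).
  move=> [Fx Wx]; split; first exact: TF.
  move: Wx => /= /eqP; rewrite /W subr_eq0 => /eqP e.
  by rewrite VT// e subrr.
suff <- : E = F by move=> x [_ /eqP]; rewrite subr_eq0 => /eqP.
apply: csubspace_eqT => // [x []//|x Fx xE].
have TEo y : orthocompl E y -> orthocompl E (T y).
  by move=> yE z Ez; rewrite Ta; apply/yE/TE.
have Gx : F x /\ orthocompl E x by split.
apply: orthocompl_self xE; split => //=.
pose G := F `&` orthocompl E.
(* An eigenvector z of [T] in [G], with eigenvalue l, satisfies T' T' (V z) = l^2 V z, hence T' (V
   z) = l V z by positivity; then z is also in [E], and so is 0. *)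
have T0 y : G y -> T y = 0.
  move=> [Fy yE]; apply/eqP; apply: contraT => Ty0.
  have [|z [Fz zE]|//|z [l [[Fz zE] z0 l0 Tz]]] :=
    @compact_psd_eigenvector _ _ _ Tc Ta Tp G.
  - by apply: csubspaceI sF _; exact: csubspace_orthocompl.
  - by split; [exact: TF|exact: TEo].
  - by exists y.
  suff Ez : E z by rewrite (orthocompl_self Ez zE) eqxx in z0.
  split => //=; rewrite /W Tz VZ (@psd_sqrt_eigen _ _ _ Tp' l) ?subrr//.
  by rewrite -VT// Tz linearZ/= Tz scalerA VZ -rmorphM/= expr2.

rewrite /W (T0 _ Gx) V0 sub0r; apply/eqP; rewrite oppr_eq0; apply/eqP.
by apply: (adj_sqr_ker Ta'); rewrite -VT// (T0 _ Gx) linear0 V0.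
Qed.

(** * Integer powers of a unitary operator on a closed subspace *)

Section zpower_theory.
Context {R : realType} {H : hilbertType R} (E : set H) (U : {linear H -> H}).
Hypothesis sE : csubspace E.
Hypothesis UE : unitary_onto E E U.
Implicit Types (m n : int) (x y : H).

Lemma unitary_onto_sub x : E x -> E (U x).
Proof. by move=> Ex; have [<- _] := UE; exists x. Qed.

Lemma unitary_onto_hdot x y : E x -> E y -> hdot (U x) (U y) = hdot x y.
Proof. by have [_ h] := UE; exact: h. Qed.

Lemma unitary_onto_inj x y : E x -> E y -> U x = U y -> x = y.
Proof.
move=> Ex Ey Uxy; have Exy := csubspaceB sE Ex Ey.
apply/eqP; rewrite -subr_eq0; apply/eqP/hdotxx_eq0.
by rewrite -unitary_onto_hdot// linearB/= Uxy subrr hdot0l.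
Qed.

Let UEs : set_surj E E U.
Proof. by have [h _] := UE; rewrite /set_surj h. Qed.

Lemma unitary_onto_pinv x : E x -> E ('pinv_(fun=> 0) E U x) /\ U ('pinv_(fun=> 0) E U x) = x.
Proof.
move=> Ex; split; last by have := @surjpK _ _ (fun=> 0) E E U UEs x (mem_set Ex).
by apply: (surjpinv_image_sub UEs); exists x.
Qed.

Lemma zpower_in n x : E x -> E (zpower E U n x).
Proof.
move=> Ex; case: n => n /=.
  by elim: n => //= n; exact: unitary_onto_sub.
by elim: n => [|n IH] /=; apply: (unitary_onto_pinv _).1.
Qed.

Lemma zpowerS n x : E x -> U (zpower E U n x) = zpower E U (n + 1) x.
Proof.
move=> Ex; case: n => n; first by rewrite -PoszD addn1.
case: n => [|n]; first by rewrite [LHS]/= (unitary_onto_pinv Ex).2.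
have -> : Negz n.+1 + 1 = Negz n by rewrite !NegzE; lia.
by rewrite [in LHS]/= -/(iter n.+1 _ _) (unitary_onto_pinv (zpower_in (Negz n) Ex)).2.
Qed.

(** Two-sided orbits are determined by their value at 0; through this characterization later
    identities avoid the pseudo-inverse. *)
Lemma zpower_uniq (y : int -> H) : (forall n, E (y n)) -> (forall n, U (y n) = y (n + 1)) ->
  forall n, y n = zpower E U n (y 0).
Proof.
move=> Ey Uy n; elim/int_rect: n => // n IH.
  by rewrite -addn1 PoszD -Uy IH zpowerS.
apply: unitary_onto_inj => //; first exact: zpower_in.
rewrite Uy zpowerS//.
by have -> : - Posz n.+1 + 1 = - Posz n by lia.
Qed.

Lemma zpowerZ n c x : E x -> zpower E U n (c *: x) = c *: zpower E U n x.
Proof.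
move=> Ex; have := @zpower_uniq (fun n => c *: zpower E U n x); rewrite /= => <- // m.
  by apply: csubspaceZ => //; exact: zpower_in.
by rewrite linearZ/= zpowerS.
Qed.

Lemma zpower_hdot m n x y : E x -> E y ->
  hdot (zpower E U m x) (zpower E U n y) = hdot (zpower E U (m - n) x) y.
Proof.
move=> Ex Ey; elim/int_rect: n m => [m|n IH m|n IH m]; first by rewrite subr0.
  rewrite -[in RHS]addn1 PoszD opprD addrA -addrAC -IH.
  rewrite -[in LHS](subrK 1 m) -addn1 PoszD -!zpowerS// unitary_onto_hdot//; exact: zpower_in.
rewrite -[LHS]unitary_onto_hdot; [|exact: zpower_in..]; rewrite !zpowerS//.
have -> : - Posz n.+1 + 1 = - Posz n by lia.
by rewrite IH; congr (hdot (zpower _ _ _ _) _); lia.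
Qed.

Lemma star_cyclic_orth v x : star_cyclic E U v ->
  (forall n, hdot x (zpower E U n v) = 0) -> orthocompl E x.
Proof.
move=> cy xv; suff : orthocompl (closed_span [set zpower E U n v | n in [set: int]]) x.
  by rewrite cy.
by apply: orthocompl_closed_span => _ [n _ <-].
Qed.

Variable J : {linear H -> H | (@Num.conj R[i]) \; *:%R}.
Hypothesis JC : conjugation J.
Hypothesis JE : forall x, E x -> E (J x).
Hypothesis JU : J_symmetric J U.

(** J-symmetry makes J U J the adjoint of [U], that is its inverse on [E]; so J applied to the
    reversed orbit of [v] is again an orbit of [U] starting at [v]. *)
Lemma zpower_conj n v : E v -> J v = v -> J (zpower E U n v) = zpower E U (- n) v.
Proof.
move=> Ev Jv; have JJ := JC.2.
have UJU z : E z -> U (J (U z)) = J z.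
  move=> Ez; rewrite -[LHS]JJ; congr (J _).
  have Ew : E (J (U (J (U z)))).
    by apply/JE/unitary_onto_sub/JE/unitary_onto_sub.
  apply/eqP; rewrite -subr_eq0; apply/eqP/hdotxx_eq0.
  have Ez' := csubspaceB sE Ew Ez.
  by rewrite hdotBr -JU unitary_onto_hdot// subrr.
have := @zpower_uniq (fun n => J (zpower E U (- n) v)); rewrite /= => h.
rewrite -[n in LHS]opprK h ?oppr0/= ?Jv// => m; first by apply/JE/zpower_in.
rewrite -[in LHS](subrK 1 (- m)) -zpowerS// UJU; last exact: zpower_in.
by rewrite opprD.
Qed.

End zpower_theory.

(** * Expansions along orthogonal sequences *)

Section orthogonal_sequences.
Context {R : realType} {H : hilbertType R} (P : nat -> H).
Hypothesis Po : forall j k, j <> k -> hdot (P j) (P k) = 0.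

(** The [P k] are not normalized and may vanish, as padded sequences do; a zero vector then gets the
    coefficient 0 / 0 = 0. *)
Let S N x := \sum_(0 <= k < N) (hdot x (P k) / (nm (P k) ^+ 2)%:C) *: P k.

Let S_orth N x k : (k < N)%N -> hdot (x - S N x) (P k) = 0.
Proof.
move=> kN; rewrite hdotBl hdot_suml.
rewrite (bigD1_seq k) ?mem_index_iota ?iota_uniq//= big1 ?addr0; last first.
  by move=> i ik; rewrite hdotZl Po ?mulr0//; apply/eqP.
rewrite hdotZl hdotxx; have [->|Pk] := eqVneq (P k) 0.
  by rewrite hdot0r mul0r mul0r subrr.
by rewrite divfK ?subrr// (inj_eq (@complexI R) _ 0) sqrf_eq0 nm_eq0.
Qed.

Let S_best N x s : (forall q, q \in s -> (q.2 < N)%N) ->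
  nm (x - S N x) <= nm (x - lincomb P s).
Proof.
move=> sN; have -> : x - lincomb P s = (x - S N x) + (S N x - lincomb P s).
  by rewrite addrA subrK.
have o : hdot (x - S N x) (S N x - lincomb P s) = 0.
  rewrite hdotBr !hdot_sumr big_seq big1 ?sub0r => [|k].
    rewrite big_seq big1 ?oppr0// => q qs.
    by rewrite hdotZr S_orth ?mulr0// sN.
  by rewrite mem_index_iota => /andP[_ kN]; rewrite hdotZr S_orth ?mulr0.
rewrite -(@ler_pXn2r _ 2) ?nnegrE ?nm_ge0//.
by rewrite (pythagoras o) lerDl sqr_ge0.
Qed.

Lemma orth_expansion x (e : R) : closed_span (range P) x -> 0 < e ->
  exists N0, forall N, (N0 <= N)%N -> nm (x - S N x) < e.
Proof.
move=> /closureP + e0 => /(_ e e0)[_ /lincomb_span[s ->]] xs.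
exists (\max_(q <- s) q.2).+1 => N sN; apply: le_lt_trans xs.
apply: S_best => q qs; apply: leq_trans sN; rewrite ltnS.
by rewrite (big_rem q qs)/= leq_maxl.
Qed.

Lemma parseval x y (a b : nat -> R) (c : R) : closed_span (range P) x ->
  (forall k, hdot x (P k) = (a k)%:C) -> (forall k, hdot (P k) y = (b k)%:C) ->
  hdot x y = c%:C ->
  summ (fun k => a k * b k / nm (P k) ^+ 2) /\
  sumR (fun k => a k * b k / nm (P k) ^+ 2) = c.
Proof.
move=> Px xa yb xy; set u := fun k => _.
suff uc : series u @ \oo --> c.
  by split; [apply/cvg_ex; exists c | exact/cvg_lim].
have Su N : hdot (S N x) y = (series u N)%:C.
  rewrite /series/= rmorph_sum hdot_suml; apply: eq_bigr => k _.
  by rewrite hdotZl xa yb -fmorphV -!rmorphM/= mulrAC.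
apply/cvgrPdist_lt => e e0.
have n0 : 0 < nm y + 1 by rewrite ltr_wpDl ?nm_ge0.
have [N0 h] := orth_expansion Px (divr_gt0 e0 n0).
exists N0 => // N /= NN0.
have -> : c - series u N = complex.Re (hdot (x - S N x) y).
  by rewrite hdotBl xy Su.
have [h1 _ _] := cabs_ReIm (hdot (x - S N x) y); apply: le_lt_trans h1 _.
apply: le_lt_trans (cauchy_schwarzR _ _) _.
have := h _ NN0; rewrite ltr_pdivlMr// => h2; apply: le_lt_trans h2.
by rewrite ler_wpM2l ?nm_ge0// lerDl.
Qed.
End orthogonal_sequences.

(** * The operators of a canonical tuple *)

Section canonical_data_theory.
Context {R : realType} {H : hilbertType R} (D : spectral_data H).
Hypothesis cD : canonical_compact_data D.

Local Notation T := (sdR D).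
Local Notation T1 := (sdR1 D).
Local Notation p := (sdp D).
Local Notation J := (sdJ D).
Local Notation phi := (sdphi D).
Local Notation phi1 := (sdphi1 D).
Local Notation M := (sdH0 D).

Let Tc := cd_R_compact cD.
Let Ta := cd_R_self_adjoint cD.
Let Tp := cd_R_psd cD.
Let T1c := cd_R1_compact cD.
Let T1a := cd_R1_self_adjoint cD.
Let T1p := cd_R1_psd cD.

Lemma sdR_inj x : T x = 0 -> x = 0.
Proof. by move=> Tx; have : Defs.kernel T x by []; rewrite (cd_R_ker cD). Qed.

Lemma sdphi_hdot x y : hdot (phi x) (phi y) = hdot x y.
Proof. by have [_ h] := cd_phi_unitary cD; exact: h. Qed.

Lemma sdphi_nm x : nm (phi x) = nm x.
Proof.
have := sdphi_hdot x x; rewrite !hdotxx => /complexI /eqP.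
by rewrite eqrXn2 ?nm_ge0// => /eqP.
Qed.

Lemma csubspace_ker1 : csubspace (Defs.kernel T1).
Proof.
suff -> : Defs.kernel T1 = eigspace T1 0 by exact: csubspace_eigspace.
by apply/seteqP; split => x; rewrite /Defs.kernel /eigspace/= scale0r.
Qed.

(** Removing the component in the kernel does not change the image, and on the rest [phi1] is
    isometric. The kernel is closed since it is that of the compact operator R_1. *)
Lemma sdphi1_nm x : nm (phi1 x) <= nm x.
Proof.
have [y Ey o] := projection x csubspace_ker1.
rewrite -(cd_phi1_ker cD) in Ey o.
have [_ iso] := cd_phi1_pisom cD.
have -> : phi1 x = phi1 (x - y) by rewrite linearB/= [phi1 y]Ey subr0.
have -> : nm (phi1 (x - y)) = nm (x - y) by rewrite /nm iso.
rewrite -(@ler_pXn2r _ 2) ?nnegrE ?nm_ge0//.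
by rewrite -[in leRHS](subrK y x) (pythagoras (o _ Ey)) lerDl sqr_ge0.
Qed.

Lemma csubspace_sdH0 : csubspace M.
Proof. exact: csubspace_closed_span. Qed.
Let sM := csubspace_sdH0.

Lemma sdH0_p : M p.
Proof. by apply: subset_closed_span; exists 0%N. Qed.

Lemma sdH0_R x : M x -> M (T x).
Proof.
have [c c0 Tb] := compact_operator_bounded Tc.
move: x; apply: closed_span_sub.
  by apply: (csubspace_preim sM) Tb => a x y; rewrite linearP.
by move=> _ [n _ <-]; apply: subset_closed_span; exists n.+1.
Qed.

Lemma sdR_cyclic x (l : R) : M x -> 0 < l -> T x = l%:C *: x -> hdot x p = 0 -> x = 0.
Proof.
move=> Mx l0 Tx xp; apply: orthocompl_self Mx _.
apply: orthocompl_closed_span => _ [n _ <-].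
elim: n => //= n IH; rewrite -Ta Tx hdotZl [hdot _ _]IH mulr0 //.
Qed.

Lemma sdR_orthocompl x : orthocompl M x -> orthocompl M (T x).
Proof. exact: (T_orthocompl Ta sdH0_R). Qed.

Lemma sdR1_sqr x : hdot x p = 0 -> T1 (T1 x) = T (T x).
Proof.
by move=> xp; have := cd_rank1 cD x; rewrite xp scale0r => /eqP; rewrite subr_eq0 => /eqP.
Qed.

(** Vectors orthogonal to H_0 are orthogonal to p, so R_1^2 = R^2 on that invariant subspace, where
    positive square roots are unique. *)
Lemma sdR1_orthocompl x : orthocompl M x -> T1 x = T x.
Proof.
move=> xM; apply/esym.
apply: (@intertwine_sqrt _ _ _ T T1 id 1 (orthocompl M)) => //.
- by move=> y; rewrite mul1r.
- exact: csubspace_orthocompl.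
- exact: sdR_orthocompl.
- by move=> y yM; rewrite sdR1_sqr// yM//; exact: sdH0_p.
Qed.

Lemma sdH0_R1 x : M x -> M (T1 x).
Proof.
move=> Mx; apply: (orthocomplK sM) => y yM.
rewrite T1a sdR1_orthocompl// -Ta.
by apply: hdot_eq0C; apply: yM; exact: sdH0_R.
Qed.

(** An eigenvector of R_1 orthogonal to p is an eigenvector of R^2, hence of R for the same
    eigenvalue. *)
Lemma sdR1_cyclic x (l : R) : M x -> 0 < l -> T1 x = l%:C *: x -> hdot x p = 0 -> x = 0.
Proof.
move=> Mx l0 T1x xp; apply: (sdR_cyclic Mx l0) => //.
apply: (psd_sqrt_eigen Tp l0); rewrite -sdR1_sqr// T1x linearZ/= T1x scalerA.
by rewrite -rmorphM.
Qed.

Lemma sdR_sdR1_hdot (l m : R) x y : T x = l%:C *: x -> T1 y = m%:C *: y ->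
  ((l ^+ 2) - (m ^+ 2))%:C * hdot x y = hdot x p * hdot p y.
Proof.
move=> Tx T1y; rewrite -[RHS]hdotZl -(cd_rank1 cD) hdotBl.
have -> : hdot (T1 (T1 x)) y = (m ^+ 2)%:C * hdot x y.
  rewrite [LHS]T1a T1y hdotZr [hdot (T1 x) y]T1a T1y hdotZr mulrA !conjc_real.
  by rewrite -rmorphM.
have e : T (T x) = (l ^+ 2)%:C *: x by rewrite Tx linearZ/= Tx scalerA -rmorphM.
by rewrite [T (T x)]e hdotZl -mulrBl -rmorphB.
Qed.

End canonical_data_theory.
Arguments sdH0_p {R H} D.

Lemma interlacing_bounds (R : realType) len (lam mu : nat -> R) : interlacing len lam mu ->
  [/\ forall k, in_range len k -> mu k < lam k,
      forall k, in_range len k.+1 -> lam k.+1 < mu k &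
      forall k, in_range len k -> 0 <= mu k].
Proof.
case: len => [n [n1 a b c]|[h _]]; last by split=> k _; have [? ? ?] := h k => //; exact: ltW.
split => //= k kn; have [d dE] : exists d, (k + d)%N = n.-1 by exists (n.-1 - k)%N; lia.
elim: d k kn dE => [|d IH] k kn dE; first by have -> : k = n.-1 by lia.
apply: le_trans (IH k.+1 _ _) _; [lia|lia|].
by apply: ltW; apply: lt_trans (b k _); [apply: a|]; lia.
Qed.

(** Only the last [mu] of a finite sequence can vanish: any other one exceeds the next [lam]. *)
Lemma interlacing_pos (R : realType) len (lam mu : nat -> R) : interlacing len lam mu ->
  [/\ forall k, in_range len k -> 0 < lam k,
      forall k, in_range len k.+1 -> 0 < mu k & in_range len 0].
Proof.
move=> i; have [a b c] := interlacing_bounds i.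
have l0 k : in_range len k -> 0 < lam k by move=> kr; apply: le_lt_trans (c _ kr) (a _ kr).
split => // [k kr|]; first exact: lt_trans (l0 _ kr) (b _ kr).
by case: len i {a b c l0} => //= n [].
Qed.

Lemma interlacing_sqr (R : realType) len (lam mu : nat -> R) : interlacing len lam mu ->
  interlaced len (fun k => lam k ^+ 2) (fun k => mu k ^+ 2).
Proof.
move=> i; have [a b c] := interlacing_bounds i; have [l0 m0 _] := interlacing_pos i.
have rle j k : (j <= k)%N -> in_range len k -> in_range len j.
  by case: (len) => //= n jk; exact: leq_ltn_trans.
split => [k kr|j k jk kr|k kr|k kr|e e0].
- by rewrite ltrXn2r//; [exact: c|exact: a].
- have h : lam k < mu j.
    elim: k jk kr => // k IH; rewrite ltnS leq_eqVlt => /orP[/eqP <-|jk] kr; first exact: b.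
    have kr' := rle _ _ (leqnSn k) kr.
    by apply: lt_trans (b _ kr) _; apply: lt_trans (a _ kr') (IH jk kr').
  by rewrite ltrXn2r// ltW// l0.
- by rewrite exprn_gt0// l0.
- by rewrite sqr_ge0.
case: len i {a b c m0 rle} l0 => [n _ _|[_ lam0] l0].
  by exists n => k nk; rewrite /= ltnNge nk.
(* The bound lam k < 1 gives lam k ^+ 2 <= lam k < e. *)
move/cvgrPdist_lt : lam0 => /(_ (Num.min e 1)).
rewrite lt_min e0 ltr01 => /(_ isT)[N _ h]; exists N => k Nk _.
have := h k Nk; rewrite sub0r normrN (gtr0_norm (l0 k isT)) lt_min => /andP[h1 h2].
by apply: le_lt_trans h1; rewrite expr2 ger_pMr ?ltW ?l0.
Qed.

(** * The weights of a canonical tuple *)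

Section spectral_weights.
Context {R : realType} {H : hilbertType R} (D : spectral_data H).
Variables (len : option nat) (lam mu : nat -> R).
Variables (rho rho1 : nat -> probability (borel_circle R) R).
Hypothesis cD : canonical_compact_data D.
Hypothesis lam_mu : interlacing len lam mu.
Hypothesis hD : has_spectral_data D len lam mu rho rho1.

Local Notation T := (sdR D).
Local Notation T1 := (sdR1 D).
Local Notation p := (sdp D).
Local Notation M := (sdH0 D).
Local Notation L := (fun k => lam k ^+ 2).
Local Notation L1 := (fun k => mu k ^+ 2).

(** Padding by 0 lets sums run over all of nat. [Qvec] is also 0 at an index with mu j = 0, for
    which the data prescribe no eigenvector. *)
Definition Pvec k : H := if in_range len k then sdpk D (lam k)%:C else 0.
Definition Qvec j : H := if in_range len j && (0 < mu j) then sdp1k D (mu j)%:C else 0.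
Local Notation P := Pvec.
Local Notation Q := Qvec.
Local Notation w := (fun k => nm (P k) ^+ 2).
Local Notation v := (fun j => nm (Q j) ^+ 2).

Let Tc := cd_R_compact cD.
Let Ta := cd_R_self_adjoint cD.
Let T1c := cd_R1_compact cD.
Let T1a := cd_R1_self_adjoint cD.
Let sM := csubspace_sdH0 D.
Let LM := interlacing_sqr lam_mu.

Lemma Pvec_eig k : T (P k) = (lam k)%:C *: P k.
Proof.
rewrite /P; case: ifP => _; last by rewrite linear0 scaler0.
exact: (oproj_eigspace_eig Tc).
Qed.

Lemma Qvec_eig j : T1 (Q j) = (mu j)%:C *: Q j.
Proof.
rewrite /Q; case: ifP => _; last by rewrite linear0 scaler0.
exact: (oproj_eigspace_eig T1c).
Qed.

Lemma Pvec_sdH0 k : M (P k).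
Proof.
rewrite /P; case: ifP => _; last exact: csubspace0.
exact: (oproj_eigspace_sub Ta Tc sM (sdH0_p D) (sdH0_R cD)).
Qed.

Lemma Qvec_sdH0 j : M (Q j).
Proof.
rewrite /Q; case: ifP => _; last exact: csubspace0.
exact: (oproj_eigspace_sub T1a T1c sM (sdH0_p D) (sdH0_R1 cD)).
Qed.

Lemma Pvec_p k : hdot (P k) p = (w k)%:C.
Proof.
rewrite /P; case: ifP => _; last by rewrite hdot0l nm0 expr0n.
exact: (hdot_oproj_self Tc).
Qed.

Lemma Qvec_p j : hdot (Q j) p = (v j)%:C.
Proof.
rewrite /Q; case: ifP => _; last by rewrite hdot0l nm0 expr0n.
exact: (hdot_oproj_self T1c).
Qed.

Lemma sdeig_lam k : in_range len k -> sdeig D (lam k)%:C.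
Proof. by move=> kr; have [-> _ _ _] := hD; exists k. Qed.

Lemma sdeig1_mu j : in_range len j -> 0 < mu j -> sdeig1 D (mu j)%:C.
Proof. by move=> jr m0; have [_ -> _ _] := hD; exists j. Qed.

Lemma Pvec_neq0 k : in_range len k -> P k != 0.
Proof.
move=> kr; rewrite /P kr; have [l0 _ _] := interlacing_pos lam_mu.
apply: (oproj_eigspace_neq0 Ta Tc sM (sdH0_p D) (sdH0_R cD) (sdR_cyclic cD)) => //; first exact: l0.
exact: sdeig_lam.
Qed.

Lemma Qvec_neq0 j : in_range len j -> 0 < mu j -> Q j != 0.
Proof.
move=> jr j0; rewrite /Q jr j0/=.
apply: (oproj_eigspace_neq0 T1a T1c sM (sdH0_p D) (sdH0_R1 cD) (sdR1_cyclic cD)) => //.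
by have [] := sdeig1_mu jr j0.
Qed.

Lemma Pvec_orth j k : j <> k -> hdot (P j) (P k) = 0.
Proof.
move=> jk.
have [kr|kr] := boolP (in_range len k); last by rewrite [P k]/P (negPf kr) hdot0r.
have [jr|jr] := boolP (in_range len j); last by rewrite [P j]/P (negPf jr) hdot0l.
apply: (eigen_orth Ta _ (Pvec_eig j) (Pvec_eig k)); apply/eqP => ljk.
by apply: jk; apply: (interlaced_L_inj LM jr kr); rewrite ljk.
Qed.

Lemma Qvec_orth j k : j <> k -> hdot (Q j) (Q k) = 0.
Proof.
move=> jk.
have [/andP[kr k0]|kr] := boolP (in_range len k && (0 < mu k)); last first.
  by rewrite [Q k]/Q (negPf kr) hdot0r.
have [/andP[jr j0]|jr] := boolP (in_range len j && (0 < mu j)); last first.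
  by rewrite [Q j]/Q (negPf jr) hdot0l.
apply: (eigen_orth T1a _ (Qvec_eig j) (Qvec_eig k)); apply/eqP => ljk.
by apply: jk; apply: (interlaced_M_inj LM jr kr); rewrite ljk.
Qed.

Lemma Pvec_span : closed_span (range P) = M.
Proof.
apply: csubspace_eqT => //; first exact: csubspace_closed_span.
  by apply: closed_span_sub => // _ [k _ <-]; exact: Pvec_sdH0.
move=> x Mx xP; apply: (sdR_inj cD).
apply: (orth_oproj_ker Ta (cd_R_psd cD) Tc sM (sdH0_R cD) (sdR_cyclic cD) Mx) => l l0 el.
have : sdeig D l%:C by [].
have [-> _ _ _] := hD => -[k kr <-].
by apply: xP; apply: subset_closed_span; exists k => //; rewrite /P kr.
Qed.

Lemma Qvec_ker x : M x -> (forall j, hdot x (Q j) = 0) -> T1 x = 0.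
Proof.
move=> Mx xQ.
apply: (orth_oproj_ker T1a (cd_R1_psd cD) T1c sM (sdH0_R1 cD) (sdR1_cyclic cD) Mx) => l l0 el.
have : sdeig1 D l%:C by split => //= /complexI l00; rewrite l00 ltxx in l0.
have [_ -> _ _] := hD => -[j [jr j0] <-].
by have := xQ j; rewrite /Q jr j0.
Qed.

Lemma Pvec_Qvec k j : hdot (P k) (Q j) = (w k * v j / (L k - L1 j))%:C.
Proof.
have [kr|kr] := boolP (in_range len k); last by rewrite /P (negPf kr) hdot0l nm0 expr0n/= !mul0r.
have [/andP[jr j0]|jr] := boolP (in_range len j && (0 < mu j)); last first.
  by rewrite /Q (negPf jr) hdot0r nm0 expr0n/= mulr0 mul0r.
have n0 := interlaced_LM_neq LM jr kr.
have := sdR_sdR1_hdot cD (Pvec_eig k) (Qvec_eig j).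
rewrite Pvec_p (hdotC p) Qvec_p conjc_real => e.
have c0 : (lam k ^+ 2 - mu j ^+ 2)%:C != 0.
  by rewrite (inj_eq (@complexI R) _ 0).
apply: (mulfI c0); rewrite e -!rmorphM/=; congr (_%:C); by field.
Qed.

(** Both <Q j, p> and <Q j, Q j> equal v j. Parseval along the [P k] evaluates the first as v j
    times the secular sum, which must then be 1, and the second as v j^2 times the sum with squared
    denominators, which determines v j. *)
Lemma Qvec_eqs j : in_range len j -> 0 < mu j ->
  [/\ summ (fun k => w k / (L k - L1 j)), sumR (fun k => w k / (L k - L1 j)) = 1 &
      v j = (sumR (fun k => w k / (L k - L1 j) ^+ 2))^-1].
Proof.
move=> jr j0; have Q0 := Qvec_neq0 jr j0.
have v0 : v j != 0 by rewrite sqrf_eq0 nm_eq0.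
have QM : closed_span (range P) (Q j) by rewrite Pvec_span; exact: Qvec_sdH0.
have QP k : hdot (Q j) (P k) = (w k * v j / (L k - L1 j))%:C.
  by rewrite hdotC Pvec_Qvec conjc_real.
have wE k : w k * w k / w k = w k.
  by have [->|w0] := eqVneq (w k) 0; rewrite ?mul0r// mulfK.
have [s1 e1] := parseval Pvec_orth QM QP Pvec_p (Qvec_p j).
have [s2 e2] := parseval Pvec_orth QM QP (Pvec_Qvec^~ j) (hdotxx (Q j)).
have f1 : (fun k => w k * v j / (L k - L1 j) * w k / w k) = (fun k => v j * (w k / (L k - L1 j))).
  by apply/funext => k; rewrite -[in RHS]wE; ring.
have f2 : (fun k => w k * v j / (L k - L1 j) * (w k * v j / (L k - L1 j)) / w k) =
    (fun k => v j ^+ 2 * (w k / (L k - L1 j) ^+ 2)).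
  by apply/funext => k; rewrite -[in RHS]wE -[((_ - _) ^+ 2)^-1]exprVn; ring.
have unZ (c : R) u : c != 0 -> summ (fun k => c * u k) ->
    summ u /\ sumR (fun k => c * u k) = c * sumR u.
  move=> c0 su; have [su' eu'] := summZ c^-1 su.
  have E : (fun k => c^-1 * (c * u k)) = u by apply/funext => k; rewrite mulKf.
  by rewrite E in su' eu'; rewrite eu' mulVKf.
rewrite f1 in s1 e1; rewrite f2 in s2 e2.
have [t1 d1] := unZ _ _ v0 s1; rewrite d1 in e1.
have v20 : v j ^+ 2 != 0 by rewrite sqrf_eq0.
have [t2 d2] := unZ _ _ v20 s2; rewrite d2 in e2.
split => //; first by apply: (mulfI v0); rewrite e1 mulr1.
have e3 : v j * sumR (fun k => w k / (L k - L1 j) ^+ 2) = 1.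
  by apply: (mulfI v0); rewrite mulrA -expr2 e2 mulr1.
rewrite -[RHS]mul1r -e3 mulfK//.
by apply/eqP => s0; move: e3; rewrite s0 mulr0 => /esym/eqP; rewrite oner_eq0.
Qed.

(** A truncation of the formal vector R^{-2} p. Positivity of R_1^2 at [y N] reads s N - (s N)^2 >=
    0. *)
Let y N := \sum_(0 <= k < N) ((L k)^-1)%:C *: P k.
Let s N := \sum_(0 <= k < N) w k / L k.

Let Lpos k : in_range len k -> L k != 0.
Proof. by move=> kr; have [l0 _ _] := interlacing_pos lam_mu; rewrite expf_neq0// gt_eqF ?l0. Qed.

Let T_y N : T (T (y N)) = \sum_(0 <= k < N) P k.
Proof.
rewrite !linear_sum; apply: eq_bigr => k _.
have [kr|kr] := boolP (in_range len k); last by rewrite /P (negPf kr) scaler0 !linear0.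
have e1 : T (((L k)^-1)%:C *: P k) = (lam k / L k)%:C *: P k.
  by rewrite linearZ/= Pvec_eig scalerA -rmorphM mulrC.
have e2 : T (T (((L k)^-1)%:C *: P k)) = (lam k * (lam k / L k))%:C *: P k.
  by rewrite e1 linearZ/= Pvec_eig scalerA -rmorphM [in LHS]mulrC.
by rewrite [LHS]e2 mulrA -expr2 divff ?scale1r//; exact: Lpos.
Qed.

Let y_p N : hdot (y N) p = (s N)%:C.
Proof.
rewrite hdot_suml rmorph_sum; apply: eq_bigr => k _.
by rewrite hdotZl Pvec_p -rmorphM mulrC.
Qed.

Let P_y N k : (k < N)%N -> hdot (P k) (y N) = (w k / L k)%:C.
Proof.
move=> kN; rewrite hdot_sumr.
rewrite (bigD1_seq k) ?mem_index_iota ?iota_uniq//= big1 ?addr0; last first.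
  by move=> i ik; rewrite hdotZr Pvec_orth ?mulr0// => ki; rewrite ki eqxx in ik.
by rewrite hdotZr hdotxx conjc_real -rmorphM mulrC.
Qed.

Lemma Pvec_sum_le N : s N <= 1.
Proof.
have : 0 <= hdot (T1 (T1 (y N))) (y N) by rewrite [hdot _ _]T1a hdotxx ler0c sqr_ge0.
have -> : T1 (T1 (y N)) = T (T (y N)) - (s N)%:C *: p.
  by rewrite -y_p -(cd_rank1 cD) opprB addrC subrK.
rewrite hdotBl T_y hdotZl (hdotC p) y_p conjc_real hdot_suml.
rewrite (_ : \sum_(0 <= k < N) _ = (s N)%:C); last first.
  by rewrite rmorph_sum; apply: eq_big_nat => k /andP[_ kN]; rewrite P_y.
rewrite -rmorphM/= -rmorphB/= ler0c subr_ge0 => h.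
rewrite leNgt; apply/negP => s1.
by move: h; rewrite leNgt => /negP; apply; rewrite ltr_pMr// (lt_trans ltr01).
Qed.

(** Here no eigenvector supplies the equation at M j = 0. The space H_0 has dimension j + 1, but R_1
    has only j nonzero eigenvalues on it; were the sum not 1, R_1 would be injective on H_0 and the
    j vectors [Q i] would span it. *)
Lemma Pvec_last j : in_range len j -> mu j = 0 -> s j.+1 = 1.
Proof.
move=> jr j0; have [_ m0 _] := interlacing_pos lam_mu.
have nr : ~~ in_range len j.+1 by apply/negP => /m0; rewrite j0 ltxx.
have rE k : in_range len k = (k <= j)%N.
  case: (len) jr nr => //= n jn; rewrite -leqNgt => nj.
  by rewrite (_ : n = j.+1) ?ltnS//; apply/eqP; rewrite eqn_leq nj.
have rE' k : in_range len k && (0 < mu k) = (k < j)%N.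
  rewrite rE ltn_neqAle; have [->|kj] := eqVneq k j; first by rewrite leqnn j0 ltxx.
  case: leqP => //= kj'; apply: m0; rewrite rE; first by rewrite ltn_neqAle kj.
apply/eqP; apply: contraT => s1.
have ep : \sum_(0 <= k < j.+1) P k = p.
  apply/eqP; rewrite eq_sym -subr_eq0; apply/eqP.
  have sMp : M (p - \sum_(0 <= k < j.+1) P k).
    apply: (csubspaceB sM (sdH0_p D)).
    by apply: (csubspace_sum _ sM) => k _; exact: Pvec_sdH0.
  apply: orthocompl_self sMp _; rewrite -Pvec_span.
  apply: orthocompl_closed_span => _ [k _ <-].
  rewrite hdotBl (hdotC p) Pvec_p conjc_real hdot_suml.
  have [kj|kj] := ltnP k j.+1; last first.
    rewrite [P k]/P rE leqNgt kj nm0 expr0n/= big1 ?subr0// => i _.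
    by rewrite hdot0r.
  rewrite (bigD1_seq k) ?mem_index_iota ?iota_uniq//= big1 ?addr0 ?hdotxx ?subrr//.
  by move=> i ik; rewrite Pvec_orth//; apply/eqP.
(* Unless s = 1, this puts p in the range of R_1^2. A vector of the kernel of R_1 is then orthogonal
   to p, so R^2 kills it as well. *)
have T1y : T1 (T1 (y j.+1)) = (1 - s j.+1)%:C *: p.
  rewrite rmorphB/= scalerBl scale1r -y_p -(cd_rank1 cD) T_y ep.
  by rewrite opprB addrC subrK.
have T1inj x : M x -> T1 x = 0 -> x = 0.
  move=> Mx T1x; apply/(sdR_inj cD)/(sdR_inj cD).
  have xp : hdot x p = 0.
    have : hdot x (T1 (T1 (y j.+1))) = 0 by rewrite -[LHS]T1a T1x hdot0l.
    rewrite T1y hdotZr conjc_real => /eqP; rewrite mulf_eq0 => /orP[|/eqP//].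
    by rewrite (inj_eq (@complexI R) _ 0) subr_eq0 eq_sym (negPf s1).
  by rewrite -(sdR1_sqr cD xp) T1x linear0.
have Qs : closed_span (range Q) = M.
  apply: csubspace_eqT => //; first exact: csubspace_closed_span.
    by apply: closed_span_sub => // _ [k _ <-]; exact: Qvec_sdH0.
  move=> x Mx xQ; apply: T1inj => //; apply: Qvec_ker => // i.
  by apply: xQ; apply: subset_closed_span; exists i.
pose a k i := w k * v i / (L k - L1 i).
have aP k i : hdot (P k) (Q i) = (a k i)%:C by exact: Pvec_Qvec.
have aQ k i : hdot (Q i) (P k) = (a k i)%:C by rewrite hdotC aP conjc_real.
have Pk0 k : (j < k)%N -> P k = 0 by move=> jk; rewrite /P rE leqNgt jk.
have Qk0 k : (j <= k)%N -> Q k = 0 by move=> jk; rewrite /Q rE' ltnNge jk.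
(* Parseval for [P k] along the [Q i], and below for [Q i] along the [P k]: the squared cosines form
   a matrix with j + 1 rows and j columns, all of sum 1. *)
have rows k : (k <= j)%N -> \sum_(0 <= i < j) a k i * a k i / v i / w k = 1.
  move=> kj; have w0 : w k != 0 by rewrite sqrf_eq0 nm_eq0 Pvec_neq0// rE.
  have PM : closed_span (range Q) (P k) by rewrite Qs; exact: Pvec_sdH0.
  have [_ e] := parseval Qvec_orth PM (aP k) (aQ k) (hdotxx (P k)).
  have [|_ e'] := @summ_finite _ (fun i => a k i * a k i / v i) j.
    by move=> i ji; rewrite /a (Qk0 i)// nm0 expr0n/= invr0 mulr0.
  by rewrite -mulr_suml -e' e divff.
have cols i : (i < j)%N -> \sum_(0 <= k < j.+1) a k i * a k i / v i / w k = 1.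
  move=> ij; have /andP[ir i0] : in_range len i && (0 < mu i) by rewrite rE'.
  have v0 : v i != 0 by rewrite sqrf_eq0 nm_eq0 Qvec_neq0.
  have QM : closed_span (range P) (Q i) by rewrite Pvec_span; exact: Qvec_sdH0.
  have [_ e] := parseval Pvec_orth QM (aQ^~ i) (aP^~ i) (hdotxx (Q i)).
  have [|_ e'] := @summ_finite _ (fun k => a k i * a k i / w k) j.+1.
    by move=> k jk; rewrite /a (Pk0 k)// nm0 expr0n/= invr0 mulr0.
  under eq_bigr do rewrite mulrAC.
  by rewrite -mulr_suml -e' e divff.
have : \sum_(0 <= k < j.+1) (1 : R) = \sum_(0 <= i < j) 1.
  transitivity (\sum_(0 <= k < j.+1) \sum_(0 <= i < j) a k i * a k i / v i / w k).
    by apply: eq_big_nat => k /andP[_ kj]; rewrite rows.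
  by rewrite exchange_big/=; apply: eq_big_nat => i /andP[_ ij]; rewrite cols.
rewrite !sumr_const_nat !subn0 => /eqP.
by rewrite eqr_nat (gtn_eqF (ltnSn j)).
Qed.

Lemma Pvec_weights : weight_solution len L L1 0 w.
Proof.
split => [k|k //|k kr|j _ jr|N]; first exact: sqr_ge0.
- by rewrite /P (negPf kr) nm0 expr0n.
- have [_ _ m0] := interlacing_bounds lam_mu.
  have := m0 j jr; rewrite le_eqVlt => /orP[/eqP/esym j0|j0]; last by have [] := Qvec_eqs jr j0.
  rewrite j0 expr0n/=.
  have -> : (fun k => w k / (L k - 0)) = (fun k => w k / L k) by apply/funext => k; rewrite subr0.
  have <- := Pvec_last jr j0; apply: summ_finite => k jk.
  rewrite /P; case: ifP => [kr|]; last by rewrite nm0 expr0n mul0r.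
  have [_ m0' _] := interlacing_pos lam_mu.
  by have := m0' j (in_range_le jk kr); rewrite j0 ltxx.
- exact: Pvec_sum_le.
Qed.

End spectral_weights.

(** * The orbit of the projection of p in one eigenspace *)

Section spectral_orbit.
Context {R : realType} {H : hilbertType R} (T U : {linear H -> H}).
Variables (J : {linear H -> H | (@Num.conj R[i]) \; *:%R}) (p : H) (l : R).
Variable (rho : {measure set (borel_circle R) -> \bar R}).
Local Notation E := (eigspace T l%:C).
Local Notation v := (oproj E p).
Local Notation mom n := (circle_integral rho (fun xi => circle_val xi ^ n)).
Hypothesis Tc : compact_operator T.
Hypothesis Urho : is_spectral_measure E U (`|v|^-1 *: v) rho.
Hypothesis v0 : v != 0.

Let sE : csubspace E := csubspace_eigspace Tc _.
Let UE : unitary_onto E E U := Urho.1.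
Let Ev : E v := (oprojP p sE).1.

Lemma orbit_moment n : hdot (zpower E U n v) v = (nm v ^+ 2)%:C * mom n.
Proof.
have := Urho.2 n; rewrite (zpowerZ sE UE)// hdotZl hdotZr => <-.
have c0 : (nm v)%:C != 0 by rewrite (inj_eq (@complexI R) _ 0) nm_eq0.
rewrite nmE -fmorphV conjc_real fmorphV rmorphXn/= expr2 -mulrA !mulrA.
by rewrite mulfK// fmorphV mulfV// mul1r.
Qed.

Lemma orbit_hdot m n :
  hdot (zpower E U m v) (zpower E U n v) = (nm v ^+ 2)%:C * mom (m - n).
Proof. by rewrite (zpower_hdot UE)// orbit_moment. Qed.

Lemma orbit_p n : hdot (zpower E U n v) p = (nm v ^+ 2)%:C * mom n.
Proof. by rewrite -orbit_moment; apply: (hdot_oproj_eig Tc); apply: (zpower_in UE). Qed.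

Hypothesis JC : conjugation J.
Hypothesis Jp : J p = p.
Hypothesis JT : commutes J T.
Hypothesis JU : J_symmetric J U.

Let JE x : E x -> E (J x).
Proof.
move=> Ex; rewrite /eigspace/= -JT [T x]Ex.
by rewrite (linearZ_LR J)/=; congr (_ *: _); exact: conjc_real.
Qed.

(** The eigenvalue is real, so J preserves the eigenspace; since J fixes p and conjugates inner
    products, J v is also a projection of p. *)
Lemma conj_oproj_eigspace : J v = v.
Proof.
apply/esym; apply: oproj_uniq => //; first exact: JE.
move=> y Ey; have [_ o] := oprojP p sE.
have e : p - J v = J (p - v) by rewrite (raddfB J)/= Jp.
rewrite e -[y](JC.2) (hdotJ JC) o ?conjc0//; exact: JE.
Qed.

Lemma orbit_conj n : J (zpower E U n v) = zpower E U (- n) v.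
Proof. by apply: (zpower_conj sE UE JC JE JU) => //; exact: conj_oproj_eigspace. Qed.

End spectral_orbit.

(** * The family of all orbits and its span *)

Section orbit_family.
Context {R : realType} {H : hilbertType R} (D : spectral_data H).
Variables (len : option nat) (lam mu : nat -> R).
Variables (rho rho1 : nat -> probability (borel_circle R) R).

Local Notation T := (sdR D).
Local Notation T1 := (sdR1 D).
Local Notation p := (sdp D).
Local Notation J := (sdJ D).
Local Notation phi := (sdphi D).
Local Notation phi1 := (sdphi1 D).
Local Notation M := (sdH0 D).
Local Notation L := (fun k => lam k ^+ 2).
Local Notation L1 := (fun k => mu k ^+ 2).
Local Notation w k := (nm (Pvec D len lam k) ^+ 2).
Local Notation v j := (nm (Qvec D len mu j) ^+ 2).
Local Notation mom r n := (circle_integral r (fun xi => circle_val xi ^ n)).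

Definition orbA k n : H :=
  if in_range len k then zpower (eigspace T (lam k)%:C) phi n (sdpk D (lam k)%:C) else 0.
Definition orbB j n : H :=
  if in_range len j && (0 < mu j)
  then zpower (eigspace T1 (mu j)%:C) phi1 n (sdp1k D (mu j)%:C) else 0.
Definition orb (i : bool * nat * int) : H :=
  if i.1.1 then orbA i.1.2 i.2 else orbB i.1.2 i.2.

Hypothesis cD : canonical_compact_data D.
Hypothesis lam_mu : interlacing len lam mu.
Hypothesis hD : has_spectral_data D len lam mu rho rho1.

Let Tc := cd_R_compact cD.
Let Ta := cd_R_self_adjoint cD.
Let T1c := cd_R1_compact cD.
Let T1a := cd_R1_self_adjoint cD.
Let LM := interlacing_sqr lam_mu.

Let specA k : in_range len k -> is_spectral_measure (eigspace T (lam k)%:C) phi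
  (`|sdpk D (lam k)%:C|^-1 *: sdpk D (lam k)%:C) (rho k).
Proof. by have [_ _ h _] := hD; exact: h. Qed.

Let specB k : in_range len k && (0 < mu k) -> is_spectral_measure (eigspace T1 (mu k)%:C) phi1
  (`|sdp1k D (mu k)%:C|^-1 *: sdp1k D (mu k)%:C) (rho1 k).
Proof. by have [_ _ _ h] := hD; move=> /andP[]; exact: h. Qed.

Let A0 k : in_range len k -> sdpk D (lam k)%:C != 0.
Proof. by move=> kr; have := Pvec_neq0 cD lam_mu hD kr; rewrite /Pvec kr. Qed.

Let B0 k : in_range len k && (0 < mu k) -> sdp1k D (mu k)%:C != 0.
Proof.
by move=> /andP[kr k0]; have := Qvec_neq0 cD hD kr k0; rewrite /Qvec kr k0.
Qed.

Let orbA_in k n : eigspace T (lam k)%:C (orbA k n).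
Proof.
rewrite /orbA; case: ifP => kr; last exact: (csubspace0 (csubspace_eigspace Tc _)).
exact: (zpower_in (specA kr).1 n (oprojP p (csubspace_eigspace Tc _)).1).
Qed.

Let orbB_in k n : eigspace T1 (mu k)%:C (orbB k n).
Proof.
rewrite /orbB; case: ifP => kr; last exact: (csubspace0 (csubspace_eigspace T1c _)).
exact: (zpower_in (specB kr).1 n (oprojP p (csubspace_eigspace T1c _)).1).
Qed.

Lemma orbA_eig k n : T (orbA k n) = (lam k)%:C *: orbA k n.
Proof. exact: orbA_in. Qed.

Lemma orbB_eig k n : T1 (orbB k n) = (mu k)%:C *: orbB k n.
Proof. exact: orbB_in. Qed.

Lemma orbA_phi k n : phi (orbA k n) = orbA k (n + 1).
Proof.
rewrite /orbA; case: ifP => kr; last exact: linear0.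
exact: (zpowerS (specA kr).1 n (oprojP p (csubspace_eigspace Tc _)).1).
Qed.

Lemma orbB_phi1 k n : phi1 (orbB k n) = orbB k (n + 1).
Proof.
rewrite /orbB; case: ifP => kr; last exact: linear0.
exact: (zpowerS (specB kr).1 n (oprojP p (csubspace_eigspace T1c _)).1).
Qed.

Lemma orbA_conj k n : J (orbA k n) = orbA k (- n).
Proof.
rewrite /orbA; case: ifP => kr; last exact: (raddf0 J).
exact: (orbit_conj Tc (specA kr) (cd_J_conj cD) (cd_J_p cD) (cd_J_R cD) (cd_phi_sym cD)).
Qed.

Lemma orbB_conj k n : J (orbB k n) = orbB k (- n).
Proof.
rewrite /orbB; case: ifP => kr; last exact: (raddf0 J).
exact: (orbit_conj T1c (specB kr) (cd_J_conj cD) (cd_J_p cD) (cd_J_R1 cD) (cd_phi1_sym cD)).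
Qed.

Lemma orbA_p k n : hdot (orbA k n) p = (w k)%:C * mom (rho k) n.
Proof.
rewrite /orbA /Pvec; case: ifP => kr; last by rewrite hdot0l nm0 expr0n mul0r.
exact: (orbit_p Tc (specA kr) (A0 kr)).
Qed.

Lemma orbB_p k n : hdot (orbB k n) p = (v k)%:C * mom (rho1 k) n.
Proof.
rewrite /orbB /Qvec; case: ifP => kr; last by rewrite hdot0l nm0 expr0n mul0r.
exact: (orbit_p T1c (specB kr) (B0 kr)).
Qed.

Lemma orbA_hdot k m n : hdot (orbA k m) (orbA k n) = (w k)%:C * mom (rho k) (m - n).
Proof.
rewrite /orbA /Pvec; case: ifP => kr; last by rewrite hdot0l nm0 expr0n mul0r.
exact: (orbit_hdot Tc (specA kr) (A0 kr)).
Qed.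

Lemma orbB_hdot k m n : hdot (orbB k m) (orbB k n) = (v k)%:C * mom (rho1 k) (m - n).
Proof.
rewrite /orbB /Qvec; case: ifP => kr; last by rewrite hdot0l nm0 expr0n mul0r.
exact: (orbit_hdot T1c (specB kr) (B0 kr)).
Qed.

Lemma orbA_orth j k m n : j != k -> hdot (orbA j m) (orbA k n) = 0.
Proof.
move=> jk.
have [kr|kr] := boolP (in_range len k); last by rewrite [orbA k n]/orbA (negPf kr) hdot0r.
have [jr|jr] := boolP (in_range len j); last by rewrite [orbA j m]/orbA (negPf jr) hdot0l.
apply: (eigen_orth Ta _ (orbA_eig j m) (orbA_eig k n)); apply: contra_neq jk => ljk.
by apply: (interlaced_L_inj LM jr kr); rewrite ljk.
Qed.

Lemma orbB_orth j k m n : j != k -> hdot (orbB j m) (orbB k n) = 0.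
Proof.
move=> jk.
have [/andP[kr _]|kr] := boolP (in_range len k && (0 < mu k)); last first.
  by rewrite [orbB k n]/orbB (negPf kr) hdot0r.
have [/andP[jr _]|jr] := boolP (in_range len j && (0 < mu j)); last first.
  by rewrite [orbB j m]/orbB (negPf jr) hdot0l.
apply: (eigen_orth T1a _ (orbB_eig j m) (orbB_eig k n)); apply: contra_neq jk => ljk.
by apply: (interlaced_M_inj LM jr kr); rewrite ljk.
Qed.

Lemma orbA_orbB j k m n : hdot (orbA k m) (orbB j n) =
  (w k)%:C * mom (rho k) m * ((v j)%:C * mom (rho1 j) n)^*%C / (L k - L1 j)%:C.
Proof.
rewrite -orbA_p -orbB_p.
have [kr|kr] := boolP (in_range len k); last by rewrite /orbA (negPf kr) !hdot0l !mul0r.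
have [/andP[jr _]|jr] := boolP (in_range len j && (0 < mu j)); last first.
  by rewrite /orbB (negPf jr) hdot0r hdot0l conjc0 mulr0 mul0r.
have c0 : (L k - L1 j)%:C != 0.
  by rewrite (inj_eq (@complexI R) _ 0) (interlaced_LM_neq LM jr kr).
apply: (mulfI c0); rewrite (sdR_sdR1_hdot cD (orbA_eig k m) (orbB_eig j n)).
by rewrite [RHS]mulrC divfK// -hdotC.
Qed.

(** [spanA] contains H_0 and K, so its complement lies in K_1, where phi is the identity. The
    complement of [spanB] lies in the sum of K and the kernel of R_1 in H_0, where phi_1 is the
    identity and 0 respectively. Thus the operators are known off the orbits too. *)
Definition spanA : set H := closed_span (range (fun i : nat * int => orbA i.1 i.2)).
Definition spanB : set H := closed_span (range (fun i : nat * int => orbB i.1 i.2)).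

Lemma csubspace_spanA : csubspace spanA.
Proof. exact: csubspace_closed_span. Qed.

Lemma csubspace_spanB : csubspace spanB.
Proof. exact: csubspace_closed_span. Qed.

Lemma spanA_orb k n : spanA (orbA k n).
Proof. by apply: subset_closed_span; exists (k, n). Qed.

Lemma spanB_orb k n : spanB (orbB k n).
Proof. by apply: subset_closed_span; exists (k, n). Qed.

Lemma eigspace_spanA l : sdeig D l -> eigspace T l `<=` spanA.
Proof.
move=> el x Ex; apply: (orthocomplK csubspace_spanA) => y yA; apply: hdot_eq0C.
apply: star_cyclic_orth (cd_phi_cyclic cD el) _ x Ex => n.
move: el; have [-> _ _ _] := hD => -[k kr <-].
by have := yA _ (@spanA_orb k n); rewrite /orbA kr.
Qed.

Lemma eigspace_spanB l : sdeig1 D l -> eigspace T1 l `<=` spanB.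
Proof.
move=> el x Ex; apply: (orthocomplK csubspace_spanB) => y yA; apply: hdot_eq0C.
apply: star_cyclic_orth (cd_phi1_cyclic cD el) _ x Ex => n.
move: el; have [_ -> _ _] := hD => -[k [kr k0] <-].
by have := yA _ (@spanB_orb k n); rewrite /orbB kr k0.
Qed.

Lemma sdK_spanA : sdK D `<=` spanA.
Proof.
move=> x [+ _]; move: x; apply: closed_span_sub => [|y [l el Ey]]; first exact: csubspace_spanA.
exact: eigspace_spanA Ey.
Qed.

Lemma sdK1_spanB : sdK1 D `<=` spanB.
Proof.
move=> x [+ _]; move: x; apply: closed_span_sub => [|y [l el Ey]]; first exact: csubspace_spanB.
exact: eigspace_spanB Ey.
Qed.

Lemma sdH0_spanA : M `<=` spanA.
Proof.
rewrite -(Pvec_span cD hD); apply: closed_span_sub; first exact: csubspace_spanA.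
move=> _ [i _ <-]; rewrite /Pvec; case: ifP => ir; last exact: (csubspace0 csubspace_spanA).
apply: (eigspace_spanA (sdeig_lam hD ir)).
exact: (oprojP p (csubspace_eigspace Tc _)).1.
Qed.

Lemma spanA_orthocompl x : orthocompl spanA x -> sdK1 D x.
Proof.
move=> xA; have [h [k [k1 [Mh Kk Kk1 xE]]]] := cd_sum cD x.
have hk : hdot h k = 0 by apply: hdot_eq0C; apply: Kk.2.
have k1h : hdot k1 h = 0 by apply: Kk1.2.
have k1k : hdot k1 k = 0 by apply: hdot_eq0C; apply: (cd_K_orth_K1 cD).
have h0 : h = 0.
  apply: hdotxx_eq0; have := xA _ (sdH0_spanA Mh).
  by rewrite xE !hdotDl (hdot_eq0C hk) k1h !addr0.
have k0 : k = 0.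
  apply: hdotxx_eq0; have := xA _ (sdK_spanA Kk).
  by rewrite xE !hdotDl hk k1k add0r addr0.
by rewrite xE h0 k0 !add0r.
Qed.

Lemma spanB_orthocompl x : orthocompl spanB x ->
  exists h k, [/\ sdH0 D h, T1 h = 0, sdK D k & x = h + k].
Proof.
move=> xB; have [h [k [k1 [Mh Kk Kk1 xE]]]] := cd_sum cD x.
exists h, k.
have k10 : k1 = 0.
  apply: hdotxx_eq0; have := xB _ (sdK1_spanB Kk1).
  rewrite xE !hdotDl (cd_K_orth_K1 cD Kk Kk1) (hdot_eq0C (Kk1.2 _ Mh)).
  by rewrite !add0r.
split => //; last by rewrite xE k10 addr0.
apply: (Qvec_ker cD hD Mh) => j.
have Qs : spanB (Qvec D len mu j).
  rewrite /Qvec; case: ifP => [/andP[jr j0]|_]; last exact: (csubspace0 csubspace_spanB).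
  apply: (eigspace_spanB (sdeig1_mu hD jr j0)).
  exact: (oprojP p (csubspace_eigspace T1c _)).1.
have := xB _ Qs; rewrite xE k10 addr0 hdotDl.
have QM : M (Qvec D len mu j) by exact: Qvec_sdH0.
by rewrite (Kk.2 _ QM) addr0.
Qed.

Lemma orb_total : total_family orb.
Proof.
apply/orth_total => x xo.
have xA : orthocompl spanA x.
  by apply: orthocompl_closed_span => _ [[k n] _ <-]; exact: (xo (true, k, n)).
have xB : orthocompl spanB x.
  by apply: orthocompl_closed_span => _ [[k n] _ <-]; exact: (xo (false, k, n)).
exact: (orthocompl_self (sdK1_spanB (spanA_orthocompl xA)) xB).
Qed.

End orbit_family.

Lemma sdH0_iter (R : realType) (H : hilbertType R) (D : spectral_data H) x :
  (forall n, hdot x (iter n (sdR D) (sdp D)) = 0) <-> orthocompl (sdH0 D) x.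
Proof.
split => [h|h n]; first by apply: orthocompl_closed_span => _ [n _ <-].
by apply: h; apply: subset_closed_span; exists n.
Qed.

Lemma eq_on_projection (R : realType) (H H' : hilbertType R) (E : set H) (f g : H -> H') :
  csubspace E -> (forall a x y, f (a *: x + y) = a *: f x + f y) ->
  (forall a x y, g (a *: x + y) = a *: g x + g y) ->
  (forall x, E x -> f x = g x) -> (forall x, orthocompl E x -> f x = g x) -> f =1 g.
Proof.
move=> sE fl gl fgE fgo x; have [y Ey o] := projection x sE.
have -> : x = 1 *: y + (x - y) by rewrite scale1r addrC subrK.
by rewrite fl gl fgE// fgo.
Qed.

Lemma eq_on_closed_span (R : realType) (H H' : hilbertType R) (I : Type) (x : I -> H)
    (f g : H -> H') (c d : R) :
  (forall a x y, f (a *: x + y) = a *: f x + f y) ->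
  (forall a x y, g (a *: x + y) = a *: g x + g y) ->
  (forall x, nm (f x) <= c * nm x) -> (forall x, nm (g x) <= d * nm x) ->
  (forall i, f (x i) = g (x i)) -> forall y, closed_span (range x) y -> f y = g y.
Proof.
move=> fl gl fc gd fg.
have s : csubspace [set y | f y - g y = 0].
  apply: (@csubspace_eq_lip _ _ _ (fun y => f y - g y) (c + d)) => [a y z|y].
    by rewrite fl gl scalerBr opprD addrACA.
  by apply: le_trans (nmD _ _) _; rewrite nmN mulrDl lerD.
move=> y ys; suff : [set y | f y - g y = 0] y by move=> /= /eqP; rewrite subr_eq0 => /eqP.
by apply: closed_span_sub ys => // _ [i _ <-] /=; rewrite fg subrr.
Qed.

(** * Unitary equivalence of two tuples *)

Section uniqueness.
Context {R : realType} {H H' : hilbertType R} (D : spectral_data H) (D' : spectral_data H').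
Variables (len : option nat) (lam mu : nat -> R).
Variables (rho rho1 : nat -> probability (borel_circle R) R).
Hypothesis lam_mu : interlacing len lam mu.
Hypothesis cD : canonical_compact_data D.
Hypothesis hD : has_spectral_data D len lam mu rho rho1.
Hypothesis cD' : canonical_compact_data D'.
Hypothesis hD' : has_spectral_data D' len lam mu rho rho1.

Lemma Pvec_nm_uniq k : nm (Pvec D len lam k) ^+ 2 = nm (Pvec D' len lam k) ^+ 2.
Proof.
exact: (weight_solution_unique (interlacing_sqr lam_mu)
  (Pvec_weights cD lam_mu hD) (Pvec_weights cD' lam_mu hD')).
Qed.

Lemma Qvec_nm_uniq k : nm (Qvec D len mu k) ^+ 2 = nm (Qvec D' len mu k) ^+ 2.
Proof.
have [/andP[kr k0]|kr] := boolP (in_range len k && (0 < mu k)); last first.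
  by rewrite /Qvec (negPf kr) !nm0.
have [_ _ ->] := Qvec_eqs cD lam_mu hD kr k0.
have [_ _ ->] := Qvec_eqs cD' lam_mu hD' kr k0.
by congr (sumR _)^-1; apply/funext => i; rewrite Pvec_nm_uniq.
Qed.

Lemma orb_gram i j : hdot (orb D len lam mu i) (orb D len lam mu j) =
  hdot (orb D' len lam mu i) (orb D' len lam mu j).
Proof.
move: i j => [[b k] m] [[b' k'] n]; rewrite /orb/=.
have AB c l r q : hdot (orbA D len lam c l) (orbB D len mu r q) =
    hdot (orbA D' len lam c l) (orbB D' len mu r q).
  rewrite (orbA_orbB cD lam_mu hD) (orbA_orbB cD' lam_mu hD').
  by rewrite Pvec_nm_uniq Qvec_nm_uniq.
case: b b' => [] [].
- have [->|kk'] := eqVneq k k'; last first.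
    by rewrite (orbA_orth cD lam_mu hD)// (orbA_orth cD' lam_mu hD').
  by rewrite (orbA_hdot cD lam_mu hD) (orbA_hdot cD' lam_mu hD') Pvec_nm_uniq.
- exact: AB.
- by rewrite hdotC AB -hdotC.
- have [->|kk'] := eqVneq k k'; last first.
    by rewrite (orbB_orth cD lam_mu hD)// (orbB_orth cD' lam_mu hD').
  by rewrite (orbB_hdot cD hD) (orbB_hdot cD' hD') Qvec_nm_uniq.
Qed.

Theorem spectral_data_unique : unitarily_equivalent D D'.
Proof.
have [V [Vorb VU Vhdot Vnm]] := unitary_gram (orb_total cD hD) (orb_total cD' hD') orb_gram.
have VA k n : V (orbA D len lam k n) = orbA D' len lam k n by exact: (Vorb (true, k, n)).
have VB k n : V (orbB D len mu k n) = orbB D' len mu k n by exact: (Vorb (false, k, n)).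
have Vl a x y : V (a *: x + y) = a *: V x + V y by rewrite linearP.
have Vb x : nm (V x) <= 1 * nm x by rewrite mul1r Vnm.
have comp_lin (H1 H2 H3 : hilbertType R) (f : {linear H2 -> H3}) (g : {linear H1 -> H2}) a x y :
    f (g (a *: x + y)) = a *: f (g x) + f (g y) by rewrite !linearP.
have [c c0 Tb] := compact_operator_bounded (cd_R_compact cD).
have [c' c0' Tb'] := compact_operator_bounded (cd_R_compact cD').
have [d d0 T1b] := compact_operator_bounded (cd_R1_compact cD).
have [d' d0' T1b'] := compact_operator_bounded (cd_R1_compact cD').
(* Both vectors have the same inner products, weights times moments, with the total family of
   [D']. *)
have Vp : V (sdp D) = sdp D'.
  apply/eqP; rewrite -subr_eq0; apply/eqP.
  apply: (iffRL (orth_total _) (orb_total cD' hD')) => i.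
  have e : hdot (V (sdp D)) (orb D' len lam mu i) = hdot (sdp D) (orb D len lam mu i).
    by rewrite -Vorb Vhdot.
  rewrite hdotBl {}e (hdotC (sdp D)) (hdotC (sdp D')).
  move: i => [[[] k] n]; rewrite /orb/=.
    by rewrite (orbA_p cD lam_mu hD) (orbA_p cD' lam_mu hD') Pvec_nm_uniq subrr.
  by rewrite (orbB_p cD hD) (orbB_p cD' hD') Qvec_nm_uniq subrr.
have VK1 x : orthocompl (spanA D len lam) x -> sdK1 D' (V x).
  move=> xA; apply: (spanA_orthocompl cD' hD').
  apply: orthocompl_closed_span => _ [[k n] _ <-] /=.
  by rewrite -VA Vhdot; apply: xA; exact: spanA_orb.
have VT1B x : spanB D len mu x -> V (sdR1 D x) = sdR1 D' (V x).
  apply: (@eq_on_closed_span _ _ _ _ _ (fun x => V (sdR1 D x)) (fun x => sdR1 D' (V x)) d d').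
  - exact: comp_lin.
  - exact: comp_lin.
  - by move=> y; rewrite Vnm.
  - by move=> y; rewrite -(Vnm y).
  - move=> [k n] /=; rewrite (orbB_eig cD hD) VB (orbB_eig cD' hD').
    by rewrite linearZ/= VB.
have VT x : V (sdR D x) = sdR D' (V x).
  apply: (eq_on_projection (f := fun x => V (sdR D x)) (g := fun x => sdR D' (V x))
    (csubspace_spanA D len lam)) => [||y|y yA].
  - exact: comp_lin.
  - exact: comp_lin.
  - apply: (@eq_on_closed_span _ _ _ _ _ (fun x => V (sdR D x)) (fun x => sdR D' (V x)) c c').
    + exact: comp_lin.
    + exact: comp_lin.
    + by move=> z; rewrite Vnm.
    + by move=> z; rewrite -(Vnm z).
    + move=> [k n] /=; rewrite (orbA_eig cD hD) VA (orbA_eig cD' hD').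
      by rewrite linearZ/= VA.
  (* Here y is in K_1, hence orthogonal to H_0, and R agrees with R_1 at y; R_1 is already
     intertwined on [spanB], which contains K_1. *)
  - have yK := spanA_orthocompl cD hD yA.
    rewrite -(sdR1_orthocompl cD yK.2) -(sdR1_orthocompl cD' (VK1 _ yA).2).
    by apply: VT1B; exact: (sdK1_spanB cD hD).
(* R_1^2 = R^2 - p p^* is intertwined, hence so is its positive square root. *)
have VT1 x : V (sdR1 D x) = sdR1 D' (V x).
  apply: (@intertwine_sqrt _ _ _ (sdR1 D) (sdR1 D') V 1 [set: H]) => //.
  - exact: cd_R1_compact.
  - exact: cd_R1_self_adjoint.
  - exact: cd_R1_psd.
  - exact: cd_R1_compact.
  - exact: cd_R1_self_adjoint.
  - exact: cd_R1_psd.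
  - move=> y _; have e := cd_rank1 cD y; have e' := cd_rank1 cD' (V y).
    have {}e : sdR1 D (sdR1 D y) = sdR D (sdR D y) - hdot y (sdp D) *: sdp D.
      by rewrite -e opprB addrC subrK.
    have {}e' : sdR1 D' (sdR1 D' (V y)) = sdR D' (sdR D' (V y)) - hdot (V y) (sdp D') *: sdp D'.
      by rewrite -e' opprB addrC subrK.
    by rewrite e e' linearB linearZ/= !VT Vp -{2}Vp Vhdot.
have Vphi x : V (sdphi D x) = sdphi D' (V x).
  apply: (eq_on_projection (f := fun x => V (sdphi D x)) (g := fun x => sdphi D' (V x))
    (csubspace_spanA D len lam)) => [||y|y yA].
  - exact: comp_lin.
  - exact: comp_lin.
  - apply: (@eq_on_closed_span _ _ _ _ _ (fun x => V (sdphi D x)) (fun x => sdphi D' (V x)) 1 1).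
    + exact: comp_lin.
    + exact: comp_lin.
    + by move=> z; rewrite Vnm (sdphi_nm cD) mul1r.
    + by move=> z; rewrite (sdphi_nm cD') Vnm mul1r.
    + by move=> [k n] /=; rewrite (orbA_phi cD hD) !VA (orbA_phi cD' hD').
  - rewrite (cd_phi_K1 cD (spanA_orthocompl cD hD yA)).
    by rewrite (cd_phi_K1 cD' (VK1 _ yA)).
have VK x : sdK D x -> sdK D' (V x).
  move=> Kx; split.
    have VA' y : spanA D len lam y -> closed_span (\bigcup_(l in sdeig D') eigspace (sdR D') l) (V y).
      move: y; apply: closed_span_sub.
        by apply: (csubspace_preim (csubspace_closed_span _) Vl Vb).
      move=> _ [[k n] _ <-] /=; rewrite VA.
      have [kr|kr] := boolP (in_range len k); last first.
        rewrite /orbA (negPf kr); exact: (csubspace0 (csubspace_closed_span _)).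
      apply: subset_closed_span; exists (lam k)%:C; first exact: (sdeig_lam hD' kr).
      exact: (orbA_eig cD' hD').
    by apply: VA'; exact: (sdK_spanA cD hD).
  apply/sdH0_iter => n.
  have -> : iter n (sdR D') (sdp D') = V (iter n (sdR D) (sdp D)).
    by elim: n => //= n IH; rewrite IH VT.
  rewrite Vhdot; exact: (iffRL (sdH0_iter D x) Kx.2 n).
have Vphi1 x : V (sdphi1 D x) = sdphi1 D' (V x).
  apply: (eq_on_projection (f := fun x => V (sdphi1 D x)) (g := fun x => sdphi1 D' (V x))
    (csubspace_spanB D len mu)) => [||y|y yB].
  - exact: comp_lin.
  - exact: comp_lin.
  - apply: (@eq_on_closed_span _ _ _ _ _ (fun x => V (sdphi1 D x)) (fun x => sdphi1 D' (V x)) 1 1).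
    + exact: comp_lin.
    + exact: comp_lin.
    + by move=> z; rewrite Vnm mul1r; exact: sdphi1_nm.
    + by move=> z; rewrite mul1r -(Vnm z); exact: sdphi1_nm.
    + by move=> [k n] /=; rewrite (orbB_phi1 cD hD) !VB (orbB_phi1 cD' hD').
  - have [h [k [Mh T1h Kk ->]]] := spanB_orthocompl cD hD yB.
    have ph : sdphi1 D h = 0.
      by have : Defs.kernel (sdphi1 D) h by rewrite (cd_phi1_ker cD).
    have ph' : sdphi1 D' (V h) = 0.
      have : Defs.kernel (sdphi1 D') (V h); last by [].
      by rewrite (cd_phi1_ker cD') /Defs.kernel/= -VT1 T1h linear0.
    have e : sdphi1 D (h + k) = k by rewrite linearD/= ph add0r (cd_phi1_K cD Kk).
    have e' : sdphi1 D' (V h + V k) = V k.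
      by rewrite linearD/= ph' add0r (cd_phi1_K cD' (VK _ Kk)).
    by rewrite e linearD e'.
have JP (K : hilbertType R) (J : {linear K -> K | (@Num.conj R[i]) \; *:%R}) a y z :
  J (a *: y + z) = a^*%C *: J y + J z by rewrite (linearP J).
exists V; split => //; split => //; split => // x.
(* Conjugating [V] by two conjugate-linear maps gives a linear map, so the density lemma for linear
   maps applies. *)
have e : V x = sdJ D' (V (sdJ D x)).
  apply: (@bounded_eq_total _ _ _ _ _ V (fun x => sdJ D' (V (sdJ D x))) 1 1
    (orb_total cD hD) Vl _ Vb).
  - by move=> a y z; rewrite (JP _ (sdJ D)) Vl (JP _ (sdJ D')) conjcK.
  - by move=> y; rewrite (nmJ (cd_J_conj cD')) Vnm (nmJ (cd_J_conj cD)) mul1r.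
  - move=> [[[] k] n]; rewrite /orb/=.
      by rewrite (orbA_conj cD hD) VA VA (orbA_conj cD' hD') opprK.
    by rewrite (orbB_conj cD hD) VB VB (orbB_conj cD' hD') opprK.
by rewrite e (cd_J_conj cD').2.
Qed.

End uniqueness.

(** * Existence *)

Lemma rat_approx (R : realType) (r e : R) : 0 < e -> exists q : rat, `|r - ratr q| < e.
Proof.
move=> e0; have [q] := @rat_in_itvoo _ (r - e) (r + e) ltac:(lra).
rewrite in_itv/= => /andP[h1 h2]; exists q; rewrite ltr_distl; lra.
Qed.

Definition ratc (R : realType) (q : rat * rat) : R[i] := (ratr q.1) +i* (ratr q.2).

Lemma ratc_approx (R : realType) (z : R[i]) (e : R) : 0 < e ->
  exists q, complex.Re `|z - ratc R q| < e.
Proof.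
move=> e0; have e2 : 0 < e / 2 by rewrite divr_gt0.
have [q1 h1] := rat_approx (complex.Re z) e2; have [q2 h2] := rat_approx (complex.Im z) e2.
exists (q1, q2); have [_ _ h] := cabs_ReIm (z - ratc R (q1, q2)); apply: le_lt_trans h _.
by rewrite [e]splitr; move: h1 h2; case: (z) => a b /= h1 h2; exact: ltrD.
Qed.

(** Combinations with Gaussian rational coefficients are countably many and dense. *)
Lemma separable_total_family (R : realType) (H : hilbertType R) (I : countType) (x : I -> H) :
  total_family x -> separable H.
Proof.
move=> xT; pose f (s : seq (rat * rat * I)) := lincomb x [seq (ratc R q.1, q.2) | q <- s].
exists (range f); first exact: (sub_countable (card_image_le f setT) (countableP _)).
have approx s (e : R) : 0 < e -> exists s', nm (lincomb x s - f s') < e.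
  elim: s e => [|[a i] s IH] e e0.
    by exists [::]; rewrite /f/= subrr nm0.
  have e2 : 0 < e / 2 by rewrite divr_gt0.
  have [s' h'] := IH _ e2.
  have n0 : 0 < nm (x i) + 1 by rewrite ltr_wpDl ?nm_ge0.
  have [q hq] := ratc_approx a (divr_gt0 e2 n0).
  exists ((q, i) :: s'); rewrite /f/= /lincomb !big_cons/= -/(lincomb x s).
  rewrite -/(lincomb x [seq (ratc R q.1, q.2) | q <- s']) -/(f s').
  rewrite opprD addrACA -scalerBl; apply: le_lt_trans (nmD _ _) _.
  rewrite [e]splitr ltr_leD//; last exact: ltW.
  rewrite nmZ; move: hq; rewrite ltr_pdivlMr// => hq; apply: le_lt_trans hq.
  by rewrite ler_wpM2l ?cabs_ge0// lerDl.
move=> O [z Oz] oO.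
have cz : closure (range f) z.
  apply/closureP => e e0; have e2 : 0 < e / 2 by rewrite divr_gt0.
  have [s hs] := xT z _ e2; have [s' hs'] := approx s _ e2.
  exists (f s'); first by exists s'.
  by apply: le_lt_trans (nm_tri (lincomb x s) _ _) _; rewrite [e]splitr ltrD.
have [|y [fy Oy]] := cz O; first exact: open_nbhs_nbhs.
by exists y.
Qed.

(** Invertibility of the Vandermonde matrix, obtained by testing on the polynomial that vanishes at
    every node except [x i]. *)
Lemma power_sums_inj (F : fieldType) (n : nat) (x c : nat -> F) :
  {in [pred i | (i < n)%N] &, injective x} ->
  (forall m : nat, \sum_(i < n) c i * x i ^+ m = 0) ->
  forall i, (i < n)%N -> c i = 0.
Proof.
move=> xi h i ni.
pose q : {poly F} := \prod_(j < n | (j : nat) != i) ('X - (x j)%:P).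
have hq (r : {poly F}) : \sum_(j < n) c j * r.[x j] = 0.
  under eq_bigr do rewrite horner_coef mulr_sumr.
  rewrite exchange_big/= big1// => m _.
  under eq_bigr do rewrite mulrCA.
  by rewrite -mulr_sumr h mulr0.
have := hq q; rewrite (bigD1 (Ordinal ni))//= big1 ?addr0 => [/eqP|j ji]; last first.
  have -> : q.[x j] = 0 by rewrite /q horner_prod (bigD1 j)//= !hornerE subrr mul0r.
  by rewrite mulr0.
rewrite mulf_eq0 => /orP[/eqP//|]; rewrite horner_prod prodf_seq_eq0 => /hasP[j _ /andP[ji]].
rewrite !hornerE subr_eq0 => /eqP /xi e; rewrite e ?inE ?ltn_ord ?eqxx// in ji.
Qed.

(** * A finite-dimensional block with prescribed spectral measure *)

Section cyclic_block.
Context {R : realType} {H : hilbertType R} (E : set H) (U : {linear H -> H}).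
Variables (n : nat) (b : nat -> H) (x : nat -> R[i]) (a : nat -> R).
Hypothesis sE : csubspace E.
Hypothesis Eb : forall i, (i < n)%N -> E (b i).
Hypothesis bb : forall i j, (i < n)%N -> (j < n)%N -> hdot (b i) (b j) = (i == j)%:R.
Hypothesis bE : forall h, E h -> (forall i, (i < n)%N -> hdot h (b i) = 0) -> h = 0.
Hypothesis Ub : forall i, (i < n)%N -> U (b i) = x i *: b i.
Hypothesis x1 : forall i, (i < n)%N -> `|x i| = 1.
Hypothesis xi : {in [pred i | (i < n)%N] &, injective x}.
Hypothesis a0 : forall i, (i < n)%N -> 0 < a i.

Let v := \sum_(i < n) (Num.sqrt (a i))%:C *: b i.

Lemma block_coord (c : nat -> R[i]) i : (i < n)%N -> hdot (\sum_(j < n) c j *: b j) (b i) = c i.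
Proof.
move=> ni; rewrite hdot_suml (bigD1 (Ordinal ni))//= big1 ?addr0 => [|j ji].
  by rewrite hdotZl bb// eqxx mulr1.
by rewrite hdotZl bb// (_ : (j == i :> nat) = false) ?mulr0//; apply: negbTE.
Qed.

Lemma block_expand h : E h -> h = \sum_(i < n) hdot h (b i) *: b i.
Proof.
move=> Eh; apply/eqP; rewrite -subr_eq0; apply/eqP; apply: bE.
  apply: (csubspaceB sE Eh); apply: (csubspace_sum _ sE) => i _.
  by apply: (csubspaceZ _ sE); exact: Eb.
by move=> i ni; rewrite hdotBl (block_coord (fun i => hdot h (b i)) ni) subrr.
Qed.

Lemma block_sum (c d : nat -> R[i]) :
  hdot (\sum_(i < n) c i *: b i) (\sum_(i < n) d i *: b i) = \sum_(i < n) c i * (d i)^*%C.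
Proof.
by rewrite hdot_sumr; apply: eq_bigr => i _; rewrite hdotZr block_coord// mulrC.
Qed.

Lemma block_U (c : nat -> R[i]) :
  U (\sum_(i < n) c i *: b i) = \sum_(i < n) (x i * c i) *: b i.
Proof.
rewrite linear_sum; apply: eq_bigr => i _.
by rewrite linearZ/= Ub// scalerA mulrC.
Qed.

Lemma xconj i : (i < n)%N -> x i * (x i)^*%C = 1.
Proof. by move=> ni; have := sqr_normc (x i); rewrite x1// expr1n. Qed.

Lemma block_unitary : unitary_onto E E U.
Proof.
split; last first.
  move=> g h Eg Eh; rewrite (block_expand Eg) (block_expand Eh).
  rewrite (block_U (fun i => hdot g (b i))) (block_U (fun i => hdot h (b i))).
  rewrite (block_sum (fun i => x i * hdot g (b i)) (fun i => x i * hdot h (b i))).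
  rewrite (block_sum (fun i => hdot g (b i)) (fun i => hdot h (b i))).
  by apply: eq_bigr => i _; rewrite rmorphM/= mulrACA xconj ?mul1r.
apply/seteqP; split => [_ [h Eh <-]|h Eh].
  rewrite (block_expand Eh) (block_U (fun i => hdot h (b i))).
  by apply: (csubspace_sum _ sE) => i _; apply: (csubspaceZ _ sE); exact: Eb.
exists (\sum_(i < n) ((x i)^*%C * hdot h (b i)) *: b i).
  by apply: (csubspace_sum _ sE) => i _; apply: (csubspaceZ _ sE); exact: Eb.
rewrite (block_U (fun i => (x i)^*%C * hdot h (b i))) [RHS](block_expand Eh).
by apply: eq_bigr => i _; rewrite mulrA xconj ?mul1r.
Qed.

Lemma block_v : E v.
Proof. by apply: (csubspace_sum _ sE) => i _; apply: (csubspaceZ _ sE); exact: Eb. Qed.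

Lemma block_zpower m : zpower E U m v = \sum_(i < n) (x i ^ m * (Num.sqrt (a i))%:C) *: b i.
Proof.
have := @zpower_uniq _ _ E U sE block_unitary
  (fun m => \sum_(i < n) (x i ^ m * (Num.sqrt (a i))%:C) *: b i).
rewrite /= => ->.
- by congr zpower; apply: eq_bigr => i _; rewrite expr0z mul1r.
- by move=> k; apply: (csubspace_sum _ sE) => i _; apply: (csubspaceZ _ sE); exact: Eb.
- move=> k; rewrite (block_U (fun i => x i ^ k * (Num.sqrt (a i))%:C)); apply: eq_bigr => i _.
  have x0 : x i != 0 by rewrite -normr_eq0 x1// oner_eq0.
  by rewrite mulrA expfzDr// expr1z [x i * _]mulrC.
Qed.

Lemma block_moment m : hdot (zpower E U m v) v = \sum_(i < n) (a i)%:C * x i ^ m.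
Proof.
rewrite block_zpower (block_sum (fun i => x i ^ m * (Num.sqrt (a i))%:C) (fun i => (Num.sqrt (a i))%:C)).
apply: eq_bigr => i _; rewrite conjc_real -mulrA -rmorphM/= -expr2 sqr_sqrtr 1?mulrC//.
by rewrite ltW// a0.
Qed.

(** Orthogonality to the nonnegative powers already gives vanishing power sums with distinct nodes
    [x i]; the coefficients vanish, and sqrt (a i) > 0 leaves no nonzero coordinate of [h]. *)
Lemma block_cyclic (c : R[i]) : c != 0 -> star_cyclic E U (c *: v).
Proof.
move=> c0; apply: csubspace_eqT => //.
- exact: csubspace_closed_span.
- apply: closed_span_sub => // _ [m _ <-].
  by apply: (zpower_in block_unitary); apply: (csubspaceZ _ sE); exact: block_v.
move=> h Eh ho; apply: bE => // i ni.
suff : (Num.sqrt (a i))%:C * (hdot h (b i))^*%C = 0.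
  move/eqP; rewrite mulf_eq0 (inj_eq (@complexI R) _ 0) sqrtr_eq0 leNgt a0//= => /eqP e.
  by rewrite -[LHS]conjcK e conjc0.
apply: (@power_sums_inj _ n x (fun i => (Num.sqrt (a i))%:C * (hdot h (b i))^*%C)) => // m.
have hz : hdot (zpower E U m v) h = 0.
  apply: hdot_eq0C; have : hdot h (zpower E U m (c *: v)) = 0.
    by apply: ho; apply: subset_closed_span; exists (Posz m).
  rewrite (zpowerZ sE block_unitary _ _ block_v) hdotZr => /eqP.
  by rewrite mulf_eq0 conjc_eq0 (negPf c0)/= => /eqP.
rewrite -[RHS]hz block_zpower [in RHS](block_expand Eh).
rewrite (block_sum (fun i => x i ^ m * (Num.sqrt (a i))%:C) (fun i => hdot h (b i))).
by apply: eq_bigr => j _; rewrite -exprnP mulrC mulrA.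
Qed.

End cyclic_block.

(** * A symmetric real orthogonal matrix with prescribed first row *)

Section householder.
Context {R : realType} (n : nat) (a : nat -> R).
Hypothesis n0 : (0 < n)%N.
Hypothesis a0 : 0 < a 0%N.
Hypothesis a1 : \sum_(i < n) a i ^+ 2 = 1.

(* The reflection exchanging the unit vector a and the first basis vector, up to sign. *)
Let u i := a i + (i == 0%N)%:R.
Definition householder i l : R := u i * u l / (1 + a 0%N) - (i == l)%:R.

Lemma householderC i l : householder i l = householder l i.
Proof. by rewrite /householder mulrC [l == i]eq_sym [u l * u i]mulrC mulrC. Qed.

Lemma householder0 l : householder 0 l = a l.
Proof.
rewrite /householder /u eqxx eq_sym; have h : 1 + a 0%N != 0 by rewrite gt_eqF// addr_gt0.
by rewrite (_ : true%:R = 1)//; move: (_%:R) => d; field.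
Qed.

Let sum_delta (f : nat -> R) i : (i < n)%N -> \sum_(l < n) (i == l :> nat)%:R * f l = f i.
Proof.
move=> ni; rewrite (bigD1 (Ordinal ni))//= big1 ?addr0 ?eqxx ?mul1r// => j ji.
by rewrite (_ : (i == j :> nat) = false) ?mul0r// eq_sym; apply: negbTE.
Qed.

(** The squared length of [u] is 2 (1 + a 0), so the matrix u u^T / (1 + a 0) - I is a symmetric
    involution. Adding the first basis vector instead of subtracting it keeps the denominator
    positive. *)
Lemma householder_sqr i j : (i < n)%N -> (j < n)%N ->
  \sum_(l < n) householder i l * householder l j = (i == j)%:R.
Proof.
move=> ni nj; pose s := 1 + a 0%N.
have s0 : s != 0 by rewrite gt_eqF// addr_gt0.
have uu : \sum_(l < n) u l * u l = s *+ 2.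
  transitivity (\sum_(l < n) (a l ^+ 2 + ((0 == l :> nat)%:R * (a l *+ 2) + (0 == l :> nat)%:R * 1))).
    apply: eq_bigr => l _; rewrite /u eq_sym; case: (0%N == l); rewrite /=; ring.
  rewrite !big_split/= a1 (sum_delta (fun l => a l *+ 2))// (sum_delta (fun=> 1))//.
  by rewrite /s; ring.
transitivity (\sum_(l < n) ((u i * u j / s ^+ 2) * (u l * u l) -
    ((j == l :> nat)%:R * (u i * u l / s) + (i == l :> nat)%:R * (u l * u j / s))
    + (i == l :> nat)%:R * (l == j :> nat)%:R)).
  by apply: eq_bigr => l _; rewrite /householder -/s [l == j :> nat]eq_sym; field.
rewrite big_split/= sumrB -mulr_sumr uu big_split/= (sum_delta (fun l => u i * u l / s))//.
rewrite (sum_delta (fun l => u l * u j / s))// (sum_delta (fun l => (l == j)%:R))//.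
by rewrite -[RHS]add0r; congr (_ + _); field.
Qed.

End householder.

(** * Orthonormal bases padded by zero vectors *)

Section padded_bases.
Context {R : realType} {H : hilbertType R} {I : choiceType}.
Implicit Types (V : pred I) (b : I -> H).

(* An orthonormal basis indexed by a subset V of I, extended by 0 to I. *)
Definition vonb V b : Prop :=
  (forall i j, hdot (b i) (b j) = ((i == j) && V i)%:R) /\
  forall h, (forall i, hdot h (b i) = 0) -> h = 0.

Lemma vonb_out V b i : vonb V b -> ~~ V i -> b i = 0.
Proof. by move=> [bo _] Vi; apply: hdotxx_eq0; rewrite bo eqxx (negPf Vi). Qed.

Lemma vonb_onb V b : vonb V b -> onb (fun i : {i | V i} => b (val i)).
Proof.
move=> vb; have [bo bt] := vb; split => [[i Vi] [j Vj]|h hb].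
  by rewrite bo/= Vi andbT.
apply: bt => i; have [Vi|Vi] := boolP (V i); first exact: (hb (exist _ i Vi)).
by rewrite (vonb_out vb Vi) hdot0r.
Qed.

Lemma onb_vonb V (e : {i | V i} -> H) : onb e ->
  vonb V (fun i => if insub i is Some j then e j else 0).
Proof.
move=> [bo bt]; split => [i j|h hb].
  case: insubP => [u Vi <-|/negPf ->]; last by rewrite hdot0l andbF.
  case: insubP => [v Vj <-|/negPf Vj]; first by rewrite bo (valP u) andbT.
  rewrite hdot0r; case: eqP => //= uj; by rewrite uj Vj.
apply: bt => i; have := hb (val i); by rewrite valK.
Qed.

Variables (V : pred I) (b : I -> H).
Hypothesis vb : vonb V b.

Lemma vonb_nm1 i : V i -> nm (b i) = 1.
Proof.
move=> Vi; apply/eqP; rewrite -(@eqrXn2 _ 2)// ?nm_ge0// expr1n.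
by rewrite -(inj_eq (@complexI R)) -hdotxx vb.1 eqxx Vi.
Qed.

Lemma vonb_sub c D : diag_op b c D ->
  diag_op (fun i : {i | V i} => b (val i)) (fun i => c (val i)) D.
Proof. by move=> [bd e]; split => // x i; rewrite e. Qed.

Lemma sub_vonb c D :
  diag_op (fun i : {i | V i} => b (val i)) (fun i => c (val i)) D -> diag_op b c D.
Proof.
move=> [bd e]; split => // x i; have [Vi|Vi] := boolP (V i).
  exact: (e x (exist _ i Vi)).
by rewrite (vonb_out vb Vi) !hdot0r mulr0.
Qed.

Lemma vonb_supp_closed_span (S : set I) x : (forall i, ~ S i -> hdot x (b i) = 0) ->
  closed_span (b @` S) x.
Proof.
move=> xS; have := @supp_closed_span _ _ _ _ (vonb_onb vb) [set i | S (val i)] x.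
move=> h; apply: (closed_span_sub (csubspace_closed_span _)) (h _) => [|i]; last exact: xS.
by move=> _ [i Si <-]; apply: subset_closed_span; exists (val i).
Qed.

Lemma vonb_supp_orth x y : (forall i, hdot x (b i) = 0 \/ hdot y (b i) = 0) -> hdot x y = 0.
Proof. by move=> h; apply: (supp_orth (vonb_onb vb)) => i; exact: h. Qed.

Lemma vonb_ext x y : (forall i, hdot x (b i) = hdot y (b i)) -> x = y.
Proof. by move=> h; apply: (onb_ext (vonb_onb vb)) => i; exact: h. Qed.

Lemma vonb_diag_basis c D i : diag_op b c D -> D (b i) = c i *: b i.
Proof.
move=> Dc; have [Vi|Vi] := boolP (V i).
  exact: (diag_basis (vonb_onb vb) (exist _ i Vi) (vonb_sub Dc)).
rewrite (vonb_out vb Vi) scaler0; apply: vonb_ext => j.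
by rewrite Dc.2 hdot0l mulr0.
Qed.

Lemma vonb_eigspace c D l : diag_op b c D ->
  eigspace D l = [set x | forall i, c i != l -> hdot x (b i) = 0].
Proof.
move=> Dc; rewrite (diag_eigspace (vonb_onb vb) l (vonb_sub Dc)); apply/seteqP; split => x /= h.
  move=> i il; have [Vi|Vi] := boolP (V i); first exact: (h (exist _ i Vi)).
  by rewrite (vonb_out vb Vi) hdot0r.
by move=> i; exact: h.
Qed.

Lemma diag_of_eigen (r : I -> R) (D : H -> H) (M : R) : (forall x, nm (D x) <= M * nm x) ->
  self_adjoint D -> (forall i, D (b i) = (r i)%:C *: b i) -> diag_op b (fun i => (r i)%:C) D.
Proof.
move=> DM Da Db; split; first by exists M.
by move=> x i; rewrite Da Db hdotZr conjc_real.
Qed.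

End padded_bases.

(** * Rotating the blocks of a basis *)

Section block_rotation.
Context {R : realType} {H : hilbertType R}.
Local Notation I := (bool * nat * nat)%type.
Variables (s : bool) (N : nat -> nat) (O : nat -> nat -> nat -> R).
Variables (Q : pred nat) (V : pred I) (b : I -> H).
Hypothesis VQ : forall k i, V (s, k, i) = Q k && (i < N k)%N.
Hypothesis OC : forall k i l, O k i l = O k l i.
Hypothesis OO : forall k i j, Q k -> (i < N k)%N -> (j < N k)%N ->
  \sum_(l < N k) O k i l * O k l j = (i == j)%:R.
Hypothesis vb : vonb V b.

(** Only indices with first component [s] are rotated, so that the same lemmas serve the blocks of
    phi (s = true) and those of phi_1 (s = false). *)
Definition brot (x : I) : H :=
  if x.1.1 == s then
    if (x.2 < N x.1.2)%N then \sum_(l < N x.1.2) (O x.1.2 x.2 l)%:C *: b (s, x.1.2, l : nat)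
    else 0
  else b x.

Let rotE k i : (i < N k)%N -> brot (s, k, i) = \sum_(l < N k) (O k i l)%:C *: b (s, k, l : nat).
Proof. by move=> iN; rewrite /brot/= eqxx iN. Qed.

Let rot_out k i : (N k <= i)%N -> brot (s, k, i) = 0.
Proof. by move=> iN; rewrite /brot/= eqxx ltnNge iN. Qed.

Let rotN t k i : t != s -> brot (t, k, i) = b (t, k, i).
Proof. by rewrite /brot/= => /negPf ->. Qed.

Let rot_coord k i l : (i < N k)%N -> (l < N k)%N ->
  hdot (brot (s, k, i)) (b (s, k, l)) = (Q k)%:R * (O k i l)%:C.
Proof.
move=> iN lN; rewrite rotE// hdot_suml (bigD1 (Ordinal lN))//= big1 ?addr0 => [|j jl].
  by rewrite hdotZl vb.1 eqxx/= VQ lN andbT mulrC.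
rewrite hdotZl vb.1 (_ : (_ == _) = false) ?mulr0//.
by apply/negbTE; apply: contra jl => /eqP[e]; apply/eqP/val_inj.
Qed.

Lemma rot_inv k l : Q k -> (l < N k)%N ->
  b (s, k, l) = \sum_(i < N k) (O k l i)%:C *: brot (s, k, i : nat).
Proof.
move=> Qk lN.
under eq_bigr => i _ do rewrite rotE// scaler_sumr.
rewrite exchange_big/=.
under eq_bigr => j _ do under eq_bigr => i _ do rewrite scalerA -rmorphM/=.
under eq_bigr => j _ do rewrite -scaler_suml -rmorph_sum/= OO//.
rewrite (bigD1 (Ordinal lN))//= big1 ?addr0 ?eqxx ?scale1r// => j jl.
rewrite (_ : (l == j :> nat) = false) ?scale0r// eq_sym.
by apply/negbTE; apply: contra jl => /eqP e; apply/eqP/val_inj.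
Qed.

Let rot_out_Q k i : ~~ Q k -> brot (s, k, i) = 0.
Proof.
move=> Qk; have [iN|iN] := ltnP i (N k); last exact: rot_out.
rewrite rotE// big1// => l _; rewrite (vonb_out vb) ?scaler0//.
by rewrite VQ (negPf Qk).
Qed.

Lemma rot_vonb : vonb V brot.
Proof.
split=> [[[t k] i] [[t' k'] i']|h hb]; last first.
  apply: vb.2 => -[[t k] i]; have [->|ts] := eqVneq t s; last by rewrite -rotN.
  have [Vi|Vi] := boolP (V (s, k, i)); last by rewrite (vonb_out vb Vi) hdot0r.
  move: Vi; rewrite VQ => /andP[Qk iN]; rewrite rot_inv// hdot_sumr big1// => l _.
  by rewrite hdotZr hb mulr0.
have nsE u v a c : u != s -> hdot (brot (s, k, a)) (b (u, v, c)) = 0.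
  move=> us; have [aN|aN] := ltnP a (N k); last by rewrite rot_out// hdot0l.
  rewrite rotE// hdot_suml big1// => l _; rewrite hdotZl vb.1 (_ : (_ == _) = false) ?mulr0//.
  by apply/negbTE; apply: contra us => /eqP[->].
have nsE' u v a c k0 : u != s -> hdot (b (u, v, c)) (brot (s, k0, a)) = 0.
  move=> us; have [aN|aN] := ltnP a (N k0); last by rewrite rot_out// hdot0r.
  rewrite rotE// hdot_sumr big1// => l _; rewrite hdotZr vb.1 (_ : (_ == _) = false) ?mulr0//.
  by apply/negbTE; apply: contra us => /eqP[->].
have [->|ts] := eqVneq t s; last first.
  rewrite (rotN _ _ ts); have [->|ts'] := eqVneq t' s; last by rewrite rotN// vb.1.
  by rewrite nsE'// (_ : (_ == _) = false)//; apply/negbTE; apply: contra ts => /eqP[->].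
have [->|ts'] := eqVneq t' s; last first.
  rewrite (rotN _ _ ts') nsE// (_ : (_ == _) = false)//.
  by apply/negbTE; apply: contra ts' => /eqP[->].
rewrite VQ.
have [Qk|Qk] := boolP (Q k); last by rewrite (rot_out_Q i Qk) hdot0l !andbF.
have [iN|iN] := ltnP i (N k); last by rewrite rot_out// hdot0l !andbF.
rewrite !andbT.
have [iN'|iN'] := ltnP i' (N k'); last first.
  rewrite [brot (s, k', i')]rot_out// hdot0r; case: eqP => // -[kk ii].
  by move: iN'; rewrite -kk -ii leqNgt iN.
rewrite [brot (s, k', i')]rotE// hdot_sumr.
have [kk|kk] := eqVneq k k'; last first.
  rewrite (_ : (_ == _) = false); last by apply/negbTE; apply: contra kk => /eqP[-> _].
  rewrite big1// => l _; rewrite hdotZr rotE// hdot_suml big1 ?mulr0// => j _.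
  rewrite hdotZl vb.1 (_ : (_ == _) = false) ?mulr0//.
  by apply/negbTE; apply: contra kk => /eqP[kk' _]; apply/eqP.
rewrite -kk in iN' *.
under eq_bigr => l _ do rewrite hdotZr rot_coord// Qk mul1r conjc_real -rmorphM/= mulrC (OC k i' l).
rewrite -rmorph_sum/= OO//.
by rewrite (_ : ((s, k, i) == (s, k, i')) = (i == i')) ?rmorph_nat// xpair_eqE eqxx.
Qed.

End block_rotation.

(** * Positive roots of the secular equation *)

Section weight_gap.
Context {R : realType} (len : option nat) (L M : nat -> R).
Hypothesis LM : interlaced len L M.
Hypothesis r0 : in_range len 0.
Local Notation w := (weight len L M).

(** Above all poles the sum is nonpositive. Otherwise let [L j] be the smallest pole above z. No
    pole separates z from [M j], so (L k - z) (L k - M j) > 0 for all k, and the difference of the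
    equations at z and at [M j] is z - M j times a positive sum. *)
Lemma weight_secular_root z : 0 < z -> (forall k, in_range len k -> L k != z) ->
  summ (fun k => w k / (L k - z)) -> sumR (fun k => w k / (L k - z)) = 1 ->
  exists2 j, in_range len j & z = M j.
Proof.
move=> z0 Lz sz ez.
have [Lz0|zL0] := ltP (L 0) z.
  have := @summ_le _ (fun k => w k / (L k - z)) (fun=> 0) sz summ0.1 _; rewrite ez summ0.2.
  move=> h; suff : (1 : R) <= 0 by rewrite ler10.
  apply: h => k; have [kr|kr] := boolP (in_range len k); last by rewrite weight_nrange// mul0r.
  rewrite mulr_ge0_le0 ?weight_ge0// invr_le0 subr_le0 ltW//.
  exact: le_lt_trans (L_le0 LM kr) Lz0.
have zL : z < L 0 by rewrite lt_neqAle zL0 andbT eq_sym Lz.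
pose P k := in_range len k && (z < L k).
have [B hB] : exists B, forall k, P k -> (k <= B)%N.
  have [_ _ _ _ /(_ z z0)[N hN]] := LM; exists N => k /andP[kr zk].
  by rewrite leqNgt; apply/negP => Nk; have := hN k (ltnW Nk) kr; rewrite ltNge (ltW zk).
have exP : exists k, P k by exists 0%N; rewrite /P r0.
have [j /andP[jr zj] jmax] := ex_maxnP exP hB.
exists j => //; have [sM eM] := (weight_sum_eq LM jr, I).
have [C C0 hC] := interlaced_inv_bound LM jr.
have sMj : summ (fun k => w k / (L k - M j)).
  have [s' _] := summZ C (weight_summ LM r0); apply: summ_dom s' _ => k.
  have [kr|kr] := boolP (in_range len k); last by rewrite weight_nrange// mul0r normr0 mulr0.
  rewrite normrM ger0_norm ?weight_ge0// mulrC ler_wpM2r ?weight_ge0//; exact: hC.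
pose t k := w k / ((L k - z) * (L k - M j)).
have prod_gt0 k : in_range len k -> 0 < (L k - z) * (L k - M j).
  move=> kr; have [h1 h2 _ _ _] := LM; have [jk|kj] := ltnP j k.
    rewrite nmulr_rgt0 subr_lt0; first exact: h2.
    have : ~~ P k by apply/negP => /jmax; rewrite leqNgt jk.
    by rewrite /P kr/= -leNgt => Lkz; rewrite lt_neqAle Lz.
  have Lkj : L j <= L k.
    move: kj; rewrite leq_eqVlt => /orP[/eqP ->//|kj]; exact/ltW/(interlaced_L LM).
  by rewrite mulr_gt0// subr_gt0; [exact: lt_le_trans zj Lkj|exact: lt_le_trans (h1 _ jr) Lkj].
have t_ge0 k : 0 <= t k.
  have [kr|kr] := boolP (in_range len k); last by rewrite /t weight_nrange// mul0r.
  by rewrite divr_ge0 ?weight_ge0// ltW// prod_gt0.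
apply/eqP; apply: contraT; rewrite -subr_eq0 => zM.
have [] := summP (-1) sMj sz; rewrite ez sM.
have -> : (fun k => -1 * (w k / (L k - M j)) + w k / (L k - z)) = (fun k => (z - M j) * t k).
  apply/funext => k; have [kr|kr] := boolP (in_range len k); last first.
    by rewrite /t weight_nrange// !mul0r !mulr0 addr0.
  have h1 : L k - z != 0 by rewrite subr_eq0 Lz.
  have h2 := interlaced_LM_neq LM jr kr.
  rewrite /t; field.
  by rewrite h1 andbT.
move=> st et.
have [s' e'] := summZ (z - M j)^-1 st.
have E : (fun k => (z - M j)^-1 * ((z - M j) * t k)) = t by apply/funext => k; rewrite mulKf.
rewrite E in s' e'; have := summ_ge_partial 1 t_ge0 s'.
rewrite e' et mulN1r addNr mulr0 big_nat1 => h.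
have : 0 < t 0 by rewrite divr_gt0 ?weight_gt0 ?prod_gt0.
by rewrite ltNge h.
Qed.

End weight_gap.

(** * The operator R^2 - p p^* on the span of the h_k *)

Section scalar_model.
Context {R : realType} {H : hilbertType R} (len : option nat) (h : nat -> H).
Hypothesis hh : forall j k, hdot (h j) (h k) = ((j == k) && in_range len j)%:R.
Local Notation X0 := (closed_span (range h)).

Let sX0 : csubspace X0. Proof. exact: csubspace_closed_span. Qed.

Let X0h k : X0 (h k). Proof. by apply: subset_closed_span; exists k. Qed.

Let h_out k : ~~ in_range len k -> h k = 0.
Proof. by move=> kr; apply: hdotxx_eq0; rewrite hh (negPf kr) andbF. Qed.

Let h_orth j k : j <> k -> hdot (h j) (h k) = 0.
Proof. by move=> /eqP/negPf jk; rewrite hh jk. Qed.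

Let nm_h k : nm (h k) ^+ 2 = (in_range len k)%:R.
Proof.
apply: (@complexI R); rewrite -hdotxx hh eqxx/=.
by case: in_range.
Qed.

Lemma h_ext x y : X0 x -> X0 y -> (forall k, in_range len k -> hdot x (h k) = hdot y (h k)) -> x = y.
Proof.
move=> Xx Xy xy; apply/eqP; rewrite -subr_eq0; apply/eqP.
apply: (orthocompl_self (csubspaceB sX0 Xx Xy)).
apply: orthocompl_closed_span => _ [k _ <-]; rewrite hdotBl.
have [kr|kr] := boolP (in_range len k); first by rewrite xy// subrr.
by rewrite (h_out kr) !hdot0r subrr.
Qed.

Lemma h_parseval x y (a b : nat -> R) : X0 x ->
  (forall k, in_range len k -> hdot x (h k) = (a k)%:C) ->
  (forall k, in_range len k -> hdot y (h k) = (b k)%:C) ->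
  (forall k, ~~ in_range len k -> a k = 0) ->
  summ (fun k => a k * b k) /\ hdot x y = (sumR (fun k => a k * b k))%:C.
Proof.
move=> Xx xa yb a0.
have xa' k : hdot x (h k) = (a k)%:C.
  have [kr|kr] := boolP (in_range len k); first exact: xa.
  by rewrite (h_out kr) hdot0r a0.
pose b' k := if in_range len k then b k else 0.
have yb' k : hdot (h k) y = (b' k)%:C.
  rewrite /b'; case: ifPn => kr; first by rewrite hdotC yb// conjc_real.
  by rewrite (h_out kr) hdot0l.
have im0 : complex.Im (hdot x y) = 0.
  apply/eqP; rewrite -normr_le0; apply/ler_addgt0Pr => e e0; rewrite add0r.
  have n0 : 0 < nm y + 1 by rewrite ltr_wpDl ?nm_ge0.
  have [N0 hN] := orth_expansion h_orth Xx (divr_gt0 e0 n0).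
  have := hN N0 (leqnn _); set s := \sum_(0 <= k < N0) _; rewrite ltr_pdivlMr// => xs.
  have -> : complex.Im (hdot x y) = complex.Im (hdot (x - s) y).
    rewrite hdotBl hdot_suml.
    have -> : \sum_(0 <= k < N0) hdot ((hdot x (h k) / (nm (h k) ^+ 2)%:C) *: h k) y =
        (\sum_(0 <= k < N0) a k / nm (h k) ^+ 2 * b' k)%:C.
      rewrite rmorph_sum; apply: eq_bigr => k _.
      by rewrite hdotZl xa' yb' -fmorphV -!rmorphM.
    by case: (hdot x y) => u v /=; rewrite oppr0 addr0.
  have [_ h1 _] := cabs_ReIm (hdot (x - s) y); apply: le_trans h1 _.
  apply: le_trans (cauchy_schwarzR _ _) _; apply: le_trans (ltW xs).
  by rewrite ler_wpM2l ?nm_ge0// lerDl.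
have xy : hdot x y = (complex.Re (hdot x y))%:C.
  by case: (hdot x y) im0 => u v /= ->.
have [s e] := parseval h_orth Xx xa' yb' xy.
have E : (fun k => a k * b' k / nm (h k) ^+ 2) = (fun k => a k * b k).
  apply/funext => k; rewrite nm_h /b'; case: ifPn => kr; first by rewrite divr1.
  by rewrite a0// !mul0r.
by rewrite E in s e; rewrite xy -e.
Qed.

(** The Riesz-Fischer theorem for real coefficients. *)
Lemma h_vector (u : nat -> R) (B : R) : (forall N, \sum_(0 <= k < N) u k ^+ 2 <= B) ->
  exists2 x, X0 x & forall k, in_range len k -> hdot x (h k) = (u k)%:C.
Proof.
move=> uB; pose S N := \sum_(0 <= k < N) (u k)%:C *: h k.
have [su eu] := @summ_bounded _ (fun k => u k ^+ 2) B (fun k => sqr_ge0 _) uB.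
have S_tail m d : nm (S (m + d)%N - S m) ^+ 2 <= \sum_(m <= k < m + d) u k ^+ 2.
  elim: d => [|d IH]; first by rewrite addn0 subrr nm0 expr0n big_geq.
  rewrite addnS big_nat_recr ?leq_addr//= {1}/S big_nat_recr//= -/(S _) addrAC.
  rewrite pythagoras; last first.
    rewrite hdotZr hdotBl !hdot_suml !big_nat !big1 ?subrr ?mulr0// => k /andP[_ kd].
      rewrite hdotZl h_orth ?mulr0// => e; rewrite e in kd.
      by move: kd; rewrite ltnNge leq_addr.
    by rewrite hdotZl h_orth ?mulr0// => e; rewrite e ltnn in kd.
  rewrite lerD// nmZ exprMn nm_h.
  have -> : complex.Re `|(u (m + d)%N)%:C| ^+ 2 = u (m + d)%N ^+ 2.
    by rewrite normc_def/= expr0n/= addr0 sqrtr_sqr real_normK// num_real.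
  by rewrite ler_piMr ?sqr_ge0//; case: in_range.
have S_cauchy (e : R) : 0 < e -> exists N, forall m d, (N <= m)%N -> nm (S (m + d)%N - S m) < e.
  move=> e0; have e2 : 0 < e ^+ 2 by rewrite exprn_gt0.
  have /cvgrPdist_lt/(_ _ e2)[N _ hN] : series (fun k => u k ^+ 2) @ \oo --> sumR (fun k => u k ^+ 2).
    exact: su.
  exists N => m d Nm; rewrite -(@ltr_pXn2r _ 2) ?nnegrE ?nm_ge0 ?(ltW e0)//.
  apply: le_lt_trans (S_tail m d) _; have := hN m Nm; rewrite /= /series/=; apply: le_lt_trans.
  apply: le_trans (ler_norm _); rewrite lerBrDl.
  have := summ_ge_partial (m + d) (fun k => sqr_ge0 (u k)) su.
  by rewrite (big_cat_nat (n := m))//= leq_addr.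
have [x hx] : exists x, forall e : R, 0 < e -> exists N, forall n, (N <= n)%N -> nm (x - S n) < e.
  apply: hilbert_complete => e e0; have e2 : 0 < e / 2 by rewrite divr_gt0.
  have [N hN] := S_cauchy _ e2; exists N => m n Nm Nn.
  have [mn|nm'] := leqP m n.
    rewrite nmB -(subnKC mn); apply: lt_trans (hN _ _ Nm) _; lra.
  rewrite -(subnKC (ltnW nm')); apply: lt_trans (hN _ _ Nn) _; lra.
exists x.
  apply: (csubspace_closed sX0) => e /hx[N hN]; exists (S N); last exact: hN.
  by apply: (csubspace_sum _ sX0) => k _; apply: (csubspaceZ _ sX0); exact: X0h.
move=> k kr; apply/eqP; rewrite -subr_eq0; apply/eqP; apply: cabs_le0.
apply/ler_addgt0Pr => e e0; rewrite add0r.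
have [N hN] := hx _ e0.
have -> : hdot x (h k) - (u k)%:C = hdot (x - S (maxn N k.+1)) (h k).
  rewrite hdotBl; congr (_ - _); rewrite hdot_suml.
  rewrite (bigD1_seq k) ?mem_index_iota ?iota_uniq ?leq_maxr//= big1 ?addr0; last first.
    by move=> i ik; rewrite hdotZl hh (negPf ik) mulr0.
  by rewrite hdotZl hh eqxx kr mulr1.
apply: le_trans (cauchy_schwarzR _ _) _.
have -> : nm (h k) = 1.
  by apply/eqP; rewrite -(@eqrXn2 _ 2)// ?nm_ge0// nm_h kr expr1n.
by rewrite mulr1 ltW// hN// leq_maxl.
Qed.

Variables (L L1 : nat -> R).
Hypothesis LM : interlaced len L L1.
Hypothesis r0 : in_range len 0.
Local Notation w := (weight len L L1).
Variables (T : {linear H -> H}) (r : nat -> R) (p : H).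
Hypothesis Ta : self_adjoint T.
Hypothesis Tb : exists c, forall x, nm (T x) <= c * nm x.
Hypothesis Th : forall k, in_range len k -> T (h k) = (r k)%:C *: h k.
Hypothesis rL : forall k, in_range len k -> r k ^+ 2 = L k.
Hypothesis Xp : X0 p.
Hypothesis ph : forall k, in_range len k -> hdot p (h k) = (Num.sqrt (w k))%:C.

Let sqw k : Num.sqrt (w k) * Num.sqrt (w k) = w k.
Proof. by rewrite -expr2 sqr_sqrtr// weight_ge0. Qed.

Let sw0 k : ~~ in_range len k -> Num.sqrt (w k) = 0.
Proof. by move=> kr; rewrite weight_nrange// sqrtr0. Qed.

Let L0 k : in_range len k -> L k != 0.
Proof. by have [_ _ h3 _ _] := LM; move=> kr; rewrite gt_eqF ?h3. Qed.

Let Th2 k : in_range len k -> T (T (h k)) = (L k)%:C *: h k.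
Proof. by move=> kr; rewrite Th// linearZ/= Th// scalerA -rmorphM -expr2 rL. Qed.

(** Formally p = T q with |q|^2 = sum_k w_k / L k <= 1, whence |<x, p>| = |<T x, q>| <= |T x|. The
    proof uses truncations, with [T y] in the role of q. This is what makes R^2 - p p^* positive. *)
Lemma rank1_le x : complex.Re `|hdot x p| <= nm (T x).
Proof.
apply/ler_addgt0Pr => e e0.
have n0 : 0 < nm x + 1 by rewrite ltr_wpDl ?nm_ge0.
have [N /(_ N (leqnn _))] := orth_expansion h_orth Xp (divr_gt0 e0 n0).
set s := \sum_(0 <= k < N) _; rewrite ltr_pdivlMr// => ps.
pose y := \sum_(0 <= k < N) (Num.sqrt (w k) / L k)%:C *: h k.
have TTy : T (T y) = s.
  rewrite /y !linear_sum; apply: eq_bigr => k _.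
  have [kr|kr] := boolP (in_range len k); last by rewrite (h_out kr) !scaler0 !linear0.
  have e1 a : T (T (a *: h k)) = a *: T (T (h k)) by rewrite !linearZ.
  rewrite [LHS]e1 Th2// scalerA -rmorphM/= divfK ?L0// ph// nm_h kr.
  by rewrite divr1.
have nTy : nm (T y) <= 1.
  rewrite -(@ler_pXn2r _ 2) ?nnegrE ?nm_ge0// expr1n -lecR -hdotxx.
  rewrite [hdot _ _]Ta TTy {1}/y hdot_suml.
  have -> : \sum_(0 <= k < N) hdot ((Num.sqrt (w k) / L k)%:C *: h k) s =
      (\sum_(0 <= k < N) w k / L k)%:C.
    rewrite rmorph_sum big_nat [RHS]big_nat; apply: eq_bigr => k /andP[_ kN].
    have [kr|kr] := boolP (in_range len k); last first.
      by rewrite weight_nrange// mul0r sqrtr0 mul0r scale0r hdot0l.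
    rewrite hdotZl hdot_sumr (bigD1_seq k) ?mem_index_iota ?iota_uniq//= big1 ?addr0; last first.
      by move=> i ik; rewrite hdotZr h_orth ?mulr0// => e1; rewrite e1 eqxx in ik.
    rewrite hdotZr hdotxx nm_h kr ph// divr1 conjc_real mulr1 -rmorphM/=.
    by rewrite mulrAC sqw.
  by rewrite lecR weight_sum_le.
have -> : hdot x p = hdot (T x) (T y) + hdot x (p - s).
  by rewrite Ta TTy hdotBr addrC subrK.
have h1 : complex.Re `|hdot (T x) (T y) + hdot x (p - s)| <=
    complex.Re `|hdot (T x) (T y)| + complex.Re `|hdot x (p - s)|.
  rewrite -lecR rmorphD/= -!cabsE; exact: ler_normD.
apply: le_trans h1 _; apply: lerD.
  apply: le_trans (cauchy_schwarzR _ _) _; rewrite -[leRHS]mulr1.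
  by rewrite ler_wpM2l ?nm_ge0.
apply: le_trans (cauchy_schwarzR _ _) _; apply: le_trans (ltW ps).
by rewrite mulrC ler_wpM2l ?nm_ge0// lerDl.
Qed.

Variable S : {linear H -> H}.
Hypothesis SE : forall x, S x = T (T x) - hdot x p *: p.
Hypothesis Sc : compact_operator S.

Lemma rank1_self_adjoint : self_adjoint S.
Proof.
move=> x y; rewrite !SE hdotBl hdotBr hdotZl hdotZr -hdotC mulrC.
by congr (_ - _); rewrite Ta Ta.
Qed.

Lemma rank1_psd : psd S.
Proof.
move=> x; rewrite SE hdotBl hdotZl [hdot (T _) _]Ta hdotxx (hdotC p).
have -> : hdot x p * (hdot x p)^*%C = (complex.Re `|hdot x p| ^+ 2)%:C.
  by rewrite -sqr_normc {1}cabsE rmorphXn.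
rewrite -rmorphB/= ler0c subr_ge0 ler_pXn2r ?nnegrE ?nm_ge0 ?cabs_ge0//.
exact: rank1_le.
Qed.

Lemma X0_T x : X0 x -> X0 (T x).
Proof.
have [c Tc] := Tb; move: x; apply: closed_span_sub.
  by apply: (csubspace_preim sX0) Tc => a x y; rewrite linearP.
move=> _ [k _ <-]; have [kr|kr] := boolP (in_range len k).
  by rewrite /= Th//; apply: (csubspaceZ _ sX0); exact: X0h.
by rewrite /= (h_out kr) linear0; exact: (csubspace0 sX0).
Qed.

Lemma X0_S x : X0 x -> X0 (S x).
Proof.
move=> Xx; rewrite SE; apply: (csubspaceB sX0); first by do 2!apply: X0_T.
exact: (csubspaceZ _ sX0).
Qed.

Let S_coord x k : in_range len k ->
  hdot (S x) (h k) = (L k)%:C * hdot x (h k) - hdot x p * (Num.sqrt (w k))%:C.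
Proof.
by move=> kr; rewrite SE hdotBl hdotZl ph// Ta Ta Th2// hdotZr conjc_real.
Qed.

(** At coordinate k the eigenvalue equation is (L k - L1 j) x_k = <x, p> sqrt (w k). Normalized by
    <x, p> = 1 it prescribes the coordinates, and the normalization itself is the secular equation
    at [L1 j]. *)
Lemma secular_vector j : in_range len j -> exists x, [/\ X0 x,
  forall k, in_range len k -> hdot x (h k) = (Num.sqrt (w k) / (L k - L1 j))%:C,
  hdot x p = 1 & S x = (L1 j)%:C *: x].
Proof.
move=> jr; have [C C0 hC] := interlaced_inv_bound LM jr.
have [|x Xx xh] := @h_vector (fun k => Num.sqrt (w k) / (L k - L1 j)) (C ^+ 2 * sumR w).
  move=> N; apply: (@le_trans _ _ (C ^+ 2 * \sum_(0 <= k < N) w k)); last first.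
    by rewrite ler_wpM2l ?sqr_ge0// summ_ge_partial//; [exact: weight_ge0|exact: weight_summ].
  rewrite mulr_sumr; apply: ler_sum => k _.
  have [kr|kr] := boolP (in_range len k); last first.
    by rewrite sw0// weight_nrange// mul0r expr0n mulr0.
  rewrite exprMn expr2 sqw mulrC ler_wpM2r ?weight_ge0//.
  by rewrite -real_normK ?num_real// ler_pXn2r ?nnegrE ?normr_ge0 ?(ltW C0)// hC.
have xp : hdot x p = 1.
  have [|_ ->] := h_parseval Xx xh ph; first by move=> k kr; rewrite sw0// mul0r.
  rewrite -[RHS]/(1%:C); congr (_%:C); rewrite -(weight_sum_eq LM jr); congr sumR.
  by apply/funext => k; rewrite mulrAC sqw.
exists x; split => //; apply: h_ext; first exact: X0_S.
  exact: (csubspaceZ _ sX0).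
move=> k kr; rewrite S_coord// xp mul1r hdotZl xh// -!rmorphM/= -rmorphB/=; congr (_%:C).
have n0 := interlaced_LM_neq LM jr kr; field.
by rewrite n0.
Qed.

Lemma X0_S_ker x : X0 x -> S x = 0 -> hdot x p = 0 -> x = 0.
Proof.
move=> Xx Sx xp; apply: (h_ext Xx (csubspace0 sX0)) => k kr; rewrite hdot0l.
have := S_coord x kr; rewrite Sx hdot0l xp mul0r subr0 => /esym/eqP.
by rewrite mulf_eq0 (inj_eq (@complexI R) _ 0) (negPf (L0 kr)) => /eqP.
Qed.

(** Otherwise [S] has an eigenvector y in [X0], for some l > 0, orthogonal to all [f j]. If <y, p> =
    0, then y is a multiple of some [h k], which is not orthogonal to p. If not, y / <y, p> has
    secular coordinates at l, so l is some [L1 j] and y a multiple of [f j]. *)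
Lemma secular_complete (f : nat -> H) x :
  (forall j, in_range len j -> 0 < L1 j -> [/\ X0 (f j),
    forall k, in_range len k -> hdot (f j) (h k) = (Num.sqrt (w k) / (L k - L1 j))%:C,
    hdot (f j) p = 1 & S (f j) = (L1 j)%:C *: f j]) ->
  X0 x -> (forall j, in_range len j -> 0 < L1 j -> hdot x (f j) = 0) -> S x = 0.
Proof.
move=> hf Xx xf; apply/eqP; apply: contraT => Sx0.
pose E := X0 `&` orthocompl [set f j | j in [set j | in_range len j /\ 0 < L1 j]].
have sE : csubspace E by apply: csubspaceI sX0 _; exact: csubspace_orthocompl.
have [||y [l [[Xy yf] y0 l0 Sy]]] :=
  compact_psd_eigenvector Sc rank1_self_adjoint rank1_psd sE.
- move=> z [Xz zf]; split; first exact: X0_S.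
  move=> _ [j [jr j0] <-]; have [_ _ _ e] := hf j jr j0.
  by rewrite rank1_self_adjoint e hdotZr zf ?mulr0//; exists j.
- by exists x => //; split => // _ [j [jr j0] <-]; exact: xf.
have yk k : in_range len k -> (L k - l)%:C * hdot y (h k) = hdot y p * (Num.sqrt (w k))%:C.
  move=> kr; have := S_coord y kr; rewrite Sy hdotZl rmorphB/= mulrBl => ->.
  by rewrite opprB addrC subrK.
have sw_neq0 k : in_range len k -> (Num.sqrt (w k))%:C != 0.
  by move=> kr; rewrite (inj_eq (@complexI R) _ 0) sqrtr_eq0 -ltNge weight_gt0.
have yp0 : hdot y p != 0.
  apply/eqP => yp0; have [k [kr yk0]] : exists k, in_range len k /\ hdot y (h k) != 0.
    apply: contrapT => nk; move/eqP: y0; apply; apply: (h_ext Xy (csubspace0 sX0)) => k kr.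
    by rewrite hdot0l; apply/eqP; apply: contraT => ?; exfalso; apply: nk; exists k.
  have lk : L k = l.
    have := yk k kr; rewrite yp0 mul0r => /eqP; rewrite mulf_eq0 (negPf yk0) orbF.
    by rewrite (inj_eq (@complexI R) _ 0) subr_eq0 => /eqP.
  have ye : y = hdot y (h k) *: h k.
    apply: (h_ext Xy); first by apply: (csubspaceZ _ sX0); exact: X0h.
    move=> i ir; rewrite hdotZl hh kr andbT.
    have [<-|ki] := eqVneq k i; first by rewrite mulr1.
    have := yk i ir; rewrite yp0 mul0r mulr0 => /eqP; rewrite mulf_eq0 => /orP[|/eqP//].
    rewrite (inj_eq (@complexI R) _ 0) subr_eq0 -lk => /eqP /(interlaced_L_inj LM ir kr) e.
    by rewrite e eqxx in ki.
  move: yp0; rewrite ye hdotZl (hdotC _ p) ph// conjc_real => /eqP.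
  by rewrite mulf_eq0 (negPf yk0) (negPf (sw_neq0 _ kr)).
have Ll k : in_range len k -> L k != l.
  move=> kr; apply/eqP => e; have := yk k kr.
  rewrite e subrr mul0r => /esym/eqP.
  by rewrite mulf_eq0 (negPf yp0) (negPf (sw_neq0 _ kr)).
pose c := hdot y p; pose z := c^-1 *: y.
have Xz : X0 z by exact: (csubspaceZ _ sX0).
have zk k : in_range len k -> hdot z (h k) = (Num.sqrt (w k) / (L k - l))%:C.
  move=> kr; have n0 : (L k - l)%:C != 0 by rewrite (inj_eq (@complexI R) _ 0) subr_eq0 Ll.
  apply: (mulfI n0); rewrite hdotZl mulrCA yk// mulKf// -rmorphM/=; congr (_%:C).
  by rewrite mulrC divfK// subr_eq0 Ll.
have zp : hdot z p = 1 by rewrite hdotZl mulVf.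
have [|sz ez] := h_parseval Xz zk ph; first by move=> k kr; rewrite sw0// mul0r.
have E1 : (fun k => Num.sqrt (w k) / (L k - l) * Num.sqrt (w k)) = (fun k => w k / (L k - l)).
  by apply/funext => k; rewrite mulrAC sqw.
rewrite E1 in sz ez; rewrite zp -[1]/(1%:C) in ez.
have [j jr lj] := weight_secular_root LM r0 l0 Ll sz (esym (complexI ez)).
have j0 : 0 < L1 j by rewrite -lj.
have [Xf fh fp _] := hf j jr j0.
have zf : z = f j.
  by apply: (h_ext Xz Xf) => k kr; rewrite zk// fh// lj.
have : hdot z (f j) = 0 by rewrite hdotZl yf ?mulr0//; exists j.
rewrite -zf => /hdotxx_eq0 z0; move: zp; rewrite z0 hdot0l => /esym/eqP.
by rewrite oner_eq0.
Qed.

(** By [X0_S_ker] the kernel of [S] in [X0] is at most a line. The value e = 0 encodes a trivial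
    kernel, so that both cases share one basis. Scaling to <y, p> = 1 makes the coordinates real,
    hence [e] fixed by the conjugation. *)
Lemma kernel_vector : exists e, [/\ X0 e, S e = 0, e = 0 \/ nm e = 1,
  forall k, in_range len k -> exists a : R, hdot e (h k) = a%:C &
  forall x, X0 x -> S x = 0 -> hdot x e = 0 -> x = 0].
Proof.
have [[x [Xx Sx x0]]|nx] := pselect (exists x, [/\ X0 x, S x = 0 & x != 0]); last first.
  exists 0; split => //; first exact: (csubspace0 sX0).
  - by rewrite linear0.
  - by left.
  - by move=> k _; exists 0; rewrite hdot0l.
  - move=> x Xx Sx _; apply/eqP; apply: contraT => x0; exfalso; apply: nx; by exists x.
have xp : hdot x p != 0 by apply/eqP => xp; move/eqP: x0; apply; exact: X0_S_ker.
pose y := (hdot x p)^-1 *: x.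
have Xy : X0 y by exact: (csubspaceZ _ sX0).
have Sy : S y = 0 by rewrite linearZ/= Sx scaler0.
have yp : hdot y p = 1 by rewrite hdotZl mulVf.
have y0 : y != 0 by apply/eqP => y0; move: yp; rewrite y0 hdot0l => /esym/eqP; rewrite oner_eq0.
have n0 : nm y != 0 by rewrite nm_eq0.
exists ((nm y)^-1%:C *: y); split.
- exact: (csubspaceZ _ sX0).
- by rewrite linearZ/= Sy scaler0.
- right; rewrite nmZ ger0_norm ?ler0c ?invr_ge0 ?nm_ge0//=.
  by rewrite mulVf.
- move=> k kr; exists ((nm y)^-1 * (Num.sqrt (w k) / L k)).
  rewrite hdotZl rmorphM/=; congr (_ * _).
  have Lk0 : (L k)%:C != 0 by rewrite (inj_eq (@complexI R) _ 0) L0.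
  apply: (mulfI Lk0); have := S_coord y kr; rewrite Sy hdot0l yp mul1r => /esym/eqP.
  rewrite subr_eq0 => /eqP ->; rewrite -rmorphM/=; congr (_%:C).
  by rewrite mulrC divfK// L0.
move=> u Xu Su ue; have uy : u = hdot u p *: y.
  apply/eqP; rewrite -subr_eq0; apply/eqP; apply: X0_S_ker.
  - by apply: (csubspaceB sX0 Xu); exact: (csubspaceZ _ sX0).
  - by rewrite linearB linearZ/= Su Sy scaler0 subrr.
  - by rewrite hdotBl hdotZl yp mulr1 subrr.
apply: X0_S_ker => //; move: ue; rewrite uy hdotZl hdotZr conjc_real => /eqP.
rewrite !mulf_eq0 (inj_eq (@complexI R) _ 0) invr_eq0 (negPf n0) hdotxx.
rewrite (inj_eq (@complexI R) _ 0) sqrf_eq0 (negPf n0) !orbF => /eqP up.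
by rewrite up scale0r hdot0l.
Qed.

End scalar_model.

Lemma vdiag_exists (R : realType) (H : hilbertType R) (I : choiceType) (V : pred I) (b : I -> H)
    (c : I -> R[i]) (M : R) : vonb V b -> 0 <= M -> (forall i, V i -> complex.Re `|c i| <= M) ->
  exists D : {linear H -> H}, diag_op b c D.
Proof.
move=> vb M0 cM.
have [|D [Dd _]] := @diag_exists _ _ _ _ (fun i : {i | V i} => c (val i)) M (vonb_onb vb) M0.
  by move=> i; exact: cM (valP i).
by exists D; exact: (sub_vonb vb).
Qed.

(** * Bases rotated by Householder matrices *)

Section rotation_facts.
Context {R : realType} {H : hilbertType R} (s : bool) (N : nat -> nat) (a : nat -> nat -> R).
Local Notation I := (bool * nat * nat)%type.
Variables (Q : pred nat) (V : pred I) (b : I -> H).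
Hypothesis VQ : forall k i, V (s, k, i) = Q k && (i < N k)%N.
Hypothesis vb : vonb V b.
Hypothesis N0 : forall k, Q k -> (0 < N k)%N.
Hypothesis a0 : forall k i, Q k -> (i < N k)%N -> 0 < a k i.
Hypothesis a1 : forall k, Q k -> \sum_(i < N k) a k i = 1.

Definition rotb := brot s N (fun k => householder (fun i => Num.sqrt (a k i))) b.

Let OC k i l : householder (fun i => Num.sqrt (a k i)) i l = householder (fun i => Num.sqrt (a k i)) l i.
Proof. exact: householderC. Qed.

Let OO k i j : Q k -> (i < N k)%N -> (j < N k)%N ->
  \sum_(l < N k) householder (fun i => Num.sqrt (a k i)) i l *
    householder (fun i => Num.sqrt (a k i)) l j = (i == j)%:R.
Proof.
move=> Qk; apply: householder_sqr; first exact: N0.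
  by rewrite sqrtr_gt0 a0// N0.
rewrite -[RHS](a1 Qk); apply: eq_bigr => l _; rewrite sqr_sqrtr// ltW// a0//.
Qed.

Lemma rotb_vonb : vonb V rotb.
Proof. exact: (rot_vonb VQ OC OO vb). Qed.

Lemma rotb_other t k i : t != s -> rotb (t, k, i) = b (t, k, i).
Proof. by rewrite /rotb /brot/= => /negPf ->. Qed.

(** In the rotated basis the distinguished vector of a block has the square roots of the masses as
    coordinates, so its spectral measure has these masses. *)
Lemma rotb_first k : Q k ->
  b (s, k, 0%N) = \sum_(i < N k) (Num.sqrt (a k i))%:C *: rotb (s, k, i : nat).
Proof.
move=> Qk; have e := @rot_inv _ _ s N (fun k => householder (fun i => Num.sqrt (a k i))) Q b OO k 0%N Qk (N0 Qk); rewrite [LHS]e; apply: eq_bigr => i _.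
by rewrite householder0// sqrtr_gt0 a0// N0.
Qed.

Lemma rotb_eigen (D : {linear H -> H}) (c : I -> R[i]) :
  (forall k i, c (s, k, i) = c (s, k, 0%N)) -> (forall x, D (b x) = c x *: b x) ->
  forall x, D (rotb x) = c x *: rotb x.
Proof.
move=> cs Db [[t k] i]; rewrite /rotb /brot/=; case: eqVneq => [->|_]; last exact: Db.
case: ifP => _; last by rewrite linear0 scaler0.
rewrite linear_sum scaler_sumr; apply: eq_bigr => l _.
by rewrite linearZ/= Db !scalerA mulrC (cs k i) (cs k l).
Qed.

Lemma rotb_orth x k i : (forall l, hdot x (b (s, k, l)) = 0) -> hdot x (rotb (s, k, i)) = 0.
Proof.
move=> xb; rewrite /rotb /brot/= eqxx; case: ifP => _; last exact: hdot0r.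
by rewrite hdot_sumr big1// => l _; rewrite hdotZr xb mulr0.
Qed.

Lemma rotb_conj (J : {linear H -> H | (@Num.conj R[i]) \; *:%R}) :
  (forall x, J (b x) = b x) -> forall x, J (rotb x) = rotb x.
Proof.
move=> Jb [[t k] i]; rewrite /rotb /brot/=; case: ifP => _; last exact: Jb.
case: ifP => _; last exact: (raddf0 J).
rewrite (raddf_sum J); apply: eq_bigr => l _.
have e : J ((householder (fun i => Num.sqrt (a k i)) i l)%:C *: b (s, k, l : nat)) =
  ((householder (fun i => Num.sqrt (a k i)) i l)%:C)^*%C *: J (b (s, k, l : nat)) by exact: linearZ_LR.
by rewrite [LHS]e conjc_real Jb.
Qed.

End rotation_facts.

(** * The model tuple *)

Section second_basis.
Context {R : realType} {H : hilbertType R}.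
Local Notation I := (bool * nat * nat)%type.
Variables (len : option nat) (lam mu : nat -> R) (N N1 : nat -> nat).
Hypothesis lam_mu : interlacing len lam mu.
Local Notation L := (fun k => lam k ^+ 2).
Local Notation L1 := (fun k => mu k ^+ 2).
Local Notation w := (weight len L L1).

Definition inB j := in_range len j && (0 < mu j).
(* (true, k, 0) indexes h_k, (true, k, i) with i > 0 the rest of Ker(R - lam_k), and
   (false, j, i) with i > 0 the orthogonal complement of f_j in Ker(R_1 - mu_j). *)
Definition validC (x : I) : bool :=
  if x.1.1 then in_range len x.1.2 && (x.2 < N x.1.2)%N
  else [&& inB x.1.2, (0 < x.2)%N & (x.2 < N1 x.1.2)%N].
Definition evC (x : I) : R[i] := (if x.1.1 then lam x.1.2 else mu x.1.2)%:C.

Hypothesis N0 : forall k, in_range len k -> (0 < N k)%N.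
Hypothesis N10 : forall k, inB k -> (0 < N1 k)%N.

Variables (c : I -> H) (J : {linear H -> H | (@Num.conj R[i]) \; *:%R}).
Hypothesis vc : vonb validC c.
Hypothesis JC : conjugation J.
Hypothesis Jc : forall x, J (c x) = c x.
Variable T : {linear H -> H}.
Hypothesis Td : diag_op c evC T.

Local Notation h := (fun k => c (true, k, 0%N)).
Local Notation X0 := (closed_span (range h)).

Let LM := interlacing_sqr lam_mu.
Let r0 : in_range len 0. Proof. by have [] := interlacing_pos lam_mu. Qed.

Lemma h_hdot j k : hdot (h j) (h k) = ((j == k) && in_range len j)%:R.
Proof.
rewrite vc.1 /validC/= !xpair_eqE eqxx andbT/=.
by case jr: (in_range len j); rewrite ?andbF// N0.
Qed.

Lemma X0P x : X0 x <-> forall t k i, ~~ (t && (i == 0%N)) -> hdot x (c (t, k, i)) = 0.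
Proof.
split => [Xx t k i ti|xc].
  apply: hdot_eq0C; have : orthocompl X0 (c (t, k, i)); last exact.
  apply: orthocompl_closed_span => _ [l _ <-]; rewrite vc.1.
  rewrite (_ : (_ == _) = false)//; apply/negbTE; apply: contra ti => /eqP[-> _ ->].
  by rewrite eqxx.
have /(@closed_span_sub _ _ _ X0) : closed_span (c @` [set y | y.1.1 && (y.2 == 0%N)]) x.
  by apply: (vonb_supp_closed_span vc) => -[[t k] i] /negP; exact: xc.
apply; first exact: csubspace_closed_span.
by move=> _ [[[t k] i] /= /andP[tt /eqP ->] <-]; rewrite tt; apply: subset_closed_span; exists k.
Qed.

Lemma T_basis x : T (c x) = evC x *: c x.
Proof. exact: (vonb_diag_basis vc). Qed.

Lemma evC_real x : (evC x)^*%C = evC x.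
Proof. exact: conjc_real. Qed.

Lemma T_self_adjoint : self_adjoint T.
Proof. have h : forall i : {i | validC i}, (evC (val i))^*%C = evC (val i) by move=> i; exact: evC_real.
move=> x y; have e := diag_self_adjoint (vonb_onb vc) h (@vonb_sub _ _ _ validC _ _ _ Td).
exact: e. Qed.

Lemma X0_conj x : X0 x -> (forall k, in_range len k -> exists a : R, hdot x (h k) = a%:C) -> J x = x.
Proof.
move=> Xx xr; apply: (vonb_ext vc) => -[[t k] i].
have -> : hdot (J x) (c (t, k, i)) = (hdot x (c (t, k, i)))^*%C by rewrite -(hdotJ JC) Jc.
have [/andP[-> /eqP ->]|ti] := boolP (t && (i == 0%N)); last by rewrite (iffLR (X0P x) Xx _ _ _ ti) conjc0.
have [kr|kr] := boolP (in_range len k).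
  by have [a ->] := xr k kr; rewrite conjc_real.
by rewrite (vonb_out vc) ?hdot0r ?conjc0// /validC/= (negPf kr).
Qed.

Lemma lam_le0 k : in_range len k -> lam k <= lam 0.
Proof.
have [l0 _ _] := interlacing_pos lam_mu.
move=> kr; rewrite -(@ler_pXn2r _ 2) ?nnegrE ?(ltW (l0 _ _))//.
exact: (L_le0 LM kr).
Qed.

Lemma mu_lam j : in_range len j -> 0 <= mu j <= lam 0.
Proof.
move=> jr; have [a _ m0] := interlacing_bounds lam_mu.
by rewrite m0// (le_trans (ltW (a _ jr)))// lam_le0.
Qed.

Lemma lam_mu_tends (e : R) : 0 < e ->
  exists K, forall k, (K <= k)%N -> in_range len k -> lam k <= e /\ mu k <= e.
Proof.
move=> e0; have [_ _ _ _ /(_ (e ^+ 2))] := LM.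
have [l0 _ _] := interlacing_pos lam_mu; have [a _ m0] := interlacing_bounds lam_mu.
rewrite exprn_gt0// => /(_ isT)[K hK]; exists K => k Kk kr.
have lk : lam k <= e.
  by rewrite -(@ler_pXn2r _ 2) ?nnegrE ?(ltW (l0 _ kr)) ?(ltW e0)//; exact/ltW/hK.
by split => //; apply: le_trans lk; exact/ltW/a.
Qed.

(* All but finitely many valid indices have small eigenvalue: the blocks are finite. *)
Lemma tends0_ev (V : pred I) (ev : I -> R[i]) (B : nat -> nat) :
  (forall t k i, V (t, k, i) -> [/\ complex.Re `|ev (t, k, i)| = 0 \/
     (in_range len k /\ (complex.Re `|ev (t, k, i)| <= lam k \/ complex.Re `|ev (t, k, i)| <= mu k))
     & (i < B k)%N]) ->
  tends0 (fun i : {i | V i} => ev (val i)).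
Proof.
move=> hV e e0; have [K hK] := lam_mu_tends e0.
pose Bm := \max_(k < K) B k.
pose l : seq I := [seq (tk, i) | tk <- [seq (t, k) | t <- [:: true; false], k <- iota 0 K], i <- iota 0 Bm].
exists (undup (pmap insub l)); first exact: undup_uniq.
move=> [[[t k] i] Vi]; rewrite mem_undup mem_pmap_sub/= => il.
have [ev0 iB] := hV t k i Vi.
suff : complex.Re `|ev (t, k, i)| <= e by [].
case: ev0 => [->|[kr evl]]; first exact: ltW.
have [kK|Kk] := ltnP k K; last first.
  by have [h1 h2] := hK k Kk kr; case: evl => h3; [exact: le_trans h1|exact: le_trans h2].
case/negP: il; apply/allpairsP; exists ((t, k), i); split => //=.
  rewrite cats0 mem_cat; apply/orP; case: (t); [left|right]; apply: map_f;
    by rewrite mem_iota.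
rewrite mem_iota/= add0n; apply: leq_trans iB _.
exact: (@leq_bigmax _ (fun k : 'I_K => B k) (Ordinal kK)).
Qed.

Lemma validC_bound t k i : validC (t, k, i) -> (i < maxn (N k) (N1 k))%N.
Proof.
by rewrite /validC/=; case: t => [/andP[_ iN]|/and3P[_ _ iN]]; rewrite leq_max iN ?orbT.
Qed.

Lemma validC_range t k i : validC (t, k, i) -> in_range len k.
Proof. by rewrite /validC/=; case: t => [/andP[]//|/and3P[/andP[]]]. Qed.

Lemma normc_real (r : R) : 0 <= r -> complex.Re `|r%:C| = r.
Proof. by move=> r_ge0; rewrite ger0_norm// ler0c. Qed.

Lemma tends0_evC : tends0 (fun i : {i | validC i} => evC (val i)).
Proof.
apply: (@tends0_ev _ _ (fun k => maxn (N k) (N1 k))) => t k i Vi; split; last exact: (@validC_bound t).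
right; have kr := validC_range Vi; split => //.
have [l0 _ _] := interlacing_pos lam_mu; have /andP[m0 _] := mu_lam kr.
have -> : evC (t, k, i) = (if t then lam k else mu k)%:C by [].
by case: t {Vi}; [left|right]; rewrite normc_real// ltW// l0.
Qed.

Lemma exists_p : exists p, [/\ X0 p, J p = p &
  forall k, in_range len k -> hdot p (h k) = (Num.sqrt (w k))%:C].
Proof.
have [|p Xp ph] := @h_vector _ _ _ _ h_hdot (fun k => Num.sqrt (w k)) (sumR w).
  move=> n; have -> : \sum_(0 <= k < n) Num.sqrt (w k) ^+ 2 = \sum_(0 <= k < n) w k.
    by apply: eq_bigr => k _; rewrite sqr_sqrtr// weight_ge0.
  by apply: summ_ge_partial; [exact: weight_ge0|exact: weight_summ].
exists p; split => //; apply: X0_conj => // k kr; by exists (Num.sqrt (w k)); exact: ph.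
Qed.

Variable p : H.
Hypothesis Xp : X0 p.
Hypothesis ph : forall k, in_range len k -> hdot p (h k) = (Num.sqrt (w k))%:C.

Lemma T_bounded : exists a, forall x, nm (T x) <= a * nm x.
Proof. exact: Td.1. Qed.

Lemma T_h k : in_range len k -> T (h k) = (lam k)%:C *: h k.
Proof. by move=> _; rewrite T_basis. Qed.

Lemma T2_compact (S : {linear H -> H}) :
  (forall x, S x = T (T x) - hdot x p *: p) -> compact_operator S.
Proof.
move=> SE; apply: precompact_finitely_approx.
have TT : diag_op c (fun x => evC x * evC x) (T \o T).
  have [a Ta] := T_bounded; split; last by move=> x i; rewrite /= !Td.2 mulrA.
  exists (`|a| * `|a|) => x /=; apply: le_trans (Ta _) _.
  apply: (@le_trans _ _ (`|a| * nm (T x))); first by rewrite ler_wpM2r ?nm_ge0 ?ler_norm.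
  rewrite -mulrA ler_wpM2l//; apply: le_trans (Ta _) _; by rewrite ler_wpM2r ?nm_ge0 ?ler_norm.
have t0 : tends0 (fun i : {i | validC i} => evC (val i) * evC (val i)).
  move=> e e0; have [s su hs] := tends0_evC (e := Num.min e 1) ltac:(by rewrite lt_min e0 ltr01).
  exists s => // i il; rewrite cabsM; have h1 := hs i il; rewrite le_min in h1.
  have /andP[h2 h3] := h1; apply: le_trans h2.
  by rewrite ler_piMr ?cabs_ge0.
have := diag_approx (vonb_onb vc) p t0 (@vonb_sub _ _ _ validC _ _ _ TT).
rewrite /finitely_approx => hap e e0; have [n [v [M hM]]] := hap e e0.
by exists n, v, M => _ [x x1 <-]; apply: hM; exists x => //=.
Qed.

Variables (f : nat -> H) (S : {linear H -> H}) (e : H).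
Hypothesis SE : forall x, S x = T (T x) - hdot x p *: p.
Hypothesis hf : forall j, inB j -> [/\ X0 (f j),
    forall k, in_range len k -> hdot (f j) (h k) = (Num.sqrt (w k) / (L k - L1 j))%:C,
    hdot (f j) p = 1 & S (f j) = (L1 j)%:C *: f j].
Hypothesis he : [/\ X0 e, S e = 0, e = 0 \/ nm e = 1,
  forall k, in_range len k -> exists a : R, hdot e (h k) = a%:C &
  forall x, X0 x -> S x = 0 -> hdot x e = 0 -> x = 0].

(** The vectors h_k, which span [X0], are exchanged for eigenvectors of [S] in [X0]; the places
    (false, j, 0), not valid for [c], receive the normalized [f j]. *)
Definition basis1 (x : I) : H :=
  let: (t, k, i) := x in
  if i == 0%N then
    if t then (if k == 0%N then e else 0)
    else (if inB k then (nm (f k))^-1%:C *: f k else 0)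
  else c x.

Definition valid1 (x : I) : bool :=
  let: (t, k, i) := x in
  if t then (if i == 0%N then (k == 0%N) && (e != 0) else in_range len k && (i < N k)%N)
  else inB k && (i < N1 k)%N.

(* The kernel vector e sits at index (true, 0, 0), and f_j at (false, j, 0). *)
Definition ev1 (x : I) : R[i] :=
  let: (t, k, i) := x in
  (if t then (if i == 0%N then 0 else lam k) else mu k)%:C.

Let nf0 j : inB j -> nm (f j) != 0.
Proof.
move=> jB; have [_ _ fp _] := hf jB; rewrite nm_eq0; apply/eqP => f0.
by move: fp; rewrite f0 hdot0l => /esym/eqP; rewrite oner_eq0.
Qed.

Let X0_basis1 t k : X0 (basis1 (t, k, 0%N)).
Proof.
have z := csubspace0 (csubspace_closed_span (range h)).
rewrite /basis1/=; case: t; first by case: ifP => // _; have [] := he.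
case: ifP => // kB; apply: (csubspaceZ _ (csubspace_closed_span _)).
by have [] := hf kB.
Qed.

Let basis1_pos t k i : (0 < i)%N -> basis1 (t, k, i) = c (t, k, i).
Proof. by case: i. Qed.

Let valid1_pos t k i : (0 < i)%N -> valid1 (t, k, i) = validC (t, k, i).
Proof. by case: t; case: i => //= i _; rewrite /validC/= . Qed.

Lemma S_basis1 t k : S (basis1 (t, k, 0%N)) = (if t then 0 else L1 k)%:C *: basis1 (t, k, 0%N).
Proof.
rewrite /basis1/=; case: t.
  rewrite scale0r; case: ifP => _; last exact: linear0.
  by have [_ ->] := he.
case: ifP => kB; last by rewrite linear0 scaler0.
by have [_ _ _ e1] := hf kB; rewrite linearZ/= e1 !scalerA mulrC.
Qed.

(** The nonzero vectors with last index 0 are eigenvectors of the self-adjoint [S] for distinct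
    eigenvalues; the others come from [c] and are orthogonal to [X0]. Completeness is
    [secular_complete] followed by the last clause of [he]. *)
Lemma basis1_vonb : vonb valid1 basis1.
Proof.
have Ssa := rank1_self_adjoint T_self_adjoint SE.
have Sc := T2_compact SE.
split; last first.
  move=> x xb.
  have Xx : X0 x.
    apply/X0P => t k [|i] ti; last by rewrite -basis1_pos//; exact: xb.
    case: t ti => // _; rewrite (vonb_out vc) ?hdot0r//.
      by rewrite /validC/= andbF.
  have [_ _ _ _ eK] := he; apply: (eK x Xx); last exact: (xb (true, 0%N, 0%N)).
  apply: (@secular_complete _ _ len h h_hdot L L1 LM r0 T lam p T_self_adjoint T_bounded T_h
    (fun k _ => erefl) Xp ph S SE Sc f x) => // j jr j0.
    have [_ _ m0] := interlacing_bounds lam_mu.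
    by apply: hf; rewrite /inB jr lt_neqAle m0// andbT eq_sym -sqrf_eq0 gt_eqF.
  have [_ _ m0] := interlacing_bounds lam_mu.
  have jB : inB j by rewrite /inB jr lt_neqAle m0// andbT eq_sym -sqrf_eq0 gt_eqF.
  have := xb (false, j, 0%N); rewrite /basis1/= jB hdotZr conjc_real => /eqP.
  by rewrite mulf_eq0 (inj_eq (@complexI R) _ 0) invr_eq0 (negPf (nf0 jB)) => /eqP.
move=> [[t k] i] [[t' k'] i'].
have X0c t1 k1 i1 t2 k2 : (0 < i1)%N -> hdot (basis1 (t2, k2, 0%N)) (c (t1, k1, i1)) = 0.
  move=> i10; have XX := iffLR (X0P (basis1 (t2, k2, 0%N))) (@X0_basis1 t2 k2).
  by apply: XX; rewrite negb_and -lt0n i10 orbT.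
have [i0|i0] := posnP i; have [i0'|i0'] := posnP i'; last 1 first.
- by rewrite !basis1_pos// vc.1 valid1_pos.
- rewrite i0 i0'.
  have [tk|tk] := eqVneq (t, k) (t', k').
    rewrite -tk eqxx {tk}.
    rewrite hdotxx; case: t => /=.
      have [_ _ e01 _ _] := he.
      case: eqP => _ /=; last by rewrite nm0 expr0n.
      by case: e01 => [->|n1]; rewrite ?nm0 ?expr0n ?eqxx//= n1 expr1n -nm_eq0 n1 oner_eq0.
    case: ifP => kB /=; last by rewrite nm0 expr0n.
    rewrite nmZ ger0_norm ?ler0c ?invr_ge0 ?nm_ge0//= mulVf ?nf0// expr1n.
    by rewrite N10.
  rewrite (_ : (_ == _) = false); last by apply/negbTE; apply: contra tk => /eqP[-> ->].
  have [e1|ne1] := eqVneq (if t then 0 else L1 k) (if t' then 0 else L1 k'); last first.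
    exact: (eigen_orth Ssa ne1 (S_basis1 _ _) (S_basis1 _ _)).
  have [_ _ m0] := interlacing_bounds lam_mu.
  have L1n j : inB j -> L1 j != 0 by move=> /andP[_ j0]; rewrite sqrf_eq0 gt_eqF.
  case: t t' tk e1 => [] [] /= tk e1.
  + case: eqP => [k0|_]; last by rewrite hdot0l.
    case: eqP => [k0'|_]; last by rewrite hdot0r.
    by rewrite k0 k0' eqxx in tk.
  + have [kB|kB] := boolP (inB k'); last by rewrite hdot0r.
    by have := L1n _ kB; rewrite -e1 eqxx.
  + have [kB|kB] := boolP (inB k); last by rewrite hdot0l.
    by have := L1n _ kB; rewrite e1 eqxx.
  + case: ifP => kB; last by rewrite hdot0l.
    case: ifP => kB'; last by rewrite hdot0r.
    have kk := interlaced_M_inj LM (andP kB).1 (andP kB').1 e1.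
    by rewrite kk eqxx in tk.
- rewrite i0 [basis1 (t', k', i')]basis1_pos// X0c// (_ : (_ == _) = false)//.
  by apply/negbTE/eqP => -[_ _ ii]; rewrite -ii in i0'.
- rewrite i0' [basis1 (t, k, i)]basis1_pos// (hdot_eq0C (X0c _ _ _ _ _ i0)) (_ : (_ == _) = false)//.
  by apply/negbTE/eqP => -[_ _ ii]; rewrite ii in i0.
Qed.

Lemma basis1_conj x : J (basis1 x) = basis1 x.
Proof.
case: x => [[t k] [|i]]; last exact: Jc.
apply: X0_conj => // j jr; rewrite /basis1/=; case: t.
  case: ifP => _; first by have [_ _ _ h1 _] := he; exact: h1.
  by exists 0; rewrite hdot0l.
case: ifP => kB; last by exists 0; rewrite hdot0l.
have [_ fh _ _] := hf kB.
exists ((nm (f k))^-1 * (Num.sqrt (w j) / (L j - L1 k))); rewrite hdotZl fh//.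
by rewrite -rmorphM.
Qed.

Lemma basis1_0 t k : basis1 (t, k, 0%N) =
  if t then (if k == 0%N then e else 0) else (if inB k then (nm (f k))^-1%:C *: f k else 0).
Proof. by []. Qed.

Lemma basis1S t k i : (0 < i)%N -> basis1 (t, k, i) = c (t, k, i).
Proof. by case: i. Qed.

Let sX0 : csubspace X0. Proof. exact: csubspace_closed_span. Qed.

Lemma X0_kappa x t k i : X0 x -> ~~ (t && (i == 0%N)) -> hdot x (c (t, k, i)) = 0.
Proof. by move=> /X0P h1 h2; exact: h1. Qed.

Lemma sum_basis1 x : X0 x -> (forall t k, hdot x (basis1 (t, k, 0%N)) = 0) -> x = 0.
Proof.
move=> Xx xb; apply: (basis1_vonb.2) => -[[t k] [|i]]; first exact: xb.
by rewrite basis1S//; apply: X0_kappa => //; rewrite andbF.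
Qed.

Lemma X0_h_eq0 x : X0 x -> (forall k, in_range len k -> hdot x (h k) = 0) -> x = 0.
Proof.
move=> Xx xh; apply: (vc.2) => -[[t k] i].
have [/andP[-> /eqP ->]|ti] := boolP (t && (i == 0%N)); last exact: X0_kappa.
have [kr|kr] := boolP (in_range len k); first exact: xh.
by rewrite (vonb_out vc) ?hdot0r// /validC/= (negPf kr).
Qed.

Lemma lam_inj k k' : in_range len k -> in_range len k' -> lam k = lam k' -> k = k'.
Proof. by move=> kr kr' e1; apply: (interlaced_L_inj LM kr kr'); rewrite e1. Qed.

Lemma mu_inj k k' : in_range len k -> in_range len k' -> mu k = mu k' -> k = k'.
Proof. by move=> kr kr' e1; apply: (interlaced_M_inj LM kr kr'); rewrite e1. Qed.

Lemma lam_mu_neq k j : in_range len k -> in_range len j -> lam k != mu j.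
Proof.
move=> kr jr; apply/eqP => e1; have := interlaced_LM_neq LM jr kr.
by rewrite e1 subrr eqxx.
Qed.

Lemma lam_gt0 k : in_range len k -> 0 < lam k.
Proof. by have [l0 _ _] := interlacing_pos lam_mu; exact: l0. Qed.

Let real_eq (a b : R) : (a%:C == b%:C) = (a == b).
Proof. exact: (inj_eq (@complexI R)). Qed.

(** Strict interlacing makes lam k differ from all the other eigenvalues of [T], so its eigenspace
    is exactly one block. *)
Lemma eigspace_lam (b : I -> H) k x : vonb validC b -> diag_op b evC T -> in_range len k ->
  eigspace T (lam k)%:C x <-> forall t l i, ~~ (t && (l == k)) -> hdot x (b (t, l, i)) = 0.
Proof.
move=> vb Tb kr; rewrite (vonb_eigspace vb _ Tb); split => /= xb.
  move=> t l i tl; have [Vi|Vi] := boolP (validC (t, l, i)); last by rewrite (vonb_out vb) ?hdot0r.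
  apply: xb; rewrite /evC/= real_eq; have lr := validC_range Vi.
  case: t tl {Vi} => /= [lk|_]; last by rewrite eq_sym lam_mu_neq.
  by apply: contra lk => /eqP /lam_inj ->.
move=> [[t l] i] ne; apply: xb; apply: contra ne => /andP[tt /eqP ->].
by rewrite /evC/= tt.
Qed.

Lemma eigspace_mu (b : I -> H) (T1 : {linear H -> H}) j x : vonb valid1 b ->
  diag_op b ev1 T1 -> inB j ->
  eigspace T1 (mu j)%:C x <-> forall t l i, t || (l != j) -> hdot x (b (t, l, i)) = 0.
Proof.
move=> vb Tb /andP[jr j0]; rewrite (vonb_eigspace vb _ Tb); split => /= xb.
  move=> t l i tl; have [Vi|Vi] := boolP (valid1 (t, l, i)); last by rewrite (vonb_out vb) ?hdot0r.
  apply: xb; rewrite /ev1/= real_eq.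
  case: t tl Vi => /= [_|lj]; last first.
    by move=> /andP[/andP[lr _] _]; apply: contra lj => /eqP /mu_inj ->.
  case: eqP => _; first by move=> _; rewrite lt_eqF.
  by move=> /andP[lr _]; rewrite lam_mu_neq.
move=> [[t l] i] ne; apply: xb; apply: contraR ne; rewrite negb_or negbK => /andP[tt /eqP ->].
by rewrite /ev1/= (negPf tt).
Qed.

Lemma T_compact : compact_operator T.
Proof.
exact: (diag_compact (vonb_onb vc) tends0_evC (@vonb_sub _ _ _ validC _ _ _ Td)).
Qed.

Lemma vonb_psd (V : pred I) (b : I -> H) (ev : I -> R) (D : H -> H) : vonb V b ->
  (forall x, V x -> 0 <= ev x <= lam 0) -> diag_op b (fun x => (ev x)%:C) D -> psd D.
Proof.
move=> vb evb Dd.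
apply: (@diag_psd _ _ _ _ (vonb_onb vb) (fun i : {i | V i} => (ev (val i))%:C)
  (fun i => Num.sqrt (ev (val i))) (Num.sqrt (lam 0))) => //.
- by move=> [i Vi] /=; have /andP[h1 _] := evb i Vi; rewrite sqr_sqrtr.
- by move=> [i Vi] /=; have /andP[_ h1] := evb i Vi; rewrite sqrtr_ge0 ler_wsqrtr.
- exact: (vonb_sub _ Dd).
Qed.

Lemma T_psd : psd T.
Proof.
apply: (vonb_psd vc (ev := fun x : I => if x.1.1 then lam x.1.2 else mu x.1.2)) Td => -[[t k] i] Vi.
have kr := validC_range Vi; case: t {Vi} => /=; last exact: mu_lam.
by rewrite lam_le0// ltW// lam_gt0.
Qed.

Variable T1 : {linear H -> H}.
Hypothesis T1d : diag_op basis1 ev1 T1.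
Variables (phi phi1 : {linear H -> H}).

Local Notation D := (SpectralData T T1 p J phi phi1).

(** Cyclicity of p: an eigenvector in [X0] orthogonal to the orbit of p would be a multiple of some
    h_k, while p has the nonzero coordinate sqrt (w k) there. *)
Lemma model_sdH0 : sdH0 D = X0.
Proof.
have TX := X0_T h_hdot T_bounded T_h.
apply: csubspace_eqT => //; first exact: csubspace_closed_span.
  apply: closed_span_sub => // _ [n _ <-]; elim: n => //= n; exact: TX.
move=> x Xx xo; apply/eqP; apply: contraT => x0.
pose E := X0 `&` orthocompl (sdH0 D).
have sE : csubspace E by apply: csubspaceI sX0 _; exact: csubspace_orthocompl.
have [||y [l [[Xy yo] y0 l0 Ty]]] := @compact_psd_eigenvector _ _ T T_compact T_self_adjoint T_psd E sE.
- move=> z [Xz zo]; split; first exact: TX.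
  apply: orthocompl_closed_span => _ [n _ <-]; rewrite T_self_adjoint.
  by apply: zo; apply: subset_closed_span; exists n.+1.
- exists x; first by split.
  apply: contra_neq x0 => Tx; apply: X0_h_eq0 => // k kr.
  have : hdot (T x) (h k) = 0 by rewrite Tx hdot0l.
  rewrite Td.2 /evC/= => /eqP; rewrite mulf_eq0 real_eq.
  by rewrite (gt_eqF (lam_gt0 kr)) => /eqP.
have yk k : hdot (T y) (h k) = (lam k)%:C * hdot y (h k) by rewrite Td.2.
have yp : hdot y p = 0 by apply: yo; apply: subset_closed_span; exists 0%N.
have [k [kr yk0]] : exists k, in_range len k /\ hdot y (h k) != 0.
  apply: contrapT => nk; move/eqP: y0; apply; apply: X0_h_eq0 => // k kr.
  by apply/eqP; apply: contraT => ?; exfalso; apply: nk; exists k.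
have lk : l = lam k.
  have := yk k; rewrite Ty hdotZl => /(mulIf yk0) e1; exact: complexI e1.
have ye : y = hdot y (h k) *: h k.
  apply/eqP; rewrite -subr_eq0; apply/eqP; apply: X0_h_eq0.
    apply: (csubspaceB sX0 Xy); apply: (csubspaceZ _ sX0).
    by apply: subset_closed_span; exists k.
  move=> i ir; rewrite hdotBl hdotZl h_hdot kr andbT.
  have [<-|ki] := eqVneq k i; first by rewrite mulr1 subrr.
  rewrite mulr0 subr0; have := yk i; rewrite Ty hdotZl lk => /eqP.
  rewrite -subr_eq0 -mulrBl mulf_eq0 => /orP[|/eqP//].
  by rewrite subr_eq0 real_eq => /eqP /lam_inj e1; rewrite e1 ?eqxx in ki.
move: yp; rewrite ye hdotZl (hdotC _ p) ph// conjc_real => /eqP.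
rewrite mulf_eq0 (negPf yk0)/= (inj_eq (@complexI R) _ 0) sqrtr_eq0 leNgt.
by rewrite weight_gt0.
Qed.

Lemma model_sdeig : sdeig D = [set (lam k)%:C | k in [set k | in_range len k]].
Proof.
rewrite /sdeig model_sdH0; apply/seteqP; split => l.
  move=> [x [Xx x0 Tx]].
  have [k [kr xk0]] : exists k, in_range len k /\ hdot x (h k) != 0.
    apply: contrapT => nk; move/eqP: x0; apply; apply: X0_h_eq0 => // k kr.
    by apply/eqP; apply: contraT => ?; exfalso; apply: nk; exists k.
  exists k => //; have : hdot (T x) (h k) = (lam k)%:C * hdot x (h k) by rewrite Td.2.
  by rewrite [sdR D x]Tx hdotZl => /(mulIf xk0).
move=> [k kr <-]; exists (h k); split.
- by apply: subset_closed_span; exists k.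
- apply/eqP => h0; have := h_hdot k k; rewrite h0 hdot0l eqxx kr => /esym/eqP.
  by rewrite oner_eq0.
- exact: T_h.
Qed.

Lemma basis1_neq0 j : inB j -> basis1 (false, j, 0%N) != 0.
Proof.
move=> jB; apply/eqP => b0; have := basis1_vonb.1 (false, j, 0%N) (false, j, 0%N).
by rewrite b0 hdot0l eqxx /= jB N10// => /esym/eqP; rewrite oner_eq0.
Qed.

Lemma model_sdeig1 : sdeig1 D = [set (mu k)%:C | k in [set k | in_range len k /\ 0 < mu k]].
Proof.
rewrite /sdeig1 model_sdH0; apply/seteqP; split => l.
  move=> [[x [Xx x0 Tx]] /eqP l0].
  have [t [k xk0]] : exists t k, hdot x (basis1 (t, k, 0%N)) != 0.
    apply: contrapT => nk; move/eqP: x0; apply; apply: sum_basis1 => // t k.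
    by apply/eqP; apply: contraT => ?; exfalso; apply: nk; exists t, k.
  have : hdot (T1 x) (basis1 (t, k, 0%N)) = ev1 (t, k, 0%N) * hdot x (basis1 (t, k, 0%N)).
    by rewrite T1d.2.
  rewrite [T1 x]Tx hdotZl => /(mulIf xk0) lE.
  case: t xk0 lE => xk0 lE; first by rewrite lE /ev1/= eqxx in l0.
  have kB : inB k.
    by apply/negPn/negP => kB; move: xk0; rewrite basis1_0 (negPf kB) hdot0r eqxx.
  by exists k => //=; apply/andP.
move=> [k [kr k0] <-]; have kB : inB k by apply/andP.
split; last by move=> /= /complexI e1; rewrite e1 ltxx in k0.
exists (basis1 (false, k, 0%N)); split; [exact: X0_basis1|exact: basis1_neq0|].
exact: (vonb_diag_basis basis1_vonb (false, k, 0%N) T1d).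
Qed.

Lemma T1_compact : compact_operator T1.
Proof.
apply: (diag_compact (vonb_onb basis1_vonb) _ (@vonb_sub _ _ _ valid1 _ _ _ T1d)).
apply: (@tends0_ev _ _ (fun k => (maxn (N k) (N1 k)).+1)) => t k i.
have m0 j : in_range len j -> 0 <= mu j by move=> /mu_lam /andP[].
case: t; last first.
  move=> /andP[/andP[kr k0] iN]; split; last by rewrite ltnS leq_max (ltnW iN) orbT.
  right; split => //; right; have -> : ev1 (false, k, i) = (mu k)%:C by [].
  by rewrite normc_real// ltW.
case: i => [|i] Vi.
  by split => //; left; have -> : ev1 (true, k, 0%N) = 0%:C by []; rewrite normc_real.
have /andP[kr iN] : in_range len k && (i.+1 < N k)%N by [].
split; last by rewrite ltnS leq_max (ltnW iN).
right; split => //; left; have -> : ev1 (true, k, i.+1) = (lam k)%:C by [].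
by rewrite normc_real// ltW// lam_gt0.
Qed.

Lemma model_sdpk k : in_range len k -> sdpk D (lam k)%:C = (Num.sqrt (w k))%:C *: h k.
Proof.
move=> kr; apply: oproj_uniq; first exact: (csubspace_eigspace T_compact).
  by apply: (csubspaceZ _ (csubspace_eigspace T_compact _)); exact: T_h.
move=> y /(eigspace_lam _ vc Td kr) yc; apply: (vonb_supp_orth vc) => -[[t l] i].
have [/andP[-> /eqP ->]|tl] := boolP (t && (l == k)); last by right; exact: yc.
left; rewrite hdotBl hdotZl; case: i => [|i].
  by rewrite ph// h_hdot eqxx kr mulr1 subrr.
rewrite (@X0_kappa p)// (@X0_kappa (h k))// ?mulr0 ?subrr//.
by apply: subset_closed_span; exists k.
Qed.

(** Since <f j, p> = 1, the projection is f j / |f j|^2. *)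
Lemma model_sdp1k j : inB j -> sdp1k D (mu j)%:C = (nm (f j))^-1%:C *: basis1 (false, j, 0%N).
Proof.
move=> jB; apply: oproj_uniq; first exact: (csubspace_eigspace T1_compact).
  apply: (csubspaceZ _ (csubspace_eigspace T1_compact _)).
  exact: (vonb_diag_basis basis1_vonb (false, j, 0%N) T1d).
move=> y /(eigspace_mu _ basis1_vonb T1d jB) yc.
apply: (vonb_supp_orth basis1_vonb) => -[[t l] i].
have [tl|] := boolP (t || (l != j)); first by right; exact: yc.
rewrite negb_or negbK => /andP[/negPf -> /eqP ->].
left; rewrite hdotBl hdotZl basis1_vonb.1; case: i => [|i].
  have [_ _ fp _] := hf jB.
  rewrite [X in _ - _ * X](_ : _ = 1) ?mulr1; last by rewrite eqxx/= jB N10.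
  rewrite basis1_0 jB hdotZr conjc_real (hdotC p) fp.
  by rewrite conjc1 mulr1 subrr.
rewrite (_ : (_ == _) = false) ?mulr0 ?subr0; last by apply/negbTE/eqP => -[].
by rewrite basis1S//; apply: X0_kappa.
Qed.

(** Thus K is spanned by the (true, k, i) with i > 0; the next lemma gives K_1 as the span of the
    (false, k, i) with i > 0. *)
Lemma model_sdK x : sdK D x <->
  forall t k i, ~~ (t && (0 < i)%N) -> hdot x (c (t, k, i)) = 0.
Proof.
rewrite /sdK model_sdH0 model_sdeig; split.
  move=> [xE xo] t k i; case: t => /= [|_].
    rewrite -eqn0Ngt => /eqP ->; apply: xo; by apply: subset_closed_span; exists k.
  apply: hdot_eq0C; move: xE; have : orthocompl (closed_span
    (\bigcup_(l in [set (lam k)%:C | k in [set k | in_range len k]]) eigspace (sdR D) l)) (c (false, k, i)).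
    apply: orthocompl_closed_span => y [_ [l lr <-]] /(eigspace_lam _ vc Td lr) h1.
    by apply: hdot_eq0C; apply: h1.
  by move=> h1 h2; exact: h1.
move=> xc; split.
  have h1 : closed_span (c @` [set y | y.1.1 && (0 < y.2)%N]) x.
    by apply: (vonb_supp_closed_span vc) => -[[t k] i] /negP; exact: xc.
  apply: (closed_span_sub (csubspace_closed_span _) _ h1) => _ [[[t k] i] /= /andP[tt i0] <-].
  have [Vi|Vi] := boolP (validC (t, k, i)); last first.
    by rewrite (vonb_out vc Vi); exact: (csubspace0 (csubspace_closed_span _)).
  apply: subset_closed_span; exists (lam k)%:C; first by exists k => //; exact: validC_range Vi.
  by rewrite /eigspace/= T_basis /evC/= tt.
apply: orthocompl_closed_span => _ [k _ <-]; exact: xc.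
Qed.

Lemma model_sdK1 x : sdK1 D x <->
  forall t k i, t || (i == 0%N) -> hdot x (c (t, k, i)) = 0.
Proof.
have c00 k : c (false, k, 0%N) = 0 by rewrite (vonb_out vc)// /validC/= andbF.
rewrite /sdK1 model_sdH0 model_sdeig1; split.
  move=> [xE xo] t k [|i] ti.
    case: t ti => _; last by rewrite c00 hdot0r.
    by apply: xo; apply: subset_closed_span; exists k.
  rewrite orbF in ti; rewrite ti.
  apply: hdot_eq0C; move: xE; have : orthocompl (closed_span
    (\bigcup_(l in [set (mu k)%:C | k in [set k | in_range len k /\ 0 < mu k]])
      eigspace (sdR1 D) l)) (c (true, k, i.+1)).
    apply: orthocompl_closed_span => y [_ [l [lr l0] <-]].
    have lB : inB l by apply/andP.
    move=> /(eigspace_mu _ basis1_vonb T1d lB) h1.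
    by apply: hdot_eq0C; rewrite -basis1S//; apply: h1.
  by move=> h1 h2; exact: h1.
move=> xc; split.
  have h1 : closed_span (c @` [set y | ~~ (y.1.1 || (y.2 == 0%N))]) x.
    by apply: (vonb_supp_closed_span vc) => -[[t k] i] /negP; rewrite negbK; exact: xc.
  apply: (closed_span_sub (csubspace_closed_span _) _ h1) => _ [[[t k] i] /= + <-].
  rewrite negb_or => /andP[/negPf tt i0].
  have [Vi|Vi] := boolP (validC (t, k, i)); last first.
    by rewrite (vonb_out vc Vi); exact: (csubspace0 (csubspace_closed_span _)).
  move: Vi; rewrite tt /validC/= => /and3P[/andP[kr k0] _ _].
  apply: subset_closed_span; exists (mu k)%:C; first by exists k.
  rewrite -basis1S ?lt0n//.
  exact: (vonb_diag_basis basis1_vonb (false, k, i) T1d).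
by apply: orthocompl_closed_span => _ [k _ <-]; exact: xc.
Qed.

(** [T1] squares to [S]: on last index 0 by the choice of eigenvectors, and on positive last index
    because those vectors are orthogonal to p and [T1], [T] have the same eigenvalues there. *)
Lemma model_rank1 x : T (T x) - T1 (T1 x) = hdot x p *: p.
Proof.
have -> : T1 (T1 x) = S x.
  apply: (vonb_ext basis1_vonb) => -[[t k] i].
  rewrite !T1d.2 (rank1_self_adjoint T_self_adjoint SE).
  have -> : S (basis1 (t, k, i)) = (ev1 (t, k, i) * ev1 (t, k, i)) *: basis1 (t, k, i).
    case: i => [|i].
      by rewrite S_basis1 /ev1/=; case: t; rewrite -rmorphM/= ?mul0r -?expr2.
    rewrite basis1S// SE (hdotC _ p) (@X0_kappa p) ?andbF// conjc0 scale0r subr0.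
    have -> : ev1 (t, k, i.+1) = evC (t, k, i.+1) by [].
    by rewrite T_basis linearZ/= T_basis scalerA.
  rewrite hdotZr mulrA; congr (_ * _).
  by rewrite /ev1; rewrite -rmorphM conjc_real.
by rewrite SE opprB addrC subrK.
Qed.

Lemma model_sum x : exists y k k1, [/\ sdH0 D y, sdK D k, sdK1 D k1 & x = y + k + k1].
Proof.
have sH0 : csubspace (sdH0 D) by exact: csubspace_closed_span.
have sK : csubspace (sdK D).
  by apply: csubspaceI; [exact: csubspace_closed_span|exact: csubspace_orthocompl].
have [y Hy yo] := projection x sH0.
have [k Kk ko] := projection (x - y) sK.
exists y, k, (x - y - k); split => //; last by rewrite -addrA [k + _]addrC subrK addrC subrK.
apply/model_sdK1 => t l i ti.
case: t ti => /= [_|/eqP ->]; last first.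
  by rewrite (vonb_out vc) ?hdot0r// /validC/= andbF.
have [->|i0] := posnP i.
  have Hh : sdH0 D (h l) by rewrite model_sdH0; apply: subset_closed_span; exists l.
  by rewrite hdotBl (yo _ Hh) (Kk.2 _ Hh) subrr.
apply: ko; apply/model_sdK => t' l' i' ti'; rewrite vc.1.
rewrite (_ : (_ == _) = false)//; apply/negbTE; apply: contra ti' => /eqP[<- _ <-].
by rewrite i0.
Qed.

Lemma model_K_orth : orthogonal_sets (sdK D) (sdK1 D).
Proof.
move=> x y /model_sdK xc /model_sdK1 yc; apply: (vonb_supp_orth vc) => -[[t k] i].
have [/andP[-> _]|ti] := boolP (t && (0 < i)%N); first by right; exact: yc.
by left; exact: xc.
Qed.

Lemma T1_self_adjoint : self_adjoint T1.
Proof.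
have h1 : forall i : {i | valid1 i}, (ev1 (val i))^*%C = ev1 (val i).
  by move=> [[[t k] i] Vi]; exact: conjc_real.
move=> x y; exact: (diag_self_adjoint (vonb_onb basis1_vonb) h1 (@vonb_sub _ _ _ valid1 _ _ _ T1d)).
Qed.

Lemma T1_psd : psd T1.
Proof.
have T1d' : diag_op basis1 (fun x : I => (let: (t, k, i) := x in
    if t then (if i == 0%N then 0 else lam k) else mu k)%:C) T1.
  by split => [|x [[t k] i]]; [exact: T1d.1|rewrite T1d.2].
apply: (vonb_psd basis1_vonb _ T1d') => -[[t k] i] Vi.
have lam00 : 0 <= lam 0 by exact/ltW/lam_gt0.
case: t Vi => /=; last by move=> /andP[/andP[kr _] _]; exact: mu_lam.
by case: eqP => _; [rewrite lexx|move=> /andP[kr _]; rewrite lam_le0// ltW// lam_gt0].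
Qed.

(** Positions [xi k i] and masses [al k i] of the atoms of rho_k, and likewise [xi1], [al1] for
    rho_k^1. *)
Variables (xi xi1 : nat -> nat -> R[i]) (al al1 : nat -> nat -> R).
Hypothesis xi_norm : forall k i, in_range len k -> (i < N k)%N -> `|xi k i| = 1.
Hypothesis xi_inj : forall k, in_range len k -> {in [pred i | (i < N k)%N] &, injective (xi k)}.
Hypothesis al_gt0 : forall k i, in_range len k -> (i < N k)%N -> 0 < al k i.
Hypothesis al_sum : forall k, in_range len k -> \sum_(i < N k) al k i = 1.
Hypothesis xi1_norm : forall k i, inB k -> (i < N1 k)%N -> `|xi1 k i| = 1.
Hypothesis xi1_inj : forall k, inB k -> {in [pred i | (i < N1 k)%N] &, injective (xi1 k)}.
Hypothesis al1_gt0 : forall k i, inB k -> (i < N1 k)%N -> 0 < al1 k i.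
Hypothesis al1_sum : forall k, inB k -> \sum_(i < N1 k) al1 k i = 1.

Definition basisA := rotb true N al c.
Definition basisB := rotb false N1 al1 basis1.

(** The entry 1 at the indices (false, k, i) makes phi the identity on K_1. *)
Definition zA (x : I) : R[i] := let: (t, k, i) := x in if t then xi k i else 1.
(** At the indices (true, k, i), the entry 0 for i = 0 kills the kernel vector [e], and the entry 1
    for i > 0 makes phi_1 the identity on K. *)
Definition zB (x : I) : R[i] :=
  let: (t, k, i) := x in if t then (i != 0%N)%:R else xi1 k i.

Hypothesis phid : diag_op basisA zA phi.
Hypothesis phi1d : diag_op basisB zB phi1.

Let VA k i : validC (true, k, i) = in_range len k && (i < N k)%N.
Proof. by []. Qed.

Let VB k i : valid1 (false, k, i) = inB k && (i < N1 k)%N.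
Proof. by []. Qed.

Lemma basisA_vonb : vonb validC basisA.
Proof. exact: (rotb_vonb VA vc N0 al_gt0 al_sum). Qed.

Lemma basisB_vonb : vonb valid1 basisB.
Proof. exact: (rotb_vonb VB basis1_vonb N10 al1_gt0 al1_sum). Qed.

Lemma basisA_T : diag_op basisA evC T.
Proof.
have [a Ta] := Td.1.
apply: (@diag_of_eigen _ _ _ basisA (fun x : I => if x.1.1 then lam x.1.2 else mu x.1.2) T a Ta
  T_self_adjoint).
exact: (@rotb_eigen _ _ true N al c T evC (fun _ _ => erefl) T_basis).
Qed.

Lemma basisB_T1 : diag_op basisB ev1 T1.
Proof.
have [a T1a] := T1d.1.
have h1 : diag_op basisB (fun x : I => (let: (t, k, i) := x in
    if t then (if i == 0%N then 0 else lam k) else mu k)%:C) T1.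
  apply: (diag_of_eigen T1a T1_self_adjoint).
  move=> x; transitivity (ev1 x *: basisB x); last by case: x => [[t k] i].
  apply: (@rotb_eigen _ _ false N1 al1 basis1 T1 ev1 (fun _ _ => erefl)) => {}x.
  exact: (vonb_diag_basis basis1_vonb x T1d).
by split => [|x [[t k] i]]; [exact: h1.1|rewrite h1.2].
Qed.

Lemma basisB_true k i : basisB (true, k, i) = basis1 (true, k, i).
Proof. exact: rotb_other. Qed.

Lemma zA_norm x : validC x -> `|zA x| = 1.
Proof.
case: x => [[[] k] i]; last by rewrite /zA/= normr1.
by move=> /andP[kr iN]; exact: xi_norm.
Qed.

Lemma zB_norm x : valid1 x -> zB x = 0 \/ `|zB x| = 1.
Proof.
case: x => [[[] k] i] /=; last by move=> /andP[kr iN]; right; exact: xi1_norm.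
by case: (i == 0%N) => _; [left|right; rewrite normr1].
Qed.

Lemma phi_unitary : unitary_onto [set: H] [set: H] phi.
Proof.
apply: (diag_unitary (vonb_onb basisA_vonb) _ (@vonb_sub _ _ _ validC _ _ _ phid)).
by move=> [x Vx]; exact: zA_norm.
Qed.

Lemma phi_R : commutes phi T.
Proof.
exact: (diag_comm (vonb_onb basisA_vonb) (@vonb_sub _ _ _ validC _ _ _ phid)
  (@vonb_sub _ _ _ validC _ _ _ basisA_T)).
Qed.

Lemma phi1_R1 : commutes phi1 T1.
Proof.
exact: (diag_comm (vonb_onb basisB_vonb) (@vonb_sub _ _ _ valid1 _ _ _ phi1d)
  (@vonb_sub _ _ _ valid1 _ _ _ basisB_T1)).
Qed.

Lemma phi_sym : J_symmetric J phi.
Proof.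
have h1 (i : {i | validC i}) : J (basisA (val i)) = basisA (val i) by exact: rotb_conj.
exact: (diag_J_symmetric (vonb_onb basisA_vonb) JC h1 (@vonb_sub _ _ _ validC _ _ _ phid)).
Qed.

Lemma phi1_sym : J_symmetric J phi1.
Proof.
have h1 (i : {i | valid1 i}) : J (basisB (val i)) = basisB (val i).
  by apply: rotb_conj; exact: basis1_conj.
exact: (diag_J_symmetric (vonb_onb basisB_vonb) JC h1 (@vonb_sub _ _ _ valid1 _ _ _ phi1d)).
Qed.

Lemma J_R : commutes J T.
Proof.
have h1 (i : {i | validC i}) : J (c (val i)) = c (val i) by exact: Jc.
have h2 (i : {i | validC i}) : (evC (val i))^*%C = evC (val i) by exact: evC_real.
exact: (diag_J_comm (vonb_onb vc) JC h1 h2 (@vonb_sub _ _ _ validC _ _ _ Td)).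
Qed.

Lemma J_R1 : commutes J T1.
Proof.
have h1 (i : {i | valid1 i}) : J (basis1 (val i)) = basis1 (val i) by exact: basis1_conj.
have h2 (i : {i | valid1 i}) : (ev1 (val i))^*%C = ev1 (val i).
  by case: i => -[[t k] i] Vi; exact: conjc_real.
exact: (diag_J_comm (vonb_onb basis1_vonb) JC h1 h2 (@vonb_sub _ _ _ valid1 _ _ _ T1d)).
Qed.

Lemma phi1_pisom : partial_isometry phi1.
Proof.
apply: (diag_partial_isometry (vonb_onb basisB_vonb) _ (@vonb_sub _ _ _ valid1 _ _ _ phi1d)).
by move=> [x Vx]; exact: zB_norm.
Qed.

Lemma phi1_ker : Defs.kernel phi1 = Defs.kernel T1.
Proof.
rewrite (diag_kernel (vonb_onb basisB_vonb) (@vonb_sub _ _ _ valid1 _ _ _ phi1d)).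
rewrite (diag_kernel (vonb_onb basisB_vonb) (@vonb_sub _ _ _ valid1 _ _ _ basisB_T1)).
have E (x : I) : valid1 x -> (zB x != 0) = (ev1 x != 0).
  case: x => [[[] k] i] /=.
    rewrite (inj_eq (@complexI R) _ 0); case: eqP => _ /=; first by rewrite !eqxx.
    by move=> /andP[kr _]; rewrite oner_eq0 gt_eqF// lam_gt0.
  move=> /andP[kB iN]; have := xi1_norm kB iN; move: kB => /andP[_ k0].
  rewrite (inj_eq (@complexI R) _ 0) (gt_eqF k0) => h1.
  by rewrite -normr_eq0 h1 oner_eq0.
apply/seteqP; split => x /= xb [i Vi] ne; apply: (xb (exist _ i Vi)).
  by rewrite /= E.
by rewrite /= -E.
Qed.

Lemma R_ker : Defs.kernel T = [set 0].
Proof.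
rewrite (diag_kernel (vonb_onb vc) (@vonb_sub _ _ _ validC _ _ _ Td)).
apply/seteqP; split => x /=; last by move=> -> i _; exact: hdot0l.
move=> xb; apply: (vc.2) => i; have [Vi|Vi] := boolP (validC i); last first.
  by rewrite (vonb_out vc Vi) hdot0r.
apply: (xb (exist _ i Vi)) => /=; move: i Vi => [[t k] i] Vi.
rewrite /evC/= (inj_eq (@complexI R) _ 0); have := Vi; rewrite /validC/=.
case: t {Vi} => [/andP[kr _]|/and3P[/andP[_ k0] _ _]]; last by rewrite gt_eqF.
by rewrite gt_eqF// lam_gt0.
Qed.

Lemma phi_K1 x : sdK1 D x -> phi x = x.
Proof.
move=> /model_sdK1 xc; apply: (vonb_ext basisA_vonb) => -[[t k] i]; rewrite phid.2.
case: t; last by rewrite /zA mul1r.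
by rewrite [hdot x _](rotb_orth (s := true)) ?mulr0// => l; exact: xc.
Qed.

Lemma phi1_K x : sdK D x -> phi1 x = x.
Proof.
move=> Kx; have xc := iffLR (model_sdK x) Kx; have [_ xo] := Kx.
rewrite model_sdH0 in xo.
apply: (vonb_ext basisB_vonb) => -[[t k] i]; rewrite phi1d.2.
case: t; last first.
  rewrite [hdot x _](rotb_orth (s := false)) ?mulr0// => -[|l]; first by apply: xo; exact: X0_basis1.
  by rewrite basis1S//; exact: xc.
rewrite basisB_true; case: i => [|i]; last by rewrite /zB/= mul1r.
by rewrite (xo _ (@X0_basis1 true k)) mulr0.
Qed.

(** * Spectral measures and cyclicity in the blocks of the model *)

Section blockA.
Variable k : nat.
Hypothesis kr : in_range len k.
Local Notation E := (eigspace T (lam k)%:C).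
Local Notation bA := (fun i : nat => basisA (true, k, i)).
Let sE : csubspace E := csubspace_eigspace T_compact _.
Let Eb i : (i < N k)%N -> E (basisA (true, k, i)).
Proof. by move=> _; exact: (vonb_diag_basis basisA_vonb (true, k, i) basisA_T). Qed.
Let bb i j : (i < N k)%N -> (j < N k)%N ->
  hdot (basisA (true, k, i)) (basisA (true, k, j)) = (i == j)%:R.
Proof. by move=> iN jN; rewrite basisA_vonb.1 /validC/= kr iN/= !xpair_eqE !eqxx/= andbT. Qed.
Let bE x : E x -> (forall i, (i < N k)%N -> hdot x (basisA (true, k, i)) = 0) -> x = 0.
Proof.
move=> /(eigspace_lam _ basisA_vonb basisA_T kr) xb xA; apply: (basisA_vonb.2) => -[[t l] i].
have [/andP[-> /eqP ->]|tl] := boolP (t && (l == k)); last exact: xb.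
have [iN|iN] := ltnP i (N k); first exact: xA.
by rewrite (vonb_out basisA_vonb) ?hdot0r// /validC/= kr -leqNgt.
Qed.
Let Ub i : (i < N k)%N -> phi (basisA (true, k, i)) = xi k i *: basisA (true, k, i).
Proof. by move=> _; exact: (vonb_diag_basis basisA_vonb (true, k, i) phid). Qed.
Let ve : c (true, k, 0%N) = \sum_(i < N k) (Num.sqrt (al k i))%:C *: basisA (true, k, i : nat).
Proof. exact: (rotb_first true c N0 al_gt0 al_sum kr). Qed.

Lemma blockA_unitary : unitary_onto E E phi.
Proof. exact: (@block_unitary _ _ E phi (N k) bA (xi k) sE Eb bb bE Ub (fun i => @xi_norm k i kr)). Qed.

Lemma blockA_moment m : hdot (zpower E phi m (c (true, k, 0%N))) (c (true, k, 0%N)) = \sum_(i < N k) (al k i)%:C * xi k i ^ m.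
Proof.
rewrite ve; exact: (@block_moment _ _ E phi (N k) bA (xi k) (al k) sE Eb bb bE Ub (fun i => @xi_norm k i kr) (fun i => @al_gt0 k i kr)).
Qed.

Lemma blockA_cyclic (a : R[i]) : a != 0 -> star_cyclic E phi (a *: c (true, k, 0%N)).
Proof.
rewrite ve.
exact: (@block_cyclic _ _ E phi (N k) bA (xi k) (al k) sE Eb bb bE Ub (fun i => @xi_norm k i kr) (xi_inj kr)
  (fun i => @al_gt0 k i kr)).
Qed.

End blockA.

Section blockB.
Variable k : nat.
Hypothesis kB : inB k.
Local Notation E := (eigspace T1 (mu k)%:C).
Local Notation bB := (fun i : nat => basisB (false, k, i)).
Let sE : csubspace E := csubspace_eigspace T1_compact _.
Let Eb i : (i < N1 k)%N -> E (basisB (false, k, i)).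
Proof. by move=> _; exact: (vonb_diag_basis basisB_vonb (false, k, i) basisB_T1). Qed.
Let bb i j : (i < N1 k)%N -> (j < N1 k)%N ->
  hdot (basisB (false, k, i)) (basisB (false, k, j)) = (i == j)%:R.
Proof. by move=> iN jN; rewrite basisB_vonb.1 /= kB iN/= !xpair_eqE !eqxx/= andbT. Qed.
Let bE x : E x -> (forall i, (i < N1 k)%N -> hdot x (basisB (false, k, i)) = 0) -> x = 0.
Proof.
move=> /(eigspace_mu _ basisB_vonb basisB_T1 kB) xb xA; apply: (basisB_vonb.2) => -[[t l] i].
have [tl|] := boolP (t || (l != k)); first exact: xb.
rewrite negb_or negbK => /andP[/negPf -> /eqP ->].
have [iN|iN] := ltnP i (N1 k); first exact: xA.
by rewrite (vonb_out basisB_vonb) ?hdot0r// /= kB -leqNgt.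
Qed.
Let Ub i : (i < N1 k)%N -> phi1 (basisB (false, k, i)) = xi1 k i *: basisB (false, k, i).
Proof. by move=> _; exact: (vonb_diag_basis basisB_vonb (false, k, i) phi1d). Qed.
Let ve : basis1 (false, k, 0%N) = \sum_(i < N1 k) (Num.sqrt (al1 k i))%:C *: basisB (false, k, i : nat).
Proof. exact: (rotb_first false basis1 N10 al1_gt0 al1_sum kB). Qed.

Lemma blockB_unitary : unitary_onto E E phi1.
Proof. exact: (@block_unitary _ _ E phi1 (N1 k) bB (xi1 k) sE Eb bb bE Ub (fun i => @xi1_norm k i kB)). Qed.

Lemma blockB_moment m : hdot (zpower E phi1 m (basis1 (false, k, 0%N))) (basis1 (false, k, 0%N)) =
  \sum_(i < N1 k) (al1 k i)%:C * xi1 k i ^ m.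
Proof.
rewrite ve; exact: (@block_moment _ _ E phi1 (N1 k) bB (xi1 k) (al1 k) sE Eb bb bE Ub (fun i => @xi1_norm k i kB)
  (fun i => @al1_gt0 k i kB)).
Qed.

Lemma blockB_cyclic (a : R[i]) : a != 0 -> star_cyclic E phi1 (a *: basis1 (false, k, 0%N)).
Proof.
rewrite ve.
exact: (@block_cyclic _ _ E phi1 (N1 k) bB (xi1 k) (al1 k) sE Eb bb bE Ub (fun i => @xi1_norm k i kB) (xi1_inj kB)
  (fun i => @al1_gt0 k i kB)).
Qed.

End blockB.

Lemma model_canonical : canonical_compact_data D.
Proof.
split.
- apply: (separable_total_family (x := fun i : {i | validC i} => c (val i))).
  exact: (onb_total (vonb_onb vc)).
- exact: T_compact.
- exact: T_self_adjoint.
- exact: T_psd.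
- exact: T1_compact.
- exact: T1_self_adjoint.
- exact: T1_psd.
- exact: R_ker.
- exact: model_rank1.
- exact: model_K_orth.
- exact: model_sum.
- exact: JC.
- exact: J_R.
- exact: J_R1.
- by apply: X0_conj => // k kr; exists (Num.sqrt (w k)); exact: ph.
- exact: phi_unitary.
- exact: phi_sym.
- exact: phi_R.
- exact: phi1_pisom.
- exact: phi1_sym.
- exact: phi1_R1.
- exact: phi1_ker.
- exact: phi_K1.
- exact: phi1_K.
- move=> l; rewrite model_sdeig => -[k kr <-]; rewrite model_sdpk//.
  apply: (blockA_cyclic kr).
  by rewrite (inj_eq (@complexI R) _ 0) sqrtr_eq0 -ltNge weight_gt0.
- move=> l; rewrite model_sdeig1 => -[k [kr k0] <-].
  have kB : inB k by apply/andP.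
  rewrite model_sdp1k//; apply: (blockB_cyclic kB).
  by rewrite (inj_eq (@complexI R) _ 0) invr_eq0 nf0.
Qed.

Lemma normalizeZ (r : R) (u : H) : 0 < r -> nm u = 1 -> `|r%:C *: u|^-1 *: (r%:C *: u) = u.
Proof.
move=> r_gt0 u1; rewrite nmE nmZ u1 mulr1 [complex.Re _]normc_real ?ltW//.
rewrite scalerA mulVf ?scale1r// (inj_eq (@complexI R) _ 0) gt_eqF//.
Qed.

Variables (rho rho1 : nat -> probability (borel_circle R) R).
Hypothesis rhoE : forall k (n : int), in_range len k ->
  circle_integral (rho k) (fun x => circle_val x ^ n) = \sum_(i < N k) (al k i)%:C * xi k i ^ n.
Hypothesis rho1E : forall k (n : int), inB k ->
  circle_integral (rho1 k) (fun x => circle_val x ^ n) = \sum_(i < N1 k) (al1 k i)%:C * xi1 k i ^ n.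

Lemma model_spectral : has_spectral_data D len lam mu rho rho1.
Proof.
split.
- exact: model_sdeig.
- exact: model_sdeig1.
- move=> k kr; rewrite model_sdpk// normalizeZ; last 2 first.
  + by rewrite sqrtr_gt0 weight_gt0.
  + by apply: (vonb_nm1 vc); rewrite /validC/= kr N0.
  split; first exact: blockA_unitary.
  by move=> n; rewrite rhoE// blockA_moment.
- move=> k kr k0; have kB : inB k by apply/andP.
  rewrite model_sdp1k// normalizeZ; last 2 first.
  + by rewrite invr_gt0 lt_neqAle eq_sym nf0//= nm_ge0.
  + by apply: (vonb_nm1 basis1_vonb); rewrite /= kB N10.
  split; first exact: blockB_unitary.
  by move=> n; rewrite rho1E// blockB_moment.
Qed.

End second_basis.

(** * Assembling the model from the data *)

Section existence.
Context {R : realType} (len : option nat) (lam mu : nat -> R).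
Variables (rho rho1 : nat -> probability (borel_circle R) R).
Hypothesis lam_mu : interlacing len lam mu.
Hypothesis rho_fin : forall k, in_range len k -> finitely_supported (rho k).
Hypothesis rho1_fin : forall k, in_range len k -> 0 < mu k -> finitely_supported (rho1 k).
Local Notation I := (bool * nat * nat)%type.

Theorem spectral_data_exists : exists (H : hilbertType R) (D : spectral_data H),
  canonical_compact_data D /\ has_spectral_data D len lam mu rho rho1.
Proof.
pose atoms (r : probability (borel_circle R) R) (t : nat * (nat -> R[i]) * (nat -> R)) :=
  [/\ (0 < t.1.1)%N, {in [pred i | (i < t.1.1)%N] &, injective t.1.2},
      forall i, (i < t.1.1)%N -> `|t.1.2 i| = 1 /\ 0 < t.2 i,
      \sum_(i < t.1.1) t.2 i = 1 &
      forall n : int, circle_integral r (fun x => circle_val x ^ n) =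
        \sum_(i < t.1.1) (t.2 i)%:C * t.1.2 i ^ n].
have atomsP (r : probability (borel_circle R) R) : finitely_supported r -> exists t, atoms r t.
  move=> /finitely_supported_atoms[n [x [a [n0 xinj [x1 a_gt0] s m]]]]; exists (n, x, a).
  split; [exact: n0|exact: xinj| |exact: s|exact: m].
  by move=> i ni; split; [exact: x1|exact: a_gt0].
have [|t ht] := @boolp.choice _ _ (fun k t => in_range len k -> atoms (rho k) t).
  move=> k.
  (* Out of range the triple is arbitrary: no valid index lies over such a [k]. *)
  have [kr|kr] := pselect (in_range len k); last by exists (0%N, fun=> 0, fun=> 0).
  by have [t ht] := atomsP _ (rho_fin kr); exists t.
have [|t1 ht1] := @boolp.choice _ _ (fun k t => inB len mu k -> atoms (rho1 k) t).
  move=> k.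
  have [/andP[kr k0]|kr] := pselect (inB len mu k); last by exists (0%N, fun=> 0, fun=> 0).
  by have [t1 ht1] := atomsP _ (rho1_fin kr k0); exists t1.
pose N k := (t k).1.1; pose xi k := (t k).1.2; pose al k := (t k).2.
pose N1 k := (t1 k).1.1; pose xi1 k := (t1 k).1.2; pose al1 k := (t1 k).2.
have N0 k : in_range len k -> (0 < N k)%N by move=> /ht[].
have N10 k : inB len mu k -> (0 < N1 k)%N by move=> /ht1[].
pose V := validC len mu N N1.
(* Only valid indices carry basis vectors; [pickle] supplies the injection into nat that [l2_model]
   asks for. *)
have [H [e0 [J [e01 e0o e0t JC Je0]]]] := @l2_model R {x : I | V x} (fun x => pickle (val x))
  (fun x y h => val_inj (pcan_inj pickleK h)).
pose c (x : I) : H := if insub x is Some i then e0 i else 0.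
have vc : vonb V c.
  apply: onb_vonb; split => // i j; case: eqVneq => [<-|/eqP ij]; [exact: e01|exact: e0o].
have Jc x : J (c x) = c x.
  by rewrite /c; case: insub => [i|]; [exact: Je0|exact: (raddf0 J)].
have [l0 _ r0] := interlacing_pos lam_mu.
have [T Td] : exists T : {linear H -> H}, diag_op c (evC lam mu) T.
  apply: (vdiag_exists vc (ltW (l0 _ r0))) => -[[b k] i] Vi.
  have kr := validC_range Vi; have /andP[m0 m1] := mu_lam lam_mu kr.
  have -> : evC lam mu (b, k, i) = (if b then lam k else mu k)%:C by [].
  case: b {Vi}; last by rewrite normc_real.
  by rewrite normc_real; [exact: (lam_le0 lam_mu kr)|exact/ltW/l0].
have [p [Xp Jp ph]] := exists_p lam_mu N0 vc JC Jc.
pose Sf x := T (T x) - hdot x p *: p.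
have Sl a x y : Sf (a *: x + y) = a *: Sf x + Sf y.
  by rewrite /Sf !linearP hdotDl hdotZl scalerBr scalerDl scalerA opprD addrACA.
pose S : {linear H -> H} := make_linear Sl.
have SE x : S x = T (T x) - hdot x p *: p by [].
have hh := h_hdot N0 vc.
have Tsa := T_self_adjoint vc Td.
have Tb := T_bounded Td.
have Th := T_h vc Td.
have Sc := T2_compact lam_mu vc Td SE.
pose LM := interlacing_sqr lam_mu.
pose L k := lam k ^+ 2; pose L1 k := mu k ^+ 2.
pose h k := c (true, k, 0%N).
have [|f hf] := @boolp.choice _ _ (fun j x => inB len mu j -> [/\ closed_span (range h) x,
    forall k, in_range len k -> hdot x (h k) = (Num.sqrt (weight len L L1 k) / (L k - L1 j))%:C,
    hdot x p = 1 & S x = (L1 j)%:C *: x]).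
  move=> j.
  have [/andP[jr j0]|jB] := pselect (inB len mu j); last by exists 0.
  have [x hx] := @secular_vector R H len h hh L L1 LM r0 T lam p Tsa Tb Th
    (fun _ _ => erefl) Xp ph S SE j jr.
  by exists x.
have [e he] := @kernel_vector R H len h hh L L1 LM T lam p Tsa Th
    (fun _ _ => erefl) ph S SE.
pose b1 := basis1 len mu c f e.
have vb1 : vonb (valid1 len mu N N1 e) b1.
  exact: (basis1_vonb lam_mu N0 N10 vc Td Xp ph SE hf he).
have [T1 T1d] : exists T1 : {linear H -> H}, diag_op b1 (ev1 lam mu) T1.
  apply: (vdiag_exists vb1 (ltW (l0 _ r0))) => -[[b k] i] Vi.
  have -> : ev1 lam mu (b, k, i) = (if b then (if i == 0%N then 0 else lam k) else mu k)%:C by [].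
  case: b Vi => [|/andP[/andP[kr k0] _]]; last first.
    by have /andP[m0 m1] := mu_lam lam_mu kr; rewrite normc_real.
  rewrite /valid1; case: eqP => [_ _|_ /andP[kr _]].
    by rewrite normc_real// ltW// l0.
  by rewrite normc_real; [exact: (lam_le0 lam_mu kr)|exact/ltW/l0].
have xi_norm k i : in_range len k -> (i < N k)%N -> `|xi k i| = 1.
  by move=> /ht[_ _ h1 _ _] /h1[].
have xi_inj k : in_range len k -> {in [pred i | (i < N k)%N] &, injective (xi k)}.
  by move=> /ht[].
have al_gt0 k i : in_range len k -> (i < N k)%N -> 0 < al k i.
  by move=> /ht[_ _ h1 _ _] /h1[].
have al_sum k : in_range len k -> \sum_(i < N k) al k i = 1 by move=> /ht[].
have xi1_norm k i : inB len mu k -> (i < N1 k)%N -> `|xi1 k i| = 1.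
  by move=> /ht1[_ _ h1 _ _] /h1[].
have xi1_inj k : inB len mu k -> {in [pred i | (i < N1 k)%N] &, injective (xi1 k)}.
  by move=> /ht1[].
have al1_gt0 k i : inB len mu k -> (i < N1 k)%N -> 0 < al1 k i.
  by move=> /ht1[_ _ h1 _ _] /h1[].
have al1_sum k : inB len mu k -> \sum_(i < N1 k) al1 k i = 1 by move=> /ht1[].
pose bA := basisA N c al; pose bB := basisB len mu N1 c f e al1.
have vA : vonb V bA by exact: (basisA_vonb N0 vc al_gt0 al_sum).
have vB : vonb (valid1 len mu N N1 e) bB.
  exact: (basisB_vonb lam_mu N0 N10 vc Td Xp ph SE hf he al1_gt0 al1_sum).
have [phi phid] : exists phi : {linear H -> H}, diag_op bA (zA xi) phi.
  by apply: (vdiag_exists vA ler01) => x Vx; rewrite (zA_norm xi_norm Vx).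
have [phi1 phi1d] : exists phi1 : {linear H -> H}, diag_op bB (zB xi1) phi1.
  apply: (vdiag_exists vB ler01) => x Vx.
  by have [->|->] := zB_norm xi1_norm Vx; rewrite ?normr0.
exists H, (SpectralData T T1 p J phi phi1); split.
  exact: (model_canonical lam_mu N0 N10 vc JC Jc Td Xp ph SE hf he T1d
    xi_norm xi_inj al_gt0 al_sum xi1_norm xi1_inj al1_gt0 al1_sum phid phi1d).
apply: (model_spectral lam_mu N0 N10 J vc Td Xp ph SE hf he T1d
    xi_norm al_gt0 al_sum xi1_norm al1_gt0 al1_sum phid phi1d).
  by move=> k n /ht[].
by move=> k n /ht1[].
Qed.

End existence.

Theorem mainTheorem3 (R : realType) (len : option nat) (lam mu : nat -> R)
    (rho rho1 : nat -> probability (borel_circle R) R)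
    (lam_mu : interlacing len lam mu)
    (rho_fin : forall k, in_range len k -> finitely_supported (rho k))
    (rho1_fin : forall k, in_range len k -> 0 < mu k ->
      finitely_supported (rho1 k)) :
  exists (H : hilbertType R) (D : spectral_data H),
    (canonical_compact_data D /\ has_spectral_data D len lam mu rho rho1) /\
    forall (H' : hilbertType R) (D' : spectral_data H'),
      canonical_compact_data D' ->
      has_spectral_data D' len lam mu rho rho1 ->
      unitarily_equivalent D D'.
Proof.
have [H [D [cD hD]]] := spectral_data_exists lam_mu rho_fin rho1_fin.
exists H, D; split => // H' D' cD' hD'.
exact: (spectral_data_unique lam_mu cD hD cD' hD').
Qed.
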